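(* Let $-\infty\le a<b\le\infty$, $m\in\mathbb{N}$, and let $P,Q,R$ be $\mathbb{C}^{m\times m}$-valued functions with Lebesgue measurable entries on $(a,b)$ such that $P>0$ and $R>0$ a.e. on $(a,b)$, $Q=Q^*$ is self-adjoint, and $P^{-1},Q,R\in L^1_{loc}((a,b);dx)^{m\times m}$. Let $$L=R^{-1}\Big(-\frac{d}{dx}P\frac{d}{dx}+Q\Big)\quad\text{on }(a,b),$$ and let $T_{min}$ be the associated minimal operator in $L^2((a,b);R\,dx;\mathbb{C}^m)$. (i) Suppose that for some $\lambda_a\in\mathbb{R}$, $(u,[T_{min}-\lambda_a I]u)_{L^2((a,b);R\,dx;\mathbb{C}^m)}\ge0$ for all $u\in\mathrm{dom}(T_{min})$ with $u=0$ in a neighborhood of $b$. In addition, assume that $L$ is in the limit point case at $a$. Then for all $\lambda<\lambda_a$, the Weyl--Titchmarsh solution $\Psi_-(\lambda,\cdot)$ is also a principal solution of $LU=\lambda U$ at $a$, that is, for $x,x_0$ to the left of the first zero of $\det_{\mathbb{C}^m}(\Psi_-(\lambda,\cdot))$ and $\det_{\mathbb{C}^m}(U_a(\lambda,\cdot))$ (if any), $$\Psi_-(\lambda,x)\Psi_-(\lambda,x_0)^{-1}=U_a(\lambda,x)U_a(\lambda,x_0)^{-1},$$ where $U_a(\lambda,\cdot)$ denotes a principal solution of $LU=\lambda U$ at $a$. (ii) Suppose that for some $\lambda_b\in\mathbb{R}$, $(u,[T_{min}-\lambda_b I]u)_{L^2((a,b);R\,dx;\mathbb{C}^m)}\ge0$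 for all $u\in\mathrm{dom}(T_{min})$ with $u=0$ in a neighborhood of $a$. In addition, assume that $L$ is in the limit point case at $b$. Then for all $\lambda<\lambda_b$, the Weyl--Titchmarsh solution $\Psi_+(\lambda,\cdot)$ is also a principal solution of $LU=\lambda U$ at $b$, that is, for $x,x_0$ to the right of the last zero of $\det_{\mathbb{C}^m}(\Psi_+(\lambda,\cdot))$ and $\det_{\mathbb{C}^m}(U_b(\lambda,\cdot))$ (if any), $$\Psi_+(\lambda,x)\Psi_+(\lambda,x_0)^{-1}=U_b(\lambda,x)U_b(\lambda,x_0)^{-1},$$ where $U_b(\lambda,\cdot)$ denotes a principal solution of $LU=\lambda U$ at $b$.
   Context: $L^2((a,b);R\,dx;\mathbb{C}^m)$ is the Hilbert space of (classes of) measurable $U:(a,b)\to\mathbb{C}^m$ with $\int_{(a,b)}dx\,(U(x),R(x)U(x))_{\mathbb{C}^m}<\infty$ and scalar product $(U,V)=\int_{(a,b)}dx\,(U(x),R(x)V(x))_{\mathbb{C}^m}$, where $(\cdot,\cdot)_{\mathbb{C}^m}$ is the standard scalar product, linear in the second entry. $I$ is the identity operator. The minimal operator is $T_{min}u=Lu$ with domain $\mathrm{dom}(T_{min})$ consisting of all $v\in L^2((a,b);R\,dx;\mathbb{C}^m)$ such that $v$ and $Pv'$ have locally absolutely continuous entries on $(a,b)$, $\mathrm{supp}(v)\subset(a,b)$ is compact, and $Lv\in L^2((a,b);R\,dx;\mathbb{C}^m)$. $m\times m$ matrix-valued solutions $U$ of $LU=zU$, $z\in\mathbb{C}$, are understood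 in the distributional sense: $U$ and $PU'$ have locally absolutely continuous entries on $(a,b)$ and the equation holds a.e. Limit point case: $L$ is in the limit point case at $a$ (resp. $b$) if, for $z\in\mathbb{C}\setminus\mathbb{R}$ and for some (hence for all) $c\in(a,b)$, there exists a unique (up to right multiplication by constant, generally $z$-dependent, invertible $m\times m$ matrices) invertible $m\times m$ matrix-valued solution $\Psi_-(z,\cdot)$ (resp. $\Psi_+(z,\cdot)$) of $LU=zU$ such that the $m\times m$ matrix $\int_a^c dx\,\Psi_-(z,x)^*R(x)\Psi_-(z,x)$ (resp. $\int_c^b dx\,\Psi_+(z,x)^*R(x)\Psi_+(z,x)$) exists. Weyl--Titchmarsh solutions for real spectral parameter: under the hypotheses of (i) (resp. (ii)), $\Psi_-(z,\cdot)$ (resp. $\Psi_+(z,\cdot)$), suitably normalized by right multiplication with $z$-dependent constant invertible matrices, extends analytically in $z$ from $\mathbb{C}\setminus\mathbb{R}$ to $\mathbb{C}\setminus[\lambda_a,\infty)$ (resp. $\mathbb{C}\setminus[\lambda_b,\infty)$), and $\Psi_-(\lambda,\cdot)$, $\lambda<\lambda_a$ (resp. $\Psi_+(\lambda,\cdot)$, $\lambda<\lambda_b$) denotes this extension; it is an $m\times m$ matrix-valued solution of $LU=\lambda U$, unique up to right multiplication by constant invertible matrices, for which the integral above (with $z=\lambda$) exists. Self-conjugate solutions: for $\lambda\in\mathbb{R}$, an $m\times m$ matrix-valued solution $U(\lambda,\cdot)$ of $LU=\lambda U$ is called self-conjugate if $U(\lambda,x)^*[P(x)U'(\lambda,x)]=[P(x)U'(\lambda,x)]^*U(\lambda,x)$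 for all $x\in(a,b)$. Principal solutions: let $\lambda\in\mathbb{R}$. A self-conjugate solution $U_a(\lambda,\cdot)$ of $LU=\lambda U$ that is invertible on $(a,c]$ for some $c\in(a,b)$ is called a principal solution of $LU=\lambda U$ at $a$ if $$\lim_{x\downarrow a}\bigg[\int_x^c dx'\,U_a(\lambda,x')^{-1}P(x')^{-1}\big[U_a(\lambda,x')^{-1}\big]^*\bigg]^{-1}=0.$$ A self-conjugate solution $U_b(\lambda,\cdot)$ of $LU=\lambda U$ that is invertible on $[c,b)$ for some $c\in(a,b)$ is called a principal solution of $LU=\lambda U$ at $b$ if $$\lim_{x\uparrow b}\bigg[\int_c^x dx'\,U_b(\lambda,x')^{-1}P(x')^{-1}\big[U_b(\lambda,x')^{-1}\big]^*\bigg]^{-1}=0.$$ Principal solutions, if they exist, are unique up to right multiplication by constant (generally $\lambda$-dependent) invertible $m\times m$ matrices. *)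

(* Defs.v *)
From HB Require Import structures.
From mathcomp Require Import all_boot all_order all_algebra.
From mathcomp Require Import all_classical all_reals all_analysis.
From mathcomp Require Export complex.

Set Implicit Arguments.
Unset Strict Implicit.
Unset Printing Implicit Defensive.

Import Order.TTheory GRing.Theory Num.Theory.
Import numFieldNormedType.Exports.

Local Open Scope classical_set_scope.
Local Open Scope ring_scope.
Local Open Scope sesquilinear_scope.

(* [cplx K] is [K[i]]; going through [numClosedFieldType] is what makes the
   norm topology of [numFieldNormedType] available on it. *)
Definition cplx (K : realType) : numClosedFieldType := K[i].
Definition mkC (K : realType) (x y : K) : cplx K := Complex x y.
Definition realC (K : realType) (x : K) : cplx K := mkC x 0.
Definition reC (K : realType) (z : cplx K) : K := complex.Re (z : K[i]).
Definition imC (K : realType) (z : cplx K) : K := complex.Im (z : K[i]).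

(* Lebesgue measure on the sigma-algebra of Lebesgue (not just Borel)
   measurable sets, i.e. the completed measure; [lebT K] is an alias of [K]
   that carries this sigma-algebra. *)
Notation lebT K := (caratheodory_type ((@wlength K idfun)^*)%mu).
Notation leb := completed_lebesgue_measure.

Definition oint (K : realType) (a b : \bar K) : set K :=
  [set x | (a < x%:E < b)%E].

Section complex_functions.
Variable K : realType.
Notation C := (cplx K).

Definition cmeasurable (D : set K) (f : K -> C) : Prop :=
  measurable_fun (D : set (lebT K)) ((fun x => reC (f x)) : lebT K -> K) /\
  measurable_fun (D : set (lebT K)) ((fun x => imC (f x)) : lebT K -> K).

Definition cintegrable (D : set K) (f : K -> C) : Prop :=
  leb.-integrable (D : set (lebT K)) (fun x : lebT K => (reC (f x))%:E) /\
  leb.-integrable (D : set (lebT K)) (fun x : lebT K => (imC (f x))%:E).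

Definition cintegral (D : set K) (f : K -> C) : C :=
  mkC (\int[leb]_(x in (D : set (lebT K))) reC (f x))
      (\int[leb]_(x in (D : set (lebT K))) imC (f x)).

Definition cderiv (f : K -> C) (x : K) : C :=
  mkC (derive1 (fun t => reC (f t)) x) (derive1 (fun t => imC (f t)) x).

Definition abs_continuous (c d : K) (f : K -> C) : Prop :=
  forall e : K, 0 < e -> exists2 dl : K, 0 < dl &
    forall (n : nat) (x y : 'I_n -> K),
      (forall i, [/\ c <= x i, x i <= y i & y i <= d]) ->
      trivIset [set: 'I_n] (fun i => `]x i, y i[%classic) ->
      \sum_(i < n) (y i - x i) < dl ->
      \sum_(i < n) `|f (y i) - f (x i)| < realC e.

End complex_functions.

Section matrix_functions.
Variable K : realType.
Notation C := (cplx K).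
Variables m n : nat.

Definition mx_measurable (D : set K) (F : K -> 'M[C]_(m, n)) : Prop :=
  forall i j, cmeasurable D (fun x => F x i j).

Definition mx_integrable (D : set K) (F : K -> 'M[C]_(m, n)) : Prop :=
  forall i j, cintegrable D (fun x => F x i j).

Definition mx_integral (D : set K) (F : K -> 'M[C]_(m, n)) : 'M[C]_(m, n) :=
  \matrix_(i, j) cintegral D (fun x => F x i j).

Definition mx_loc_integrable (I : set K) (F : K -> 'M[C]_(m, n)) : Prop :=
  forall c d, I c -> I d -> mx_integrable `[c, d] F.

Definition mx_deriv (F : K -> 'M[C]_(m, n)) (x : K) : 'M[C]_(m, n) :=
  \matrix_(i, j) cderiv (fun t => F t i j) x.

(* [I] is an interval in all uses, so that [[c, d]] is contained in [I]. *)
Definition mx_loc_ac (I : set K) (F : K -> 'M[C]_(m, n)) : Prop :=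
  forall c d, I c -> I d -> forall i j, abs_continuous c d (fun x => F x i j).

End matrix_functions.

Definition cdot (K : realType) (m : nat) (u v : 'cV[cplx K]_m) : cplx K :=
  (u ^t* *m v) 0 0.

Definition posdef (K : realType) (m : nat) (A : 'M[cplx K]_m) : Prop :=
  A ^t* = A /\ forall v : 'cV[cplx K]_m, v != 0 -> 0 < cdot v (A *m v).

Definition coefficients (K : realType) (m : nat) (a b : \bar K)
    (P Q R : K -> 'M[cplx K]_m) : Prop :=
  let I := oint a b in
  [/\ [/\ mx_measurable I P, mx_measurable I Q & mx_measurable I R],
      {ae leb, forall x : lebT K, I x -> posdef (P x) /\ posdef (R x)},
      {ae leb, forall x : lebT K, I x -> (Q x) ^t* = Q x} &
      [/\ mx_loc_integrable I (fun x => invmx (P x)),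
          mx_loc_integrable I Q & mx_loc_integrable I R]].

Section sturm_liouville.
Variables (K : realType) (m : nat).
Notation C := (cplx K).
Variables (a b : \bar K) (P Q R : K -> 'M[C]_m).
Notation I := (oint a b).

(* [P] and [U'] are only determined almost everywhere: "P U' is locally
   absolutely continuous" means that it has a locally absolutely continuous
   representative [W], which is then unique on (a,b). *)
Definition qderiv (n : nat) (U W : K -> 'M[C]_(m, n)) : Prop :=
  mx_loc_ac I W /\
  {ae leb, forall x : lebT K, I x -> W x = P x *m mx_deriv U x}.

(* The expression L U, where [W] is the representative of P U'. *)
Definition Lexpr (n : nat) (U W : K -> 'M[C]_(m, n)) (x : K) : 'M[C]_(m, n) :=
  invmx (R x) *m (- mx_deriv W x + Q x *m U x).

Definition solution_with (z : C) (U W : K -> 'M[C]_m) : Prop :=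
  [/\ mx_loc_ac I U, qderiv U W &
      {ae leb, forall x : lebT K, I x -> Lexpr U W x = z *: U x}].

Definition solution (z : C) (U : K -> 'M[C]_m) : Prop :=
  exists W, solution_with z U W.

Definition L2R (u : K -> 'cV[C]_m) : Prop :=
  mx_measurable I u /\
  (\int[leb]_(x in (I : set (lebT K))) (reC (cdot (u x) (R x *m u x)))%:E
     < +oo)%E.

Definition innerR (u v : K -> 'cV[C]_m) : C :=
  cintegral I (fun x => cdot (u x) (R x *m v x)).

Definition Tmin_dom (v W : K -> 'cV[C]_m) : Prop :=
  let S := closure [set x | I x /\ v x != 0] in
  [/\ L2R v, mx_loc_ac I v, qderiv v W,
      compact S /\ S `<=` I & L2R (Lexpr v W)].

(* (u, [T_min - l] u) >= 0 for all u in dom(T_min) satisfying [Z]; in the order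
   of [cplx K], [0 <= w] says that w is real and nonnegative. *)
Definition Tmin_bounded_below (l : K) (Z : (K -> 'cV[C]_m) -> Prop) : Prop :=
  forall u W, Tmin_dom u W -> Z u ->
    0 <= innerR u (fun x => Lexpr u W x - realC l *: u x).

Definition zero_near_a (u : K -> 'cV[C]_m) : Prop :=
  exists2 c, I c & forall x, oint a c%:E x -> u x = 0.

Definition zero_near_b (u : K -> 'cV[C]_m) : Prop :=
  exists2 c, I c & forall x, oint c%:E b x -> u x = 0.

Definition sq_integrable (D : set K) (U : K -> 'M[C]_m) : Prop :=
  mx_integrable D (fun x => (U x) ^t* *m R x *m U x).

Definition invertible_on (D : set K) (U : K -> 'M[C]_m) : Prop :=
  forall x, D x -> U x \in unitmx.

Definition weyl_solution (z : C) (D : set K) (U : K -> 'M[C]_m) : Prop :=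
  [/\ solution z U, invertible_on I U & sq_integrable D U].

Definition unique_weyl_solution (z : C) (D : set K) : Prop :=
  exists2 U, weyl_solution z D U & forall V, weyl_solution z D V ->
    exists2 M : 'M[C]_m, M \in unitmx & forall x, I x -> V x = U x *m M.

Definition limit_point_a : Prop :=
  forall z : C, imC z != 0 ->
    exists2 c, I c & unique_weyl_solution z (oint a c%:E).

Definition limit_point_b : Prop :=
  forall z : C, imC z != 0 ->
    exists2 c, I c & unique_weyl_solution z (oint c%:E b).

(* At a real spectral parameter det U may vanish at some points; nondegeneracy
   (linear independence of the columns of U as functions) excludes solutions
   such as U = 0, and is necessary for uniqueness up to right multiplication by
   invertible matrices. *)
Definition nondegenerate (U : K -> 'M[C]_m) : Prop :=
  forall v : 'cV[C]_m, (forall x, I x -> U x *m v = 0) -> v = 0.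

Definition slit_plane (l : K) : set C :=
  [set z | ~ exists2 t : K, l <= t & z = realC t].

Definition analytic_on (D : set C) (f : C -> C) : Prop :=
  forall z, D z -> derivable (f : C^o -> C^o) z 1.

(* [Psi z] is the Weyl-Titchmarsh solution at nonreal z, normalized such that it
   is analytic in z on C \ [l, oo[; for real t < l, [Psi t] is the value of the
   extension. [D c] is (a,c) for the endpoint a and (c,b) for the endpoint b. *)
Definition weyl_titchmarsh (D : K -> set K) (l : K) (Psi : C -> K -> 'M[C]_m)
    : Prop :=
  [/\ forall z, imC z != 0 -> exists2 c, I c & weyl_solution z (D c) (Psi z),
      forall x, I x -> forall i j,
        analytic_on (slit_plane l) (fun z => Psi z x i j) &
      forall t, t < l ->
        [/\ solution (realC t) (Psi (realC t)), nondegenerate (Psi (realC t)) &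
            exists2 c, I c & sq_integrable (D c) (Psi (realC t))]].

Definition weyl_titchmarsh_a : K -> (C -> K -> 'M[C]_m) -> Prop :=
  weyl_titchmarsh (fun c => oint a c%:E).

Definition weyl_titchmarsh_b : K -> (C -> K -> 'M[C]_m) -> Prop :=
  weyl_titchmarsh (fun c => oint c%:E b).

Definition self_conjugate_solution (l : K) (U : K -> 'M[C]_m) : Prop :=
  exists2 W, solution_with (realC l) U W &
    forall x, I x -> (U x) ^t* *m W x = (W x) ^t* *m U x.

(* The filters of x decreasing to a and of x increasing to b; the values
   for a = +oo and b = -oo are irrelevant, as a < b. *)
Definition to_a : set_system K := if a is r%:E then r^'+ else ninfty_nbhs K.
Definition to_b : set_system K := if b is r%:E then r^'- else pinfty_nbhs K.

Definition principal_integral (c d : K) (U : K -> 'M[C]_m) : 'M[C]_m :=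
  mx_integral `[c, d]
    (fun x => invmx (U x) *m invmx (P x) *m (invmx (U x)) ^t*).

Definition principal_a (l : K) (U : K -> 'M[C]_m) : Prop :=
  self_conjugate_solution l U /\
  exists c, [/\ I c, invertible_on [set x | I x /\ x <= c] U &
    invmx (principal_integral x c U) @[x --> to_a] --> (0 : 'M[C]_m)].

Definition principal_b (l : K) (U : K -> 'M[C]_m) : Prop :=
  self_conjugate_solution l U /\
  exists c, [/\ I c, invertible_on [set x | I x /\ c <= x] U &
    invmx (principal_integral c x U) @[x --> to_b] --> (0 : 'M[C]_m)].

(* x lies to the left (right) of the first (last) zero of det U, if any. *)
Definition left_of_zeros (U : K -> 'M[C]_m) (x : K) : Prop :=
  I x /\ forall y, I y -> y <= x -> \det (U y) != 0.

Definition right_of_zeros (U : K -> 'M[C]_m) (x : K) : Prop :=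
  I x /\ forall y, I y -> x <= y -> \det (U y) != 0.

End sturm_liouville.

(* Main.v *)
Require Import Defs.
From HB Require Import structures.
From mathcomp Require Import all_boot all_order all_algebra.
From mathcomp Require Import all_classical all_reals all_analysis.
From mathcomp Require Import measurable_realfun ring lra.

Set Implicit Arguments.
Unset Strict Implicit.
Unset Printing Implicit Defensive.

Import Order.TTheory GRing.Theory Num.Theory.
Import numFieldNormedType.Exports.
Local Open Scope classical_set_scope.
Local Open Scope ring_scope.

(** Write [{U, V}] for the Lagrange bracket [U^* (P V') - (P U')^* V] and let [l] be real and
    below the lower bound. By Lagrange's identity [wr_prim] the bracket of two solutions at [l]
    is constant. The theorem for the endpoint [a] rests on three facts, and the endpoint [b]
    follows by the reflection of the line.

    First, the lower bound gives the corner inequality [corner_ineq]. Let [v] consist of a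
    solution on [[d, c]] and another one on [[c, e]], continuous at [c] and zero at [d] and [e].
    Then [la - l] times the squared norm of [v] is at most the pairing of [v c] with the jump of
    [P v'] at [c]. Such a [v] is not in the domain of the minimal operator. It is
    approximated by functions in that domain, namely by solutions of the inhomogeneous equation
    with sources concentrated near the three points. A first consequence is that a solution
    that vanishes at a point does not vanish again [dirichlet_ex].

    Second, in the limit point case the bracket of two solutions at [l] that are square
    integrable near [a] is zero [L2a_bracket]. The hypothesis only speaks of invertible
    solutions at nonreal [z]. It implies that a column solution [y] at [z] that is square
    integrable and vanishes somewhere is zero [limit_point_zero]: otherwise one adds a
    rank one multiple of [y] to the Weyl solution [U], and keeps it invertible because the curve
    [U^-1 y] is rectifiable and does not fill the plane. Hence the Gram matrices over [[d, c]]
    of the solutions at [z = l +- i] that vanish at [c] tend to infinity as [d] tends to [a].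
    For a square integrable solution [f] at [l], the solution [y] at [z] with [y c = 0] and
    [y d = - f d] then turns Lagrange's identity into a bound of the bracket [{f, f}], with
    either sign, by the squared norm of [f] on [(a, c)] [self_bracket_bound]. It remains to let
    [c] tend to [a]. In particular two square integrable matrix solutions are multiples of
    each other as soon as one of them is invertible somewhere [L2a_proportional].

    Third, let [U] be a self-conjugate solution that is invertible up to [c], and let [V] be the
    solution with [V c = 0] and [{U, V} = - 1]. Then [S = U^-1 V] is the integral from [x] to [c]
    in the definition of principal solutions [reduction_prim]. It increases as [x] decreases, so
    that its inverse converges to some [A] [reduction_inverse]. The solutions
    [U - V S(d)^-1] vanish at [d]. Continued beyond [c] by solutions that vanish
    at a fixed [e], they have bounded norm by the corner inequality. In the limit [U - V A] is
    square integrable near [a] [reduced_L2a].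

    For a principal [U] the matrix [A] is zero, hence [U] itself is square integrable and
    proportional to the Weyl-Titchmarsh solution; this is the formula of the theorem. Conversely,
    for [U] vanishing at a point to the right, the Weyl-Titchmarsh solution is a
    multiple of [U - V A], whose principal integral is [(S^-1 - A)^-1] with an inverse that
    tends to zero [weyl_principal]. *)

(** * Lebesgue measurable functions and their Borel versions *)
Section almost_everywhere.
Variable K : realType.
Implicit Types P Q : lebT K -> Prop.

Lemma ae_mono P Q : (forall x, P x -> Q x) ->
  {ae leb, forall x, P x} -> {ae leb, forall x, Q x}.
Proof. by move=> PQ; apply: negligibleS => x; exact/contra_not/PQ. Qed.

Lemma ae_and P Q : {ae leb, forall x, P x} -> {ae leb, forall x, Q x} ->
  {ae leb, forall x, P x /\ Q x}.
Proof.
move=> p q; have := negligibleU p q.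
by apply: negligibleS => x /not_andP[]; [left|right].
Qed.

Lemma ae_nat (P : nat -> lebT K -> Prop) :
  (forall n, {ae leb, forall x, P n x}) ->
  {ae leb, forall x, forall n, P n x}.
Proof.
move=> p; have := negligible_bigcup p.
by apply: negligibleS => x /existsNP[n nP]; exists n.
Qed.

Lemma ae_always P : (forall x, P x) -> {ae leb, forall x, P x}.
Proof.
by move=> p; apply: negligibleS (negligible_set0 leb) => x; apply; exact: p.
Qed.

End almost_everywhere.

Section borel_version.
Variable K : realType.
Notation lebm := (@lebesgue_measure K).
Local Open Scope ereal_scope.

Lemma measurable_leb (A : set K) :
  measurable (A : set (measurableTypeR K)) -> measurable (A : set (lebT K)).
Proof. exact: sub_caratheodory. Qed.

Lemma measurable_leb_id : measurable_fun setT (id : lebT K -> measurableTypeR K).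
Proof. by move=> _ Y mY; rewrite setTI; exact: measurable_leb. Qed.

Lemma lebE (A : set K) : leb (A : set (lebT K)) = lebm A.
Proof. reflexivity. Qed.

Lemma ge0_integral_leb (A : set K) (g : K -> \bar K) :
  measurable (A : set (measurableTypeR K)) ->
  measurable_fun (A : set (measurableTypeR K)) g ->
  (forall x, A x -> 0 <= g x) ->
  \int[lebm]_(x in A) g x = \int[leb]_(x in (A : set (lebT K))) g x.
Proof.
move=> mA mg g0.
rewrite -[RHS](@ge0_integral_pushforward _ _ _ _ K _ measurable_leb_id leb A g) //.
- by move=> y; rewrite inE; exact: g0.
Qed.

Lemma integrable_leb (g : K -> \bar K) :
  lebm.-integrable setT g -> leb.-integrable (setT : set (lebT K)) g.
Proof.
move=> /integrableP[mg ig]; apply/integrableP; split.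
  by move=> _ Y mY; apply: measurable_leb; exact: mg.
by rewrite -ge0_integral_leb //; apply: measurableT_comp.
Qed.

Lemma integral_leb (A : set K) (g : K -> \bar K) :
  measurable (A : set (measurableTypeR K)) -> lebm.-integrable setT g ->
  \int[lebm]_(x in A) g x = \int[leb]_(x in (A : set (lebT K))) g x.
Proof.
move=> mA ig; have mg := measurable_int _ ig.
rewrite -[RHS](@integral_pushforward _ _ _ _ K _ measurable_leb_id leb A g) //.
- apply: (@integrableS _ _ _ _ setT) => //; first exact: measurable_leb.
  exact: integrable_leb.
Qed.

Section version.
Variable h : lebT K -> K.
Hypothesis ih : leb.-integrable setT (EFin \o h).

(** The differentiation theorem applies to integrals over the Borel sigma-algebra, while
   the integrands at hand are only Lebesgue measurable; the Radon-Nikodym derivative of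
   this charge on the Borel sets bridges the gap. *)
Definition borel_charge (A : set (measurableTypeR K)) : \bar K :=
  \int[leb]_(x in (A : set (lebT K))) (h x)%:E.

Let charge0 : borel_charge set0 = 0.
Proof. by rewrite /borel_charge integral_set0. Qed.

Let charge_fin A : measurable A -> borel_charge A \is a fin_num.
Proof.
move=> mA; apply: integrable_fin_num; first exact: measurable_leb.
by apply: integrableS ih => //; exact: measurable_leb.
Qed.

Let charge_additive : semi_sigma_additive borel_charge.
Proof.
move=> F mF tF mU.
apply: (@charge_semi_sigma_additive _ _ _ (induced_charge ih)) => //.
- by move=> i; exact: measurable_leb.
- exact: measurable_leb.
Qed.

HB.instance Definition _ :=
  isCharge.Build _ _ _ borel_charge charge0 charge_fin charge_additive.

Lemma borel_charge_dominated : borel_charge `<< lebm.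
Proof.
apply/null_content_dominatesP => A mA A0'.
have A0 : leb (A : set (lebT K)) = 0 by rewrite lebE; exact: A0'.
have mlA := measurable_leb mA.
apply: null_set_integral A0; first exact: mlA.
by apply: measurable_funTS; exact: (measurable_int leb ih).
Qed.

(** Lebesgue measurable sets are the completion of the Borel sets. *)
Lemma leb_borel_approx (E : set (lebT K)) : measurable E ->
  exists2 A : set K, measurable (A : set (measurableTypeR K)) &
    [/\ A `<=` E, measurable (E `\` A) & leb (E `\` A) = 0].
Proof.
move=> mE.
have mE' : (completed_algebra_gen lebm).-sigma.-measurable E.
  rewrite completed_caratheodory_measurable.
  exact: mE.
move: mE'; rewrite g_sigma_completed_algebra_genE => -[A mA [N negN EE]].
exists A => //; have [B [mB B0 NB]] := negN.
have mlB := measurable_leb mB.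
have B0' : leb (B : set (lebT K)) = 0 by rewrite lebE.
have EAB : E `\` A `<=` B by rewrite -EE => x [[//|Nx] _]; exact: NB.
have mEA : measurable (E `\` A : set (lebT K)).
  by apply: (@negligible_sub_caratheodory K); exists B; split; [exact: mlB|exact: B0'|exact: EAB].
split; [by rewrite -EE; exact: subsetUl|exact: mEA|].
exact: (subset_measure0 mEA mlB EAB B0').
Qed.

(** A Lebesgue integrable function has a Borel version: its indefinite integral,
   restricted to Borel sets, has a Radon-Nikodym derivative. *)
Lemma borel_version_ex : exists2 g : K -> K,
  lebm.-integrable setT (EFin \o g) &
  {ae leb, forall x : lebT K, h x = g x}.
Proof.
pose nu : {charge set _ -> \bar K} := borel_charge.
have numu := borel_charge_dominated.
pose g := fine \o Radon_Nikodym nu lebm.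
have gE x : (g x)%:E = Radon_Nikodym nu lebm x.
  by rewrite /g /= fineK //; exact: Radon_Nikodym_fin_num.
have ig : lebm.-integrable setT (EFin \o g).
  rewrite (_ : EFin \o g = Radon_Nikodym nu lebm); last by apply/funext => x /=.
  exact: Radon_Nikodym_integrable.
exists g => //.
have igl := integrable_leb ig.
have : ae_eq leb (setT : set (lebT K)) (EFin \o h) (EFin \o g).
  apply: (@integral_ae_eq _ _ K leb setT measurableT (EFin \o g) (EFin \o h)).
  - exact: ih.
  - exact: (measurable_int leb igl).
  move=> E _ mE.
  have [A mA [AE mNA NA0]] := leb_borel_approx mE.
  have mlA := measurable_leb mA.
  have EU : E = A `|` (E `\` A) by rewrite setDUK.
  have key (f : lebT K -> \bar K) : leb.-integrable setT f ->
      \int[leb]_(x in E) f x = \int[leb]_(x in (A : set (lebT K))) f x.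
    move=> f_int; rewrite EU integral_setU //.
    - rewrite (@null_set_integral _ _ _ _ (E `\` A)) ?adde0 //.
      by apply: measurable_funTS; exact: (measurable_int leb).
    - by apply: measurable_funTS; exact: (measurable_int leb).
    - by apply/disj_set2P; rewrite setDIK.
  have E1 : \int[lebm]_(x in A) (EFin \o g) x = nu A.
    by rewrite (Radon_Nikodym_integral numu mA); apply: eq_integral => x _; exact: gE.
  by rewrite (key _ ih) (key _ igl) -(integral_leb mA ig) E1.
by apply: ae_mono => x /= /(_ Logic.I) [].
Qed.

End version.
End borel_version.

(** * Absolutely continuous functions of a real variable *)
Section real_ac.
Variable K : realType.
Implicit Types (c d : K) (f g h : K -> K).

(** Absolute continuity of a real function. Complex functions are treated by their real
   and imaginary parts, for which monotone functions and total variation are at hand. *)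
Definition rac c d f := forall e : K, 0 < e -> exists2 dl : K, 0 < dl &
  forall n (x y : 'I_n -> K),
    (forall i, [/\ c <= x i, x i <= y i & y i <= d]) ->
    trivIset [set: 'I_n] (fun i => `]x i, y i[%classic) ->
    \sum_(i < n) (y i - x i) < dl -> \sum_(i < n) `|f (y i) - f (x i)| < e.

(** The families of intervals may be indexed by any finite type, as needed when each
   interval of a family is itself subdivided. *)
Lemma rac_fin c d f : rac c d f -> forall e : K, 0 < e ->
  exists2 dl : K, 0 < dl & forall (T : finType) (x y : T -> K),
    (forall i, [/\ c <= x i, x i <= y i & y i <= d]) ->
    trivIset [set: T] (fun i => `]x i, y i[%classic) ->
    \sum_i (y i - x i) < dl -> \sum_i `|f (y i) - f (x i)| < e.
Proof.
move=> F e /F[dl dl0 H]; exists dl => // T x y xy tr s.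
have E (g : T -> K) : \sum_(i < #|T|) g (enum_val i) = \sum_i g i.
  by rewrite [RHS](reindex (@enum_val T T)) //=; exact/onW_bij/enum_val_bij.
rewrite -(E (fun i => `|f (y i) - f (x i)|)); apply: H => //.
- by move=> i j _ _ ij; apply: enum_val_inj; exact: (tr _ _ Logic.I Logic.I ij).
- by rewrite (E (fun i => y i - x i)).
Qed.

Lemma partition_nth_default c d s j : itv_partition c d s -> (size s <= j)%N ->
  nth d (c :: s) j = d.
Proof.
move=> [_ /eqP l]; rewrite leq_eqVlt => /predU1P[<-|sj]; last by rewrite nth_default.
by rewrite -(last_nth d) l.
Qed.

Lemma partition_nth_mono c d s j k : itv_partition c d s -> (j <= k)%N ->
  nth d (c :: s) j <= nth d (c :: s) k.
Proof.
move=> P; elim: k => [|k IH]; first by rewrite leqn0 => /eqP ->.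
rewrite leq_eqVlt => /predU1P[-> //|]; rewrite ltnS => /IH /le_trans; apply.
have [sk|ks] := leqP (size s) k.
  by rewrite !(partition_nth_default P) // leqW.
by case: P => /(pathP d)/(_ _ ks)/ltW.
Qed.

Lemma variation_cells c d f s n : itv_partition c d s -> (size s <= n)%N ->
  variation c d f s = \sum_(j < n) `|f (nth d (c :: s) j.+1) - f (nth d (c :: s) j)|.
Proof.
move=> P sn; rewrite -(big_mkord predT (fun j =>
  `|f (nth d (c :: s) j.+1) - f (nth d (c :: s) j)|)).
rewrite (@big_cat_nat _ _ _ (size s)) // [X in _ = _ + X]big_nat [X in _ = _ + X]big1 ?addr0 //.
by move=> j /andP[sj _]; rewrite !(partition_nth_default P) ?subrr ?normr0 // leqW.
Qed.

(** The absolute continuity bound is inherited by refinements: subdividing every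
   interval of a family changes neither the total length nor disjointness. *)
Lemma rac_variation c d f : rac c d f -> forall e : K, 0 < e ->
  exists2 dl : K, 0 < dl & forall n (x y : 'I_n -> K) (s : 'I_n -> seq K),
    (forall i, [/\ c <= x i, x i <= y i & y i <= d]) ->
    trivIset [set: 'I_n] (fun i => `]x i, y i[%classic) ->
    (forall i, itv_partition (x i) (y i) (s i)) ->
    \sum_(i < n) (y i - x i) < dl ->
    \sum_(i < n) variation (x i) (y i) f (s i) < e.
Proof.
move=> /rac_fin F e /F[dl dl0 H]; exists dl => // n x y s xy tr P sdl.
pose M := (\max_(i < n) size (s i))%N.
have sM i : (size (s i) <= M)%N by rewrite /M (leq_bigmax i).
pose u (p : 'I_n * 'I_M) := nth (y p.1) (x p.1 :: s p.1) p.2.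
pose v (p : 'I_n * 'I_M) := nth (y p.1) (x p.1 :: s p.1) p.2.+1.
have ux p : x p.1 <= u p by exact: (partition_nth_mono (P p.1) (leq0n _)).
have vy p : v p <= y p.1.
  rewrite -[leRHS](partition_nth_default (P p.1) (sM _)).
  by apply: partition_nth_mono => //; exact: ltn_ord.
have -> : \sum_(i < n) variation (x i) (y i) f (s i) =
    \sum_(p : 'I_n * 'I_M) `|f (v p) - f (u p)|.
  rewrite -(pair_bigA _ (fun i j => `|f (v (i, j)) - f (u (i, j))|)) /=.
  by apply: eq_bigr => i _; rewrite (variation_cells f (P i) (sM i)).
apply: H.
- move=> p; have [cx _ yd] := xy p.1; split.
  + exact: le_trans cx (ux p).
  + exact: partition_nth_mono.
  + exact: le_trans (vy p) yd.
- move=> [i j] [i' j'] _ _ [t] /= []; rewrite !in_itv /= => /andP[t1 t2] /andP[t3 t4].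
  have ii' : i = i'.
    apply: (tr i i' Logic.I Logic.I); exists t; rewrite /= !in_itv /=.
    rewrite (le_lt_trans (ux (i, j)) t1) (lt_le_trans t2 (vy (i, j))).
    by rewrite (le_lt_trans (ux (i', j')) t3) (lt_le_trans t4 (vy (i', j'))).
  subst i'; congr (_, _); apply/val_inj => /=.
  have [jj'|jj'|//] := ltngtP j j'.
  + have := partition_nth_mono (P i) jj'.
    by move=> /(lt_le_trans t2)/lt_trans/(_ t3); rewrite ltxx.
  + have := partition_nth_mono (P i) jj'.
    by move=> /(lt_le_trans t4)/lt_trans/(_ t1); rewrite ltxx.
- rewrite -(pair_bigA _ (fun i j => v (i, j) - u (i, j))) /=.
  rewrite (eq_bigr (fun i => y i - x i)) // => i _.
  rewrite -(big_mkord predT (fun j => nth (y i) (x i :: s i) j.+1 - nth (y i) (x i :: s i) j)).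
  by rewrite telescope_sumr // (partition_nth_default (P i) (sM i)).
Qed.

Lemma rac_tv_le c d f : rac c d f -> forall e : K, 0 < e ->
  exists2 dl : K, 0 < dl & forall n (x y : 'I_n -> K),
    (forall i, [/\ c <= x i, x i <= y i & y i <= d]) ->
    trivIset [set: 'I_n] (fun i => `]x i, y i[%classic) ->
    (forall i, total_variation (x i) (y i) f \is a fin_num) ->
    \sum_(i < n) (y i - x i) < dl ->
    \sum_(i < n) fine (total_variation (x i) (y i) f) <= e.
Proof.
move=> /rac_variation F e /F[dl dl0 H]; exists dl => // n x y xy tr fi sdl.
apply/ler_addgt0Pr => eta eta0.
have eta' : 0 < eta / n.+1%:R by rewrite divr_gt0.
have /choice[s sP] i : exists s, itv_partition (x i) (y i) s /\
    fine (total_variation (x i) (y i) f) <=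
    variation (x i) (y i) f s + eta / n.+1%:R.
  have /(ub_ereal_sup_adherent eta') := fi i.
  move=> [_ [_ [s Ps <-] <-]] /ltW; rewrite -[X in (X - _)%E]fineK ?fi //.
  by rewrite -EFinB lee_fin lerBlDr => le; exists s.
have := H n x y s xy tr (fun i => (sP i).1) sdl => /ltW le.
apply: (@le_trans _ _ (\sum_(i < n) (variation (x i) (y i) f (s i) + eta / n.+1%:R))).
  by apply: ler_sum => i _; exact: (sP i).2.
rewrite big_split /= lerD // sumr_const card_ord -(mulr_natr _ n) -mulrA ler_piMr ?(ltW eta0) //.
by rewrite mulrC ler_pdivrMr // mul1r ler_nat.
Qed.

Lemma rac_sub c d c' d' f : c <= c' -> d' <= d -> rac c d f -> rac c' d' f.
Proof.
move=> cc dd F e /F[dl dl0 H]; exists dl => // n x y xy; apply: H => i.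
by have [? ? ?] := xy i; split => //; [exact: le_trans cc _|exact: le_trans dd].
Qed.

Lemma rac_small c d f : rac c d f -> forall e : K, 0 < e ->
  exists2 dl : K, 0 < dl & forall x y, c <= x -> x <= y -> y <= d -> y - x < dl ->
    total_variation x y f \is a fin_num /\ fine (total_variation x y f) <= e.
Proof.
move=> F e e0; have [dl dl0 H] := rac_variation F e0.
exists dl => // x y cx xy yd xydl.
have tve : (total_variation x y f <= e%:E)%E.
  apply: ge_ereal_sup => _ [_ [s Ps <-] <-]; rewrite lee_fin.
  have := H 1%N (fun=> x) (fun=> y) (fun=> s).
  rewrite !big_ord1 => /(_ _ _ _ _)/ltW; apply => //.
  by move=> i j _ _ _; rewrite !ord1.
have fi : total_variation x y f \is a fin_num.
  rewrite ge0_fin_numE ?total_variation_ge0 //; exact: le_lt_trans tve (ltry _).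
by split => //; rewrite -lee_fin fineK.
Qed.

Lemma rac_bv c d f : c <= d -> rac c d f -> total_variation c d f \is a fin_num.
Proof.
move=> cd F; have [dl dl0 H] := rac_small F ltr01.
pose N := (Num.truncn ((d - c) / dl)).+1.
have N0 : (0 : K) < N%:R by rewrite ltr0n.
have NP : d - c < N%:R * dl.
  by rewrite -ltr_pdivrMr // /N truncnS_gt.
pose t (k : nat) : K := c + (d - c) * k%:R / N%:R.
have step k : t k.+1 - t k = (d - c) / N%:R.
  by rewrite /t -natr1; field; rewrite lt0r_neq0.
have step0 : 0 <= (d - c) / N%:R by rewrite divr_ge0 ?subr_ge0 // ltW.
have ct k : c <= t k by rewrite /t lerDl divr_ge0 ?mulr_ge0 ?subr_ge0 // ltW.
have tN : t N = d by rewrite /t; field; rewrite lt0r_neq0.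
have td k : (k <= N)%N -> t k <= d.
  move=> kN; rewrite -[leRHS]tN /t lerD2l ler_pM2r ?invr_gt0 //.
  by rewrite ler_wpM2l ?subr_ge0 // ler_nat.
rewrite -tN; suff : forall k, (k <= N)%N -> total_variation c (t k) f \is a fin_num by exact.
elim => [_|k IH kN]; first by rewrite /t mulr0 mul0r addr0 total_variationxx.
have tt : t k <= t k.+1 by rewrite -subr_ge0 step.
rewrite (total_variationD f (ct k) tt) fin_numD IH 1?ltnW //=.
by have [] := H _ _ (ct k) tt (td _ kN) _; rewrite // step ltr_pdivrMr // mulrC.
Qed.

(** The total variation inherits the absolute continuity of the function, hence a
   function is a difference of nondecreasing absolutely continuous ones. *)
Lemma rac_tv c d f : c <= d -> rac c d f ->
  rac c d (fun x => fine (total_variation c x f)).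
Proof.
move=> cd F e e0; have e20 : 0 < e / 2 by rewrite divr_gt0.
have [dl dl0 H] := rac_tv_le F e20; exists dl => // n x y xy tr sdl.
have fi i : total_variation (x i) (y i) f \is a fin_num.
  by have [? ? ?] := xy i; apply: rac_bv => //; apply: rac_sub F.
apply: (@le_lt_trans _ _ (e / 2)); last by rewrite ltr_pdivrMr // ltr_pMr // ltr1n.
apply: le_trans (H n x y xy tr fi sdl).
apply: ler_sum => i _; have [cx xy' yd] := xy i.
have fx : total_variation c (x i) f \is a fin_num.
  by apply: rac_bv => //; apply: rac_sub F => //; exact: le_trans xy' yd.
rewrite (total_variationD f cx xy') fineD // addrC addKr ger0_norm //.
by apply: fine_ge0; exact: total_variation_ge0.
Qed.

Lemma racD c d f g : rac c d f -> rac c d g -> rac c d (fun x => f x + g x).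
Proof.
move=> F G e e0; have e20 : 0 < e / 2 by rewrite divr_gt0.
have [dl dl0 Hf] := F _ e20; have [dl' dl'0 Hg] := G _ e20.
exists (Num.min dl dl'); first by rewrite lt_min dl0.
move=> n x y xy tr; rewrite lt_min => /andP[s1 s2].
rewrite [e]splitr; apply: le_lt_trans (ltrD (Hf _ _ _ xy tr s1) (Hg _ _ _ xy tr s2)).
rewrite -big_split /=; apply: ler_sum => i _.
by rewrite opprD addrACA ler_normD.
Qed.

Lemma racZ c d f (k : K) : rac c d f -> rac c d (fun x => k * f x).
Proof.
move=> F e e0; have k0 : 0 < `|k| + 1 by rewrite ltr_wpDl.
have e20 : 0 < e / (`|k| + 1) by rewrite divr_gt0.
have [dl dl0 Hf] := F _ e20; exists dl => // n x y xy tr s.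
have := Hf n x y xy tr s; rewrite ltr_pdivlMr //; apply: le_lt_trans.
rewrite mulr_suml; apply: ler_sum => i _.
by rewrite -mulrBr normrM mulrC ler_wpM2l // lerDl.
Qed.

End real_ac.

(** Continuity from below, in the form of a bound. *)
Lemma nondecreasing_measure_le (K : realType)
    (mu : {measure set (measurableTypeR K) -> \bar K}) (F : nat -> set K) (M : \bar K) :
  (forall n, measurable (F n : set (measurableTypeR K))) -> nondecreasing_seq F ->
  (forall n, (mu (F n) <= M)%E) -> (mu (\bigcup_n F n) <= M)%E.
Proof.
move=> mF ndF H; have mU := bigcupT_measurable F mF.
have C := nondecreasing_cvg_mu (mu := mu) mF mU ndF.
rewrite -(cvg_lim _ C) //; apply: lime_le; first by apply/cvg_ex; eexists; exact: C.
by apply: nearW => n /=.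
Qed.

Section stieltjes.
Variables (K : realType) (c d : K) (h : K -> K).
Hypothesis cd : c < d.
Hypothesis ndh : forall x y, c <= x -> x <= y -> y <= d -> h x <= h y.
Hypothesis ach : rac c d h.
Notation lebm := (@lebesgue_measure K).

Let clamp (t : K) : K := Num.max c (Num.min t d).

Let clamp_ge t : c <= clamp t. Proof. by rewrite /clamp le_max lexx. Qed.
Let clamp_le t : clamp t <= d.
Proof. by rewrite /clamp ge_max (ltW cd) ge_min lexx orbT. Qed.
Let clamp_id t : c <= t -> t <= d -> clamp t = t.
Proof. by move=> ct td; rewrite /clamp (min_l td) (max_r ct). Qed.
Let clamp_mono s t : s <= t -> clamp s <= clamp t.
Proof.
move=> st; rewrite /clamp ge_max !le_max lexx /= le_min !ge_min st lexx.
by rewrite orbT orbT.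
Qed.
Let clamp_lip s t : s <= t -> clamp t - clamp s <= t - s.
Proof.
move=> st; rewrite /clamp.
have [a1|a1] := leP t d; have [a2|a2] := leP s d;
 have [a3|a3] := leP c t; have [a4|a4] := leP c s; rewrite /=;
 have [a5|a5] := leP c d; lra.
Qed.

(** The function continued by constants outside [[c, d]], so that it generates a finite
   Stieltjes measure on the whole line. *)
Definition clamped (t : K) : K := h (clamp t).

Let nd : nondecreasing clamped.
Proof. by move=> s t st; apply: ndh => //; exact: clamp_mono. Qed.

Let rac1 (e : K) : 0 < e -> exists2 dl : K, 0 < dl &
  forall x y, c <= x -> x <= y -> y <= d -> y - x < dl -> `|h y - h x| < e.
Proof.
move=> e0; have [dl dl0 H] := ach e0; exists dl => // x y cx xy yd sd.
have := H 1%N (fun=> x) (fun=> y); rewrite !big_ord1; apply => //.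
by move=> i j _ _ _; rewrite !ord1.
Qed.

Let rc : right_continuous clamped.
Proof.
move=> x; apply/cvgrPdist_lt => e e0; have [dl dl0 H] := rac1 e0.
near=> t; rewrite distrC; apply: H => //.
- by apply: clamp_mono; near: t; exact: nbhs_right_ge.
- apply: (@le_lt_trans _ _ (t - x)).
    by apply: clamp_lip; near: t; exact: nbhs_right_ge.
  by rewrite ltrBlDl; near: t; apply: nbhs_right_lt; rewrite ltrDl.
Unshelve. all: by end_near. Qed.

HB.instance Definition _ := isCumulative.Build K _ K clamped nd rc.

Definition ac_measure := lebesgue_stieltjes_measure clamped.
HB.instance Definition _ := Measure.on ac_measure.
Let nu := ac_measure.

Let nu_itv x y : x <= y -> nu `]x, y]%classic = (clamped y - clamped x)%:E.
Proof.
move=> xy; rewrite /nu /ac_measure /lebesgue_stieltjes_measure /measure_extension.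
by rewrite measurable_mu_extE /= ?wlength_itv_bnd //; exists (x, y).
Qed.

Let nuT_le : (nu setT <= (h d - h c)%:E)%E.
Proof.
pose F (n : nat) := `](- n%:R), (n%:R : K)]%classic.
have mF n : measurable (F n : set (measurableTypeR K)) by exact: measurable_itv.
have ndF : nondecreasing_seq F.
  move=> n m nm; apply/subsetPset => x; rewrite /F /= !in_itv /= => /andP[a1 a2].
  have : (n%:R : K) <= m%:R by rewrite ler_nat.
  by move=> a3; rewrite (le_lt_trans _ a1) ?lerN2 // (le_trans a2 a3).
have FT : \bigcup_n F n = setT.
  apply/seteqP; split => // x _; exists (Num.truncn `|x|).+1 => //.
  rewrite /F /= in_itv /=; have := truncnS_gt `|x|.
  by rewrite ltr_norml => /andP[-> /ltW].
rewrite -[X in nu X]FT; apply: (nondecreasing_measure_le (mu := ac_measure)) => // n.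
rewrite [X in (X <= _)%E]nu_itv ?lee_fin; last by rewrite ge0_cp.
by apply: lerB; apply: ndh.
Qed.

Let nu_fin : fin_num_fun nu.
Proof.
move=> A mA; rewrite ge0_fin_numE //; apply: le_lt_trans (ltry (h d - h c)).
by apply: le_trans nuT_le; apply: le_measure; rewrite ?inE.
Qed.

HB.instance Definition _ := @Measure_isFinite.Build _ _ _ ac_measure nu_fin.

Let N (n : nat) := n.+1.
Let t n (i : nat) : K := c + (d - c) * i%:R / n.+1%:R.
Let t0 n : t n 0 = c. Proof. by rewrite /t mulr0 mul0r addr0. Qed.
Let tn n : t n n.+1 = d.
Proof. by rewrite /t mulfK ?pnatr_eq0 // addrC subrK. Qed.
Let tS n i : t n i <= t n i.+1.
Proof.
rewrite /t lerD2l ler_pM2r ?invr_gt0 ?ltr0n // ler_pM2l ?subr_gt0 //.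
by rewrite ler_nat.
Qed.
Let tmono n i j : (i <= j)%N -> t n i <= t n j.
Proof.
move=> ij; rewrite /t lerD2l ler_pM2r ?invr_gt0 ?ltr0n // ler_pM2l ?subr_gt0 //.
by rewrite ler_nat.
Qed.
Let tD n i : t n i.+1 - t n i = (d - c) / n.+1%:R.
Proof. by rewrite /t opprD addrACA subrr add0r -mulrBl -mulrBr -natr1 addrAC subrr add0r mulr1. Qed.

Section open_set.
Variable U : set K.
Let cell n (i : nat) : set K := `]t n i, t n i.+1]%classic.
Let sel n (i : nat) : bool := `[< cell n i `<=` U >].
Let D n i := if sel n i then cell n i else set0.
Let Un n := \big[setU/set0]_(i < n.+1) D n i.

Let mcell n i : measurable (cell n i : set (measurableTypeR K)).
Proof. exact: measurable_itv. Qed.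

Let mD n i : measurable (D n i : set (measurableTypeR K)).
Proof. by rewrite /D; case: ifP. Qed.

Let tr_cell n : trivIset setT (cell n).
Proof.
move=> i j _ _ [x] []; rewrite /cell /= !in_itv /= => /andP[a1 a2] /andP[a3 a4].
have [ij|ij|//] := ltngtP i j.
- by have := tmono n ij => /(le_trans a2)/(lt_le_trans a3); rewrite ltxx.
- by have := tmono n ij => /(le_trans a4)/(lt_le_trans a1); rewrite ltxx.
Qed.

Let tr_D n : trivIset setT (D n).
Proof.
move=> i j _ _; rewrite /D; case: ifP => _; case: ifP => _; rewrite ?setI0 ?set0I => -[x] //.
by move=> ij; apply: (tr_cell (n := n) Logic.I Logic.I); exists x.
Qed.

(** The cells of the [n]-th uniform subdivision that lie in [U] form a finite family to
   which the bound of absolute continuity applies, and every point of [U] is covered for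
   large [n]. *)
Lemma stieltjes_open_le (e dl : K) : open U ->
  (forall n (x y : 'I_n -> K), (forall i, [/\ c <= x i, x i <= y i & y i <= d]) ->
    trivIset [set: 'I_n] (fun i => `]x i, y i[%classic) ->
    \sum_(i < n) (y i - x i) < dl -> \sum_(i < n) `|h (y i) - h (x i)| < e) ->
  (lebm U < dl%:E)%E -> (nu (U `&` `]c, d]%classic) <= e%:E)%E.
Proof.
move=> oU H Udl.
have mU : measurable (U : set (measurableTypeR K)) by exact: open_measurable.
have mUn n : measurable (Un n : set (measurableTypeR K)).
  by apply: bigsetU_measurable => i _; exact: mD.
have UnU n : Un n `<=` U.
  rewrite /Un -(bigcup_mkord n.+1 (D n)) => x [i _]; rewrite /D.
  by case: ifP => // /asboolP; exact.
have nuUn n : (nu (Un n) <= e%:E)%E.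
  have -> : nu (Un n) = (\sum_(i < n.+1) nu (D n i))%E.
    exact: (measure_bigsetU ac_measure (mD n) (@tr_D n) n.+1).
  have lUn : (\sum_(i < n.+1) lebm (D n i) < dl%:E)%E.
    rewrite -[X in (X < _)%E](measure_bigsetU lebm (mD n) (@tr_D n) n.+1).
    apply: le_lt_trans Udl; apply: (le_measure lebm);
      [by rewrite inE; exact: mUn|by rewrite inE|exact: UnU].
  pose y (i : 'I_n.+1) := if sel n i then t n i.+1 else t n i.
  have ty (i : 'I_n.+1) : t n i <= y i by rewrite /y; case: ifP.
  have yt (i : 'I_n.+1) : y i <= t n i.+1 by rewrite /y; case: ifP.
  have ct (i : nat) : c <= t n i by rewrite -(t0 n); exact: tmono.
  have td (i : nat) : (i <= n.+1)%N -> t n i <= d by rewrite -[leRHS](tn n); exact: tmono.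
  have := H n.+1 (fun i => t n i) y.
  have -> : \sum_(i < n.+1) (y i - t n i) = fine (\sum_(i < n.+1) lebm (D n i))%E.
    rewrite (eq_bigr (fun i : 'I_n.+1 => (y i - t n i)%:E)); last first.
      move=> i _; rewrite /D /y; case: ifP => _; last by rewrite measure0 subrr.
      rewrite /cell lebesgue_measure_itv /= lte_fin.
      by rewrite lt_neqAle tS andbT; case: eqVneq => [->|_]; rewrite /= ?subrr ?EFinB.
    by rewrite sumEFin.
  move=> H'; rewrite (eq_bigr (fun i : 'I_n.+1 => (h (y i) - h (t n i))%:E)); last first.
    move=> i _; rewrite /D /y; case: ifP => _; last first.
      by rewrite subrr; exact: (measure0 ac_measure).
    by rewrite /cell nu_itv ?tS // /clamped !clamp_id // td // ltnW.
  rewrite sumEFin lee_fin.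
  apply: le_trans (ltW (H' _ _ _)).
  - by apply: ler_sum => i _; exact: ler_norm.
  - by move=> i; split => //; apply: le_trans (yt i) _; exact: td.
  - move=> i j _ _ [x] [] /=; rewrite !in_itv /= => /andP[a1 a2] /andP[a3 a4].
    apply/val_inj; apply: (tr_cell (n := n) Logic.I Logic.I); exists x.
    rewrite /cell /= !in_itv /= a1 a3 /=.
    by rewrite (ltW (lt_le_trans a2 (yt i))) (ltW (lt_le_trans a4 (yt j))).
  - rewrite -lte_fin fineK // ge0_fin_numE ?sume_ge0 //.
    exact: lt_trans lUn (ltry _).
pose V n := \bigcap_k Un (n + k)%N.
have mV n : measurable (V n : set (measurableTypeR K)) by exact: bigcapT_measurable.
have ndV : nondecreasing_seq V.
  move=> n m nm; apply/subsetPset => x Vx k _.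
  by have := Vx (m - n + k)%N Logic.I; rewrite addnA subnKC.
have UV : U `&` `]c, d]%classic `<=` \bigcup_n V n.
  move=> x [Ux]; rewrite /= in_itv /= => /andP[cx xd].
  have [r /= r0 rU] := oU x Ux.
  exists (Num.truncn ((d - c) / r)) => // k _.
  move: (_ + k)%N (leq_addr k (Num.truncn ((d - c) / r))) => n Nn.
  rewrite /Un -(bigcup_mkord n.+1 (D n)).
  have nr : (d - c) / n.+1%:R < r.
    rewrite ltr_pdivrMr ?ltr0n // mulrC -ltr_pdivrMr //.
    apply: lt_le_trans (truncnS_gt _) _; by rewrite ler_nat.
  have ex : exists i, x <= t n i by exists n.+1; rewrite tn.
  case: (ex_minnP ex) => -[|i] xi imin; first by move: xi; rewrite t0 leNgt cx.
  have xi' : t n i < x by rewrite ltNge; apply/negP => /imin; rewrite ltnn.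
  exists i => /=.
    rewrite ltnNge; apply/negP => ni.
    by have := lt_le_trans xi' (le_trans xd _); rewrite -{1}(tn n) => /(_ _ (tmono n ni)); rewrite ltxx.
  rewrite /D ifT; first by rewrite /cell /= in_itv /= xi' xi.
  apply/asboolP => z; rewrite /cell /= in_itv /= => /andP[z1 z2]; apply: rU => /=.
  rewrite -(tD n i) in nr; rewrite ltr_distl.
  move: (t n i) (t n i.+1) nr z1 z2 xi xi' => p q *; apply/andP; split; lra.
have mUV : measurable (\bigcup_n V n : set (measurableTypeR K)) by exact: bigcupT_measurable.
apply: (@le_trans _ _ (nu (\bigcup_n V n))).
  by apply: (le_measure ac_measure); rewrite ?inE //; apply: measurableI.
apply: (nondecreasing_measure_le (mu := ac_measure)) => // n.
apply: le_trans (nuUn n); apply: (le_measure ac_measure); rewrite ?inE //.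
by move=> x /(_ 0%N Logic.I); rewrite addn0.
Qed.

End open_set.

(** A null set lies in open sets of small measure, which have small Stieltjes measure by
   absolute continuity. *)
Lemma ac_measure_dominated : ac_measure `<< lebm.
Proof.
apply/null_content_dominatesP => A mA A0.
apply/eqP; rewrite eq_le measure_ge0 andbT.
pose L : set K := ~` `]c, d]%classic.
have mcd : measurable (`]c, d]%classic : set (measurableTypeR K)) by exact: measurable_itv.
have mL : measurable (L : set (measurableTypeR K)) by exact: measurableC.
have nuL : (ac_measure L <= 0)%E.
  have := nuT_le; rewrite -(setUv `]c, d]%classic).
  rewrite [X in (X <= _)%E](measureU ac_measure mcd mL) ?setICr //.
  rewrite [X in (X + _ <= _)%E](nu_itv (ltW cd)) /clamped !clamp_id // ?(ltW cd) //.
  by rewrite -[leRHS]adde0 leeD2lE.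
apply/lee_addgt0Pr => e e0; rewrite add0e.
have [dl dl0 H] := ach e0.
have dl20 : 0 < dl / 2 by rewrite divr_gt0.
have [U [oU AU lU]] := @outer_measure_open_le K A _ dl20.
have Udl : (lebm U < dl%:E)%E.
  apply: le_lt_trans lU _; move: A0; rewrite /lebesgue_measure /= => A0.
  rewrite [X in (X + _ < _)%E]A0 add0e lte_fin.
  by rewrite ltr_pdivrMr // ltr_pMr // ltr1n.
have mU : measurable (U : set (measurableTypeR K)) by exact: open_measurable.
have mUcd : measurable (U `&` `]c, d] : set (measurableTypeR K)) by exact: measurableI.
apply: (@le_trans _ _ (ac_measure ((U `&` `]c, d]) `|` L))).
  apply: (le_measure ac_measure); [by rewrite inE|by rewrite inE; exact: measurableU|].
  by move=> x Ax; have [xcd|xcd] := pselect (`]c, d]%classic x); [left; split => //; exact: AU|right].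
apply: le_trans (measureU2 ac_measure mUcd mL) _.
by rewrite -[leRHS]adde0; apply: leeD => //; exact: (stieltjes_open_le oU H Udl).
Qed.

Lemma nondecreasing_ac_FTC : exists2 g : K -> K,
  lebm.-integrable setT (EFin \o g) &
  forall x y, c <= x -> x <= y -> y <= d ->
    (h y - h x)%:E = (\int[lebm]_(t in `[x, y]) (g t)%:E)%E.
Proof.
have [f [f0 ffin fint fE]] := radon_nikodym_sigma_finite ac_measure_dominated.
have gE : EFin \o (fine \o f) = f by apply/funext => x /=; rewrite fineK.
exists (fine \o f); first by rewrite gE.
move=> x y cx xy yd.
have : ac_measure `]x, y]%classic = (h y - h x)%:E.
  rewrite [LHS](nu_itv xy) /clamped !clamp_id //.
  - exact: le_trans xy yd.
  - exact: le_trans cx xy.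
rewrite fE => [<-|]; last exact: measurable_itv.
rewrite integral_itv_obnd_cbnd; last first.
  by apply: measurable_funTS; exact: (measurable_int lebm fint).
by apply: eq_integral => z _; rewrite /= fineK.
Qed.

End stieltjes.

Section ac_FTC.
Variable K : realType.
Notation lebm := (@lebesgue_measure K).
Implicit Types (c d : K) (f : K -> K).

Lemma rac_FTC c d f : c < d -> rac c d f -> exists2 g : K -> K,
  lebm.-integrable setT (EFin \o g) &
  forall x y, c <= x -> x <= y -> y <= d ->
    (f y - f x)%:E = (\int[lebm]_(t in `[x, y]) (g t)%:E)%E.
Proof.
move=> cd F; pose T x := fine (total_variation c x f).
have TD x y : c <= x -> x <= y -> y <= d ->
    T y - T x = fine (total_variation x y f) /\ `|f y - f x| <= T y - T x.
  move=> cx xy yd.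
  have f1 : total_variation c x f \is a fin_num.
    by apply: rac_bv => //; apply: rac_sub F => //; exact: le_trans xy yd.
  have f2 : total_variation x y f \is a fin_num.
    by apply: rac_bv => //; apply: rac_sub F.
  have TE : T y - T x = fine (total_variation x y f).
    by rewrite /T (total_variationD f cx xy) fineD // addrC addKr.
  by split => //; rewrite TE -lee_fin fineK //; exact: total_variation_ge.
have aT : rac c d T by apply: rac_tv => //; exact: ltW.
have aTf : rac c d (fun x => T x + -1 * f x) by apply: racD aT _; exact: racZ.
have mT x y : c <= x -> x <= y -> y <= d -> T x <= T y.
  by move=> cx xy yd; rewrite -subr_ge0; apply: le_trans (TD _ _ cx xy yd).2.
have mTf x y : c <= x -> x <= y -> y <= d -> T x + -1 * f x <= T y + -1 * f y.
  move=> cx xy yd; have := le_trans (ler_norm _) (TD _ _ cx xy yd).2.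
  by rewrite !mulN1r; lra.
have [g1 i1 E1] := nondecreasing_ac_FTC cd mT aT.
have [g2 i2 E2] := nondecreasing_ac_FTC cd mTf aTf.
exists (fun x => g1 x - g2 x); first exact: (integrableB measurableT i1 i2).
move=> x y cx xy yd.
have mxy : measurable (`[x, y]%classic : set (measurableTypeR K)) by exact: measurable_itv.
rewrite (@integralB_EFin _ _ _ lebm _ g1 g2 mxy) -?E1 -?E2 //.
- by rewrite -EFinB; congr (_%:E); ring.
- exact: (integrableS measurableT mxy _ i1).
- exact: (integrableS measurableT mxy _ i2).
Qed.

(** Lebesgue points of [g] are points where its integral is differentiable. *)
Lemma ae_FTC c d f (g : K -> K) : lebm.-integrable setT (EFin \o g) ->
  (forall x y, c <= x -> x <= y -> y <= d ->
    (f y - f x)%:E = (\int[lebm]_(t in `[x, y]) (g t)%:E)%E) ->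
  {ae leb, forall x : lebT K, c < x < d -> is_derive (x : K) 1 f (g x)}.
Proof.
move=> ig E.
suff key (x : K) : lebesgue_pt g x -> c < x -> x < d -> is_derive x 1 f (g x).
  have [N [mN N0 NP]] : {ae lebm, forall x, lebesgue_pt g x}.
    by apply: lebesgue_differentiation; apply: open_integrable_locally => //; exact: openT.
  exists N; split; [exact: measurable_leb|by rewrite lebE|].
  by move=> x /= nx; apply: NP => /= gx; apply: nx => /andP[]; exact: key.
move=> gx cx xd.
have icd : lebm.-integrable [set` Interval (BLeft c) (BRight d)] (EFin \o g).
  by apply: (integrableS measurableT _ _ ig).
have cx' : (BLeft c < BRight x)%E by rewrite lte_fin.
have [dF FE] := FTC1_lebesgue_pt xd icd cx' gx.
set F := (fun y : K => _) in dF FE.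
have D : is_derive x 1 F (g x) by split; [exact: dF|rewrite -derive1E; exact: FE].
have D' : is_derive x 1 (fun y => f c + F y) (g x).
  by rewrite -[g x]add0r; exact: is_deriveD.
apply: near_eq_is_derive D'; near=> y.
have : y \in `]c, d[ by near: y; apply: near_in_itvoo; rewrite in_itv /= cx.
rewrite in_itv /= => /andP[/ltW cy /ltW yd].
rewrite /F /Rintegral -E //= addrC subrK //.
Unshelve. all: by end_near. Qed.

(** Lebesgue's fundamental theorem: an absolutely continuous function is almost
   everywhere differentiable and is the integral of its derivative.  The total
   variation and its difference with the function are nondecreasing and absolutely
   continuous, and the Stieltjes measures of such functions have densities. *)
Lemma rac_derivable_FTC c d f : c < d -> rac c d f -> exists2 g : K -> K,
  leb.-integrable (setT : set (lebT K)) (EFin \o g) &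
  (forall x y, c <= x -> x <= y -> y <= d ->
    f y - f x = \int[leb]_(t in (`[x, y]%classic : set (lebT K))) g t) /\
  {ae leb, forall x : lebT K, c < x < d -> is_derive (x : K) 1 f (g x)}.
Proof.
move=> cd /(rac_FTC cd)[g ig E]; exists g; first exact: integrable_leb.
split; last exact: ae_FTC E.
move=> x y cx xy yd; have := E x y cx xy yd.
have mxy : measurable (`[x, y]%classic : set (measurableTypeR K)) by exact: measurable_itv.
rewrite (integral_leb mxy ig).
by rewrite /Rintegral => <-.
Qed.

End ac_FTC.

(** * Primitives on an open interval *)
Section rprim.
Variable K : realType.
Variables a b : \bar K.
Notation I := (oint a b).
Notation itv c d := (`[c, d]%classic : set (lebT K)).
Implicit Types (c d x y : K) (f g : K -> K).
Notation lebm := (@lebesgue_measure K).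

Lemma oint_conv c d x : I c -> I d -> c <= x -> x <= d -> I x.
Proof.
move=> /andP[ac _] /andP[_ db] cx xd; apply/andP; split.
  by apply: lt_le_trans ac _; rewrite lee_fin.
by apply: le_lt_trans db; rewrite lee_fin.
Qed.

Lemma oint_left c : I c -> exists2 c', I c' & c' < c.
Proof.
move=> /andP[ac cb]; case: a ac => [r|//|_].
- rewrite lte_fin => rc; exists ((r + c) / 2); last by lra.
  apply/andP; split; first by rewrite lte_fin; lra.
  by apply: lt_trans cb; rewrite lte_fin; lra.
- exists (c - 1); last by lra.
  by apply/andP; split; [exact: ltNyr|apply: lt_trans cb; rewrite lte_fin; lra].
Qed.

Lemma oint_right c : I c -> exists2 c', I c' & c < c'.
Proof.
move=> /andP[ac cb]; case: b cb => [r|_|//].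
- rewrite lte_fin => rc; exists ((r + c) / 2); last by lra.
  apply/andP; split; last by rewrite lte_fin; lra.
  by apply: lt_trans ac _; rewrite lte_fin; lra.
- exists (c + 1); last by lra.
  by apply/andP; split; [apply: lt_trans ac _; rewrite lte_fin; lra|exact: ltry].
Qed.

Lemma ae_oint (P : K -> Prop) :
  (forall c d, I c -> I d -> {ae leb, forall x : lebT K, c < x < d -> P x}) ->
  {ae leb, forall x : lebT K, I x -> P x}.
Proof.
move=> H.
pose Q (n : nat) (x : lebT K) := if unpickle n is Some (p, q) then
  I (ratr p) -> I (ratr q) -> ratr p < (x : K) < ratr q -> P x else True.
have : {ae leb, forall x, forall n, Q n x}.
  apply: ae_nat => n; rewrite /Q; case: (unpickle n : option (rat * rat)) => [[p q]|].
    have [Ip|nIp] := pselect (I (ratr p)); last by apply: ae_always.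
    have [Iq|nIq] := pselect (I (ratr q)); last by apply: ae_always.
    by apply: ae_mono (H _ _ Ip Iq) => x h _ _; exact: h.
  exact: ae_always.
apply: ae_mono => x h Ix.
have [c Ic cx] := oint_left Ix; have [d Id xd] := oint_right Ix.
have [p] := rat_in_itvoo cx; rewrite in_itv /= => /andP[cp px].
have [q] := rat_in_itvoo xd; rewrite in_itv /= => /andP[xq qd].
have := h (pickle (p, q)); rewrite /Q pickleK; apply.
- exact: oint_conv Ic Ix (ltW cp) (ltW px).
- exact: oint_conv Ix Id (ltW xq) (ltW qd).
- by rewrite px xq.
Qed.

Definition rintg (D : set K) g :=
  leb.-integrable (D : set (lebT K)) (fun x : lebT K => (g x)%:E).
Definition rint c d g : K := \int[leb]_(t in itv c d) g t.

Lemma measurable_itvl c d : measurable (itv c d).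
Proof. by apply: measurable_leb; exact: measurable_itv. Qed.

Lemma rintgS c d x y g : c <= x -> y <= d -> rintg `[c, d] g -> rintg `[x, y] g.
Proof.
move=> cx yd; apply: integrableS; try exact: measurable_itvl.
by move=> t; rewrite /= !in_itv /= => /andP[? ?]; apply/andP; split; lra.
Qed.

Lemma rint_split c x d g : c <= x -> x <= d -> rintg `[c, d] g ->
  rint c d g = rint c x g + rint x d g.
Proof.
move=> cx xd ig.
have mo : measurable (`]x, d]%classic : set (lebT K)).
  by apply: measurable_leb; exact: measurable_itv.
have ms : measurable ([set x] : set (lebT K)) by apply: measurable_leb; exact: measurable_set1.
have s0 : leb ([set x] : set (lebT K)) = 0%E by rewrite lebE lebesgue_measure_set1.
have E1 : (`[x, d]%classic : set K) = [set x] `|` `]x, d]%classic.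
  apply/seteqP; split => t /=; rewrite !in_itv /=.
    by move=> /andP[]; rewrite le_eqVlt => /predU1P[->|-> ->]; [left|right].
  by move=> [->|/andP[/ltW -> ->//]]; rewrite lexx.
have E2 : (`[c, d]%classic : set K) = `[c, x]%classic `|` `]x, d]%classic.
  apply/seteqP; split => t /=; rewrite !in_itv /=.
    by move=> /andP[-> ->]; case: (leP t x); [left|right].
  by move=> [/andP[-> /le_trans ->//]|/andP[/ltW xt ->]]; rewrite (le_trans cx xt).
have ig' : rintg `[x, d] g by apply: rintgS ig.
have io : rintg `]x, d] g.
  by apply: integrableS ig' => //; [exact: measurable_itvl|rewrite E1; exact: subsetUr].
have -> : rint x d g = \int[leb]_(t in (`]x, d]%classic : set (lebT K))) g t.
  rewrite /rint [in LHS]E1 Rintegral_setU //; last 2 first.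
  - by rewrite -E1.
  - by apply/disj_setPS => t [/= ->]; rewrite in_itv /= ltxx.
  have mf : measurable_fun ([set x] : set (lebT K)) (fun t : lebT K => (g t)%:E).
    apply: (@measurable_funS _ _ _ _ (itv x d)); first exact: measurable_itvl.
      by rewrite E1; exact: subsetUl.
    exact: (measurable_int leb ig').
  have Z := null_set_integral ms mf s0.
  by rewrite [X in X + _](_ : _ = 0) ?add0r // /Rintegral Z.
rewrite /rint [in LHS]E2 Rintegral_setU //.
- exact: measurable_itvl.
- by rewrite -E2.
- by apply/disj_setPS => t [/=]; rewrite !in_itv /= => /andP[_ tx] /andP[]; rewrite ltNge tx.
Qed.

Lemma rintg_ae (D : set K) f g : measurable (D : set (lebT K)) ->
  {ae leb, forall x : lebT K, D x -> f x = g x} -> rintg D f -> rintg D g.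
Proof.
move=> mD fg fi.
have e : ae_eq leb (D : set (lebT K)) (fun x : lebT K => (f x)%:E) (fun x : lebT K => (g x)%:E).
  by apply: ae_mono fg => x h Dx; rewrite h.
have mf := measurable_int leb fi.
have mg := ae_measurable_fun (@completed_lebesgue_measure_is_complete K) e mf.
apply/integrableP; split => //; move/integrableP: fi => [_].
rewrite (ge0_ae_eq_integral mD _ _ _ _ (ae_eq_abse e)) //.
- by apply: measurableT_comp.
- by apply: measurableT_comp.
- by move=> x _; exact: abse_ge0.
- by move=> x _; exact: abse_ge0.
Qed.

Lemma rint_ae c d f g :
  {ae leb, forall x : lebT K, c < x < d -> f x = g x} ->
  rintg `[c, d] f -> rintg `[c, d] g /\ rint c d g = rint c d f.
Proof.
move=> fg fi.
have fg' : {ae leb, forall x : lebT K, itv c d x -> f x = g x}.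
  have nc (z : K) : {ae leb, forall x : lebT K, x <> z}.
    exists [set z]; split.
    - by apply: measurable_leb; exact: measurable_set1.
    - by rewrite lebE lebesgue_measure_set1.
    - by move=> x /= /contrapT.
  apply: ae_mono (ae_and fg (ae_and (nc c) (nc d))) => x [h [xc xd]].
  rewrite /= in_itv /= => /andP[cx dx]; apply: h.
  by rewrite !lt_neqAle cx dx !andbT; apply/andP; split; apply/eqP => // /esym.
have gi := rintg_ae (measurable_itvl c d) fg' fi; split => //.
rewrite /rint /Rintegral; congr fine; apply: ae_eq_integral.
- exact: measurable_itvl.
- exact: (measurable_int leb gi).
- exact: (measurable_int leb fi).
- by apply: ae_mono fg' => x h Dx; rewrite h.
Qed.

(** The relation between a locally absolutely continuous function and its derivative, in
   integral form: products, limits and reflections act on it without any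
   differentiability argument. *)
Definition rprim f g := forall c d, I c -> I d -> c <= d ->
  rintg `[c, d] g /\ f d - f c = rint c d g.
Definition loc_rac f := forall c d, I c -> I d -> rac c d f.

Lemma loc_rac_derivable f : loc_rac f ->
  {ae leb, forall x : lebT K, I x -> is_derive (x : K) 1 f (derive1 f x)}.
Proof.
move=> F; apply: ae_oint => c d Ic Id.
have [cd|dc] := ltP c d; last first.
  by apply: ae_always => x /andP[cx xd]; have := lt_trans cx xd; rewrite ltNge dc.
have [g _ [_]] := rac_derivable_FTC cd (F _ _ Ic Id).
apply: ae_mono => x h /h D; rewrite derive1E; apply: DeriveDef => //.
Qed.

Lemma rprim_of_ac f g : loc_rac f ->
  {ae leb, forall x : lebT K, I x -> is_derive (x : K) 1 f (g x)} -> rprim f g.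
Proof.
move=> F D x y Ix Iy xy.
have [c Ic cx] := oint_left Ix; have [d Id yd] := oint_right Iy.
have cd : c < d := lt_trans cx (le_lt_trans xy yd).
have [h hi [hE hD]] := rac_derivable_FTC cd (F _ _ Ic Id).
have hi' : rintg `[x, y] h.
  by apply: integrableS hi => //; exact: measurable_itvl.
have [] := @rint_ae x y h g _ hi'.
  apply: ae_mono (ae_and D hD) => t [Dt hDt] /andP[xt ty].
  have tcd : c < t < d by rewrite (lt_trans cx xt) (lt_trans ty yd).
  have It : I t by apply: (@oint_conv x y); rewrite ?ltW.
  by have [_ <-] := hDt tcd; have [_ <-] := Dt It.
by move=> gi gE; split => //; rewrite gE hE // ltW.
Qed.

Lemma rprim_borel f g c d : rprim f g -> I c -> I d -> c <= d ->
  exists2 g' : K -> K, lebm.-integrable setT (EFin \o g') &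
  (forall x y, c <= x -> x <= y -> y <= d ->
    (f y - f x)%:E = (\int[lebm]_(t in `[x, y]) (g' t)%:E)%E) /\
  {ae leb, forall x : lebT K, c < x < d -> g x = g' x}.
Proof.
move=> F Ic Id cd; have [gi _] := F c d Ic Id cd.
pose h : lebT K -> K := g \_ (itv c d).
have hi : leb.-integrable setT (EFin \o h).
  move: gi; rewrite /rintg integrable_mkcond; last exact: measurable_itvl.
  by rewrite /h restrict_EFin.
have [g' gi' hg'] := borel_version_ex hi.
exists g' => //; split; last first.
  apply: ae_mono hg' => t ht /andP[xt ty].
  by rewrite -ht /h patchE ifT // inE /= in_itv /= !ltW.
move=> x y cx xy yd.
have Ix : I x by apply: (oint_conv Ic Id) => //; lra.
have Iy : I y by apply: (oint_conv Ic Id) => //; lra.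
have [gxy ->] := F _ _ Ix Iy xy.
have [gi2 <-] : rintg `[x, y] g' /\ rint x y g' = rint x y g.
  apply: rint_ae gxy; apply: ae_mono hg' => t ht /andP[xt ty].
  by rewrite -ht /h patchE ifT // inE /= in_itv /=; apply/andP; split; lra.
have mxy : measurable (`[x, y]%classic : set (measurableTypeR K)) by exact: measurable_itv.
rewrite (integral_leb mxy gi') /rint /Rintegral fineK //.
by apply: integrable_fin_num => //; exact: measurable_itvl.
Qed.

(** Absolute continuity of the integral, applied to a Borel version of [g] on [[c, d]]. *)
Lemma rprim_ac f g : rprim f g -> loc_rac f.
Proof.
move=> F c d Ic Id e e0.
have [cd|dc] := leP c d; last first.
  exists 1 => // n x y xy _ _; rewrite big1 // => i _.
  by have [h1 h2 h3] := xy i; exfalso; lra.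
have [g' gi [E _]] := rprim_borel F Ic Id cd.
have [dl [dl0 H]] := integral_normr_continuous gi e0.
exists dl => // n x y xy tr sdl.
pose A (i : 'I_n) : set (measurableTypeR K) := `]x i, y i[%classic.
have mA i : measurable (A i) by exact: measurable_itv.
pose U := \big[setU/set0]_(i < n) A i.
have mU : measurable U by apply: bigsetU_measurable => i _.
have lA i : lebm (A i) = (y i - x i)%:E.
  rewrite /A lebesgue_measure_itv /= lte_fin; case: ltP => // yx.
  have [_ xyi _] := xy i.
  by rewrite (le_anti (introT andP (conj xyi yx))) subrr.
have lU : lebm U = (\sum_(i < n) (y i - x i))%:E.
  rewrite /U (@measure_bigsetU_ord _ _ _ lebm n xpredT A mA tr) //.
  by rewrite -sumEFin; apply: eq_bigr => i _; exact: lA.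
have := H U mU; rewrite -[X in (X < _)%E]/(lebm U) lU lte_fin => /(_ sdl).
apply: le_lt_trans.
have nhi : lebm.-integrable setT (EFin \o (fun t => `|g' t|)).
  exact: integrable_norm gi.
have fA i : (\int[lebm]_(t in A i) (`|g' t|)%:E)%E \is a fin_num.
  by apply: integrable_fin_num => //; exact: (integrableS measurableT _ _ nhi).
have -> : \int[lebm]_(t in U) `|g' t| = \sum_(i < n) \int[lebm]_(t in A i) `|g' t|.
  rewrite /Rintegral /U ge0_integral_bigsetU //=; last 3 first.
  - exact: index_enum_uniq.
  - by move=> i j _ _; exact: tr.
  - by apply: measurable_funTS; exact: (measurable_int lebm nhi).
  by rewrite -sum_fine // => i _; exact: fA.
apply: ler_sum => i _; have [cx xyi yd] := xy i.
have giA : lebm.-integrable (A i) (EFin \o g') by exact: (integrableS measurableT _ _ gi).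
have := E _ _ cx xyi yd.
rewrite -integral_itv_bndo_bndc; last first.
  by apply: measurable_funTS; exact: (measurable_int lebm gi).
rewrite -integral_itv_obnd_cbnd; last first.
  by apply: measurable_funTS; exact: (measurable_int lebm gi).
move=> E'; have -> : f (y i) - f (x i) = \int[lebm]_(t in A i) g' t.
  by rewrite /Rintegral -E'.
exact: le_normr_Rintegral.
Qed.

Lemma rprim_derive f g : rprim f g ->
  {ae leb, forall x : lebT K, I x -> is_derive (x : K) 1 f (g x)}.
Proof.
move=> F; apply: ae_oint => c d Ic Id.
have [cd|dc] := leP c d; last first.
  by apply: ae_always => x /andP[cx xd]; exfalso; lra.
have [g' gi' [E h]] := rprim_borel F Ic Id cd.
have D := ae_FTC gi' E.
by apply: ae_mono (ae_and D h) => x [h1 h2] /[dup] /h1 + /h2 => + ->.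
Qed.

End rprim.

Section rprim_calculus.
Variable K : realType.
Variables a b : \bar K.
Notation I := (oint a b).
Notation itv c d := (`[c, d]%classic : set (lebT K)).
Implicit Types (c d x y : K) (f g h : K -> K).

Lemma rac_bounded c d f : rac c d f ->
  exists2 M : K, 0 < M & forall x, c <= x -> x <= d -> `|f x| <= M.
Proof.
move=> F; have [cd|dc] := leP c d; last first.
  by exists 1 => // x cx xd; exfalso; lra.
have fi := rac_bv cd F.
exists (`|f c| + fine (total_variation c d f) + 1).
  by rewrite ltr_wpDl // addr_ge0 // fine_ge0 //; exact: total_variation_ge0.
move=> x cx xd; rewrite (_ : f x = f c + (f x - f c)); last by rewrite addrC subrK.
apply: le_trans (ler_normD _ _) _; rewrite -addrA lerD2l.
apply: (@le_trans _ _ (fine (total_variation c d f))); last by rewrite lerDl.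
rewrite -lee_fin fineK //; apply: le_trans (total_variation_ge f cx) _.
by rewrite (total_variationD f cx xd) leeDl // total_variation_ge0.
Qed.

Lemma racM c d f g : rac c d f -> rac c d g -> rac c d (fun x => f x * g x).
Proof.
move=> F G; have [M M0 HM] := rac_bounded F; have [N N0 HN] := rac_bounded G.
move=> e e0.
have eN : 0 < e / (2 * N) by rewrite divr_gt0 // mulr_gt0.
have eM : 0 < e / (2 * M) by rewrite divr_gt0 // mulr_gt0.
have [dl dl0 Hf] := F _ eN; have [dl' dl'0 Hg] := G _ eM.
exists (Num.min dl dl'); first by rewrite lt_min dl0.
move=> n x y xy tr; rewrite lt_min => /andP[s1 s2].
have h1 := Hf _ _ _ xy tr s1; have h2 := Hg _ _ _ xy tr s2.
have -> : e = N * (e / (2 * N)) + M * (e / (2 * M)).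
  by field; rewrite !lt0r_neq0.
rewrite -(ltr_pM2l N0) in h1; rewrite -(ltr_pM2l M0) in h2.
apply: le_lt_trans (ltrD h1 h2); rewrite !mulr_sumr -big_split /=.
apply: ler_sum => i _; have [cx xyi yd] := xy i.
rewrite (_ : _ - _ = g (y i) * (f (y i) - f (x i)) + f (x i) * (g (y i) - g (x i))); last by ring.
apply: le_trans (ler_normD _ _) _; rewrite !normrM; apply: lerD; apply: ler_wpM2r => //.
- by apply: HN => //; exact: le_trans cx xyi.
- by apply: HM => //; exact: le_trans xyi yd.
Qed.

Lemma rac_cst c d k : rac c d (fun=> k).
Proof.
move=> e e0; exists 1 => // n x y _ _ _; rewrite big1 // => i _.
by rewrite subrr normr0.
Qed.

Lemma rac_continuous c d f : rac c d f -> c < d -> {within `[c, d], continuous f}.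
Proof.
move=> F cd; apply/subspace_continuousP => x /= xcd; apply/cvgrPdist_lt => e e0.
have [dl dl0 H] := F _ e0.
have H1 s t : c <= s -> s <= t -> t <= d -> t - s < dl -> `|f t - f s| < e.
  move=> cs st td l; have := H 1%N (fun=> s) (fun=> t); rewrite !big_ord1; apply => //.
  by move=> i j _ _ _; rewrite !ord1.
apply/nbhs_ballP; exists dl => //= y; rewrite /ball /= => xy ycd.
move: xcd ycd; rewrite !in_itv /= => /andP[cx xd] /andP[cy yd].
have [le|/ltW le] := leP x y.
  rewrite distrC; apply: H1 => //; move: xy; rewrite distrC ger0_norm ?subr_ge0 //.
by apply: H1 => //; move: xy; rewrite ger0_norm ?subr_ge0.
Qed.

Lemma racV c d f : (forall x, c <= x -> x <= d -> f x != 0) -> rac c d f ->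
  rac c d (fun x => (f x)^-1).
Proof.
move=> f0 F; have [cd|dc] := ltP c d; last first.
  move=> e e0; exists 1 => // n x y xy _ _; rewrite big1 // => i _.
  have [h1 h2 h3] := xy i; have -> : y i = x i by lra.
  by rewrite subrr normr0.
have C : {within `[c, d], continuous (fun x => `|f x|)}.
  move=> x; have C := rac_continuous F cd; apply: continuous_comp; first exact: C.
  exact: norm_continuous.
have [z zcd zmin] := EVT_min (ltW cd) C.
have m0 : 0 < `|f z|.
  by rewrite normr_gt0; move: zcd; rewrite in_itv /= => /andP[? ?]; exact: f0.
have fz0 : f z != 0 by rewrite -normr_gt0.
set m := `|f z| in m0 zmin.
have fm x : c <= x -> x <= d -> m <= `|f x|.
  by move=> cx xd; apply: zmin; rewrite in_itv /= cx.
move=> e e0; have e1 : 0 < e * m ^+ 2 by rewrite mulr_gt0 // exprn_gt0.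
have [dl dl0 H] := F _ e1; exists dl => // n x y xy tr s.
have := H n x y xy tr s; rewrite -ltr_pdivrMr ?exprn_gt0 //; apply: le_lt_trans.
rewrite mulr_suml; apply: ler_sum => i _; have [cx xyi yd] := xy i.
have xd := le_trans xyi yd; have cy := le_trans cx xyi.
have fx0 := f0 _ cx xd; have fy0 := f0 _ cy yd.
have -> : (f (y i))^-1 - (f (x i))^-1 = - (f (y i) - f (x i)) / (f (x i) * f (y i)).
  by field; rewrite fx0 fy0.
rewrite normrM normrN normfV ler_wpM2l // lef_pV2 ?posrE ?exprn_gt0 ?normr_gt0 ?mulf_neq0 //.
by rewrite normrM expr2 ler_pM ?fm // ltW.
Qed.

Lemma loc_rac_eq f g : loc_rac a b f -> (forall x, f x = g x) -> loc_rac a b g.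
Proof. by move=> F /funext <-. Qed.
Lemma rprim_eq f f' g g' : rprim a b f f' -> (forall x, f x = g x) ->
  (forall x, f' x = g' x) -> rprim a b g g'.
Proof. by move=> F /funext <- /funext <-. Qed.

Lemma loc_racD f g : loc_rac a b f -> loc_rac a b g -> loc_rac a b (fun x => f x + g x).
Proof. by move=> F G c d Ic Id; apply: racD; [exact: F|exact: G]. Qed.
Lemma loc_racM f g : loc_rac a b f -> loc_rac a b g -> loc_rac a b (fun x => f x * g x).
Proof. by move=> F G c d Ic Id; apply: racM; [exact: F|exact: G]. Qed.
Lemma loc_racN f : loc_rac a b f -> loc_rac a b (fun x => - f x).
Proof.
move=> F c d Ic Id; rewrite (_ : (fun x => _) = (fun x => -1 * f x)); last first.
  by apply/funext => x; rewrite mulN1r.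
by apply: racZ; exact: F.
Qed.
Lemma loc_rac_cst k : loc_rac a b (fun=> k).
Proof. by move=> c d _ _; exact: rac_cst. Qed.
Lemma loc_racV f : (forall x, I x -> f x != 0) -> loc_rac a b f ->
  loc_rac a b (fun x => (f x)^-1).
Proof.
move=> f0 F c d Ic Id; apply: racV; last exact: F.
by move=> x cx xd; apply: f0; exact: (oint_conv Ic Id).
Qed.

Lemma rprimD f f' g g' : rprim a b f f' -> rprim a b g g' ->
  rprim a b (fun x => f x + g x) (fun x => f' x + g' x).
Proof.
move=> F G; apply: rprim_of_ac.
  by apply: loc_racD; [exact: rprim_ac F|exact: rprim_ac G].
apply: ae_mono (ae_and (rprim_derive F) (rprim_derive G)) => x [Hf Hg] Ix.
by have := Hf Ix; have := Hg Ix => ? ?; exact: is_deriveD.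
Qed.

Lemma rprimM f f' g g' : rprim a b f f' -> rprim a b g g' ->
  rprim a b (fun x => f x * g x) (fun x => f' x * g x + f x * g' x).
Proof.
move=> F G; apply: rprim_of_ac.
  by apply: loc_racM; [exact: rprim_ac F|exact: rprim_ac G].
apply: ae_mono (ae_and (rprim_derive F) (rprim_derive G)) => x [Hf Hg] Ix.
have h1 := Hf Ix; have h2 := Hg Ix.
have := is_deriveM h1 h2; rewrite /GRing.scale /= => H.
by rewrite addrC (mulrC (f' x)).
Qed.

Lemma rprim_cst k : rprim a b (fun=> k) (fun=> 0).
Proof.
apply: rprim_of_ac; first exact: loc_rac_cst.
by apply: ae_always => x _; exact: is_derive_cst.
Qed.

Lemma rprimZ f f' k : rprim a b f f' -> rprim a b (fun x => k * f x) (fun x => k * f' x).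
Proof.
move=> F; have := rprimM (rprim_cst k) F.
by rewrite (_ : (fun x => 0 * f x + _) = fun x => k * f' x) //; apply/funext => x; rewrite mul0r add0r.
Qed.

Lemma rprimN f f' : rprim a b f f' -> rprim a b (fun x => - f x) (fun x => - f' x).
Proof.
move=> /(rprimZ (-1)); congr (rprim a b _ _); apply/funext => x; exact: mulN1r.
Qed.

Lemma rprim_uniq f g h : rprim a b f g -> rprim a b f h ->
  {ae leb, forall x : lebT K, I x -> g x = h x}.
Proof.
move=> /rprim_derive G /rprim_derive H.
apply: ae_mono (ae_and G H) => x [hg hh] Ix.
by have [_ <-] := hg Ix; have [_ <-] := hh Ix.
Qed.

Lemma rprim_ae f g h : rprim a b f g ->
  {ae leb, forall x : lebT K, I x -> g x = h x} -> rprim a b f h.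
Proof.
move=> F gh; apply: rprim_of_ac; first exact: rprim_ac F.
apply: ae_mono (ae_and (rprim_derive F) gh) => x [D E] Ix.
by rewrite -E //; exact: D.
Qed.

Definition rloc g := forall c d, I c -> I d -> rintg `[c, d] g.

Lemma rloc_prim_r f g : rprim a b f g -> rloc g.
Proof.
move=> F c d Ic Id; have [cd|dc] := leP c d; first by have [] := F c d Ic Id cd.
rewrite set_itv_ge ?bnd_simp -?ltNge //.
by rewrite /rintg; exact: integrable_set0.
Qed.

Lemma loc_rac_measurable f c d : loc_rac a b f -> I c -> I d ->
  measurable_fun (itv c d) (f : lebT K -> K).
Proof.
move=> F Ic Id; have [d' Id' dd'] := oint_right Id.
have [cd|dc] := ltP c d'; last first.
  by rewrite set_itv_ge ?bnd_simp -?ltNge; [exact: measurable_fun_set0|lra].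
have C := rac_continuous (F _ _ Ic Id') cd.
have M : measurable_fun (`[c, d']%classic : set (measurableTypeR K)) (f : measurableTypeR K -> K).
  by apply: subspace_continuous_measurable_fun => //; exact: measurable_itv.
apply: (@measurable_funS _ _ _ _ (itv c d')); first exact: measurable_itvl.
  by move=> t; rewrite /= !in_itv /= => /andP[-> td]; rewrite (le_trans td) // ltW.
move=> _ Y mY; apply: measurable_leb; apply: M => //; exact: measurable_itv.
Qed.

Lemma rloc_cac f : loc_rac a b f -> rloc f.
Proof.
move=> F c d Ic Id; apply: measurable_bounded_integrable; first exact: measurable_itvl.
- rewrite [X in (X < _)%E](_ : _ = @lebesgue_measure K `[c, d]%classic); last exact: lebE.
  rewrite lebesgue_measure_itv /=; case: ifP => _; rewrite ?ltry //.
- exact: loc_rac_measurable.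
- have [M M0 H] := rac_bounded (F _ _ Ic Id); exists M; split; first exact: num_real.
  move=> N MN x /=; rewrite in_itv /= => /andP[cx xd].
  by apply: le_trans (ltW MN); exact: H.
Qed.

Lemma rloc_eq f g : rloc f -> (forall x, f x = g x) -> rloc g.
Proof. by move=> F /funext <-. Qed.

Lemma rlocM f g : loc_rac a b f -> rloc g -> rloc (fun x => f x * g x).
Proof.
move=> F G c d Ic Id; have := G c d Ic Id; rewrite /rintg => Gi.
have [M M0 H] := rac_bounded (F _ _ Ic Id).
have := @integrableMr _ _ _ leb (itv c d) (measurable_itvl c d) f
  (fun x : lebT K => (g x)%:E) (loc_rac_measurable F Ic Id).
apply => //; exists M; split; first exact: num_real.
move=> N MN x /=; rewrite in_itv /= => /andP[cx xd].
by apply: le_trans (ltW MN); exact: H.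
Qed.

Lemma rlocD f g : rloc f -> rloc g -> rloc (fun x => f x + g x).
Proof.
move=> F G c d Ic Id.
exact: (integrableD (measurable_itvl c d) (F c d Ic Id) (G c d Ic Id)).
Qed.

Lemma rlocN f : rloc f -> rloc (fun x => - f x).
Proof.
move=> F c d Ic Id; exact: (integrableN (F c d Ic Id)).
Qed.

Lemma rloc_norm f : rloc f -> rloc (fun x => `|f x|).
Proof. move=> F c d Ic Id; exact: (integrable_norm (F c d Ic Id)). Qed.


(** The primitive with base point [c0]; the integral is oriented. *)
Definition rprimf c0 g x : K :=
  if c0 <= x then rint c0 x g else - rint x c0 g.

Lemma rint_pt c g : rint c c g = 0.
Proof.
rewrite /rint set_itv1 /Rintegral.
have s0 : leb ([set c] : set (lebT K)) = 0%E by rewrite lebE lebesgue_measure_set1.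
have ms : measurable ([set c] : set (lebT K)) by apply: measurable_leb; exact: measurable_set1.
have mf : measurable_fun ([set c] : set (lebT K)) (fun t : lebT K => (g t)%:E).
  exact: measurable_fun_set1.
by have -> := null_set_integral ms mf s0.
Qed.

Lemma rprimf0 c0 g : rprimf c0 g c0 = 0.
Proof. by rewrite /rprimf lexx rint_pt. Qed.

Lemma rprimfP c0 g : I c0 -> rloc g -> rprim a b (rprimf c0 g) g.
Proof.
move=> I0 G c d Ic Id cd; split; first exact: G.
rewrite /rprimf.
have [h1|h1] := leP c0 d; have [h2|h2] := leP c0 c.
- by rewrite (@rint_split _ c0 c d) //; [ring|exact: G].
- by rewrite (@rint_split _ c c0 d) //; [ring|exact: ltW|exact: G].
- by exfalso; lra.
- by rewrite (rint_split cd (ltW h1) (G _ _ Ic I0)); ring.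
Qed.


Lemma rint_ge0 c d g : {ae leb, forall x : lebT K, c < x < d -> 0 <= g x} ->
  rintg `[c, d] g -> 0 <= rint c d g.
Proof.
move=> g0 gi; have [_ <-] : rintg `[c, d] (fun x => Num.max (g x) 0) /\
   rint c d (fun x => Num.max (g x) 0) = rint c d g.
  by apply: rint_ae gi; apply: ae_mono g0 => x h /h; rewrite /Num.max; case: ltP => // ? ?; lra.
by apply: Rintegral_ge0 => x _; rewrite le_max lexx orbT.
Qed.

Lemma rprim_le f g c d : rprim a b f g -> I c -> I d -> c <= d ->
  {ae leb, forall x : lebT K, c < x < d -> 0 <= g x} -> f c <= f d.
Proof.
move=> F Ic Id cd g0; rewrite -subr_ge0; have [gi ->] := F c d Ic Id cd.
exact: rint_ge0.
Qed.

Lemma rint_dct c d (fn : nat -> K -> K) f h :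
  (forall n, rintg `[c, d] (fn n)) -> rintg `[c, d] f -> rintg `[c, d] h ->
  {ae leb, forall x : lebT K, itv c d x -> fn n x @[n --> \oo] --> f x} ->
  {ae leb, forall x : lebT K, itv c d x -> forall n, `|fn n x| <= h x} ->
  rint c d (fn n) @[n --> \oo] --> rint c d f.
Proof.
move=> fni fi hi fnf fnh.
have := @dominated_convergence _ _ K leb (itv c d) (measurable_itvl c d)
  (fun n x => (fn n x)%:E) (fun x : lebT K => (f x)%:E) (fun x : lebT K => (h x)%:E).
move=> /(_ (fun n => measurable_int leb (fni n)) (measurable_int leb fi)).
case=> //.
- by apply: ae_mono fnf => x H Dx; apply/fine_cvgP; split; [exact: nearW|exact: H].
- by apply: ae_mono fnh => x H n Dx; rewrite /= lee_fin; exact: H.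
move=> _ _ H; apply/fine_cvg; rewrite fineK //.
by apply: integrable_fin_num => //; exact: measurable_itvl.
Qed.

End rprim_calculus.

(** * Complex and matrix valued primitives *)
Section complex_parts.
Variable K : realType.
Notation C := (cplx K).
Implicit Types (z w : C) (x y : K).

Lemma cplx_eq z w : reC z = reC w -> imC z = imC w -> z = w.
Proof. by case: z => a b; case: w => c d; rewrite /reC /imC /= => -> ->. Qed.

Lemma reCD z w : reC (z + w) = reC z + reC w. Proof. by case: z; case: w. Qed.
Lemma imCD z w : imC (z + w) = imC z + imC w. Proof. by case: z; case: w. Qed.
Lemma reCN z : reC (- z) = - reC z. Proof. by case: z. Qed.
Lemma imCN z : imC (- z) = - imC z. Proof. by case: z. Qed.
Lemma reCB z w : reC (z - w) = reC z - reC w. Proof. by rewrite reCD reCN. Qed.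
Lemma imCB z w : imC (z - w) = imC z - imC w. Proof. by rewrite imCD imCN. Qed.
Lemma reCM z w : reC (z * w) = reC z * reC w - imC z * imC w.
Proof. by case: z; case: w. Qed.
Lemma imCM z w : imC (z * w) = reC z * imC w + imC z * reC w.
Proof. by case: z => ? ?; case: w. Qed.
Lemma reC0 : reC (0 : C) = 0. Proof. by []. Qed.
Lemma imC0 : imC (0 : C) = 0. Proof. by []. Qed.
Lemma reC1 : reC (1 : C) = 1. Proof. by []. Qed.
Lemma imC1 : imC (1 : C) = 0. Proof. by []. Qed.
Lemma reC_conj z : reC z^* = reC z. Proof. by case: z. Qed.
Lemma imC_conj z : imC z^* = - imC z. Proof. by case: z. Qed.
Lemma reC_real x : reC (realC x) = x. Proof. by []. Qed.
Lemma imC_real x : imC (realC x) = 0. Proof. by []. Qed.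
Lemma reC_mk x y : reC (mkC x y) = x. Proof. by []. Qed.
Lemma imC_mk x y : imC (mkC x y) = y. Proof. by []. Qed.

Definition reimE := (reCB, imCB, reCD, imCD, reCN, imCN, reCM, imCM, reC0, imC0,
  reC1, imC1, reC_conj, imC_conj, reC_real, imC_real, reC_mk, imC_mk).

Lemma lecP z w : (z <= w) = (imC w == imC z) && (reC z <= reC w).
Proof. exact: lecE. Qed.
Lemma ltcP z w : (z < w) = (imC w == imC z) && (reC z < reC w).
Proof. exact: ltcE. Qed.

Lemma reC_sum (J : Type) (r : seq J) (p : pred J) (F : J -> C) :
  reC (\sum_(i <- r | p i) F i) = \sum_(i <- r | p i) reC (F i).
Proof. by elim/big_rec2: _ => // i y1 y2 _ <-; rewrite reCD. Qed.
Lemma imC_sum (J : Type) (r : seq J) (p : pred J) (F : J -> C) :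
  imC (\sum_(i <- r | p i) F i) = \sum_(i <- r | p i) imC (F i).
Proof. by elim/big_rec2: _ => // i y1 y2 _ <-; rewrite imCD. Qed.

Lemma realCD x y : realC (x + y) = realC x + realC y.
Proof. by apply: cplx_eq; rewrite !reimE ?addr0. Qed.
Lemma realCN x : realC (- x) = - realC x.
Proof. by apply: cplx_eq; rewrite !reimE ?oppr0. Qed.
Lemma realCB x y : realC (x - y) = realC x - realC y.
Proof. by rewrite realCD realCN. Qed.
Lemma realCM x y : realC (x * y) = realC x * realC y.
Proof. by apply: cplx_eq; rewrite !reimE; ring. Qed.
Lemma realC0 : realC (0 : K) = 0. Proof. by []. Qed.
Lemma realC_conj x : (realC x)^* = realC x.
Proof. by apply: cplx_eq; rewrite !reimE ?oppr0. Qed.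
Lemma realC_le x y : (realC x <= realC y) = (x <= y).
Proof. by rewrite lecP !reimE eqxx. Qed.
Lemma realC_lt x y : (realC x < realC y) = (x < y).
Proof. by rewrite ltcP !reimE eqxx. Qed.
Lemma realC_sum (J : Type) (r : seq J) (p : pred J) (F : J -> K) :
  realC (\sum_(i <- r | p i) F i) = \sum_(i <- r | p i) realC (F i).
Proof. by elim/big_rec2: _ => // i y1 y2 _ <-; rewrite realCD. Qed.

Lemma norm_reC z : realC `|reC z| <= `|z|. Proof. exact: normc_ge_Re. Qed.
Lemma norm_imC z : realC `|imC z| <= `|z|.
Proof.
have -> : imC z = - reC (z * mkC 0 1) by rewrite !reimE; ring.
rewrite normrN; apply: le_trans (norm_reC _) _; rewrite normrM.
rewrite [X in _ * X](_ : _ = 1) ?mulr1 //.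
by rewrite normc_def /= expr0n add0r expr1n sqrtr1.
Qed.

Lemma norm_realC x : `|realC x| = realC `|x|.
Proof. by rewrite normc_def /= expr0n addr0 sqrtr_sqr. Qed.

(** Equivalent to the modulus, but with values in [K], so that real estimates apply
   directly. *)
Definition n1 z : K := `|reC z| + `|imC z|.
Lemma norm_n1 z : `|z| <= realC (n1 z).
Proof.
have E : z = realC (reC z) + mkC 0 1 * realC (imC z) by apply: cplx_eq; rewrite !reimE; ring.
rewrite [X in `|X|]E.
apply: le_trans (ler_normD _ _) _; rewrite normrM !norm_realC.
rewrite [X in X * _](_ : _ = 1) ?mul1r; last first.
  by rewrite normc_def /= expr0n add0r expr1n sqrtr1.
by rewrite -realCD.
Qed.
Lemma n1_ge0 z : 0 <= n1 z. Proof. by rewrite addr_ge0. Qed.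
Lemma n1D z w : n1 (z + w) <= n1 z + n1 w.
Proof. by rewrite /n1 !reimE addrACA; apply: lerD; exact: ler_normD. Qed.
Lemma n1N z : n1 (- z) = n1 z. Proof. by rewrite /n1 !reimE !normrN. Qed.
Lemma n1M z w : n1 (z * w) <= n1 z * n1 w.
Proof.
rewrite /n1 !reimE; apply: le_trans (lerD (ler_normB _ _) (ler_normD _ _)) _.
by rewrite !normrM le_eqVlt; apply/orP; left; apply/eqP; ring.
Qed.
Lemma n10 : n1 0 = 0. Proof. by rewrite /n1 !reimE !normr0 addr0. Qed.
Lemma n1_re z : `|reC z| <= n1 z. Proof. by rewrite lerDl. Qed.
Lemma n1_im z : `|imC z| <= n1 z. Proof. by rewrite lerDr. Qed.
Lemma n1_conj z : n1 z^* = n1 z. Proof. by rewrite /n1 !reimE normrN. Qed.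
Lemma n1_sum (J : Type) (r : seq J) (p : pred J) (F : J -> C) :
  n1 (\sum_(i <- r | p i) F i) <= \sum_(i <- r | p i) n1 (F i).
Proof.
elim/big_rec2: _ => [|i y1 y2 _ le]; first by rewrite n10.
by apply: le_trans (n1D _ _) _; rewrite lerD2l.
Qed.
Lemma n1_eq0 z : n1 z = 0 -> z = 0.
Proof.
move=> /eqP; rewrite paddr_eq0 // !normr_eq0 => /andP[/eqP h1 /eqP h2].
exact: cplx_eq.
Qed.

End complex_parts.

Section cprim.
Variable K : realType.
Variables a b : \bar K.
Notation I := (oint a b).
Notation C := (cplx K).
Implicit Types (f g : K -> C) (c d x : K).

Definition cac f := loc_rac a b (fun x => reC (f x)) /\ loc_rac a b (fun x => imC (f x)).
Definition cloc g := rloc a b (fun x => reC (g x)) /\ rloc a b (fun x => imC (g x)).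
Definition cprim f g := rprim a b (fun x => reC (f x)) (fun x => reC (g x)) /\
  rprim a b (fun x => imC (f x)) (fun x => imC (g x)).

Lemma abs_continuousP f c d : abs_continuous c d f <->
  rac c d (fun x => reC (f x)) /\ rac c d (fun x => imC (f x)).
Proof.
split=> [F|[F G] e e0].
  split => e e0; have [dl dl0 H] := F e e0; exists dl => // n x y xy tr s.
    have := H n x y xy tr s; rewrite -realC_lt realC_sum; apply: le_lt_trans.
    by apply: ler_sum => i _; rewrite -reCB; exact: norm_reC.
  have := H n x y xy tr s; rewrite -realC_lt realC_sum; apply: le_lt_trans.
  by apply: ler_sum => i _; rewrite -imCB; exact: norm_imC.
have e2 : 0 < e / 2 by rewrite divr_gt0.
have [dl dl0 Hf] := F _ e2; have [dl' dl'0 Hg] := G _ e2.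
exists (Num.min dl dl'); first by rewrite lt_min dl0.
move=> n x y xy tr; rewrite lt_min => /andP[s1 s2].
have := ltrD (Hf n x y xy tr s1) (Hg n x y xy tr s2); rewrite -splitr -realC_lt.
apply: le_lt_trans; rewrite -big_split realC_sum; apply: ler_sum => i _ /=.
by rewrite -reCB -imCB; exact: norm_n1.
Qed.

Lemma cacD f g : cac f -> cac g -> cac (fun x => f x + g x).
Proof.
move=> [f1 f2] [g1 g2]; split.
  by apply: loc_rac_eq (loc_racD f1 g1) _ => x; rewrite !reimE.
by apply: loc_rac_eq (loc_racD f2 g2) _ => x; rewrite !reimE.
Qed.
Lemma cacM f g : cac f -> cac g -> cac (fun x => f x * g x).
Proof.
move=> [f1 f2] [g1 g2]; split.
  apply: loc_rac_eq (loc_racD (loc_racM f1 g1) (loc_racN (loc_racM f2 g2))) _ => x.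
  by rewrite !reimE.
apply: loc_rac_eq (loc_racD (loc_racM f1 g2) (loc_racM f2 g1)) _ => x.
by rewrite !reimE.
Qed.
Lemma cac_cst k : cac (fun=> k).
Proof. by split; exact: loc_rac_cst. Qed.
Lemma cac_conj f : cac f -> cac (fun x => (f x)^*).
Proof.
move=> [f1 f2]; split.
  by apply: loc_rac_eq f1 _ => x; rewrite !reimE.
by apply: loc_rac_eq (loc_racN f2) _ => x; rewrite !reimE.
Qed.
Lemma cac_eq f g : cac f -> (forall x, f x = g x) -> cac g.
Proof. by move=> F /funext <-. Qed.
Lemma cac_sum (J : Type) (r : seq J) (p : pred J) (F : J -> K -> C) :
  (forall i, cac (F i)) -> cac (fun x => \sum_(i <- r | p i) F i x).
Proof.
move=> H; elim: r => [|i r IH].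
  by apply: cac_eq (cac_cst 0) _ => x; rewrite big_nil.
have H' := cacD (H i) IH; case pi: (p i).
  by apply: cac_eq H' _ => x; rewrite big_cons pi.
by apply: cac_eq IH _ => x; rewrite big_cons pi.
Qed.
Lemma cac_prod (J : Type) (r : seq J) (p : pred J) (F : J -> K -> C) :
  (forall i, cac (F i)) -> cac (fun x => \prod_(i <- r | p i) F i x).
Proof.
move=> H; elim: r => [|i r IH].
  by apply: cac_eq (cac_cst 1) _ => x; rewrite big_nil.
have H' := cacM (H i) IH; case pi: (p i).
  by apply: cac_eq H' _ => x; rewrite big_cons pi.
by apply: cac_eq IH _ => x; rewrite big_cons pi.
Qed.

Lemma cplx_inv (z : C) : z^-1 =
  mkC (reC z / (reC z ^+ 2 + imC z ^+ 2)) (- imC z / (reC z ^+ 2 + imC z ^+ 2)).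
Proof. by case: z => p q; apply: cplx_eq; rewrite /reC /imC /= ?mulNr. Qed.

Lemma cacV f : (forall x, I x -> f x != 0) -> cac f -> cac (fun x => (f x)^-1).
Proof.
move=> f0 [f1 f2].
have h : loc_rac a b (fun x => (reC (f x) ^+ 2 + imC (f x) ^+ 2)^-1).
  apply: loc_racV.
    move=> x Ix; have := f0 x Ix; apply: contra; rewrite paddr_eq0 ?sqr_ge0 //.
    by rewrite !sqrf_eq0 => /andP[/eqP h1 /eqP h2]; apply/eqP/cplx_eq.
  by apply: loc_rac_eq (loc_racD (loc_racM f1 f1) (loc_racM f2 f2)) _ => x; rewrite !expr2.
split.
  by apply: loc_rac_eq (loc_racM f1 h) _ => x; rewrite cplx_inv !reimE.
by apply: loc_rac_eq (loc_racM (loc_racN f2) h) _ => x; rewrite cplx_inv !reimE.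
Qed.

Lemma cac_ext f g : (forall x, I x -> f x = g x) -> cac f -> cac g.
Proof.
move=> fg [f1 f2]; split => c d Ic Id e e0.
  have [dl dl0 H] := f1 c d Ic Id e e0; exists dl => // n x y xy tr s.
  rewrite (eq_bigr (fun i => `|reC (f (y i)) - reC (f (x i))|)); first exact: H.
  move=> i _; have [cx xyi yd] := xy i; rewrite -!fg //; apply: (oint_conv Ic Id) => //; lra.
have [dl dl0 H] := f2 c d Ic Id e e0; exists dl => // n x y xy tr s.
rewrite (eq_bigr (fun i => `|imC (f (y i)) - imC (f (x i))|)); first exact: H.
move=> i _; have [cx xyi yd] := xy i; rewrite -!fg //; apply: (oint_conv Ic Id) => //; lra.
Qed.

Lemma cprim_cac f g : cprim f g -> cac f.
Proof. by move=> [/rprim_ac ? /rprim_ac ?]. Qed.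

Lemma cac_cprim f : cac f -> cprim f (cderiv f).
Proof.
by move=> [f1 f2]; split; apply: rprim_of_ac => //; exact: loc_rac_derivable.
Qed.

Lemma cprim_cderiv f g : cprim f g ->
  {ae leb, forall x : lebT K, I x -> cderiv f x = g x}.
Proof.
move=> [/rprim_derive F1 /rprim_derive F2].
apply: ae_mono (ae_and F1 F2) => x [h1 h2] Ix.
have [_ e1] := h1 Ix; have [_ e2] := h2 Ix.
by apply: cplx_eq; rewrite /cderiv !reimE derive1E.
Qed.

Lemma cprim_ae f g h : cprim f g ->
  {ae leb, forall x : lebT K, I x -> g x = h x} -> cprim f h.
Proof.
by move=> [F1 F2] gh; split; [apply: rprim_ae F1 _|apply: rprim_ae F2 _];
  apply: ae_mono gh => x e Ix; rewrite e.
Qed.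

Lemma cprim_uniq f g h : cprim f g -> cprim f h ->
  {ae leb, forall x : lebT K, I x -> g x = h x}.
Proof.
move=> /cprim_cderiv F /cprim_cderiv G; apply: ae_mono (ae_and F G) => x [e1 e2] Ix.
by rewrite -e1 // e2.
Qed.

Lemma cprimD f f' g g' : cprim f f' -> cprim g g' ->
  cprim (fun x => f x + g x) (fun x => f' x + g' x).
Proof.
move=> [f1 f2] [g1 g2]; split.
  by apply: rprim_eq (rprimD f1 g1) _ _ => x; rewrite !reimE.
by apply: rprim_eq (rprimD f2 g2) _ _ => x; rewrite !reimE.
Qed.

Lemma cprimN f f' : cprim f f' -> cprim (fun x => - f x) (fun x => - f' x).
Proof.
move=> [f1 f2]; split.
  by apply: rprim_eq (rprimN f1) _ _ => x; rewrite !reimE.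
by apply: rprim_eq (rprimN f2) _ _ => x; rewrite !reimE.
Qed.

Lemma cprim_conj f f' : cprim f f' -> cprim (fun x => (f x)^*) (fun x => (f' x)^*).
Proof.
move=> [f1 f2]; split.
  by apply: rprim_eq f1 _ _ => x; rewrite !reimE.
by apply: rprim_eq (rprimN f2) _ _ => x; rewrite !reimE.
Qed.

Lemma cprimM f f' g g' : cprim f f' -> cprim g g' ->
  cprim (fun x => f x * g x) (fun x => f' x * g x + f x * g' x).
Proof.
move=> [f1 f2] [g1 g2]; split.
  by apply: rprim_eq (rprimD (rprimM f1 g1) (rprimN (rprimM f2 g2))) _ _ => x;
    rewrite !reimE //; ring.
by apply: rprim_eq (rprimD (rprimM f1 g2) (rprimM f2 g1)) _ _ => x;
  rewrite !reimE //; ring.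
Qed.

Lemma cprim_cst k : cprim (fun=> k) (fun=> 0).
Proof. by split; exact: rprim_cst. Qed.

Lemma cprim_eq f f' g g' : cprim f f' -> (forall x, f x = g x) ->
  (forall x, f' x = g' x) -> cprim g g'.
Proof. by move=> F /funext <- /funext <-. Qed.

Lemma cprim_sum (J : Type) (r : seq J) (F G : J -> K -> C) :
  (forall i, cprim (F i) (G i)) ->
  cprim (fun x => \sum_(i <- r) F i x) (fun x => \sum_(i <- r) G i x).
Proof.
move=> H; elim: r => [|i r IH].
  by apply: cprim_eq (cprim_cst 0) _ _ => x; rewrite big_nil.
by apply: cprim_eq (cprimD (H i) IH) _ _ => x; rewrite big_cons.
Qed.

Lemma cprim_cint f g c d : cprim f g -> I c -> I d -> c <= d ->
  cintegrable `[c, d] g /\ f d - f c = cintegral `[c, d] g.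
Proof.
move=> [f1 f2] Ic Id cd; have [i1 e1] := f1 c d Ic Id cd; have [i2 e2] := f2 c d Ic Id cd.
by split => //; apply: cplx_eq; rewrite !reimE.
Qed.

Lemma cprim_of_cint f g : (forall c d, I c -> I d -> c <= d ->
  cintegrable `[c, d] g /\ f d - f c = cintegral `[c, d] g) -> cprim f g.
Proof.
move=> H; split => c d Ic Id cd; have [[i1 i2] e] := H c d Ic Id cd; split => //.
  by rewrite -reCB e !reimE.
by rewrite -imCB e !reimE.
Qed.

Lemma clocM f g : cac f -> cloc g -> cloc (fun x => f x * g x).
Proof.
move=> [f1 f2] [g1 g2]; split.
  by apply: rloc_eq (rlocD (rlocM f1 g1) (rlocN (rlocM f2 g2))) _ => x; rewrite !reimE.
by apply: rloc_eq (rlocD (rlocM f1 g2) (rlocM f2 g1)) _ => x; rewrite !reimE.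
Qed.

Lemma clocD f g : cloc f -> cloc g -> cloc (fun x => f x + g x).
Proof.
move=> [f1 f2] [g1 g2]; split.
  by apply: rloc_eq (rlocD f1 g1) _ => x; rewrite !reimE.
by apply: rloc_eq (rlocD f2 g2) _ => x; rewrite !reimE.
Qed.

Lemma cac_cloc f : cac f -> cloc f.
Proof. by move=> [f1 f2]; split; exact: rloc_cac. Qed.

Lemma cloc_eq f g : cloc f -> (forall x, f x = g x) -> cloc g.
Proof. by move=> F /funext <-. Qed.



Lemma cloc_sum (J : Type) (r : seq J) (F : J -> K -> C) :
  (forall i, cloc (F i)) -> cloc (fun x => \sum_(i <- r) F i x).
Proof.
move=> H; elim: r => [|i r IH].
  by apply: cloc_eq (cac_cloc (cac_cst 0)) _ => x; rewrite big_nil.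
by apply: cloc_eq (clocD (H i) IH) _ => x; rewrite big_cons.
Qed.

Lemma cprim_cloc f g : cprim f g -> cloc g.
Proof. by move=> [/rloc_prim_r ? /rloc_prim_r]. Qed.

Definition cprimf (c0 : K) g x : C :=
  mkC (rprimf c0 (fun x => reC (g x)) x) (rprimf c0 (fun x => imC (g x)) x).

Lemma cprimfP c0 g : I c0 -> cloc g -> cprim (cprimf c0 g) g.
Proof. by move=> I0 [g1 g2]; split; exact: rprimfP. Qed.

Lemma cprimf0 c0 g : cprimf c0 g c0 = 0.
Proof. by apply: cplx_eq; rewrite !reimE rprimf0. Qed.


Lemma cprim_le f g c d : cprim f g -> I c -> I d -> c <= d ->
  {ae leb, forall x : lebT K, c < x < d -> 0 <= g x} -> f c <= f d.
Proof.
move=> [f1 f2] Ic Id cd g0; rewrite -subr_ge0 lecP !reimE.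
have h1 : {ae leb, forall x : lebT K, c < x < d -> 0 <= reC (g x)}.
  by apply: ae_mono g0 => x h /h; rewrite lecP !reimE => /andP[].
have h2 : {ae leb, forall x : lebT K, c < x < d -> 0 <= imC (g x)}.
  by apply: ae_mono g0 => x h /h; rewrite lecP !reimE => /andP[/eqP ->].
have h3 : {ae leb, forall x : lebT K, c < x < d -> 0 <= - imC (g x)}.
  by apply: ae_mono g0 => x h /h; rewrite lecP !reimE => /andP[/eqP ->]; rewrite oppr0.
have r1 := rprim_le f1 Ic Id cd h1; have r2 := rprim_le f2 Ic Id cd h2.
have r3 := rprim_le (rprimN f2) Ic Id cd h3.
by apply/andP; split; [apply/eqP; lra|lra].
Qed.

Lemma cprim0_cst f c d : cprim f (fun=> 0) -> I c -> I d -> f c = f d.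
Proof.
wlog cd : c d / c <= d.
  by move=> H; have [/H|/ltW/H h ? ? ?] := leP c d; [exact|exact/esym/h].
move=> F Ic Id; apply/le_anti/andP; split.
  by apply: (cprim_le F) => //; apply: ae_always.
rewrite -lerN2; apply: (cprim_le (cprimN F)) => //; apply: ae_always => x _.
by rewrite oppr0.
Qed.

Lemma cac_continuous f x : cac f -> I x -> forall e : K, 0 < e ->
  exists2 dl : K, 0 < dl & forall y, `|y - x| < dl -> I y /\ n1 (f y - f x) < e.
Proof.
move=> [f1 f2] Ix e e0; have e2 : 0 < e / 2 by rewrite divr_gt0.
have [c Ic cx] := oint_left Ix; have [d Id xd] := oint_right Ix.
have [d1 d10 H1] := f1 c d Ic Id _ e2; have [d2 d20 H2] := f2 c d Ic Id _ e2.
exists (Num.min (Num.min d1 d2) (Num.min (x - c) (d - x))).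
  by rewrite !lt_min d10 d20 !subr_gt0 cx xd.
move=> y; rewrite !lt_min => /andP[/andP[y1 y2] /andP[y3 y4]].
have Iy : I y by apply: (oint_conv Ic Id); move: y3 y4; rewrite !ltr_norml => /andP[? ?] /andP[? ?]; lra.
split=> //.
have K1 (h : K -> K) (dl : K) : `|y - x| < dl -> (forall n (u v : 'I_n -> K),
    (forall i, [/\ c <= u i, u i <= v i & v i <= d]) ->
    trivIset [set: 'I_n] (fun i => `]u i, v i[%classic) ->
    \sum_(i < n) (v i - u i) < dl -> \sum_(i < n) `|h (v i) - h (u i)| < e / 2) ->
    `|h y - h x| < e / 2.
  move=> ydl H; have [xy|/ltW yx] := leP x y.
    have := H 1%N (fun=> x) (fun=> y); rewrite !big_ord1; apply => //.
    - by move=> _; split; move: y3 y4; rewrite ?ger0_norm ?subr_ge0 //; lra.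
    - by move=> i j _ _ _; rewrite !ord1.
    - by move: ydl; rewrite ger0_norm ?subr_ge0.
  rewrite distrC; have := H 1%N (fun=> y) (fun=> x); rewrite !big_ord1; apply => //.
  - by move=> _; split; move: y3 y4; rewrite distrC ?ger0_norm ?subr_ge0 //; lra.
  - by move=> i j _ _ _; rewrite !ord1.
  - by move: ydl; rewrite distrC ger0_norm ?subr_ge0.
rewrite /n1 reCB imCB [e]splitr; apply: ltrD.
  exact: (K1 (fun t => reC (f t)) _ y1 H1).
exact: (K1 (fun t => imC (f t)) _ y2 H2).
Qed.

End cprim.

Section mprim.
Variable K : realType.
Variables a b : \bar K.
Notation I := (oint a b).
Notation C := (cplx K).
Local Open Scope sesquilinear_scope.

Lemma ctE m n (A : 'M[C]_(m, n)) i j : (A ^t*) i j = (A j i)^*.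
Proof. by rewrite !mxE. Qed.
Lemma ctM m n p (A : 'M[C]_(m, n)) (B : 'M[C]_(n, p)) :
  (A *m B) ^t* = B ^t* *m A ^t*.
Proof. by rewrite trmx_mul map_mxM. Qed.
Lemma ctK m n (A : 'M[C]_(m, n)) : (A ^t*) ^t* = A.
Proof. by apply/matrixP => i j; rewrite !ctE conjCK. Qed.
Lemma ctD m n (A B : 'M[C]_(m, n)) : (A + B) ^t* = A ^t* + B ^t*.
Proof. by apply/matrixP => i j; rewrite !(ctE, mxE) rmorphD. Qed.
Lemma ctN m n (A : 'M[C]_(m, n)) : (- A) ^t* = - A ^t*.
Proof. by apply/matrixP => i j; rewrite !(ctE, mxE) rmorphN. Qed.
Lemma ctB m n (A B : 'M[C]_(m, n)) : (A - B) ^t* = A ^t* - B ^t*.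
Proof. by rewrite ctD ctN. Qed.
Lemma ctZ m n k (A : 'M[C]_(m, n)) : (k *: A) ^t* = k^* *: A ^t*.
Proof. by apply/matrixP => i j; rewrite !(ctE, mxE) rmorphM. Qed.
Lemma ct0 m n : (0 : 'M[C]_(m, n)) ^t* = 0.
Proof. by apply/matrixP => i j; rewrite !(ctE, mxE) rmorph0. Qed.
Lemma ct1 m : (1%:M : 'M[C]_m) ^t* = 1%:M.
Proof. by apply/matrixP => i j; rewrite !(ctE, mxE) rmorph_nat eq_sym. Qed.
Lemma ctV m (A : 'M[C]_m) : (invmx A) ^t* = invmx (A ^t*).
Proof. by rewrite trmx_inv map_invmx. Qed.
Lemma ct_unit m (A : 'M[C]_m) : (A ^t* \in unitmx) = (A \in unitmx).
Proof. by rewrite map_unitmx unitmx_tr. Qed.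

Section defs.
Variables m n : nat.
Implicit Types F G : K -> 'M[C]_(m, n).
Definition mcac F := forall i j, cac a b (fun x => F x i j).
Definition mloc F := forall i j, cloc a b (fun x => F x i j).
(** All entries of [G] are the derivatives of those of [F]; this is how the differential
   equations below are stated. *)
Definition mprim F G := forall i j, cprim a b (fun x => F x i j) (fun x => G x i j).

Lemma mcacP F : mx_loc_ac I F <-> mcac F.
Proof.
split=> H; last by move=> c d Ic Id i j; apply/abs_continuousP; have [h1 h2] := H i j; split; [exact: h1|exact: h2].
by move=> i j; split => c d Ic Id; have [h1 h2] := (abs_continuousP _ _ _).1 (H c d Ic Id i j).
Qed.

Lemma mlocP F : mx_loc_integrable I F <-> mloc F.
Proof.
split=> H; last by move=> c d Ic Id i j; have [h1 h2] := H i j; split; [exact: h1|exact: h2].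
by move=> i j; split => c d Ic Id; have [h1 h2] := H c d Ic Id i j.
Qed.

Lemma mprim_eq F F' G G' : mprim F F' -> (forall x, F x = G x) ->
  (forall x, F' x = G' x) -> mprim G G'.
Proof. by move=> H /funext <- /funext <-. Qed.
Lemma mloc_eq F G : mloc F -> (forall x, F x = G x) -> mloc G.
Proof. by move=> H /funext <-. Qed.

Lemma mprim_mcac F G : mprim F G -> mcac F.
Proof. by move=> H i j; exact: cprim_cac (H i j). Qed.

Lemma ae_mx F G : (forall i j, {ae leb, forall x : lebT K, I x -> F x i j = G x i j}) ->
  {ae leb, forall x : lebT K, I x -> F x = G x}.
Proof.
move=> H.
pose P (k : nat) (x : lebT K) := if unpickle k is Some (i, j) then I x -> F x i j = G x i j else True.
have : {ae leb, forall x, forall k, P k x}.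
  apply: ae_nat => k; rewrite /P; case: (unpickle k : option ('I_m * 'I_n)) => [[i j]|].
    exact: H.
  exact: ae_always.
apply: ae_mono => x h Ix; apply/matrixP => i j.
by have := h (pickle (i, j)); rewrite /P pickleK; apply.
Qed.

Lemma mprim_uniq F G H : mprim F G -> mprim F H ->
  {ae leb, forall x : lebT K, I x -> G x = H x}.
Proof. by move=> h1 h2; apply: ae_mx => i j; exact: cprim_uniq (h1 i j) (h2 i j). Qed.
Lemma mprim_ae F G H : mprim F G ->
  {ae leb, forall x : lebT K, I x -> G x = H x} -> mprim F H.
Proof.
move=> h1 h2 i j; apply: cprim_ae (h1 i j) _.
by apply: ae_mono h2 => x h Ix; rewrite h.
Qed.
Lemma mprim_mx_deriv F G : mprim F G ->
  {ae leb, forall x : lebT K, I x -> mx_deriv F x = G x}.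
Proof.
move=> H; apply: ae_mx => i j; have := cprim_cderiv (H i j).
by apply: ae_mono => x h Ix; rewrite mxE h.
Qed.
Lemma mcac_mprim F : mcac F -> mprim F (mx_deriv F).
Proof.
move=> H i j; apply: cprim_eq (cac_cprim (H i j)) _ _ => // x.
by rewrite mxE.
Qed.

Lemma mprim_ext F F' G : mprim F G -> (forall x, I x -> F x = F' x) -> mprim F' G.
Proof.
move=> f FF i j; apply: cprim_of_cint => c d Ic Id cd; rewrite -!FF //.
exact: (cprim_cint (f i j) Ic Id cd).
Qed.

Lemma mprimD F F' G G' : mprim F F' -> mprim G G' ->
  mprim (fun x => F x + G x) (fun x => F' x + G' x).
Proof.
by move=> f g i j; apply: cprim_eq (cprimD (f i j) (g i j)) _ _ => x; rewrite mxE.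
Qed.
Lemma mprimN F F' : mprim F F' -> mprim (fun x => - F x) (fun x => - F' x).
Proof. by move=> f i j; apply: cprim_eq (cprimN (f i j)) _ _ => x; rewrite mxE. Qed.
Lemma mprim_cst M : mprim (fun=> M) (fun=> 0).
Proof. by move=> i j; apply: cprim_eq (cprim_cst _ _ (M i j)) _ _ => // x; rewrite mxE. Qed.
Lemma mprimZ k F F' : mprim F F' -> mprim (fun x => k *: F x) (fun x => k *: F' x).
Proof.
move=> f i j; apply: cprim_eq (cprimM (cprim_cst _ _ k) (f i j)) _ _ => x;
by rewrite mxE // mul0r add0r.
Qed.
Lemma mlocD F G : mloc F -> mloc G -> mloc (fun x => F x + G x).
Proof. by move=> f g i j; apply: cloc_eq (clocD (f i j) (g i j)) _ => x; rewrite mxE. Qed.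
Lemma mlocZ k F : mloc F -> mloc (fun x => k *: F x).
Proof.
move=> f i j; apply: cloc_eq (clocM (cac_cst _ _ k) (f i j)) _ => x; by rewrite mxE.
Qed.
Lemma mprim0_cst F c d : mprim F (fun=> 0) -> I c -> I d -> F c = F d.
Proof.
move=> f Ic Id; apply/matrixP => i j; have h : cprim a b (fun x => F x i j) (fun=> 0).
  by apply: cprim_eq (f i j) _ _ => // x; rewrite mxE.
exact: (cprim0_cst h Ic Id).
Qed.

Definition mprimf c0 G x : 'M[C]_(m, n) := \matrix_(i, j) cprimf c0 (fun x => G x i j) x.
Lemma mprimfP c0 G : I c0 -> mloc G -> mprim (mprimf c0 G) G.
Proof.
by move=> I0 g i j; apply: cprim_eq (cprimfP I0 (g i j)) _ _ => // x; rewrite mxE.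
Qed.
Lemma mprimf0 c0 G : mprimf c0 G c0 = 0.
Proof. by apply/matrixP => i j; rewrite !mxE cprimf0. Qed.
Lemma mprim_int F G c d : mprim F G -> I c -> I d -> c <= d ->
  mx_integrable `[c, d] G /\ mx_integral `[c, d] G = F d - F c.
Proof.
move=> f Ic Id cd; split=> [i j|]; first by have [] := cprim_cint (f i j) Ic Id cd.
by apply/matrixP => i j; rewrite !mxE; have [_ ->] := cprim_cint (f i j) Ic Id cd.
Qed.
End defs.

Lemma mprimM m n p (F F' : K -> 'M[C]_(m, n)) (G G' : K -> 'M[C]_(n, p)) :
  mprim F F' -> mprim G G' ->
  mprim (fun x => F x *m G x) (fun x => F' x *m G x + F x *m G' x).
Proof.
move=> f g i j; apply: cprim_eq (cprim_sum (index_enum 'I_n) (fun k => cprimM (f i k) (g k j))) _ _ => x.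
  by rewrite mxE.
by rewrite !mxE -big_split.
Qed.
Lemma mprim_ct m n (F F' : K -> 'M[C]_(m, n)) : mprim F F' ->
  mprim (fun x => (F x) ^t*) (fun x => (F' x) ^t*).
Proof.
move=> f i j; apply: cprim_eq (cprim_conj (f j i)) _ _ => x; by rewrite ctE.
Qed.
Lemma mprimMl m n p (M : 'M[C]_(m, n)) (G G' : K -> 'M[C]_(n, p)) :
  mprim G G' -> mprim (fun x => M *m G x) (fun x => M *m G' x).
Proof.
move=> g; apply: mprim_eq (mprimM (mprim_cst M) g) _ _ => // x.
by rewrite mul0mx add0r.
Qed.
Lemma mprimMr m n p (M : 'M[C]_(n, p)) (F F' : K -> 'M[C]_(m, n)) :
  mprim F F' -> mprim (fun x => F x *m M) (fun x => F' x *m M).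
Proof.
move=> f; apply: mprim_eq (mprimM f (mprim_cst M)) _ _ => // x.
by rewrite mulmx0 addr0.
Qed.
Lemma mlocMl m n p (F : K -> 'M[C]_(m, n)) (G : K -> 'M[C]_(n, p)) :
  mcac F -> mloc G -> mloc (fun x => F x *m G x).
Proof.
move=> f g i j; apply: cloc_eq (cloc_sum (index_enum 'I_n) (fun k => clocM (f i k) (g k j))) _ => x.
by rewrite mxE.
Qed.
Lemma mlocMr m n p (F : K -> 'M[C]_(m, n)) (G : K -> 'M[C]_(n, p)) :
  mloc F -> mcac G -> mloc (fun x => F x *m G x).
Proof.
move=> f g i j; apply: cloc_eq (cloc_sum (index_enum 'I_n) (fun k => clocM (g k j) (f i k))) _ => x.
by rewrite mxE; apply: eq_bigr => k _; rewrite mulrC.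
Qed.
Lemma mcac_ct m n (F : K -> 'M[C]_(m, n)) : mcac F -> mcac (fun x => (F x) ^t*).
Proof. by move=> f i j; apply: cac_eq (cac_conj (f j i)) _ => x; rewrite ctE. Qed.
Lemma mcacM m n p (F : K -> 'M[C]_(m, n)) (G : K -> 'M[C]_(n, p)) :
  mcac F -> mcac G -> mcac (fun x => F x *m G x).
Proof. by move=> /mcac_mprim f /mcac_mprim g; exact: mprim_mcac (mprimM f g). Qed.

Lemma cac_det m (F : K -> 'M[C]_m) : mcac F -> cac a b (fun x => \det (F x)).
Proof.
move=> f; apply: cac_sum => s; apply: cacM; first exact: cac_cst.
by apply: cac_prod => i; exact: f.
Qed.

Lemma mcacV m (F : K -> 'M[C]_m) : (forall x, I x -> F x \in unitmx) -> mcac F ->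
  mcac (fun x => invmx (F x)).
Proof.
move=> u f i j.
apply: (@cac_ext _ _ _ (fun x => (\det (F x))^-1 * ((-1) ^+ (j + i) * \det (row' j (col' i (F x)))))).
  by move=> x Ix; rewrite /invmx u // !mxE.
apply: cacM.
  apply: cacV; last exact: cac_det.
  by move=> x /u; rewrite unitmxE unitfE.
apply: cacM; first exact: cac_cst.
apply: cac_det => k l; apply: cac_eq (f (lift j k) (lift i l)) _ => x.
by rewrite !mxE.
Qed.

Lemma mprimV m (F F' : K -> 'M[C]_m) : (forall x, I x -> F x \in unitmx) -> mprim F F' ->
  mprim (fun x => invmx (F x)) (fun x => - (invmx (F x) *m F' x *m invmx (F x))).
Proof.
move=> u f; have g := mcac_mprim (mcacV u (mprim_mcac f)).
apply: (mprim_ae g).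
have p := mprimM f g.
have p1 : mprim (fun x => F x *m invmx (F x)) (fun=> 0).
  by apply: (mprim_ext (mprim_cst 1%:M)) => x Ix; rewrite mulmxV ?u.
have := mprim_uniq p p1; apply: ae_mono => x e Ix; have {e} := e Ix.
move=> /(congr1 (mulmx (invmx (F x)))).
rewrite mulmx0 mulmxDr !mulmxA mulVmx ?u // mul1mx addrC => /eqP.
by rewrite addr_eq0 => /eqP.
Qed.

End mprim.

(** * Linear systems with locally integrable coefficients *)
Section ode.
Variable K : realType.
Variables a b : \bar K.
Notation I := (oint a b).
Notation C := (cplx K).
Variable N : nat.
Variable A : K -> 'M[C]_N.
Hypothesis hA : mloc a b A.
Variable c0 : K.
Hypothesis I0 : I c0.

Lemma rintg_lim c d (fn : nat -> K -> K) f h :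
  (forall n, rintg `[c, d] (fn n)) -> rintg `[c, d] h ->
  (forall x, c <= x <= d -> fn n x @[n --> \oo] --> f x) ->
  (forall x n, c <= x <= d -> `|fn n x| <= h x) ->
  rintg `[c, d] f.
Proof.
move=> fi hi cv bd.
have mf : measurable_fun (`[c, d]%classic : set (lebT K)) (f : lebT K -> K).
  apply: (@measurable_fun_cvg _ _ _ _ (fun n (x : lebT K) => fn n x)).
  - by move=> n; apply/measurable_EFinP; exact: (measurable_int leb (fi n)).
  - by move=> x /=; rewrite in_itv /=; exact: cv.
apply: (le_integrable (measurable_itvl c d) _ _ hi); first exact/measurable_EFinP.
move=> x; rewrite /= in_itv /= => cxd; rewrite lee_fin.
apply: (@le_trans _ _ (h x)); last exact: ler_norm.
have C1 : `|fn n x| @[n --> \oo] --> `|f x| by apply: cvg_norm; exact: cv.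
rewrite -(cvg_lim _ C1) //; apply: limr_le; first by apply/cvg_ex; eexists; exact: C1.
by apply: nearW => n; exact: bd.
Qed.

Lemma cvg_sumr (J : Type) (r : seq J) (F : J -> nat -> K) (l : J -> K) :
  (forall i, F i n @[n --> \oo] --> l i) ->
  \sum_(i <- r) F i n @[n --> \oo] --> \sum_(i <- r) l i.
Proof.
move=> H; elim: r => [|i r IH].
  by rewrite big_nil; under eq_fun do rewrite big_nil; exact: cvg_cst.
by rewrite big_cons; under eq_fun do rewrite big_cons; apply: cvgD.
Qed.

(** A submultiplicative majorant of the entries of a product. *)
Definition mxsum (M : 'M[C]_N) : K := \sum_i \sum_j n1 (M i j).
Let al (x : K) : K := mxsum (A x).

Let al_ge0 x : 0 <= al x.
Proof. by apply: sumr_ge0 => i _; apply: sumr_ge0 => j _; exact: n1_ge0. Qed.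

Lemma rloc_sum (J : Type) (r : seq J) (F : J -> K -> K) :
  (forall i, rloc a b (F i)) -> rloc a b (fun x => \sum_(i <- r) F i x).
Proof.
move=> H; elim: r => [|i r IH].
  apply: (rloc_eq (rloc_cac (loc_rac_cst (a := a) (b := b) 0))) => x; by rewrite big_nil.
by apply: rloc_eq (rlocD (H i) IH) _ => x; rewrite big_cons.
Qed.

Let al_loc : rloc a b al.
Proof.
apply: rloc_sum => i; apply: rloc_sum => j.
by have [h1 h2] := hA i j; apply: rlocD; exact: rloc_norm.
Qed.

Let k (x : K) : K := rprimf c0 al x.
Let kP : rprim a b k al. Proof. exact: rprimfP. Qed.
Let k0 : k c0 = 0. Proof. exact: rprimf0. Qed.
Let k_mono x y : I x -> I y -> x <= y -> k x <= k y.
Proof. by move=> Ix Iy xy; apply: (rprim_le kP) => //; exact: ae_always. Qed.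

Let kpow n : rprim a b (fun x => k x ^+ n.+1 / n.+1`!%:R) (fun x => k x ^+ n / n`!%:R * al x).
Proof.
have H : rprim a b (fun x => k x ^+ n.+1) (fun x => n.+1%:R * (k x ^+ n * al x)).
  elim: n => [|n IH].
    by apply: rprim_eq kP _ _ => x; rewrite ?expr1 // expr0 !mul1r.
  apply: rprim_eq (rprimM kP IH) _ _ => x; first by rewrite -exprS.
  rewrite -[n.+2%:R]natr1 !exprS; move: (n.+1%:R : K) => q; ring.
apply: rprim_eq (rprimZ (n.+1`!%:R)^-1 H) _ _ => x; first by rewrite mulrC.
rewrite factS natrM invfM; rewrite [X in X * _ = _]mulrC -mulrA (mulrA _ n.+1%:R).
by rewrite divfK ?pnatr_eq0 //; ring.
Qed.

Fixpoint picard n : K -> 'M[C]_N :=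
  if n is n'.+1 then mprimf c0 (fun x => A x *m picard n' x) else fun=> 1%:M.

Let picard_mcac n : mcac a b (picard n).
Proof.
elim: n => [|n IH]; first exact: mprim_mcac (mprim_cst _ _ _).
by apply: mprim_mcac (mprimfP I0 _); exact: mlocMr.
Qed.

Let picardP n : mprim a b (picard n.+1) (fun x => A x *m picard n x).
Proof. by apply: mprimfP => //; exact: mlocMr. Qed.

Lemma n1_mulmx_le (B Y : 'M[C]_N) M i j : (forall p q, n1 (Y p q) <= M) ->
  n1 ((B *m Y) i j) <= mxsum B * M.
Proof.
move=> h; rewrite mxE; apply: le_trans (n1_sum _ _ _) _.
apply: (@le_trans _ _ (\sum_l n1 (B i l) * M)).
  by apply: ler_sum => l _; apply: le_trans (n1M _ _) _; rewrite ler_wpM2l // n1_ge0.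
rewrite -mulr_suml; have M0 : 0 <= M := le_trans (n1_ge0 _) (h i j).
apply: ler_wpM2r => //; rewrite /mxsum [leRHS](bigD1 i) //= lerDl sumr_ge0 // => l _.
by apply: sumr_ge0 => ? _; exact: n1_ge0.
Qed.

Lemma n1_cint_le (f g : K -> C) (h u : K -> K) c d : cprim a b f g -> rprim a b u h ->
  I c -> I d -> c <= d -> (forall x, c <= x -> x <= d -> n1 (g x) <= h x) ->
  n1 (f d - f c) <= u d - u c.
Proof.
move=> [f1 f2] U Ic Id cd gh.
pose s := Num.sg (reC (f d - f c)); pose t := Num.sg (imC (f d - f c)).
have sg1 (p q : K) : Num.sg p * q <= `|q|.
  apply: le_trans (ler_norm _) _; rewrite normrM normr_sg.
  by case: (p != 0); rewrite ?mul1r // mul0r.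
have F := rprimD (rprimZ s f1) (rprimZ t f2).
have := rprim_le (rprimD U (rprimN F)) Ic Id cd.
have -> : n1 (f d - f c) = s * reC (f d - f c) + t * imC (f d - f c).
  by rewrite /n1 !normrEsg.
move=> H; have {}H := H (ltac:(apply: ae_always => x /andP[/ltW cx /ltW xd];
  rewrite subr_ge0; apply: le_trans (gh x cx xd); apply: lerD; exact: sg1)).
rewrite reCB imCB; move: H; move: (s) (t) => ? ?; lra.
Qed.

Let picard0 n : picard n.+1 c0 = 0. Proof. exact: mprimf0. Qed.

Let picard_bound n x i j : I x -> n1 (picard n x i j) <= `|k x| ^+ n / n`!%:R.
Proof.
elim: n x i j => [|n IH] x i j Ix.
  rewrite expr0 fact0 divr1 /= mxE; case: eqP => _; rewrite ?n10 //.
  by rewrite /n1 !reimE normr1 normr0 addr0.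
have p0 : picard n.+1 c0 i j = 0 by rewrite picard0 mxE.
have [c0x|/ltW xc0] := leP c0 x.
  have kx : 0 <= k x by rewrite -k0; exact: k_mono.
  have := @n1_cint_le _ _ _ _ c0 x (picardP n i j) (kpow n) I0 Ix c0x.
  rewrite p0 subr0 k0 expr0n /= mul0r subr0 (ger0_norm kx); apply => t c0t tx.
  have It : I t by exact: (oint_conv I0 Ix).
  have kt : 0 <= k t by rewrite -k0; exact: k_mono.
  rewrite mulrC; apply: n1_mulmx_le => p q.
  by rewrite -[X in X ^+ n](ger0_norm kt); exact: IH.
have kx : k x <= 0 by rewrite -k0; exact: k_mono.
have := @n1_cint_le _ _ _ _ x c0 (picardP n i j) (rprimZ ((-1) ^+ n) (kpow n)) Ix I0 xc0.
rewrite p0 sub0r n1N k0 expr0n /= mul0r mulr0 sub0r.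
have E1 (y : K) l : y <= 0 -> (-1) ^+ l * y ^+ l = `|y| ^+ l by move=> y0; rewrite ler0_norm // -exprMn mulN1r.
rewrite -(E1 _ n.+1 kx) [(-1) ^+ n.+1]exprS mulN1r !mulNr mulrA; apply => t xt tc0.
have It : I t by exact: (oint_conv Ix I0).
have kt : k t <= 0 by rewrite -k0; exact: k_mono.
have -> : (-1) ^+ n * (k t ^+ n / n`!%:R * al t) = al t * (`|k t| ^+ n / n`!%:R).
  by rewrite -(E1 _ n kt); ring.
by apply: n1_mulmx_le => p q; exact: IH.
Qed.

Let S n x := \sum_(i < n) picard i x.

Let SS n x : S n.+1 x = S n x + picard n x.
Proof. by rewrite /S big_ord_recr. Qed.


Let SP n : mprim a b (S n.+1) (fun x => A x *m S n x).
Proof.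
elim: n => [|n IH].
  apply: mprim_eq (mprim_cst a b 1%:M) _ _ => x; rewrite /S ?big_ord0 ?mulmx0 //.
  by rewrite big_ord_recr big_ord0 /= add0r.
apply: mprim_eq (mprimD IH (picardP n)) _ _ => x; first by rewrite -SS.
by rewrite -mulmxDr -SS.
Qed.

Let S_bound n x i j : I x -> n1 (S n x i j) <= expR `|k x|.
Proof.
move=> Ix; rewrite /S summxE; apply: le_trans (n1_sum _ _ _) _.
apply: (@le_trans _ _ (series (exp_coeff `|k x|) n)).
  by rewrite /series /= big_mkord; apply: ler_sum => l _; exact: picard_bound.
apply: nondecreasing_cvgn_le; last exact: is_cvg_series_exp_coeff.
apply/nondecreasing_seqP => l; rewrite /series /= big_nat_recr //= lerDl.
exact: exp_coeff_ge0.
Qed.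

Let S_cvg (part : C -> K) x i j : I x -> {morph part : z w / z + w} -> part 0 = 0 ->
  (forall z, `|part z| <= n1 z) -> cvgn (fun n => part (S n x i j)).
Proof.
move=> Ix pD p0 pn.
have -> : (fun n => part (S n x i j)) = series (fun l => part (picard l x i j)).
  apply/funext => n; rewrite /series /= big_mkord /S summxE.
  by elim/big_rec2: _ => // l y1 y2 _ <-; rewrite pD.
apply: normed_cvg; apply: series_le_cvg (is_cvg_series_exp_coeff `|k x|) => l.
- exact: normr_ge0.
- exact: exp_coeff_ge0.
- by apply: le_trans (pn _) _; exact: picard_bound.
Qed.

Let Y x : 'M[C]_N := \matrix_(i, j)
  mkC (limn (fun n => reC (S n x i j))) (limn (fun n => imC (S n x i j))).

Let Y_re x i j : I x -> reC (S n x i j) @[n --> \oo] --> reC (Y x i j).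
Proof.
move=> Ix; rewrite mxE reC_mk; apply: S_cvg => //; [exact: reCD|exact: n1_re].
Qed.
Let Y_im x i j : I x -> imC (S n x i j) @[n --> \oo] --> imC (Y x i j).
Proof.
move=> Ix; rewrite mxE imC_mk; apply: S_cvg => //; [exact: imCD|exact: n1_im].
Qed.

Let AY_re x i j : I x -> reC ((A x *m S n x) i j) @[n --> \oo] --> reC ((A x *m Y x) i j).
Proof.
move=> Ix; have E Z : reC ((A x *m Z) i j) =
    \sum_l (reC (A x i l) * reC (Z l j) - imC (A x i l) * imC (Z l j)).
  by rewrite mxE reC_sum; apply: eq_bigr => l _; rewrite reCM.
rewrite E (_ : (fun n => reC _) = fun n => \sum_l
    (reC (A x i l) * reC (S n x l j) - imC (A x i l) * imC (S n x l j))); last first.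
  by apply/funext => n; rewrite E.
by apply: cvg_sumr => l; apply: cvgB; apply: cvgM;
  [exact: cvg_cst|exact: Y_re|exact: cvg_cst|exact: Y_im].
Qed.
Let AY_im x i j : I x -> imC ((A x *m S n x) i j) @[n --> \oo] --> imC ((A x *m Y x) i j).
Proof.
move=> Ix; have E Z : imC ((A x *m Z) i j) =
    \sum_l (reC (A x i l) * imC (Z l j) + imC (A x i l) * reC (Z l j)).
  by rewrite mxE imC_sum; apply: eq_bigr => l _; rewrite imCM.
rewrite E (_ : (fun n => imC _) = fun n => \sum_l
    (reC (A x i l) * imC (S n x l j) + imC (A x i l) * reC (S n x l j))); last first.
  by apply/funext => n; rewrite E.
by apply: cvg_sumr => l; apply: cvgD; apply: cvgM;
  [exact: cvg_cst|exact: Y_im|exact: cvg_cst|exact: Y_re].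
Qed.

Let Y_rprim (part : C -> K) i j :
  (forall z, `|part z| <= n1 z) ->
  (forall n, rprim a b (fun x => part (S n.+1 x i j)) (fun x => part ((A x *m S n x) i j))) ->
  (forall x, I x -> part (S n x i j) @[n --> \oo] --> part (Y x i j)) ->
  (forall x, I x -> part ((A x *m S n x) i j) @[n --> \oo] --> part ((A x *m Y x) i j)) ->
  rprim a b (fun x => part (Y x i j)) (fun x => part ((A x *m Y x) i j)).
Proof.
move=> pn P cY cAY c d Ic Id cd.
have Icd x : c <= x <= d -> I x by move=> /andP[cx xd]; exact: (oint_conv Ic Id).
have [M M0 HM] := rac_bounded (rprim_ac kP Ic Id).
pose h x := al x * expR M.
have hi : rintg `[c, d] h.
  have := rlocM (loc_rac_cst (expR M)) al_loc => H.
  by apply: (rloc_eq H) => // x; rewrite mulrC.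
have fi n : rintg `[c, d] (fun x => part ((A x *m S n x) i j)).
  by have [] := P n c d Ic Id cd.
have bd x n : c <= x <= d -> `|part ((A x *m S n x) i j)| <= h x.
  move=> /[dup] /andP[cx xd] /Icd Ix; apply: le_trans (pn _) _; apply: n1_mulmx_le => p q.
  by apply: le_trans (S_bound _ _ _ Ix) _; rewrite ler_expR; exact: HM.
have cv x : c <= x <= d -> part ((A x *m S n x) i j) @[n --> \oo] --> part ((A x *m Y x) i j).
  by move=> /Icd; exact: cAY.
have gi := rintg_lim fi hi cv bd; split => //.
have L1 : rint c d (fun x => part ((A x *m S n x) i j)) @[n --> \oo] -->
    rint c d (fun x => part ((A x *m Y x) i j)).
  apply: (rint_dct fi gi hi); apply: ae_always => x; rewrite /= in_itv /= => cxd.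
    exact: cv.
  by move=> n; exact: bd.
have L2 : part (S n.+1 d i j) - part (S n.+1 c i j) @[n --> \oo] -->
    part (Y d i j) - part (Y c i j).
  by apply: cvgB; rewrite (cvg_shiftS (fun n => part (S n _ i j))); exact: cY.
have E : (fun n => part (S n.+1 d i j) - part (S n.+1 c i j)) =
    (fun n => rint c d (fun x => part ((A x *m S n x) i j))).
  by apply/funext => n; have [_ <-] := P n c d Ic Id cd.
by rewrite E in L2; exact: (cvg_unique _ L2 L1).
Qed.

(** Picard iteration: the iterated integrals are dominated by the exponential
   series in the integral of the entries of the coefficient, on both sides of the
   base point. *)
Lemma linear_system_ex : exists2 Y : K -> 'M[C]_N,
  mprim a b Y (fun x => A x *m Y x) & Y c0 = 1%:M.
Proof.
exists Y.
  move=> i j; split.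
    apply: Y_rprim => //; [exact: n1_re| |by move=> x; exact: Y_re|by move=> x; exact: AY_re].
    by move=> n; have [] := SP n i j.
  apply: Y_rprim => //; [exact: n1_im| |by move=> x; exact: Y_im|by move=> x; exact: AY_im].
  by move=> n; have [] := SP n i j.
have S1 n : S n.+1 c0 = 1%:M.
  elim: n => [|n IH]; first by rewrite /S big_ord_recr big_ord0 /= add0r.
  by rewrite SS IH picard0 addr0.
apply/matrixP => i j; apply: cplx_eq.
  have := @Y_re c0 i j I0; rewrite -(cvg_shiftS (fun n => reC (S n c0 i j))).
  rewrite (_ : (fun n => _) = fun=> reC ((1%:M : 'M[C]_N) i j)); last first.
    by apply/funext => n; rewrite /= S1.
  by move=> H; exact: (cvg_unique _ H (cvg_cst _)).
have := @Y_im c0 i j I0; rewrite -(cvg_shiftS (fun n => imC (S n c0 i j))).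
rewrite (_ : (fun n => _) = fun=> imC ((1%:M : 'M[C]_N) i j)); last first.
  by apply/funext => n; rewrite /= S1.
by move=> H; exact: (cvg_unique _ H (cvg_cst _)).
Qed.

End ode.

(** * Sturm-Liouville systems *)
Section sub_interval.
Variable K : realType.
Variables (a b a' b' : \bar K).
Notation C := (cplx K).
Hypothesis sub : forall x, oint a' b' x -> oint a b x.

Lemma mprim_sub m n (F G : K -> 'M[C]_(m, n)) : mprim a b F G -> mprim a' b' F G.
Proof.
by move=> H i j; have [h1 h2] := H i j; split => c d Ic Id cd;
  [apply: h1|apply: h2] => //; exact: sub.
Qed.
Lemma mcac_sub m n (F : K -> 'M[C]_(m, n)) : mcac a b F -> mcac a' b' F.
Proof.
by move=> H i j; have [h1 h2] := H i j; split => c d Ic Id; [apply: h1|apply: h2]; exact: sub.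
Qed.
Lemma mloc_sub m n (F : K -> 'M[C]_(m, n)) : mloc a b F -> mloc a' b' F.
Proof.
by move=> H i j; have [h1 h2] := H i j; split => c d Ic Id; [apply: h1|apply: h2]; exact: sub.
Qed.
End sub_interval.

Section ae_tools.
Variable K : realType.
Variables a b : \bar K.
Notation I := (oint a b).
Notation C := (cplx K).

(** An interval is not a null set. *)
Lemma ae_point (P : K -> Prop) c d : c < d ->
  {ae leb, forall x : lebT K, c < x < d -> P x} -> exists2 x, c < x < d & P x.
Proof.
move=> cd [N [mN N0 PN]]; apply: contrapT => /forall2NP H.
have sub : (`]c, d[%classic : set K) `<=` N.
  by move=> x; rewrite /= in_itv /= => cxd; apply: PN => h; case: (H x) => //; apply; exact: h.
have mi : measurable (`]c, d[%classic : set (lebT K)) by apply: measurable_leb; exact: measurable_itv.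
have := subset_measure0 mi mN sub N0.
rewrite [X in X = _](lebE (`]c, d[%classic : set K)) lebesgue_measure_itv /= lte_fin cd -EFinD => -[] /eqP.
by rewrite subr_eq0 => /eqP e; move: cd; rewrite e ltxx.
Qed.

Lemma cac_ae0 (f : K -> C) : cac a b f -> {ae leb, forall x : lebT K, I x -> f x = 0} ->
  forall x, I x -> f x = 0.
Proof.
move=> F f0 x Ix; apply: n1_eq0; apply/eqP; rewrite eq_le n1_ge0 andbT leNgt; apply/negP => p.
have [dl dl0 H] := cac_continuous F Ix p.
have [y /andP[y1 y2] Py] : exists2 y, x - dl < y < x + dl & (I y -> f y = 0).
  by apply: ae_point; [lra|apply: ae_mono f0 => y h _].
have [Iy] := H y (ltac:(by rewrite ltr_norml; apply/andP; split; lra)).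
by rewrite (Py Iy) sub0r n1N ltxx.
Qed.
End ae_tools.

Section system.
Variable K : realType.
Variable m : nat.
Variables a b : \bar K.
Notation I := (oint a b).
Notation C := (cplx K).
Variables P Q R : K -> 'M[C]_m.
Hypothesis hPQR : coefficients a b P Q R.
Local Open Scope sesquilinear_scope.

Definition Pinv (x : K) := invmx (P x).

Lemma posdef_unit (A : 'M[C]_m) : posdef A -> A \in unitmx.
Proof.
move=> [_ pA]; rewrite -unitmx_tr; apply: contraT => nu.
have /rowV0Pn[v] : kermx A^T != 0.
  by rewrite -mxrank_eq0 mxrank_ker subn_eq0 -ltnNge ltn_neqAle rank_leq_row andbT -row_free_unit in nu *.
move=> /sub_kermxP vA v0; have := pA v^T; rewrite /cdot.
have -> : A *m v^T = 0 by apply: trmx_inj; rewrite trmx_mul trmxK vA trmx0.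
rewrite mulmx0 mxE ltxx => H; apply: H.
by apply: contraNneq v0 => h; apply/eqP/trmx_inj; rewrite h trmx0.
Qed.

Lemma posdef_inv (A : 'M[C]_m) : posdef A -> posdef (invmx A).
Proof.
move=> pA; have uA := posdef_unit pA; have [hA qA] := pA; split; first by rewrite ctV hA.
move=> v v0; have := qA (invmx A *m v); rewrite /cdot ctM ctV hA mulKVmx // -mulmxA => H; apply: H; apply: contraNneq v0 => h; apply/eqP.
by rewrite -(mulKVmx uA v) h mulmx0.
Qed.

Lemma Pinv_loc : mloc a b Pinv.
Proof. by have [_ _ _ [h _ _]] := hPQR; apply/mlocP. Qed.
Lemma Q_loc : mloc a b Q.
Proof. by have [_ _ _ [_ h _]] := hPQR; apply/mlocP. Qed.
Lemma R_loc : mloc a b R.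
Proof. by have [_ _ _ [_ _ h]] := hPQR; apply/mlocP. Qed.
Lemma ae_coef : {ae leb, forall x : lebT K, I x ->
  [/\ posdef (P x), posdef (R x) & (Q x) ^t* = Q x]}.
Proof.
have [_ h1 h2 _] := hPQR; apply: ae_mono (ae_and h1 h2) => x [p q] Ix.
by have [? ?] := p Ix; split => //; exact: q.
Qed.

(** The equation as a first order system for [U] and its quasi-derivative [W], with
   coefficients that are all locally integrable. *)
Definition sol n (z : C) (U W : K -> 'M[C]_(m, n)) :=
  mprim a b U (fun x => Pinv x *m W x) /\
  mprim a b W (fun x => (Q x - z *: R x) *m U x).

Lemma sol_of_solution z U W : solution_with a b P Q R z U W -> sol z U W.
Proof.
move=> [/mcacP hU [/mcacP hW WE] LE].
split.
  apply: (mprim_ae (mcac_mprim hU)); apply: ae_mono (ae_and ae_coef WE) => x [h1 h2] Ix.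
  by have [pP _ _] := h1 Ix; rewrite /Pinv h2 // mulKmx // posdef_unit.
apply: (mprim_ae (mcac_mprim hW)); apply: ae_mono (ae_and ae_coef LE) => x [h1 h2] Ix.
have [_ pR _] := h1 Ix; have := h2 Ix; rewrite /Lexpr => e.
have {e} : R x *m (z *: U x) = - mx_deriv W x + Q x *m U x.
  by rewrite -e mulKVmx // posdef_unit.
rewrite mulmxBl -scalemxAl -scalemxAr => ->.
by rewrite opprD opprK addrCA addrN addr0.
Qed.

Lemma solution_of_sol z U W : sol z U W -> solution_with a b P Q R z U W.
Proof.
move=> [hU hW]; split; first by apply/mcacP; exact: mprim_mcac hU.
  split; first by apply/mcacP; exact: mprim_mcac hW.
  apply: ae_mono (ae_and ae_coef (mprim_mx_deriv hU)) => x [h1 h2] Ix.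
  by have [pP _ _] := h1 Ix; rewrite h2 // mulKVmx // posdef_unit.
apply: ae_mono (ae_and ae_coef (mprim_mx_deriv hW)) => x [h1 h2] Ix.
have [_ pR _] := h1 Ix; rewrite /Lexpr h2 // mulmxBl opprB addrNK.
by rewrite -scalemxAl -scalemxAr mulKmx // posdef_unit.
Qed.

Lemma solMr n p z (U W : K -> 'M[C]_(m, n)) (M : 'M[C]_(n, p)) :
  sol z U W -> sol z (fun x => U x *m M) (fun x => W x *m M).
Proof.
move=> [h1 h2]; split.
  by apply: mprim_eq (mprimMr M h1) _ _ => // x; rewrite mulmxA.
by apply: mprim_eq (mprimMr M h2) _ _ => // x; rewrite mulmxA.
Qed.
Lemma solD n z (U W V Z : K -> 'M[C]_(m, n)) : sol z U W -> sol z V Z ->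
  sol z (fun x => U x + V x) (fun x => W x + Z x).
Proof.
move=> [h1 h2] [h3 h4]; split.
  by apply: mprim_eq (mprimD h1 h3) _ _ => // x; rewrite mulmxDr.
by apply: mprim_eq (mprimD h2 h4) _ _ => // x; rewrite mulmxDr.
Qed.
Lemma solN n z (U W : K -> 'M[C]_(m, n)) : sol z U W ->
  sol z (fun x => - U x) (fun x => - W x).
Proof.
move=> [h1 h2]; split.
  by apply: mprim_eq (mprimN h1) _ _ => // x; rewrite mulmxN.
by apply: mprim_eq (mprimN h2) _ _ => // x; rewrite mulmxN.
Qed.

(** Lagrange's bracket of two solutions, written [{U, V}] in the comments below. *)
Definition wr n p (U W : K -> 'M[C]_(m, n)) (V Z : K -> 'M[C]_(m, p)) (x : K) :=
  (U x) ^t* *m Z x - (W x) ^t* *m V x.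

(** Lagrange's identity: [P] and [Q] are self-adjoint, so only the spectral parameters
   contribute. *)
Lemma wr_prim n p z z' (U W : K -> 'M[C]_(m, n)) (V Z : K -> 'M[C]_(m, p)) :
  sol z U W -> sol z' V Z ->
  mprim a b (wr U W V Z) (fun x => (z^* - z') *: ((U x) ^t* *m R x *m V x)).
Proof.
move=> [u w] [v zz].
have := mprimD (mprimM (mprim_ct u) zz) (mprimN (mprimM (mprim_ct w) v)).
move=> H; apply: (mprim_ae H); apply: ae_mono ae_coef => x h Ix.
have [[hP _] [hR _] hQ] := h Ix.
rewrite !ctM ctB ctZ hQ hR (_ : (Pinv x) ^t* = Pinv x); last by rewrite /Pinv ctV hP.
rewrite -!mulmxA [X in _ - X]addrC opprD addrACA subrr add0r -mulmxBr -mulmxBl.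
rewrite (_ : Q x - z' *: R x - (Q x - z^* *: R x) = (z^* - z') *: R x); last first.
  by rewrite opprB addrC addrA subrK scalerBl.
by rewrite -!scalemxAl -scalemxAr.
Qed.

Lemma sol_ex n z c0 (U0 W0 : 'M[C]_(m, n)) : I c0 ->
  exists U W, [/\ sol z U W, U c0 = U0 & W c0 = W0].
Proof.
move=> I0.
pose A x : 'M[C]_(m + m) := block_mx 0 (Pinv x) (Q x - z *: R x) 0.
have Al : mloc a b A.
  move=> i j; rewrite -(splitK i) -(splitK j).
  case: (fintype.split i) => k; case: (fintype.split j) => l /=.
  - apply: (cloc_eq (cac_cloc (cac_cst _ _ 0))) => x.
    by rewrite block_mxEul mxE.
  - by apply: (cloc_eq (Pinv_loc k l)) => x; rewrite block_mxEur.
  - apply: (cloc_eq (clocD (Q_loc k l) (mlocZ (- z) R_loc k l))) => x.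
    by rewrite block_mxEdl !mxE mulNr.
  - apply: (cloc_eq (cac_cloc (cac_cst _ _ 0))) => x.
    by rewrite block_mxEdr mxE.
have [Y YP Y0] := linear_system_ex Al I0.
pose Z x := Y x *m col_mx U0 W0.
have ZP : mprim a b Z (fun x => A x *m Z x).
  by apply: mprim_eq (mprimMr _ YP) _ _ => // x; rewrite mulmxA.
have AZ x : A x *m Z x = col_mx (Pinv x *m dsubmx (Z x)) ((Q x - z *: R x) *m usubmx (Z x)).
  by rewrite -[X in A x *m X](vsubmxK (Z x)) mul_block_col !mul0mx add0r addr0.
exists (fun x => usubmx (Z x)), (fun x => dsubmx (Z x)); split.
- split => i j.
    apply: cprim_eq (ZP (lshift m i) j) _ _ => x; first by rewrite [RHS]mxE.
    by rewrite AZ col_mxEu.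
  apply: cprim_eq (ZP (rshift m i) j) _ _ => x; first by rewrite [RHS]mxE.
  by rewrite AZ col_mxEd.
- by rewrite /Z Y0 mul1mx col_mxKu.
- by rewrite /Z Y0 mul1mx col_mxKd.
Qed.


Lemma wr0 n p z (U W : K -> 'M[C]_(m, n)) (V Z : K -> 'M[C]_(m, p)) c x :
  sol z U W -> sol z^* V Z -> I c -> I x -> wr U W V Z c = wr U W V Z x.
Proof.
move=> u v Ic Ix; apply: mprim0_cst (Ic) (Ix).
by apply: mprim_eq (wr_prim u v) _ _ => // t; rewrite subrr scale0r.
Qed.

(** Uniqueness from existence: the bracket with the solutions at the conjugate parameter
   is constant, and these have arbitrary values at [x]. *)
Lemma sol_zero n z (U W : K -> 'M[C]_(m, n)) c x : sol z U W -> I c ->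
  U c = 0 -> W c = 0 -> I x -> U x = 0 /\ W x = 0.
Proof.
move=> u Ic U0 W0 Ix.
have key (V0 Z0 : 'M[C]_m) : V0 ^t* *m W x - Z0 ^t* *m U x = 0.
  have [V [Z [v <- <-]]] := sol_ex z^* V0 Z0 Ix.
  have v' : sol (z^*) V Z by [].
  have := @wr0 _ _ z^* V Z U W c x v' (ltac:(by rewrite conjCK)) Ic Ix.
  by rewrite /wr U0 W0 !mulmx0 subrr => <-.
split.
  by have := key 0 1%:M; rewrite ct0 ct1 mul0mx mul1mx sub0r => /eqP; rewrite oppr_eq0 => /eqP.
by have := key 1%:M 0; rewrite ct0 ct1 mul0mx mul1mx subr0.
Qed.

Lemma sol_uniq n z (U W V Z : K -> 'M[C]_(m, n)) c x : sol z U W -> sol z V Z -> I c ->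
  U c = V c -> W c = Z c -> I x -> U x = V x /\ W x = Z x.
Proof.
move=> u v Ic e1 e2 Ix; have [] := @sol_zero _ _ _ _ c x (solD u (solN v)) Ic _ _ Ix.
- by rewrite e1 subrr.
- by rewrite e2 subrr.
by move=> /eqP; rewrite subr_eq0 => /eqP -> /eqP; rewrite subr_eq0 => /eqP ->.
Qed.

(** The value of a Hermitian form. *)
Definition qf (A : 'M[C]_m) (v : 'cV[C]_m) : C := (v ^t* *m A *m v) 0 0.

Lemma qf_ge0 A v : posdef A -> 0 <= qf A v.
Proof.
move=> [_ pA]; have [->|v0] := eqVneq v 0; first by rewrite /qf mulmx0 mxE.
by rewrite /qf -mulmxA; apply/ltW/pA.
Qed.
Lemma qf_eq0 A v : posdef A -> qf A v = 0 -> v = 0.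
Proof.
move=> [_ pA] q0; apply/eqP; apply: contraT => v0.
by have := pA v v0; rewrite /cdot mulmxA -/(qf A v) q0 ltxx.
Qed.

(** Unique continuation: the weighted norm of a solution over an interval controls
   the solution, since [R] is positive almost everywhere. *)
Lemma sol_energy0 z (U W : K -> 'cV[C]_m) (X : K -> 'M[C]_1) c d :
  sol z U W -> mprim a b X (fun x => (U x) ^t* *m R x *m U x) ->
  I c -> I d -> c < d -> X d = X c -> forall x, I x -> U x = 0 /\ W x = 0.
Proof.
move=> u hX Ic Id cd Xe.
have subI x : oint c%:E d%:E x -> I x.
  by move=> /andP[]; rewrite !lte_fin => cx xd; apply: (oint_conv Ic Id); exact: ltW.
have Xm s t : I s -> I t -> s <= t -> X s 0 0 <= X t 0 0.
  move=> Is It st; apply: (cprim_le (hX 0 0)) => //.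
  apply: ae_mono ae_coef => x h /andP[sx xt].
  have Ix : I x by apply: (oint_conv Is It); exact: ltW.
  by have [_ pR _] := h Ix; exact: qf_ge0.
have Xc x : oint c%:E d%:E x -> X x = X c.
  move=> cdx; have Ix := subI _ cdx; move: cdx => /andP[]; rewrite !lte_fin => cx xd.
  apply/matrixP => i j; rewrite !ord1; apply/le_anti.
  by rewrite (Xm _ _ Ic Ix (ltW cx)) andbT -Xe; apply: Xm => //; exact: ltW.
have hX' := mprim_sub subI hX.
have hc : mprim c%:E d%:E X (fun=> 0).
  by apply: (mprim_ext (mprim_cst _ _ (X c))) => x /Xc.
have U0 x : oint c%:E d%:E x -> U x = 0.
  move=> cdx; apply/matrixP => i j; rewrite mxE.
  have F := mcac_sub subI (mprim_mcac u.1) i j; apply: (cac_ae0 F _ cdx).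
  apply: ae_mono (ae_and ae_coef (mprim_uniq hX' hc)) => t [h1 h2] It.
  have [_ pR _] := h1 (subI _ It); have q0 : qf (R t) (U t) = 0 by rewrite /qf h2 // mxE.
  by rewrite (qf_eq0 pR q0) mxE.
have hW : {ae leb, forall x : lebT K, oint c%:E d%:E x -> W x = 0}.
  have u1 := mprim_sub subI u.1.
  have u0 : mprim c%:E d%:E U (fun=> 0).
    by apply: (mprim_ext (mprim_cst _ _ 0)) => x /U0.
  apply: ae_mono (ae_and ae_coef (mprim_uniq u1 u0)) => x [h1 h2] Ix.
  have [pP _ _] := h1 (subI _ Ix).
  by rewrite -(mulKVmx (posdef_unit pP) (W x)) -/(Pinv x) h2 // mulmx0.
have [x cxd Wx] : exists2 x, c < x < d & (oint c%:E d%:E x -> W x = 0).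
  by apply: ae_point => //; apply: ae_mono hW => x h _.
have Ix : oint c%:E d%:E x by rewrite /oint /= !lte_fin.
by move=> y Iy; apply: (sol_zero u (subI _ Ix) (U0 _ Ix) (Wx Ix) Iy).
Qed.

End system.

(** * Limits of complex matrices *)
Section mcvg.
Variable K : realType.
Notation C := (cplx K).
Local Open Scope sesquilinear_scope.
Context {T : Type} {F : set_system T} {FF : Filter F}.

Lemma cvgC_parts (u : T -> C) (l : C) :
  u t @[t --> F] --> l <->
  (reC (u t) @[t --> F] --> reC l) /\ (imC (u t) @[t --> F] --> imC l).
Proof.
split=> [/cvgrPdist_lt H|[/cvgrPdist_lt H1 /cvgrPdist_lt H2]].
  split; apply/cvgrPdist_lt => e e0.
    have e0' : 0 < realC e by rewrite -realC0 realC_lt.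
    apply: filterS (H _ e0') => t h; rewrite -realC_lt -reCB.
    by apply: le_lt_trans h; exact: norm_reC.
  have e0' : 0 < realC e by rewrite -realC0 realC_lt.
  apply: filterS (H _ e0') => t h; rewrite -realC_lt -imCB.
  by apply: le_lt_trans h; exact: norm_imC.
apply/cvgrPdist_lt => e e0.
have ee : e = realC (reC e).
  by move: e0; rewrite ltcP reimE => /andP[/eqP h _]; apply: cplx_eq; rewrite !reimE.
have e2 : 0 < reC e / 2 by move: e0; rewrite ltcP => /andP[_]; rewrite reimE => h; rewrite divr_gt0.
apply: filterS (filterI (H1 _ e2) (H2 _ e2)) => t [h1 h2].
apply: le_lt_trans (norm_n1 _) _; rewrite ee realC_lt [ltRHS]splitr /n1 reCB imCB.
exact: ltrD.
Qed.

Lemma cvgC_n1 (u : T -> C) (l : C) :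
  (forall e : K, 0 < e -> \forall t \near F, n1 (l - u t) < e) -> u t @[t --> F] --> l.
Proof.
move=> H; apply/cvgrPdist_lt => e e0.
have ee : e = realC (reC e).
  by move: e0; rewrite ltcP reimE => /andP[/eqP h _]; apply: cplx_eq; rewrite !reimE.
have e1 : 0 < reC e by move: e0; rewrite ltcP => /andP[_].
apply: filterS (H _ e1) => t h; apply: le_lt_trans (norm_n1 _) _.
by rewrite ee realC_lt.
Qed.

Lemma cvg_n1 (u : T -> C) (l : C) : u t @[t --> F] --> l ->
  forall e : K, 0 < e -> \forall t \near F, n1 (u t - l) < e.
Proof.
move=> /cvgC_parts[/cvgrPdist_lt H1 /cvgrPdist_lt H2] e e0.
have e2 : 0 < e / 2 by rewrite divr_gt0.
apply: filterS (filterI (H1 _ e2) (H2 _ e2)) => t [h1 h2].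
by rewrite [ltRHS]splitr /n1 reCB imCB; apply: ltrD; rewrite distrC.
Qed.

Definition mcvg m n (G : T -> 'M[C]_(m, n)) (L : 'M[C]_(m, n)) :=
  forall i j, G t i j @[t --> F] --> L i j.

Lemma cvg_sumC (J : Type) (r : seq J) (u : J -> T -> C) (l : J -> C) :
  (forall i, u i t @[t --> F] --> l i) ->
  \sum_(i <- r) u i t @[t --> F] --> \sum_(i <- r) l i.
Proof.
move=> H; elim: r => [|i r IH].
  rewrite big_nil (_ : (fun t => _) = fun=> 0); last by apply/funext => t; rewrite big_nil.
  exact: cvg_cst.
rewrite big_cons (_ : (fun t => _) = fun t => u i t + \sum_(i <- r) u i t); last first.
  by apply/funext => t; rewrite big_cons.
exact: (cvgD (H i) IH).
Qed.
Lemma cvg_prodC (J : Type) (r : seq J) (u : J -> T -> C) (l : J -> C) :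
  (forall i, u i t @[t --> F] --> l i) ->
  \prod_(i <- r) u i t @[t --> F] --> \prod_(i <- r) l i.
Proof.
move=> H; elim: r => [|i r IH].
  rewrite big_nil (_ : (fun t => _) = fun=> 1); last by apply/funext => t; rewrite big_nil.
  exact: cvg_cst.
rewrite big_cons (_ : (fun t => _) = fun t => u i t * \prod_(i <- r) u i t); last first.
  by apply/funext => t; rewrite big_cons.
exact: (cvgM (H i) IH).
Qed.

Lemma mcvg_near m n (G H : T -> 'M[C]_(m, n)) L : mcvg G L ->
  (\forall t \near F, G t = H t) -> mcvg H L.
Proof.
move=> g e i j; apply: cvg_trans (g i j); apply: near_eq_cvg.
by apply: filterS e => t ->.
Qed.
Lemma mcvg_cst m n (L : 'M[C]_(m, n)) : mcvg (fun=> L) L.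
Proof. by move=> i j; exact: cvg_cst. Qed.
Lemma mcvgD m n (G H : T -> 'M[C]_(m, n)) L M : mcvg G L -> mcvg H M ->
  mcvg (fun t => G t + H t) (L + M).
Proof.
move=> g h i j; rewrite mxE (_ : (fun t => _) = fun t => G t i j + H t i j); last first.
  by apply/funext => t; rewrite mxE.
by apply: cvgD; [exact: g|exact: h].
Qed.
Lemma mcvgN m n (G : T -> 'M[C]_(m, n)) L : mcvg G L -> mcvg (fun t => - G t) (- L).
Proof.
move=> g i j; rewrite mxE (_ : (fun t => _) = fun t => - G t i j); last first.
  by apply/funext => t; rewrite mxE.
by apply: cvgN; exact: g.
Qed.
Lemma mcvgM m n p (G : T -> 'M[C]_(m, n)) (H : T -> 'M[C]_(n, p)) L M :
  mcvg G L -> mcvg H M -> mcvg (fun t => G t *m H t) (L *m M).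
Proof.
move=> g h i j; rewrite mxE (_ : (fun t => _) = fun t => \sum_k G t i k * H t k j); last first.
  by apply/funext => t; rewrite mxE.
by apply: cvg_sumC => k; apply: cvgM; [exact: g|exact: h].
Qed.
Lemma mcvg_ct m n (G : T -> 'M[C]_(m, n)) L : mcvg G L ->
  mcvg (fun t => (G t) ^t*) (L ^t*).
Proof.
move=> g i j; rewrite ctE (_ : (fun t => _) = fun t => (G t j i)^*); last first.
  by apply/funext => t; rewrite ctE.
have /cvgC_parts[h1 h2] := g j i; apply/cvgC_parts; rewrite !reimE; split.
  by rewrite (_ : (fun t => reC _) = fun t => reC (G t j i)) //; apply/funext => t; rewrite !reimE.
rewrite (_ : (fun t => imC _) = fun t => - imC (G t j i)); first exact: cvgN.
by apply/funext => t; rewrite !reimE.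
Qed.
Lemma cvg_det m (G : T -> 'M[C]_m) L : mcvg G L -> \det (G t) @[t --> F] --> \det L.
Proof.
move=> g; apply: cvg_sumC => s; apply: cvgM; first exact: cvg_cst.
by apply: cvg_prodC => i; exact: g.
Qed.

Lemma mcvgV m (G : T -> 'M[C]_m) L : L \in unitmx -> mcvg G L ->
  (\forall t \near F, G t \in unitmx) /\ mcvg (fun t => invmx (G t)) (invmx L).
Proof.
move=> uL g; have d0 : \det L != 0 by rewrite -unitfE -unitmxE.
have d := cvg_det g.
have U : \forall t \near F, G t \in unitmx.
  have e0 : 0 < `|\det L| by rewrite normr_gt0.
  have /cvgrPdist_lt/(_ _ e0) := d; apply: filterS => t h.
  rewrite unitmxE unitfE; apply: contraTneq h => ->.
  by rewrite subr0 ltxx.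
split; first exact: U.
move=> i j.
have E (A : 'M[C]_m) : A \in unitmx ->
    invmx A i j = (\det A)^-1 * ((-1) ^+ (j + i) * \det (row' j (col' i A))).
  by move=> uA; rewrite /invmx uA !mxE.
rewrite (E L uL).
apply: (@cvg_trans _ ((\det (G t))^-1 * ((-1) ^+ (j + i) * \det (row' j (col' i (G t)))) @[t --> F])).
  by apply: near_eq_cvg; apply: filterS U => t uG; rewrite E.
apply: cvgM; first exact: cvgV.
apply: cvgM; first exact: cvg_cst.
apply: cvg_det => k l; rewrite !mxE.
rewrite (_ : (fun t => _) = fun t => G t (lift j k) (lift i l)); first exact: g.
by apply/funext => t; rewrite !mxE.
Qed.

Lemma mcvg_nbhs m n (G : T -> 'M[C]_(m, n)) L : mcvg G L <-> (G t @[t --> F] --> L).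
Proof.
split=> [g|g i j].
  move=> A [B nB BA]; apply: (@filterS _ F _ [set t | forall i j, B i j (G t i j)]).
    by move=> t h; apply: BA.
  have : forall ij : 'I_m * 'I_n, F [set t | B ij.1 ij.2 (G t ij.1 ij.2)].
    by move=> [i j]; apply: g; exact: nB.
  move=> /filter_forall H; apply: filterS H => t h i j; exact: (h (i, j)).
move=> A nA; have := g [set M : 'M[C]_(m, n) | A (M i j)]; apply.
exists (fun k l => if (k == i) && (l == j) then A else setT).
  by move=> k l; case: ifP => [/andP[/eqP -> /eqP ->]//|_]; exact: filterT.
by move=> M /(_ i j); rewrite !eqxx.
Qed.

End mcvg.
Arguments mcvg {K T} F {m n}.

Section limit_order.
Variable K : realType.
Notation C := (cplx K).
Context {T : Type} {F : set_system T} {FF : ProperFilter F}.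

Lemma cvgC_ge (u : T -> C) (l k : C) : u t @[t --> F] --> l ->
  (\forall t \near F, k <= u t) -> k <= l.
Proof.
move=> /cvgC_parts[h1 h2] le; rewrite lecP; apply/andP; split.
  apply/eqP; apply: (cvg_unique _ h2) => //.
  apply: (@cvg_trans _ (imC k @[t --> F])); last exact: cvg_cst.
  by apply: near_eq_cvg; apply: filterS le => t; rewrite lecP => /andP[/eqP].
rewrite -(cvg_lim _ h1) //; apply: limr_ge; first by apply/cvg_ex; eexists; exact: h1.
by apply: filterS le => t; rewrite lecP => /andP[_].
Qed.

Lemma cvgC_le (u : T -> C) (l k : C) : u t @[t --> F] --> l ->
  (\forall t \near F, u t <= k) -> l <= k.
Proof.
move=> h le; rewrite -lerN2; apply: (@cvgC_ge (fun t => - u t)); first exact: cvgN.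
by apply: filterS le => t; rewrite lerN2.
Qed.
End limit_order.

(** * Measurable complex functions *)
Section cmeas.
Variable K : realType.
Notation C := (cplx K).
Variable D : set K.
Hypothesis mD : measurable (D : set (lebT K)).
Implicit Types f g : K -> C.
Notation cm := (cmeasurable D).
Notation rm f := (measurable_fun (D : set (lebT K)) (f : lebT K -> K)).

Lemma cmeas_eq f g : cm f -> (forall x, f x = g x) -> cm g.
Proof. by move=> h /funext <-. Qed.
Lemma rmeas_eq (f g : K -> K) : rm f -> (forall x, f x = g x) -> rm g.
Proof. by move=> h /funext <-. Qed.

Lemma cmeas_cst k : cm (fun=> k).
Proof. by split; exact: measurable_cst. Qed.
Lemma cmeasD f g : cm f -> cm g -> cm (fun x => f x + g x).
Proof.
move=> [f1 f2] [g1 g2]; split.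
  by apply: (rmeas_eq (measurable_funD f1 g1)) => x; rewrite reimE.
by apply: (rmeas_eq (measurable_funD f2 g2)) => x; rewrite reimE.
Qed.
Lemma cmeasM f g : cm f -> cm g -> cm (fun x => f x * g x).
Proof.
move=> [f1 f2] [g1 g2]; split.
  apply: (rmeas_eq (measurable_funD (measurable_funM f1 g1) (measurable_funN (measurable_funM f2 g2)))) => x.
  by rewrite /= !reimE.
apply: (rmeas_eq (measurable_funD (measurable_funM f1 g2) (measurable_funM f2 g1))) => x.
by rewrite /= !reimE.
Qed.
Lemma cmeas_conj f : cm f -> cm (fun x => (f x)^*).
Proof.
move=> [f1 f2]; split; first by apply: (rmeas_eq f1) => x; rewrite reimE.
by apply: (rmeas_eq (measurable_funN f2)) => x; rewrite reimE.
Qed.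
Lemma cmeas_real (f : K -> K) : rm f -> cm (fun x => realC (f x)).
Proof. by move=> h; split => //; exact: measurable_cst. Qed.
Lemma cmeas_sum (J : Type) (r : seq J) (F : J -> K -> C) :
  (forall i, cm (F i)) -> cm (fun x => \sum_(i <- r) F i x).
Proof.
move=> H; elim: r => [|i r IH].
  by apply: cmeas_eq (cmeas_cst 0) _ => x; rewrite big_nil.
by apply: cmeas_eq (cmeasD (H i) IH) _ => x; rewrite big_cons.
Qed.
Lemma cmeas_prod (J : Type) (r : seq J) (F : J -> K -> C) :
  (forall i, cm (F i)) -> cm (fun x => \prod_(i <- r) F i x).
Proof.
move=> H; elim: r => [|i r IH].
  by apply: cmeas_eq (cmeas_cst 1) _ => x; rewrite big_nil.
by apply: cmeas_eq (cmeasM (H i) IH) _ => x; rewrite big_cons.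
Qed.
Lemma cmeas_det m (F : K -> 'M[C]_m) : mx_measurable D F -> cm (fun x => \det (F x)).
Proof.
move=> h; apply: cmeas_sum => s; apply: cmeasM; first exact: cmeas_cst.
by apply: cmeas_prod => i; exact: h.
Qed.
Lemma mmeasM m n p (F : K -> 'M[C]_(m, n)) (G : K -> 'M[C]_(n, p)) :
  mx_measurable D F -> mx_measurable D G -> mx_measurable D (fun x => F x *m G x).
Proof.
move=> f g i j; apply: cmeas_eq (cmeas_sum (index_enum 'I_n) (fun k => cmeasM (f i k) (g k j))) _ => x.
by rewrite mxE.
Qed.
Lemma mmeas_ct m n (F : K -> 'M[C]_(m, n)) :
  mx_measurable D F -> mx_measurable D (fun x => map_mx Num.conj (F x)^T).
Proof. by move=> f i j; apply: cmeas_eq (cmeas_conj (f j i)) _ => x; rewrite ctE. Qed.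
Lemma mmeas_scale m n (F : K -> 'M[C]_(m, n)) (f : K -> C) : cm f -> mx_measurable D F ->
  mx_measurable D (fun x => f x *: F x).
Proof. by move=> h g i j; apply: cmeas_eq (cmeasM h (g i j)) _ => x; rewrite mxE. Qed.
Lemma mmeas_adj m (F : K -> 'M[C]_m) : mx_measurable D F -> mx_measurable D (fun x => \adj (F x)).
Proof.
move=> h i j; apply: (cmeas_eq (f := fun x => cofactor (F x) j i)).
  apply: cmeasM; first exact: cmeas_cst.
  by apply: cmeas_det => k l; apply: (cmeas_eq (h (lift j k) (lift i l))) => x; rewrite !mxE.
by move=> x; rewrite mxE.
Qed.

Lemma rmeas_ae (f g : K -> K) : rm f ->
  {ae leb, forall x : lebT K, D x -> f x = g x} -> rm g.
Proof.
move=> h fg; have h' : measurable_fun (D : set (lebT K)) (fun x : lebT K => (f x)%:E).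
  exact/measurable_EFinP.
have e : ae_eq leb (D : set (lebT K)) (fun x : lebT K => (f x)%:E) (fun x : lebT K => (g x)%:E).
  by apply: ae_mono fg => x k Dx; rewrite k.
exact/measurable_EFinP/(ae_measurable_fun (@completed_lebesgue_measure_is_complete K) e h').
Qed.
Lemma mmeas_ae m n (F G : K -> 'M[C]_(m, n)) : mx_measurable D F ->
  {ae leb, forall x : lebT K, D x -> F x = G x} -> mx_measurable D G.
Proof.
move=> h fg i j; have [h1 h2] := h i j; split.
  by apply: rmeas_ae h1 _; apply: ae_mono fg => x k Dx; rewrite k.
by apply: rmeas_ae h2 _; apply: ae_mono fg => x k Dx; rewrite k.
Qed.

Lemma rmeas_comp (f phi : K -> K) : rm f -> continuous phi -> rm (fun x => phi (f x)).
Proof.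
move=> h c; have mp : measurable_fun setT (phi : measurableTypeR K -> measurableTypeR K).
  exact: continuous_measurable_fun.
exact: (measurableT_comp mp h).
Qed.
Lemma rmeas_n1 f : cm f -> rm (fun x => n1 (f x)).
Proof.
move=> [f1 f2]; apply: measurable_funD.
  by apply: (rmeas_comp f1); exact: norm_continuous.
by apply: (rmeas_comp f2); exact: norm_continuous.
Qed.
Lemma rmeas_sum (J : Type) (r : seq J) (F : J -> K -> K) :
  (forall i, rm (F i)) -> rm (fun x => \sum_(i <- r) F i x).
Proof.
move=> H; elim: r => [|i r IH].
  by apply: rmeas_eq (measurable_cst (0 : K)) _ => x; rewrite big_nil.
by apply: rmeas_eq (measurable_funD (H i) IH) _ => x; rewrite big_cons.
Qed.
Lemma rmeas_inv1 (f : K -> K) : rm f -> rm (fun x => (1 + `|f x|)^-1).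
Proof.
move=> h; apply: (rmeas_comp (phi := fun y => (1 + `|y|)^-1) h) => y.
apply: cvgV; first by rewrite gt_eqF // ltr_pwDl.
by apply: cvgD; [exact: cvg_cst|exact: norm_continuous].
Qed.
End cmeas.

Section windows.
Variable K : realType.
Variables a b : \bar K.
Notation I := (oint a b).
Notation C := (cplx K).

Lemma oint_open : open I.
Proof.
rewrite openE => x Ix; have [c Ic cx] := oint_left Ix; have [d Id xd] := oint_right Ix.
have : x \in `]c, d[ by rewrite in_itv /= cx.
move=> /near_in_itvoo; apply: filterS => y; rewrite in_itv /= => /andP[cy yd].
exact: (oint_conv Ic Id (ltW cy) (ltW yd)).
Qed.
Lemma oint_meas : measurable (I : set (lebT K)).
Proof. apply: measurable_leb; exact: (open_measurable oint_open). Qed.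

Lemma cac_cmeas f : cac a b f -> cmeasurable I f.
Proof.
move=> F.
have main (g : K -> K) : (forall x, I x -> forall e, 0 < e -> exists2 dl : K, 0 < dl &
    forall y, `|y - x| < dl -> `|g y - g x| < e) ->
    measurable_fun (I : set (lebT K)) (g : lebT K -> K).
  move=> H; have m : measurable_fun (I : set (measurableTypeR K)) (g : measurableTypeR K -> K).
    apply: (open_continuous_measurable_fun oint_open) => x /set_mem Ix.
    apply/cvgrPdist_lt => e e0; have [dl dl0 h] := H x Ix e e0.
    apply/nbhs_ballP; exists dl => //= y; rewrite /ball /= => xy.
    by rewrite distrC; apply: h; rewrite distrC.
  by move=> _ Y mY; apply: measurable_leb; apply: m => //; exact: (open_measurable oint_open).
split; apply: main => x Ix e e0; have [dl dl0 h] := cac_continuous F Ix e0; exists dl => // y xy;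
  have [_] := h y xy; apply: le_lt_trans.
- by rewrite -reCB n1_re.
- by rewrite -imCB n1_im.
Qed.

Definition win (s t x : K) : C := if (s <= x) && (x <= t) then 1 else 0.

Lemma winE s t x : win s t x = realC (\1_(`[s, t]%classic) x).
Proof.
rewrite /win indicE; case: ifPn => h.
  by rewrite mem_set //= in_itv.
by rewrite memNset //= in_itv; apply/negP.
Qed.

Lemma cmeas_win s t D : measurable (D : set (lebT K)) -> cmeasurable D (win s t).
Proof.
move=> mD; apply: (cmeas_eq (f := fun x => realC (\1_(`[s, t]%classic) x))).
  apply: cmeas_real.
  by apply: (@measurable_indic _ (lebT K) K); exact: measurable_itvl.
by move=> x; rewrite winE.
Qed.

Lemma rloc_meas (g : K -> K) c d : rloc a b g -> I c -> I d ->
  measurable_fun (`[c, d]%classic : set (lebT K)) (g : lebT K -> K).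
Proof. by move=> G Ic Id; apply/measurable_EFinP; exact: (measurable_int leb (G c d Ic Id)). Qed.

Lemma rloc_win s t (g : K -> K) : rloc a b g -> rloc a b (fun x => reC (win s t x) * g x).
Proof.
move=> G c d Ic Id.
have mcd := measurable_itvl c d.
apply: (@le_integrable _ _ K leb (`[c, d]%classic : set (lebT K)) mcd _ (fun x : lebT K => (g x)%:E)).
- apply/measurable_EFinP; apply: measurable_funM; first by have [] := cmeas_win s t mcd.
  exact: rloc_meas.
- move=> x _; rewrite /= lee_fin normrM ler_piMl // /win.
  by case: ifP; rewrite !reimE ?normr1 ?normr0.
- exact: G.
Qed.

Lemma cloc_win s t g : cloc a b g -> cloc a b (fun x => win s t x * g x).
Proof.
have w0 x : imC (win s t x) = 0 by rewrite /win; case: ifP.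
move=> [g1 g2]; split.
  by apply: rloc_eq (rloc_win s t g1) _ => x; rewrite reimE w0 mul0r subr0.
by apply: rloc_eq (rloc_win s t g2) _ => x; rewrite reimE w0 mul0r addr0.
Qed.
Lemma mloc_win s t m n (G : K -> 'M[C]_(m, n)) : mloc a b G -> mloc a b (fun x => win s t x *: G x).
Proof. by move=> g i j; apply: cloc_eq (cloc_win s t (g i j)) _ => x; rewrite mxE. Qed.

End windows.

(** * Compactly supported test functions *)
Section compact_support.
Variable K : realType.
Variables a b : \bar K.
Notation I := (oint a b).
Notation C := (cplx K).

(** Measurable and locally bounded: the class of multipliers of locally integrable
   functions. *)
Definition lbm (f : K -> C) := cmeasurable I f /\
  forall c d, I c -> I d -> exists M, forall x, c <= x -> x <= d -> n1 (f x) <= M.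

Lemma cac_lbm f : cac a b f -> lbm f.
Proof.
move=> F; split; first exact: cac_cmeas.
move=> c d Ic Id; have [f1 f2] := F.
have [M _ H] := rac_bounded (f1 _ _ Ic Id); have [N _ H'] := rac_bounded (f2 _ _ Ic Id).
by exists (M + N) => x cx xd; apply: lerD; [exact: H|exact: H'].
Qed.

Lemma rlocMb (f g : K -> K) : measurable_fun (I : set (lebT K)) (f : lebT K -> K) ->
  (forall c d, I c -> I d -> exists M, forall x, c <= x -> x <= d -> `|f x| <= M) ->
  rloc a b g -> rloc a b (fun x => f x * g x).
Proof.
move=> F B G c d Ic Id; have := G c d Ic Id; rewrite /rintg => Gi.
have [M H] := B _ _ Ic Id.
have mf : measurable_fun (`[c, d]%classic : set (lebT K)) (f : lebT K -> K).
  apply: (measurable_funS (@oint_meas _ a b)) F => x /=; rewrite in_itv /= => /andP[cx xd].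
  exact: (oint_conv Ic Id).
have := @integrableMr _ _ _ leb (`[c, d]%classic : set (lebT K)) (measurable_itvl c d) f
  (fun x : lebT K => (g x)%:E) mf.
apply => //; exists M; split; first exact: num_real.
move=> N MN x /=; rewrite in_itv /= => /andP[cx xd].
by apply: le_trans (ltW MN); exact: H.
Qed.

Lemma clocMb f g : lbm f -> cloc a b g -> cloc a b (fun x => f x * g x).
Proof.
move=> [[f1 f2] B] [g1 g2].
have B1 c d : I c -> I d -> exists M, forall x, c <= x -> x <= d -> `|reC (f x)| <= M.
  by move=> Ic Id; have [M H] := B c d Ic Id; exists M => x cx xd; apply: le_trans (n1_re _) (H x cx xd).
have B2 c d : I c -> I d -> exists M, forall x, c <= x -> x <= d -> `|imC (f x)| <= M.
  by move=> Ic Id; have [M H] := B c d Ic Id; exists M => x cx xd; apply: le_trans (n1_im _) (H x cx xd).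
split.
  by apply: rloc_eq (rlocD (rlocMb f1 B1 g1) (rlocN (rlocMb f2 B2 g2))) _ => x; rewrite !reimE.
by apply: rloc_eq (rlocD (rlocMb f1 B1 g2) (rlocMb f2 B2 g1)) _ => x; rewrite !reimE.
Qed.

Lemma lbmD f g : lbm f -> lbm g -> lbm (fun x => f x + g x).
Proof.
move=> [f1 f2] [g1 g2]; split; first exact: cmeasD.
move=> c d Ic Id; have [M H] := f2 c d Ic Id; have [N H'] := g2 c d Ic Id.
by exists (M + N) => x cx xd; apply: le_trans (n1D _ _) _; apply: lerD; [exact: H|exact: H'].
Qed.
Lemma lbmM f g : lbm f -> lbm g -> lbm (fun x => f x * g x).
Proof.
move=> [f1 f2] [g1 g2]; split; first exact: cmeasM.
move=> c d Ic Id; have [M H] := f2 c d Ic Id; have [N H'] := g2 c d Ic Id.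
exists (M * N) => x cx xd; apply: le_trans (n1M _ _) _.
by apply: ler_pM; rewrite ?n1_ge0 ?H ?H'.
Qed.
Lemma lbm_cst k : lbm (fun=> k).
Proof. by apply: cac_lbm; exact: cac_cst. Qed.
Lemma lbm_conj f : lbm f -> lbm (fun x => (f x)^*).
Proof.
move=> [f1 f2]; split; first exact: cmeas_conj.
by move=> c d Ic Id; have [M H] := f2 c d Ic Id; exists M => x cx xd; rewrite n1_conj; exact: H.
Qed.
Lemma lbm_win s t : lbm (win s t).
Proof.
split; first exact: cmeas_win (@oint_meas _ a b).
move=> c d Ic Id; exists 1 => x _ _; rewrite /win /n1.
by case: ifP => _; rewrite !reimE ?normr0 ?normr1 ?addr0 // .
Qed.
Lemma lbm_eq f g : lbm f -> (forall x, f x = g x) -> lbm g.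
Proof. by move=> h /funext <-. Qed.
Lemma lbm_sum (J : Type) (r : seq J) (F : J -> K -> C) :
  (forall i, lbm (F i)) -> lbm (fun x => \sum_(i <- r) F i x).
Proof.
move=> H; elim: r => [|i r IH].
  by apply: lbm_eq (lbm_cst 0) _ => x; rewrite big_nil.
by apply: lbm_eq (lbmD (H i) IH) _ => x; rewrite big_cons.
Qed.

Lemma Rint_ae (D : set K) (f g : K -> K) : measurable (D : set (lebT K)) ->
  {ae leb, forall x : lebT K, D x -> f x = g x} -> rintg D f -> rintg D g ->
  \int[leb]_(x in (D : set (lebT K))) g x = \int[leb]_(x in (D : set (lebT K))) f x.
Proof.
move=> mD fg fi gi; rewrite /Rintegral; congr fine; apply: ae_eq_integral.
- exact: mD.
- exact: (measurable_int leb gi).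
- exact: (measurable_int leb fi).
- by apply: ae_mono fg => x h Dx; rewrite h.
Qed.

Variables s t : K.
Hypotheses (Is : I s) (It : I t) (st : s <= t).
Definition vanishes_outside (T : zmodType) (f : K -> T) :=
  forall x, I x -> ~~ (s <= x <= t) -> f x = 0.

Lemma rint_compact (f : K -> K) : rloc a b f -> vanishes_outside f ->
  rintg I f /\ \int[leb]_(x in (I : set (lebT K))) f x = rint s t f.
Proof.
move=> F f0; have mst := measurable_itvl s t; have mI := @oint_meas _ a b.
have e x : I x -> f x = (f \_ (`[s, t]%classic : set (lebT K))) x.
  move=> Ix; rewrite patchE; case: ifPn => // /negP h; apply: f0 => //.
  by apply/negP => h'; apply: h; rewrite inE /= in_itv.
split.
  have h : leb.-integrable setT (EFin \o (f \_ (`[s, t]%classic : set (lebT K)))).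
    by have /(@integrable_mkcond _ _ K leb _ _ mst) := F s t Is It; rewrite restrict_EFin.
  apply: (@rintg_ae _ I (f \_ (`[s, t]%classic : set (lebT K)))) => //.
    by apply: ae_always => x Ix; rewrite -e.
  exact: integrableS h.
have EI : (I : set (lebT K)) `&` `[s, t]%classic = `[s, t]%classic.
  apply/seteqP; split=> x /=; first by case.
  by rewrite in_itv /= => /[dup] /andP[sx xt] h; split => //; exact: (oint_conv Is It sx xt).
rewrite /rint -[in RHS]EI.
rewrite Rintegral_mkcondr; apply: eq_Rintegral => x /set_mem Ix; exact: e.
Qed.

Lemma cint_compact f h : cprim a b f h -> vanishes_outside h -> forall g : K -> C,
  {ae leb, forall x : lebT K, I x -> h x = g x} ->
  cintegrable I g /\ cintegral I g = f t - f s.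
Proof.
move=> F h0 g hg; have [_ ->] := cprim_cint F Is It st.
have [l1 l2] := cprim_cloc F; have mI := @oint_meas _ a b.
have h1 : vanishes_outside (fun x => reC (h x)) by move=> x Ix nx; rewrite h0.
have h2 : vanishes_outside (fun x => imC (h x)) by move=> x Ix nx; rewrite h0.
have [i1 e1] := rint_compact l1 h1; have [i2 e2] := rint_compact l2 h2.
have g1 : {ae leb, forall x : lebT K, I x -> reC (h x) = reC (g x)}.
  by apply: ae_mono hg => x e Ix; rewrite e.
have g2 : {ae leb, forall x : lebT K, I x -> imC (h x) = imC (g x)}.
  by apply: ae_mono hg => x e Ix; rewrite e.
have j1 := rintg_ae mI g1 i1; have j2 := rintg_ae mI g2 i2; split => //.
rewrite /cintegral -[X in _ = mkC X _]e1 -[X in _ = mkC _ X]e2; congr mkC.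
  exact: (Rint_ae mI g1 i1 j1).
exact: (Rint_ae mI g2 i2 j2).
Qed.
End compact_support.

Section compact_class.
Variable K : realType.
Variables a b : \bar K.
Notation I := (oint a b).

(** The corner inequality only tests the form on functions of compact support, which
    makes it available for both one-sided lower bounds. *)
Definition holds_for_compact (T : zmodType) (Z : (K -> T) -> Prop) :=
  forall s t v, I s -> I t -> vanishes_outside a b s t v -> Z v.

Variable m : nat.

Lemma compact_zero_near_b : holds_for_compact (@zero_near_b K m a b).
Proof.
move=> s t v Is It v0; have [t' It' tt'] := oint_right It.
exists t' => // x /andP[tx xb].
move: tx; rewrite lte_fin => tx; apply: v0.
  by rewrite /oint /= xb andbT; move: It' => /andP[at' _]; apply: lt_trans at' _; rewrite lte_fin.
by rewrite negb_and -!ltNge (lt_trans tt' tx) orbT.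
Qed.

Lemma compact_zero_near_a : holds_for_compact (@zero_near_a K m a b).
Proof.
move=> s t v Is It v0; have [s' Is' ss'] := oint_left Is.
exists s' => // x /andP[ax xs].
move: xs; rewrite lte_fin => xs; apply: v0.
  by rewrite /oint /= ax /=; move: Is' => /andP[_]; apply: lt_trans; rewrite lte_fin.
by rewrite negb_and -!ltNge (lt_trans xs ss').
Qed.
End compact_class.

Section test_functions.
Variable K : realType.
Variable m : nat.
Variables a b : \bar K.
Notation I := (oint a b).
Notation C := (cplx K).
Variables P Q R : K -> 'M[C]_m.
Hypothesis hPQR : coefficients a b P Q R.
Local Open Scope sesquilinear_scope.
Variables s t : K.
Hypotheses (Is : I s) (It : I t) (st : s <= t).
Notation voutside := (vanishes_outside a b s t).

Lemma L2R_compact (u u' : K -> 'cV[C]_m) : (forall i, lbm a b (fun x => u x i 0)) ->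
  voutside u -> {ae leb, forall x : lebT K, I x -> u x = u' x} ->
  L2R a b R u'.
Proof.
move=> lu u0 uu; split.
  apply: (mmeas_ae (F := u)); last exact: uu.
  by move=> i j; rewrite ord1; have [] := lu i.
pose h x := cdot (u x) (R x *m u x).
have hl : cloc a b h.
  apply: cloc_eq (cloc_sum (index_enum 'I_m) (fun i => clocMb (lbm_conj (lu i))
    (cloc_sum (index_enum 'I_m) (fun j => clocMb (lu j) (R_loc hPQR i j))))) _ => x.
  rewrite /h /cdot mxE; apply: eq_bigr => i _; rewrite ctE mxE; congr (_ * _).
  by apply: eq_bigr => j _; rewrite mulrC.
have h0 : voutside h by move=> x Ix nx; rewrite /h u0 // /cdot !mulmx0 mxE.
have [] := @cint_compact _ a b s t Is It st _ _ (cprimfP Is hl) h0 (fun x => cdot (u' x) (R x *m u' x)).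
  by apply: ae_mono uu => x e Ix; rewrite /h e.
move=> [i1 _] _.
by have := integrable_fin_num (@oint_meas _ a b) i1; rewrite fin_numE ltey => /andP[].
Qed.

Variable l : K.
Variables (v w g phi : K -> 'cV[C]_m).
Hypothesis hv : mprim a b v (fun x => Pinv P x *m w x).
Hypothesis hw : mprim a b w (fun x => (Q x - realC l *: R x) *m v x - g x).
Hypothesis gE : forall x, I x -> R x *m phi x = g x.
Hypothesis lphi : forall i, lbm a b (fun x => phi x i 0).
Hypothesis v0 : voutside v.
Hypothesis phi0 : voutside phi.

(** For a solution [v] of the inhomogeneous equation with source [g = R phi], [L v] is
   [l v + phi], hence the lower bound compares the norm of [v] with the work of the
   source. *)
Lemma test_Lexpr : {ae leb, forall x : lebT K, I x -> realC l *: v x + phi x = Lexpr Q R v w x}.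
Proof.
apply: ae_mono (ae_and (ae_coef hPQR) (mprim_mx_deriv hw)) => x [h1 h2] Ix.
have [_ pR _] := h1 Ix; rewrite /Lexpr h2 // -(mulKmx (posdef_unit pR) (_ + _)); congr (_ *m _).
rewrite mulmxDr gE // -scalemxAr scalemxAl mulmxBl !opprB addrC.
by rewrite -[RHS]addrA subrK.
Qed.

Lemma test_Tmin_dom : Tmin_dom a b P Q R v w.
Proof.
have lv i : lbm a b (fun x => v x i 0) by apply: cac_lbm; exact: mprim_mcac hv i 0.
have sub : closure [set x | I x /\ v x != 0] `<=` (`[s, t]%classic : set K).
  have cl := (closure_id `[s, t]%classic).1 (itv_closed (x:=s) (y:=t)).
  rewrite [X in _ `<=` X]cl; apply: closure_subset => x [Ix].
  rewrite /= in_itv /=; apply: contraNT => nx.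
  by rewrite v0.
split.
- exact: (L2R_compact lv v0 (ae_always (fun x _ => erefl))).
- by apply/mcacP; exact: mprim_mcac hv.
- split; first by apply/mcacP; exact: mprim_mcac hw.
  apply: ae_mono (ae_and (ae_coef hPQR) (mprim_mx_deriv hv)) => x [h1 h2] Ix.
  by have [pP _ _] := h1 Ix; rewrite h2 // /Pinv mulKVmx // posdef_unit.
- split; first exact: subclosed_compact (@closed_closure _ _) (@segment_compact _ s t) sub.
  move=> x /sub; rewrite /= in_itv /= => /andP[sx xt]; exact: (oint_conv Is It).
- apply: (L2R_compact (u := fun x => realC l *: v x + phi x)) test_Lexpr.
    move=> i; apply: lbm_eq (lbmD (lbmM (lbm_cst _ _ (realC l)) (lv i)) (lphi i)) _ => x.
    by rewrite !mxE.
  by move=> x Ix nx; rewrite v0 // phi0 // scaler0 addr0.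
Qed.

Lemma test_ineq (la : K) (Z : (K -> 'cV[C]_m) -> Prop) (X Y : K -> 'M[C]_1) :
  holds_for_compact a b Z -> Tmin_bounded_below a b P Q R la Z ->
  mprim a b X (fun x => (v x) ^t* *m R x *m v x) ->
  mprim a b Y (fun x => (v x) ^t* *m g x) ->
  realC (la - l) * (X t 0 0 - X s 0 0) <= Y t 0 0 - Y s 0 0.
Proof.
move=> hZ hT hX hY.
have := hT v w test_Tmin_dom (hZ s t v Is It v0); rewrite /innerR.
pose F x := (Y x 0 0 - Y s 0 0) - realC (la - l) * (X x 0 0 - X s 0 0).
have Fp : cprim a b F (fun x => (((v x) ^t* *m g x) - realC (la - l) *: ((v x) ^t* *m R x *m v x)) 0 0).
  have h := mprimD (mprimD hY (mprim_cst _ _ (- Y s)))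
    (mprimN (mprimZ (realC (la - l)) (mprimD hX (mprim_cst _ _ (- X s))))).
  by apply: cprim_eq (h 0 0) _ _ => x; rewrite ?addr0 // !mxE.
have [] := @cint_compact _ a b s t Is It st _ _ Fp _
    (fun x => cdot (v x) (R x *m (Lexpr Q R v w x - realC la *: v x))).
- by move=> x Ix nx; rewrite v0 // ct0 !mul0mx scaler0 subr0 mxE.
- apply: ae_mono test_Lexpr => x e Ix; rewrite -e // /cdot; congr (fun_of_matrix _ 0 0).
  rewrite (_ : _ + _ - _ = phi x - realC (la - l) *: v x).
    by rewrite !mulmxBr gE // -!scalemxAr mulmxA.
  by rewrite realCB scalerBl opprB addrAC addrC.
move=> _ ->; rewrite /F !subrr mulr0 subrr subr0 subr_ge0.
by [].
Qed.
End test_functions.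

(** * The symplectic structure and concentrated sources *)
Section limits_at.
Variable K : realType.
Variables a b : \bar K.
Notation I := (oint a b).
Notation C := (cplx K).

Lemma near0_right (p : K -> Prop) : (exists2 d : K, 0 < d & forall t, 0 < t -> t < d -> p t) ->
  \forall t \near 0^'+, p t.
Proof.
move=> [d d0 H]; have h1 := nbhs_right_gt (0 : K); have h2 := nbhs_right_lt d0.
by apply: filterS (filterI h1 h2) => t [/= t0 td]; exact: H.
Qed.

Lemma mcac_mcvg m n (F : K -> 'M[C]_(m, n)) x : mcac a b F -> I x -> mcvg (nbhs x) F (F x).
Proof.
move=> f Ix i j; apply: cvgC_n1 => e e0; have [dl dl0 H] := cac_continuous (f i j) Ix e0.
apply/nbhs_ballP; exists dl => //= y; rewrite /ball /= distrC => /H[_].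
by rewrite -opprB n1N.
Qed.

Lemma mcvg_comp (T T' : Type) (F : set_system T) (F' : set_system T') (f : T' -> T) m n
  (G : T -> 'M[C]_(m, n)) L : f @ F' --> F -> mcvg F G L -> mcvg F' (fun t => G (f t)) L.
Proof. move=> h g i j; exact: (cvg_comp _ _ h (g i j)). Qed.

Lemma mprim_flat m n (F G : K -> 'M[C]_(m, n)) c d : mprim a b F G -> I c -> I d -> c <= d ->
  (forall x, c < x < d -> G x = 0) -> F c = F d.
Proof.
move=> f Ic Id cd G0; apply/matrixP => i j; apply/le_anti/andP; split.
  by apply: (cprim_le (f i j) Ic Id cd); apply: ae_always => x /G0 ->; rewrite mxE.
rewrite -lerN2; apply: (cprim_le (cprimN (f i j)) Ic Id cd).
by apply: ae_always => x /G0 ->; rewrite mxE oppr0.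
Qed.
End limits_at.

Section symplectic.
Variable K : realType.
Variable m : nat.
Notation C := (cplx K).
Local Open Scope sesquilinear_scope.

(** The symplectic unit; a fundamental system normalized by [{U, U} = JJ] inverts by its
   own adjoint, see [symplectic_blocks]. *)
Definition JJ : 'M[C]_(m + m) := block_mx 0 1%:M (- 1%:M) 0.

Lemma JJ2 : JJ *m JJ = - 1%:M.
Proof.
rewrite /JJ mulmx_block !mulmx0 !mul0mx !add0r !addr0 mulmx1 mul1mx.
by rewrite (scalar_mx_block _ _ 1) opp_block_mx !oppr0.
Qed.
Lemma ctJJ : JJ ^t* = - JJ.
Proof.
rewrite /JJ tr_block_mx map_block_mx opp_block_mx !oppr0 opprK !trmx0 !map_mx0.
by rewrite trmx1 map_mx1 linearN /= trmx1 map_mxN map_mx1.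
Qed.

(** The normalization says that the two-row block of [U] and [W] has a left inverse,
   which is then a right inverse. *)
Lemma symplectic_blocks (U W : 'M[C]_(m, m + m)) : U ^t* *m W - W ^t* *m U = JJ ->
  [/\ U *m JJ *m U ^t* = 0, U *m JJ *m W ^t* = 1%:M,
      W *m JJ *m U ^t* = - 1%:M & W *m JJ *m W ^t* = 0].
Proof.
move=> h; pose Z := col_mx U W.
have Zt : Z ^t* = row_mx (U ^t*) (W ^t*) by rewrite /Z tr_col_mx map_row_mx.
have h1 : Z ^t* *m JJ *m Z = JJ.
  rewrite -mulmxA /JJ mul_block_col !mul0mx add0r addr0 mul1mx mulNmx mul1mx Zt mul_row_col.
  by rewrite mulmxN h.
have h2 : (- JJ *m Z ^t* *m JJ) *m Z = 1%:M.
  by rewrite -!mulmxA [Z ^t* *m _]mulmxA h1 mulNmx JJ2 opprK.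
have h3 : Z *m (JJ *m Z ^t*) = JJ.
  have := mulmx1C h2; rewrite !mulNmx mulmxN => /(congr1 (mulmx^~ JJ)).
  by rewrite /= mulNmx mul1mx -!mulmxA JJ2 !mulmxN mulmx1 opprK.
have : block_mx (U *m JJ *m U ^t*) (U *m JJ *m W ^t*) (W *m JJ *m U ^t*) (W *m JJ *m W ^t*) = JJ.
  by rewrite -[RHS]h3 Zt mulmxA /Z mul_col_mx mul_col_row.
by move=> /eq_block_mx[].
Qed.
End symplectic.

Section weights.
Variable K : realType.
Variable m : nat.
Variables a b : \bar K.
Notation I := (oint a b).
Notation C := (cplx K).
Variables P Q R : K -> 'M[C]_m.
Hypothesis hPQR : coefficients a b P Q R.
Local Open Scope sesquilinear_scope.

Let dR x := \det (R x).
Let Phi0 x : 'M[C]_m := (dR x)^* *: \adj (R x).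
Let q0 x := reC (dR x) ^+ 2 + imC (dR x) ^+ 2.
Let hh x := \sum_i \sum_j n1 (Phi0 x i j) + `|q0 x|.
Definition cutoff x : K := (1 + `|hh x|)^-1.
(** A test function must have [L v] square integrable with weight [R], so its source has
   to be [R phi] with a controlled [phi], although [R] may be unbounded or nearly
   singular. The adjugate, cut down to size one, gives a bounded [wphi] for which [R
   wphi] is a scalar [wq] between 0 and 1. *)
Definition wphi x : 'M[C]_m := realC (cutoff x) *: Phi0 x.
Definition wq x := cutoff x * q0 x.

Lemma R_wphi x : R x *m wphi x = (realC (wq x))%:M.
Proof.
rewrite /wphi /Phi0 -!scalemxAr mul_mx_adj !scale_scalar_mx /wq realCM; congr (_ * _)%:M.
apply: cplx_eq; rewrite /q0 /dR; move: (\det (R x)) => z; rewrite !reimE.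
  by ring.
by ring.
Qed.

Let hh_ge0 x : 0 <= hh x.
Proof. by rewrite addr_ge0 // sumr_ge0 // => i _; rewrite sumr_ge0 // => j _; exact: n1_ge0. Qed.
Let cutoff_gt0 x : 0 < cutoff x.
Proof. by rewrite invr_gt0 ltr_pwDl. Qed.

Let n1_realM k (z : C) : n1 (realC k * z) = `|k| * n1 z.
Proof. by rewrite /n1 !reimE !mul0r subr0 addr0 !normrM mulrDr. Qed.

Let cutoff_le y x : 0 <= y -> y <= hh x -> cutoff x * y <= 1.
Proof.
move=> y0 yh; rewrite /cutoff mulrC ler_pdivrMr ?mul1r ?ltr_pwDl //.
by rewrite ger0_norm ?hh_ge0 //; apply: le_trans yh _; rewrite lerDr.
Qed.

Lemma wphi_le1 x i j : n1 (wphi x i j) <= 1.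
Proof.
rewrite /wphi mxE n1_realM gtr0_norm //; apply: cutoff_le; first exact: n1_ge0.
apply: (@le_trans _ _ (\sum_i \sum_j n1 (Phi0 x i j))); last by rewrite /hh lerDl.
rewrite (bigD1 i) //= (bigD1 j) //= -addrA lerDl; apply: addr_ge0.
  by apply: sumr_ge0 => ? _; exact: n1_ge0.
by apply: sumr_ge0 => ? _; apply: sumr_ge0 => ? _; exact: n1_ge0.
Qed.

Lemma wq_ge0 x : 0 <= wq x.
Proof. by apply: mulr_ge0; [exact: ltW|rewrite addr_ge0 // sqr_ge0]. Qed.

Lemma wq_le1 x : wq x <= 1.
Proof.
have q00 : 0 <= q0 x by rewrite addr_ge0 // sqr_ge0.
apply: cutoff_le => //; rewrite /hh ger0_norm // lerDr.
by apply: sumr_ge0 => ? _; apply: sumr_ge0 => ? _; exact: n1_ge0.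
Qed.

Lemma wq_gt0 : {ae leb, forall x : lebT K, I x -> 0 < wq x}.
Proof.
apply: ae_mono (ae_coef hPQR) => x h Ix; have [_ pR _] := h Ix.
apply: mulr_gt0 => //; rewrite lt_def addr_ge0 ?sqr_ge0 // andbT.
have d0 : dR x != 0 by rewrite -unitfE -unitmxE; exact: posdef_unit.
apply: contraNN d0; rewrite paddr_eq0 ?sqr_ge0 // !sqrf_eq0 => /andP[/eqP e1 /eqP e2].
by apply/eqP/cplx_eq.
Qed.

Let mI := @oint_meas K a b.
Let mR : mx_measurable I R. Proof. by have [[]] := hPQR. Qed.
Let mdR : cmeasurable I dR. Proof. exact: cmeas_det. Qed.
Let mPhi0 : mx_measurable I Phi0.
Proof. by apply: mmeas_scale; [exact: cmeas_conj|exact: mmeas_adj]. Qed.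
Let mq0 : measurable_fun (I : set (lebT K)) (q0 : lebT K -> K).
Proof.
have [h1 h2] := mdR; apply: (rmeas_eq (measurable_funD (measurable_funM h1 h1) (measurable_funM h2 h2))).
by move=> x; rewrite /= -!expr2.
Qed.
Let mcut : measurable_fun (I : set (lebT K)) (cutoff : lebT K -> K).
Proof.
apply: rmeas_inv1; apply: measurable_funD; last by apply: (rmeas_comp mq0); exact: norm_continuous.
by apply: rmeas_sum => i; apply: rmeas_sum => j; exact: rmeas_n1.
Qed.

Lemma lbm_wphi i j : lbm a b (fun x => wphi x i j).
Proof.
split; last by move=> c d _ _; exists 1 => x _ _; exact: wphi_le1.
by apply: cmeas_eq (cmeasM (cmeas_real mcut) (mPhi0 i j)) _ => x; rewrite [RHS]mxE.
Qed.
Lemma lbm_wq : lbm a b (fun x => realC (wq x)).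
Proof.
split; first by apply: cmeas_real; exact: measurable_funM.
move=> c d _ _; exists 1 => x _ _.
by rewrite /n1 !reimE normr0 addr0 ger0_norm ?wq_le1 // wq_ge0.
Qed.
Lemma rloc_wq : rloc a b wq.
Proof.
have [h _] := clocMb lbm_wq (cac_cloc (cac_cst a b 1)).
by apply: rloc_eq h _ => x; rewrite !reimE mulr1 mulr0 subr0.
Qed.

Variable c0 : K.
Hypothesis I0 : I c0.
(** The total amount of source available to the left of [x], relative to [c0]. *)
Definition mass x := rprimf c0 wq x.
Lemma mass_prim : rprim a b mass wq. Proof. exact: rprimfP rloc_wq. Qed.
Lemma mass_le x y : I x -> I y -> x <= y -> mass x <= mass y.
Proof. by move=> Ix Iy xy; apply: (rprim_le mass_prim) => //; apply: ae_always => t _; exact: wq_ge0. Qed.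
Lemma mass_lt x y : I x -> I y -> x < y -> mass x < mass y.
Proof.
move=> Ix Iy xy; rewrite lt_def mass_le ?(ltW xy) // andbT; apply/eqP => e.
have sub t : oint x%:E y%:E t -> I t.
  by move=> /andP[]; rewrite !lte_fin => xt ty; exact: (oint_conv Ix Iy (ltW xt) (ltW ty)).
have h1 : rprim x%:E y%:E mass wq by move=> c d Ic Id cd; apply: mass_prim => //; exact: sub.
have h2 : rprim x%:E y%:E mass (fun=> 0).
  move=> c d Ic Id cd; have [] := @rprim_cst _ x%:E y%:E (mass x) c d Ic Id cd.
  suff E t : oint x%:E y%:E t -> mass t = mass x by rewrite !E.
  move=> /[dup] /sub It /andP[]; rewrite !lte_fin => xt ty.
  by apply/le_anti; rewrite -{1}e !mass_le // ltW.
have [t txy []] : exists2 t, x < t < y & (oint x%:E y%:E t -> wq t = 0) /\ (I t -> 0 < wq t).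
  apply: ae_point => //; apply: ae_mono (ae_and (rprim_uniq h1 h2) wq_gt0) => t [p q] _.
  by split.
have It : oint x%:E y%:E t by rewrite /oint /= !lte_fin.
by move=> /(_ It) -> /(_ (sub _ It)); rewrite ltxx.
Qed.

(** An approximate unit point mass at [x], as [y] decreases to [x]. *)
Definition rho x y t : C := realC (mass y - mass x)^-1 * (win x y t * realC (wq t)).
Definition srcphi x y t : 'M[C]_m := (realC (mass y - mass x)^-1 * win x y t) *: wphi t.

Lemma R_srcphi x y t : R t *m srcphi x y t = (rho x y t)%:M.
Proof. by rewrite /srcphi -scalemxAr R_wphi scale_scalar_mx /rho mulrA. Qed.
Lemma srcphi_out x y t : win x y t = 0 -> srcphi x y t = 0.
Proof. by move=> h; rewrite /srcphi h mulr0 scale0r. Qed.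
Lemma lbm_srcphi x y i j : lbm a b (fun t => srcphi x y t i j).
Proof.
apply: lbm_eq (lbmM (lbmM (lbm_cst _ _ (realC (mass y - mass x)^-1)) (lbm_win a b x y)) (lbm_wphi i j)) _ => t.
by rewrite [RHS]mxE.
Qed.
Lemma cloc_rho x y : cloc a b (rho x y).
Proof.
apply: clocM; first exact: cac_cst.
by apply: cloc_win; apply: cloc_eq (clocMb lbm_wq (cac_cloc (cac_cst a b 1))) _ => t; rewrite mulr1.
Qed.
Lemma win_out x y (t : K) : ~~ (x <= t <= y) -> win x y t = 0.
Proof. by rewrite /win => /negbTE ->. Qed.
Lemma rho_out x y t : ~~ (x <= t <= y) -> rho x y t = 0.
Proof. by move=> h; rewrite /rho win_out // mul0r mulr0. Qed.

(** Averages against [rho] stay within the bounds of the averaged function. *)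
Lemma rho_avg x y (F G : K -> C) e : I x -> I y -> x < y ->
  cprim a b F (fun t => rho x y t * G t) -> F x = 0 ->
  (forall t, x <= t -> t <= y -> n1 (G t) <= e) ->
  forall t, x <= t -> t <= y -> n1 (F t) <= e.
Proof.
move=> Ix Iy xy hF F0 Ge t xt ty.
have e0 : 0 <= e by apply: le_trans (n1_ge0 _) (Ge x (lexx x) (ltW xy)).
have M0 : 0 < mass y - mass x by rewrite subr_gt0 mass_lt.
have It := oint_conv Ix Iy xt ty.
have hu := rprimZ (e * (mass y - mass x)^-1) mass_prim.
have := n1_cint_le hF hu Ix It xt; rewrite F0 subr0 => H.
apply: le_trans (H _) _.
  move=> s xs st; rewrite /rho -mulrA n1_realM gtr0_norm ?invr_gt0 //.
  rewrite (mulrC e) -[leRHS]mulrA ler_wpM2l ?invr_ge0 ?(ltW M0) //.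
  rewrite /win xs (le_trans st ty) /= mul1r n1_realM ger0_norm ?wq_ge0 // mulrC.
  by apply: ler_wpM2r; [exact: wq_ge0|apply: Ge => //; exact: le_trans st ty].
rewrite -mulrBr -mulrA ler_piMr // mulrC ler_pdivrMr // mul1r lerD2r.
exact: mass_le.
Qed.

Lemma rho_total x y : I x -> I y -> x < y -> cprimf x (rho x y) y = 1.
Proof.
move=> Ix Iy xy; have M0 : mass y - mass x != 0 by rewrite subr_eq0 gt_eqF ?mass_lt.
pose F t := realC ((mass y - mass x)^-1 * mass t).
have hF : cprim a b F (fun t => realC ((mass y - mass x)^-1 * wq t)).
  by split; [exact: rprimZ mass_prim|exact: rprim_cst].
have h : mprim a b (fun t => (cprimf x (rho x y) t - F t)%:M : 'M[C]_1)
    (fun t => (rho x y t - realC ((mass y - mass x)^-1 * wq t))%:M).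
  move=> i j; rewrite !ord1.
  by apply: cprim_eq (cprimD (cprimfP Ix (cloc_rho x y)) (cprimN hF)) _ _ => t; rewrite mxE mulr1n.
have h0 t : x < t < y -> (rho x y t - realC ((mass y - mass x)^-1 * wq t))%:M = 0 :> 'M[C]_1.
  move=> /andP[xt ty]; rewrite /rho /win (ltW xt) (ltW ty) mul1r -realCM subrr.
  by apply/matrixP => i j; rewrite !mxE mul0rn.
have := mprim_flat h Ix Iy (ltW xy) h0.
rewrite cprimf0 sub0r => /(congr1 (fun M : 'M[C]_1 => M 0 0)); rewrite !mxE !mulr1n => E.
rewrite -(subrK (F y) (cprimf _ _ _)) -E addrC /F -realCB -mulrBr mulVf //.
Qed.
End weights.

(** * Extremals with a corner *)
Section sources.
Variable K : realType.
Variable m : nat.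
Variables a b : \bar K.
Notation I := (oint a b).
Notation C := (cplx K).
Variables P Q R : K -> 'M[C]_m.
Hypothesis hPQR : coefficients a b P Q R.
Local Open Scope sesquilinear_scope.
Variable l : K.
Variable c0 : K.
Hypothesis I0 : I c0.
Variables U W : K -> 'M[C]_(m, m + m).
Hypothesis hU : sol a b P Q R (realC l) U W.
Hypothesis hJ : forall x, I x -> (U x) ^t* *m W x - (W x) ^t* *m U x = JJ K m.
Notation rho := (rho R c0).
Notation srcphi := (srcphi R c0).
Notation J := (JJ K m).

Let cU : mcac a b U. Proof. exact: mprim_mcac hU.1. Qed.
Let UJU x : I x -> U x *m J *m (U x) ^t* = 0.
Proof. by move=> Ix; have [] := symplectic_blocks (hJ Ix). Qed.

Lemma rho_conj x y t : (rho x y t)^* = rho x y t.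
Proof.
rewrite /rho /win; case: ifP => _; rewrite ?mul1r ?mul0r -?realCM ?realC_conj //.
Qed.

(** The change of the coefficients of a solution, in the fundamental system [U],
   produced by a source spread over [[x, y]]. *)
Definition srcA x y := mprimf x (fun s => rho x y s *: (U s) ^t*).
(** The work that such a source does on the part of the solution that it produces
   itself. *)
Definition srcE x y := mprimf x (fun s => (srcA x y s) ^t* *m J *m (rho x y s *: (U s) ^t*)).

Let mloc_rhoU x y : mloc a b (fun s => rho x y s *: (U s) ^t*).
Proof.
move=> i j; have h1 := mcac_ct cU i j. have h2 := clocM h1 (cloc_rho hPQR c0 x y). apply: cloc_eq h2 _ => t.
by rewrite [RHS]mxE mulrC.
Qed.
Lemma srcA_prim x y : I x -> mprim a b (srcA x y) (fun s => rho x y s *: (U s) ^t*).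
Proof. move=> Ix; exact: (mprimfP Ix (mloc_rhoU x y)). Qed.
Lemma srcE_prim x y : I x ->
  mprim a b (srcE x y) (fun s => (srcA x y s) ^t* *m J *m (rho x y s *: (U s) ^t*)).
Proof.
move=> Ix; apply: (mprimfP Ix); apply: (mlocMl _ (mloc_rhoU x y)).
exact: (mprim_mcac (mprimMr J (mprim_ct (srcA_prim y Ix)))).
Qed.
Lemma srcA_x x y : srcA x y x = 0. Proof. exact: mprimf0. Qed.
Lemma srcE_x x y : srcE x y x = 0. Proof. exact: mprimf0. Qed.
Lemma srcA_left x y t : I x -> I t -> t <= x -> srcA x y t = 0.
Proof.
move=> Ix It tx; rewrite -(srcA_x x y); apply: (mprim_flat (srcA_prim y Ix)) => // s /andP[_ sx].
by rewrite rho_out ?scale0r // negb_and -!ltNge sx.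
Qed.
Lemma srcA_right x y t : I x -> I y -> I t -> y <= t -> srcA x y t = srcA x y y.
Proof.
move=> Ix Iy It yt; apply/esym; apply: (mprim_flat (srcA_prim y Ix)) => // s /andP[ys _].
by rewrite rho_out ?scale0r // negb_and -!ltNge ys orbT.
Qed.
Lemma srcE_right x y t : I x -> I y -> I t -> y <= t -> srcE x y t = srcE x y y.
Proof.
move=> Ix Iy It yt; apply/esym; apply: (mprim_flat (srcE_prim y Ix)) => // s /andP[ys _].
by rewrite rho_out ?scale0r ?mulmx0 // negb_and -!ltNge ys orbT.
Qed.

(** As the source concentrates at [x] it kicks the coefficients by the adjoint of [U x]. *)
Lemma srcA_lim x : I x -> mcvg 0^'+ (fun t => srcA x (x + t) (x + t)) ((U x) ^t*).
Proof.
move=> Ix i j; apply: cvgC_n1 => e e0; have e2 : 0 < e / 2 by rewrite divr_gt0.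
have [dl dl0 H] := cac_continuous (mcac_ct cU i j) Ix e2.
apply: near0_right; exists dl => // t t0 tdl; set y := x + t.
have xy : x < y by rewrite ltrDl.
have near s : x <= s -> s <= y -> I s /\ n1 ((U s) ^t* i j - (U x) ^t* i j) < e / 2.
  by move=> xs sy; apply: H; rewrite ger0_norm ?subr_ge0 // ltrBlDl; apply: le_lt_trans sy _; rewrite ltrD2l.
have Iy : I y by have [] := near y (ltW xy) (lexx y).
pose F s := srcA x y s i j - cprimf x (rho x y) s * (U x) ^t* i j.
have hF : cprim a b F (fun s => rho x y s * ((U s) ^t* i j - (U x) ^t* i j)).
  have h1 := srcA_prim y Ix i j.
  have h2 := cprimN (cprimM (cprimfP Ix (cloc_rho hPQR c0 x y)) (cprim_cst a b ((U x) ^t* i j))).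
  apply: cprim_eq (cprimD h1 h2) _ _ => s //.
  by rewrite [X in X + _]mxE mulr0 addr0 mulrBr.
have F0 : F x = 0 by rewrite /F srcA_x mxE cprimf0 mul0r subrr.
have := rho_avg hPQR I0 Ix Iy xy hF F0 (fun s xs sy => ltW (near s xs sy).2) (ltW xy) (lexx y).
rewrite /F (rho_total hPQR I0) // mul1r -opprB n1N => h; apply: le_lt_trans h _.
by rewrite ltr_pdivrMr // mulr_natr mulr2n ltrDl.
Qed.

(** The self-interaction of a source that concentrates vanishes, as the values of [U] at
   a single point are isotropic: [U J U^*] is zero. *)
Lemma srcE_lim x : I x -> mcvg 0^'+ (fun t => srcE x (x + t) (x + t)) 0.
Proof.
move=> Ix i j; rewrite mxE; apply: cvgC_n1 => e e0; have e2 : 0 < e / 2 by rewrite divr_gt0.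
have [dl dl0 H] : exists2 dl : K, 0 < dl & forall s t, `|s - x| < dl -> `|t - x| < dl ->
    n1 ((U s *m J *m (U t) ^t*) i j) < e / 2.
  have c1 : mcvg (filter_prod (nbhs x) (nbhs x)) (fun p : K * K => U p.1) (U x).
    exact: mcvg_comp cvg_fst (mcac_mcvg cU Ix).
  have c2 : mcvg (filter_prod (nbhs x) (nbhs x)) (fun p : K * K => U p.2) (U x).
    exact: mcvg_comp cvg_snd (mcac_mcvg cU Ix).
  have c3 : mcvg (filter_prod (nbhs x) (nbhs x)) (fun p : K * K => U p.1 *m J *m (U p.2) ^t*) 0.
    rewrite -(UJU Ix); apply: mcvgM; last exact: mcvg_ct.
    by apply: mcvgM; [exact: c1|exact: mcvg_cst].
  have [[A B] /= [/nbhs_ballP[d1 d10 hA] /nbhs_ballP[d2 d20 hB]] AB] := cvg_n1 (c3 i j) e2.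
  exists (Num.min d1 d2); first by rewrite lt_min d10.
  move=> s t; rewrite !lt_min => /andP[s1 s2] /andP[t1 t2].
  have := AB (s, t); rewrite /= [X in _ - X]mxE subr0; apply; split; [apply: hA|apply: hB];
    by rewrite /ball /= distrC.
have [x' Ix' xx'] := oint_right Ix.
apply: near0_right; exists (Num.min dl (x' - x)); first by rewrite lt_min dl0 subr_gt0.
move=> t t0; rewrite lt_min ltrBrDl => /andP[tdl tx']; set y := x + t.
have xy : x < y by rewrite ltrDl.
have Iy : I y := oint_conv Ix Ix' (ltW xy) (ltW tx').
have near s : x <= s -> s <= y -> `|s - x| < dl.
  by move=> xs sy; rewrite ger0_norm ?subr_ge0 // ltrBlDl; apply: le_lt_trans sy _; rewrite ltrD2l.
have key t' : x <= t' -> t' <= y -> n1 (((srcA x y t') ^t* *m J *m (U t') ^t*) i j) <= e / 2.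
  move=> xt' t'y; pose G := J *m (U t') ^t*.
  have hF : cprim a b (fun s => ((srcA x y s) ^t* *m G) i j)
      (fun s => rho x y s * (U s *m G) i j).
    apply: cprim_eq (mprimMr G (mprim_ct (srcA_prim y Ix)) i j) _ _ => // s.
    by rewrite ctZ ctK rho_conj -scalemxAl [LHS]mxE.
  rewrite -mulmxA; apply: (rho_avg hPQR I0 Ix Iy xy hF _ _ xt' t'y).
    by rewrite srcA_x ct0 mul0mx mxE.
  by move=> s xs sy; rewrite mulmxA; apply/ltW/H; exact: near.
have hE : cprim a b (fun s => srcE x y s i j)
    (fun s => rho x y s * ((srcA x y s) ^t* *m J *m (U s) ^t*) i j).
  apply: cprim_eq (srcE_prim y Ix i j) _ _ => // s.
  by rewrite -scalemxAr [LHS]mxE.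
have := rho_avg hPQR I0 Ix Iy xy hE _ key (ltW xy) (lexx y).
rewrite srcE_x mxE => /(_ erefl) h; rewrite sub0r n1N; apply: le_lt_trans h _.
by rewrite ltr_pdivrMr // mulr_natr mulr2n ltrDl.
Qed.

(** Work of a source of strength [ga] over an interval on which it is the only one:
   linear in the coefficients [b0] that it meets, with a quadratic correction. *)
Lemma segment_energy n c d (be : K -> 'cV[C]_(m + m)) (g : K -> 'cV[C]_m)
    (B B' : K -> 'M[C]_(m + m, n)) (E Y : K -> _) b0 (ga : 'cV[C]_n) :
  I c -> I d -> c <= d ->
  mprim a b B B' -> mprim a b E (fun x => (B x) ^t* *m J *m B' x) ->
  mprim a b Y (fun x => (- (U x *m J *m be x)) ^t* *m g x) ->
  B c = 0 -> E c = 0 ->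
  (forall x, c < x < d -> be x = b0 - B x *m ga /\ (U x) ^t* *m g x = B' x *m ga) ->
  Y d - Y c = b0 ^t* *m J *m (B d *m ga) - ga ^t* *m E d *m ga.
Proof.
move=> Ic Id cd hB hE hY Bc Ec H.
have h1 := mprimMr ga (mprimMl (b0 ^t* *m J) hB).
have h2 := mprimMr ga (mprimMl (ga ^t*) hE).
have e : Y c - (b0 ^t* *m J *m B c *m ga - ga ^t* *m E c *m ga) =
         Y d - (b0 ^t* *m J *m B d *m ga - ga ^t* *m E d *m ga).
  apply: (mprim_flat (mprimD hY (mprimN (mprimD h1 (mprimN h2)))) Ic Id cd) => x cxd.
  have [e1 e2] := H x cxd.
  rewrite e1 ctN !ctM ctJJ ctB ctM !(mulmxN, mulNmx) opprK -!mulmxA e2.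
  by rewrite mulmxBl -!mulmxA subrr.
by move: e; rewrite Bc Ec !mulmx0 !mul0mx subrr subr0 => ->; rewrite subKr -!mulmxA.
Qed.
End sources.

Section corner.
Variable K : realType.
Variable m : nat.
Variables a b : \bar K.
Notation I := (oint a b).
Notation C := (cplx K).
Variables P Q R : K -> 'M[C]_m.
Hypothesis hPQR : coefficients a b P Q R.
Local Open Scope sesquilinear_scope.
Notation J := (JJ K m).

Lemma unitmx_inj n (A : 'M[C]_n) : (forall v : 'cV_n, A *m v = 0 -> v = 0) -> A \in unitmx.
Proof.
move=> inj; rewrite -unitmx_tr; apply: contraT => nu.
have /rowV0Pn[v] : kermx A^T != 0.
  by rewrite -mxrank_eq0 mxrank_ker subn_eq0 -ltnNge ltn_neqAle rank_leq_row andbT -row_free_unit in nu *.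
move=> /sub_kermxP vA v0; case/eqP: v0; apply: trmx_inj; rewrite trmx0; apply: inj.
by apply: trmx_inj; rewrite trmx_mul trmxK vA trmx0.
Qed.

(** The bracket of the columns is constant, so that the normalization at [c0]
   propagates. *)
Lemma fundamental_ex l c0 : I c0 -> exists U W : K -> 'M[C]_(m, m + m),
  sol a b P Q R (realC l) U W /\
  forall x, I x -> (U x) ^t* *m W x - (W x) ^t* *m U x = J.
Proof.
move=> I0; have [U [W [hU U0 W0]]] :=
  sol_ex hPQR (realC l) (row_mx 1%:M 0 : 'M[C]_(m, m + m)) (row_mx 0 1%:M) I0.
exists U, W; split => // x Ix.
have e : wr U W U W x = wr U W U W c0 by apply: (wr0 hPQR hU) Ix I0; rewrite realC_conj.
rewrite -[LHS]/(wr U W U W x) e /wr U0 W0 !tr_row_mx !map_col_mx !trmx1 !trmx0 !map_mx1 !map_mx0 !mul_col_row !mul1mx !mul0mx.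
by rewrite opp_block_mx add_block_mx !oppr0 !addr0 !add0r.
Qed.

Variable l : K.
Variable c0 : K.
Hypothesis I0 : I c0.
Variables U W : K -> 'M[C]_(m, m + m).
Hypothesis hU : sol a b P Q R (realC l) U W.
Hypothesis hJ : forall x, I x -> (U x) ^t* *m W x - (W x) ^t* *m U x = J.

(** Every solution is [- U J beta] for the constant [beta] given by Lagrange's bracket. *)
Lemma sol_rep n (f h : K -> 'M[C]_(m, n)) c x : sol a b P Q R (realC l) f h -> I c -> I x ->
  f x = - (U x *m J *m wr U W f h c).
Proof.
move=> hf Ic Ix; rewrite (wr0 hPQR hU _ Ic Ix) ?realC_conj //.
have [e1 e2 _ _] := symplectic_blocks (hJ Ix).
by rewrite /wr mulmxBr !mulmxA e1 e2 mul0mx mul1mx sub0r opprK.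
Qed.

Definition gram := mprimf c0 (fun x => (U x) ^t* *m R x *m U x).
Lemma gram_prim : mprim a b gram (fun x => (U x) ^t* *m R x *m U x).
Proof.
have cU := mprim_mcac hU.1.
exact: (mprimfP I0 (mlocMr (mlocMl (mcac_ct cU) (R_loc hPQR)) cU)).
Qed.

(** Linearly independent solutions are independent on every interval, by unique
   continuation. *)
Lemma gram_unit s t : I s -> I t -> s < t -> gram t - gram s \in unitmx.
Proof.
move=> Is It st; apply: unitmx_inj => v Gv.
have hv := solMr v hU.
have hX := mprimMr v (mprimMl (v ^t*) gram_prim).
have e : (v ^t* *m gram t *m v) = v ^t* *m gram s *m v.
  by apply/eqP; rewrite -subr_eq0 -mulmxBl -mulmxBr -mulmxA Gv mulmx0.
have hX' : mprim a b (fun x => v ^t* *m gram x *m v)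
    (fun x => (U x *m v) ^t* *m R x *m (U x *m v)).
  by apply: (mprim_eq hX (fun x => erefl)) => x; rewrite ctM !mulmxA.
have [h1 h2] := sol_energy0 hPQR hv hX' Is It st e I0.
have : J *m v = 0 by rewrite -(hJ I0) mulmxBl -!mulmxA h1 h2 !mulmx0 subrr.
by move=> /(congr1 (mulmx J)); rewrite mulmxA JJ2 mulNmx mul1mx mulmx0 => /eqP; rewrite oppr_eq0 => /eqP.
Qed.

Variables d c e e1 e2 t : K.
Hypotheses (Id : I d) (Ie2 : I e2) (t0 : 0 < t).
Hypotheses (dc : d + t < c) (ce : c + t < e) (ee1 : e + t < e1) (e12 : e1 < e2).
Variables ga1 ga2 ga3 : 'cV[C]_m.
Notation rho x := (rho R c0 x (x + t)).
Notation srcphi x := (srcphi R c0 x (x + t)).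
Notation A x := (srcA R c0 U x (x + t)).
Notation E x := (srcE R c0 U x (x + t)).

Let mcU : mcac a b U. Proof. exact: mprim_mcac hU.1. Qed.
Definition gram' x := (U x) ^t* *m R x *m U x.
Definition cutgram' x : 'M[C]_(m + m) := win e1 e2 x *: gram' x.
Notation RU := gram'.
Notation D' := cutgram'.
(** The same as [srcA] for the sources [R U eta] on [[e1, e2]]: their effect on the
   coefficients is a Gram matrix, so that any coefficients can be steered to zero there. *)
Definition gram_cut := mprimf e1 D'.
Definition gram_cutE := mprimf e1 (fun x => (gram_cut x) ^t* *m J *m D' x).
Notation D := gram_cut.

Let In x : d <= x -> x <= e2 -> I x. Proof. exact: oint_conv. Qed.
Let Ie1 : I e1. Proof. by apply: In; move: t0 dc ce ee1 e12 => *; lra. Qed.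
Let Ic : I c. Proof. by apply: In; move: t0 dc ce ee1 e12 => *; lra. Qed.
Let Ie : I e. Proof. by apply: In; move: t0 dc ce ee1 e12 => *; lra. Qed.
Let Id' : I (d + t). Proof. by apply: In; move: t0 dc ce ee1 e12 => *; lra. Qed.
Let Ic' : I (c + t). Proof. by apply: In; move: t0 dc ce ee1 e12 => *; lra. Qed.
Let Ie' : I (e + t). Proof. by apply: In; move: t0 dc ce ee1 e12 => *; lra. Qed.

Let mRU : mloc a b RU.
Proof. exact: (mlocMr (mlocMl (mcac_ct mcU) (R_loc hPQR)) mcU). Qed.
Lemma gram_cut_prim : mprim a b D D'.
Proof. exact: (mprimfP Ie1 (mloc_win e1 e2 mRU)). Qed.
Lemma gram_cutE_prim : mprim a b gram_cutE (fun x => (D x) ^t* *m J *m D' x).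
Proof.
apply: (mprimfP Ie1); apply: (mlocMl _ (mloc_win e1 e2 mRU)).
exact: (mprim_mcac (mprimMr J (mprim_ct gram_cut_prim))).
Qed.
Lemma gram_cut_left x : I x -> x <= e1 -> D x = 0.
Proof.
move=> Ix xe; rewrite -(mprimf0 e1 D'); apply: (mprim_flat gram_cut_prim Ix Ie1 xe) => s /andP[_ se].
by rewrite /D' win_out ?scale0r // negb_and -!ltNge se.
Qed.
Lemma gram_cut_right x : I x -> e2 <= x -> D x = D e2.
Proof.
move=> Ix xe; apply/esym; apply: (mprim_flat gram_cut_prim Ie2 Ix xe) => s /andP[es _].
by rewrite /D' win_out ?scale0r // negb_and -!ltNge es orbT.
Qed.
Lemma gram_cut_total : D e2 = gram e2 - gram e1.
Proof.
have h s : e1 < s < e2 -> D' s - RU s = 0.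
  by move=> /andP[h1 h2]; rewrite /D' /win (ltW h1) (ltW h2) scale1r subrr.
have := mprim_flat (mprimD gram_cut_prim (mprimN gram_prim)) Ie1 Ie2 (ltW e12) h.
rewrite (gram_cut_left Ie1 (lexx _)) sub0r => /eqP.
by rewrite eq_sym subr_eq addrC => /eqP.
Qed.

Variables (b1 b2 b3 eta : 'cV[C]_(m + m)) (be : K -> 'cV[C]_(m + m)) (g phi v w : K -> 'cV[C]_m).
Hypothesis b1E : b1 = - (A d (d + t) *m ga1).
Hypothesis b2E : b2 = b1 - A c (c + t) *m ga2.
Hypothesis b3E : b3 = b2 - A e (e + t) *m ga3.
Hypothesis etaE : (gram e2 - gram e1) *m eta = b3.
Hypothesis beE : forall x, be x = - (A d x *m ga1 + A c x *m ga2 + A e x *m ga3 + D x *m eta).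
Hypothesis g_E : forall x,
  g x = rho d x *: ga1 + rho c x *: ga2 + rho e x *: ga3 + win e1 e2 x *: (R x *m (U x *m eta)).
Hypothesis phiE : forall x,
  phi x = srcphi d x *m ga1 + srcphi c x *m ga2 + srcphi e x *m ga3 + win e1 e2 x *: (U x *m eta).
Hypothesis vE : forall x, v x = - (U x *m J *m be x).
Hypothesis wE : forall x, w x = - (W x *m J *m be x).

Let gE x : R x *m phi x = g x.
Proof.
by rewrite phiE g_E !mulmxDr -scalemxAr; congr (_ + _ + _ + _); rewrite mulmxA R_srcphi mul_scalar_mx.
Qed.

Let UgE x : (U x) ^t* *m g x = (rho d x *: (U x) ^t*) *m ga1 + (rho c x *: (U x) ^t*) *m ga2
  + (rho e x *: (U x) ^t*) *m ga3 + D' x *m eta.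
Proof.
rewrite g_E !mulmxDr; congr (_ + _ + _ + _); try by rewrite -scalemxAr -scalemxAl.
by rewrite /cutgram' /gram' -scalemxAr -scalemxAl !mulmxA.
Qed.

Let be_prim : mprim a b be (fun x => - ((U x) ^t* *m g x)).
Proof.
have hA x (Ix : I x) (ga : 'cV_m) := mprimMr ga (srcA_prim hPQR c0 hU (x + t) Ix).
have h := mprimN (mprimD (mprimD (mprimD (hA d Id ga1) (hA c Ic ga2)) (hA e Ie ga3)) (mprimMr eta gram_cut_prim)).
by apply: (mprim_eq h) => x; rewrite ?beE ?UgE.
Qed.

Let v_prim : mprim a b v (fun x => Pinv P x *m w x).
Proof.
have h := mprim_eq (mprimN (mprimM (mprimMr J hU.1) be_prim)) (fun x => esym (vE x)) (fun x => erefl).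
apply: (mprim_ae h); apply: ae_always => x Ix.
have [e1' _ _ _] := symplectic_blocks (hJ Ix).
by rewrite mulmxN [_ *m (_ *m g x)]mulmxA e1' mul0mx subr0 wE mulmxN !mulmxA.
Qed.
Let w_prim : mprim a b w (fun x => (Q x - realC l *: R x) *m v x - g x).
Proof.
have h := mprim_eq (mprimN (mprimM (mprimMr J hU.2) be_prim)) (fun x => esym (wE x)) (fun x => erefl).
apply: (mprim_ae h); apply: ae_always => x Ix.
have [_ _ e3 _] := symplectic_blocks (hJ Ix).
by rewrite mulmxN [_ *m (_ *m g x)]mulmxA e3 mulNmx mul1mx opprK opprD vE mulmxN !mulmxA.
Qed.

Let g_loc : mloc a b g.
Proof.
have hr x (ga : 'cV_m) : mloc a b (fun s => rho x s *: ga).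
  move=> i j; apply: cloc_eq (clocM (cac_cst a b (ga i j)) (cloc_rho hPQR c0 x (x + t))) _ => s.
  by rewrite [RHS]mxE mulrC.
have hw : mloc a b (fun x => win e1 e2 x *: (R x *m (U x *m eta))).
  by apply: mloc_win; apply: (mlocMr (R_loc hPQR)); exact: mprim_mcac (mprimMr eta hU.1).
by apply: mloc_eq (mlocD (mlocD (mlocD (hr d ga1) (hr c ga2)) (hr e ga3)) hw) _ => x; rewrite g_E.
Qed.

Let phi_lbm i : lbm a b (fun x => phi x i 0).
Proof.
have hr x (ga : 'cV_m) : lbm a b (fun s => (srcphi x s *m ga) i 0).
  apply: lbm_eq (lbm_sum (index_enum 'I_m) (fun j => lbmM (lbm_srcphi hPQR c0 x (x + t) i j) (lbm_cst a b (ga j 0)))) _ => s.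
  by rewrite [RHS]mxE.
have hUe : lbm a b (fun s => (U s *m eta) i 0) by apply: cac_lbm; exact: mprim_mcac (mprimMr eta hU.1) i 0.
have h := lbmD (lbmD (lbmD (hr d ga1) (hr c ga2)) (hr e ga3)) (lbmM (lbm_win a b e1 e2) hUe).
apply: (lbm_eq h) => s.
rewrite phiE [RHS]mxE [X in _ = X + _]mxE [X in _ = X + _ + _]mxE.
by rewrite [X in _ = _ + X]mxE.
Qed.

Let A0 x s : I x -> I s -> s <= x -> A x s = 0.
Proof. move=> Ix Is; exact: (srcA_left hPQR c0 hU). Qed.
Let A1 x s : I x -> I (x + t) -> I s -> x + t <= s -> A x s = A x (x + t).
Proof. move=> Ix Iy Is; exact: (srcA_right hPQR c0 hU). Qed.

Let be_out : vanishes_outside a b d e2 be.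
Proof.
move=> x Ix; rewrite negb_and -!ltNge beE => /orP[xd|xe].
  have [x1 x2 x3] : [/\ x <= c, x <= e & x <= e1] by move: t0 dc ce ee1 e12 => *; split; lra.
  by rewrite (A0 Id Ix (ltW xd)) (A0 Ic Ix x1) (A0 Ie Ix x2) gram_cut_left // !mul0mx !addr0 oppr0.
have [x1 x2 x3] : [/\ d + t <= x, c + t <= x & e + t <= x] by move: t0 dc ce ee1 e12 => *; split; lra.
rewrite (A1 Id Id' Ix x1) (A1 Ic Ic' Ix x2) (A1 Ie Ie' Ix x3) (gram_cut_right Ix (ltW xe)) gram_cut_total etaE b3E b2E b1E.
by rewrite -!opprD addrN oppr0.
Qed.
Let v_out : vanishes_outside a b d e2 v.
Proof. by move=> x Ix nx; rewrite vE be_out // mulmx0 oppr0. Qed.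
Let phi_out : vanishes_outside a b d e2 phi.
Proof.
move=> x Ix nx.
have out y z : d <= y -> z <= e2 -> win y z x = 0.
  by move=> dy ze; apply: win_out; apply: contraNN nx => /andP[yx xz]; apply/andP; split; lra.
have [h1 h2 h3] : [/\ d + t <= e2, c + t <= e2 & e + t <= e2] by move: t0 dc ce ee1 e12 => *; split; lra.
have [h4 h5 h6] : [/\ d <= c, d <= e & d <= e1] by move: t0 dc ce ee1 e12 => *; split; lra.
have s0 y : win y (y + t) x = 0 -> srcphi y x = 0 by exact: srcphi_out.
by rewrite phiE !s0 ?(out _ _ h6) ?out // scale0r !mul0mx !addr0.
Qed.

(** The test function only gains coefficients on the four intervals that carry sources. *)
Let energy_pieces (Y : K -> 'M[C]_1) : mprim a b Y (fun x => (v x) ^t* *m g x) ->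
  Y e2 - Y d = (- (ga1 ^t* *m E d (d + t) *m ga1)
   + (b1 ^t* *m J *m (A c (c + t) *m ga2) - ga2 ^t* *m E c (c + t) *m ga2))
   + (b2 ^t* *m J *m (A e (e + t) *m ga3) - ga3 ^t* *m E e (e + t) *m ga3)
   + (b3 ^t* *m J *m (D e2 *m eta) - eta ^t* *m gram_cutE e2 *m eta).
Proof.
move=> hY'.
have hY : mprim a b Y (fun x => (- (U x *m J *m be x)) ^t* *m g x).
  by apply: (mprim_eq hY' (fun x => erefl)) => x; rewrite vE.
have EA x y : I x -> I (x + t) -> I y -> x + t <= y -> E x y = E x (x + t).
  by move=> *; exact: (srcE_right hPQR c0 hU).
have dce : [/\ d < c, c < e, e < e1, d <= c & c <= e] by move: t0 dc ce ee1 e12 => *; split; lra.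
have [dc' ce' ee1' dcl cel] := dce.
have rl y x : x < y -> rho y x = 0 by move=> h; apply: rho_out; rewrite negb_and -!ltNge h.
have rr y x : y + t < x -> rho y x = 0 by move=> h; apply: rho_out; rewrite negb_and -!ltNge h orbT.
have W0 x : x < e1 -> D' x = 0.
  by move=> h; rewrite /D' win_out ?scale0r // negb_and -!ltNge h.
have h1 : Y c - Y d = 0 ^t* *m J *m (A d c *m ga1) - ga1 ^t* *m E d c *m ga1.
  apply: (segment_energy Id Ic dcl (srcA_prim hPQR c0 hU (d + t) Id) (srcE_prim hPQR c0 hU (d + t) Id) hY).
  - exact: srcA_x.
  - exact: srcE_x.
  - move=> x /andP[dx xc]; have Ix : I x by apply: In; move: t0 dc ce ee1 e12 => *; lra.
    have [x1 x2] : x < e /\ x < e1 by move: t0 dc ce ee1 e12 => *; split; lra.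
    rewrite beE UgE (A0 Ic Ix (ltW xc)) (A0 Ie Ix (ltW x1)) (gram_cut_left Ix (ltW x2)).
    rewrite (rl _ _ xc) (rl _ _ x1) (W0 _ x2); move: (rho d x) (A d x) => rd Ad.
    by rewrite !scale0r !mul0mx !addr0 sub0r.
have h2 : Y e - Y c = b1 ^t* *m J *m (A c e *m ga2) - ga2 ^t* *m E c e *m ga2.
  apply: (segment_energy Ic Ie cel (srcA_prim hPQR c0 hU (c + t) Ic) (srcE_prim hPQR c0 hU (c + t) Ic) hY).
  - exact: srcA_x.
  - exact: srcE_x.
  - move=> x /andP[cx xe]; have Ix : I x by apply: In; move: t0 dc ce ee1 e12 => *; lra.
    have [x1 x2] : d + t < x /\ x < e1 by move: t0 dc ce ee1 e12 => *; split; lra.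
    rewrite beE UgE (A1 Id Id' Ix (ltW x1)) (A0 Ie Ix (ltW xe)) (gram_cut_left Ix (ltW x2)).
    rewrite (rr _ _ x1) (rl _ _ xe) (W0 _ x2) b1E; move: (rho c x) (A c x) (A d _) => rd Ac Ad.
    by rewrite !scale0r !mul0mx !addr0 add0r opprD.
have h3 : Y e1 - Y e = b2 ^t* *m J *m (A e e1 *m ga3) - ga3 ^t* *m E e e1 *m ga3.
  apply: (segment_energy Ie Ie1 (ltW ee1') (srcA_prim hPQR c0 hU (e + t) Ie) (srcE_prim hPQR c0 hU (e + t) Ie) hY).
  - exact: srcA_x.
  - exact: srcE_x.
  - move=> x /andP[ex xe]; have Ix : I x by apply: In; move: t0 dc ce ee1 e12 => *; lra.
    have [x1 x2] : d + t < x /\ c + t < x by move: t0 dc ce ee1 e12 => *; split; lra.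
    rewrite beE UgE (A1 Id Id' Ix (ltW x1)) (A1 Ic Ic' Ix (ltW x2)) (gram_cut_left Ix (ltW xe)).
    rewrite (rr _ _ x1) (rr _ _ x2) (W0 _ xe) b2E b1E; move: (rho e x) (A e x) (A c _) (A d _) => rd Ae Ac Ad.
    by rewrite !scale0r !mul0mx !addr0 !add0r !opprD.
have h4 : Y e2 - Y e1 = b3 ^t* *m J *m (D e2 *m eta) - eta ^t* *m gram_cutE e2 *m eta.
  apply: (segment_energy Ie1 Ie2 (ltW e12) gram_cut_prim gram_cutE_prim hY).
  - exact: mprimf0.
  - exact: mprimf0.
  - move=> x /andP[ex xe]; have Ix : I x by apply: In; move: t0 dc ce ee1 e12 => *; lra.
    have [x1 x2 x3] : [/\ d + t < x, c + t < x & e + t < x] by move: t0 dc ce ee1 e12 => *; split; lra.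
    rewrite beE UgE (A1 Id Id' Ix (ltW x1)) (A1 Ic Ic' Ix (ltW x2)) (A1 Ie Ie' Ix (ltW x3)).
    rewrite (rr _ _ x1) (rr _ _ x2) (rr _ _ x3) b3E b2E b1E; move: (A e _) (A c _) (A d _) (D x) (D' x) => Ae Ac Ad Dx Dx'.
    by rewrite !scale0r !mul0mx !add0r !opprD.
have EAc := EA d c Id Id' Ic (ltW dc); have EAe := EA c e Ic Ic' Ie (ltW ce).
have EAe1 := EA e e1 Ie Ie' Ie1 (ltW ee1).
have AAe := A1 Ic Ic' Ie (ltW ce); have AAe1 := A1 Ie Ie' Ie1 (ltW ee1).
rewrite EAc ct0 !mul0mx sub0r in h1; rewrite EAe AAe in h2; rewrite EAe1 AAe1 in h3.
have tele (p q r : 'M[C]_1) : (q - p) + (r - q) = r - p by rewrite addrC subrKA.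
by rewrite -h1 -h2 -h3 -h4 !tele.
Qed.

(** The test function [v] starts at zero, is kicked at [d], [c] and [e] by sources of
   length [t] towards the coefficients of [v1], of [v2] and of zero, and what is left of
   its coefficients is removed on [[e1, e2]]. The lower bound for [v] then only involves
   the work of the sources; on the left the norm is kept only between the sources. *)
Lemma corner_perturbed la Z : l < la -> holds_for_compact a b Z -> Tmin_bounded_below a b P Q R la Z ->
  realC (la - l) * (((J *m b1) ^t* *m (gram c - gram (d + t)) *m (J *m b1)
    + (J *m b2) ^t* *m (gram e - gram (c + t)) *m (J *m b2)) 0 0)
  <= ((- (ga1 ^t* *m E d (d + t) *m ga1)
   + (b1 ^t* *m J *m (A c (c + t) *m ga2) - ga2 ^t* *m E c (c + t) *m ga2))
   + (b2 ^t* *m J *m (A e (e + t) *m ga3) - ga3 ^t* *m E e (e + t) *m ga3)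
   + (b3 ^t* *m J *m (D e2 *m eta) - eta ^t* *m gram_cutE e2 *m eta)) 0 0.
Proof.
move=> lla hZ hT.
have dce : [/\ d < c, c < e, e < e1, d <= e2 & [/\ d + t <= c, c + t <= e, d <= d + t, c <= c + t & e <= e2]].
  by move: t0 dc ce ee1 e12 => *; split; [lra|lra|lra|lra|split; lra].
have [dc' ce' ee1' de2 [h1 h2 h3 h4 h5]] := dce.
have cv := mprim_mcac v_prim.
have hY := mprimfP Id (mlocMl (mcac_ct cv) g_loc).
have hX := mprimfP Id (mlocMr (mlocMl (mcac_ct cv) (R_loc hPQR)) cv).
move: (mprimf _ _) hY (mprimf _ _) hX => Y hY X hX.
have gE' x : I x -> R x *m phi x = g x by [].
have := test_ineq hPQR Id Ie2 de2 v_prim w_prim gE' phi_lbm v_out phi_out hZ hT hX hY.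
rewrite -(energy_pieces hY) [X in _ <= X -> _](_ : _ = (Y e2 - Y d) 0 0); last by rewrite !mxE.
apply: le_trans; apply: ler_wpM2l; first by rewrite -realC0 realC_le subr_ge0 ltW.
have Xm x y : I x -> I y -> x <= y -> 0 <= (X y - X x) 0 0.
  move=> Ix Iy xy; rewrite !mxE subr_ge0; apply: (@cprim_le _ a b (fun x => X x 0 0) _ x y (hX 0 0) Ix Iy xy).
  apply: ae_mono (ae_coef hPQR) => s h /andP[xs sy].
  have Is := oint_conv Ix Iy (ltW xs) (ltW sy).
  by have [_ pR _] := h Is; exact: qf_ge0.
have piece x y b0 : I x -> I y -> x <= y -> (forall s, x < s < y -> be s = b0) ->
    (J *m b0) ^t* *m (gram y - gram x) *m (J *m b0) = X y - X x.
  move=> Ix Iy xy be0.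
  have hg := mprimMr (J *m b0) (mprimMl ((J *m b0) ^t*) gram_prim).
  have e0 : (J *m b0) ^t* *m gram x *m (J *m b0) - X x = (J *m b0) ^t* *m gram y *m (J *m b0) - X y.
    apply: (mprim_flat (mprimD hg (mprimN hX)) Ix Iy xy) => s xsy; rewrite vE be0 //.
    rewrite ctN mulNmx mulNmx mulmxN opprK -!mulmxA !ctM -!mulmxA ; apply/eqP; rewrite subr_eq0; apply/eqP.
    by rewrite ?mulmxA.
  rewrite mulmxBr mulmxBl; apply/eqP; rewrite -subr_eq0; apply/eqP.
  move/eqP: e0; rewrite eq_sym subr_eq => /eqP ->; move: (_ *m gram x *m _) => gx.
  by rewrite [_ - gx]addrAC [gx - _ - _]addrAC subrr add0r opprB addrACA addNr addrN addr0.
have q1 : (J *m b1) ^t* *m (gram c - gram (d + t)) *m (J *m b1) = X c - X (d + t).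
  apply: (piece _ _ _ Id' Ic h1) => s /andP[ds sc]; have Is : I s by apply: In; move: t0 dc ce ee1 e12 => *; lra.
  have [x1 x2] : s < e /\ s < e1 by move: t0 dc ce ee1 e12 => *; split; lra.
  rewrite beE (A1 Id Id' Is (ltW ds)) (A0 Ic Is (ltW sc)) (A0 Ie Is (ltW x1)) (gram_cut_left Is (ltW x2)).
  by rewrite b1E; move: (A d _) => Ad; rewrite !mul0mx !addr0.
have q2 : (J *m b2) ^t* *m (gram e - gram (c + t)) *m (J *m b2) = X e - X (c + t).
  apply: (piece _ _ _ Ic' Ie h2) => s /andP[cs se]; have Is : I s by apply: In; move: t0 dc ce ee1 e12 => *; lra.
  have [x1 x2] : d + t < s /\ s < e1 by move: t0 dc ce ee1 e12 => *; split; lra.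
  rewrite beE (A1 Id Id' Is (ltW x1)) (A1 Ic Ic' Is (ltW cs)) (A0 Ie Is (ltW se)) (gram_cut_left Is (ltW x2)).
  by rewrite b2E b1E; move: (A d _) (A c _) => Ad Ac; rewrite !mul0mx !addr0 opprD.
rewrite (congr2 +%R q1 q2).
have := Xm d (d + t) Id Id' h3; have := Xm c (c + t) Ic Ic' h4; have := Xm e e2 Ie Ie2 h5.
rewrite !mxE => i1 i2 i3; rewrite -subr_ge0.
rewrite (_ : _ - _ = (X e2 0 0 - X e 0 0) + (X (c + t) 0 0 - X c 0 0) + (X (d + t) 0 0 - X d 0 0)); last by ring.
exact: addr_ge0 (addr_ge0 i1 i2) i3.
Qed.
End corner.

Lemma mcvgZ (K : realType) (T : Type) (F : set_system T) {FF : Filter F} m n k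
    (G : T -> 'M[cplx K]_(m, n)) L : mcvg F G L -> mcvg F (fun t => k *: G t) (k *: L).
Proof.
move=> g i j; rewrite mxE (_ : (fun t => _) = fun t => k * G t i j); last first.
  by apply/funext => t; rewrite mxE.
exact: (cvgM (cvg_cst k) (g i j)).
Qed.

Section corner_limit.
Variable K : realType.
Variable m : nat.
Variables a b : \bar K.
Notation I := (oint a b).
Notation C := (cplx K).
Variables P Q R : K -> 'M[C]_m.
Hypothesis hPQR : coefficients a b P Q R.
Local Open Scope sesquilinear_scope.
Notation J := (JJ K m).

Lemma sub_scale00 (A B : 'M[C]_1) k : (A - k *: B) 0 0 = A 0 0 - k * B 0 0.
Proof. by rewrite !mxE. Qed.

(** The lower bound extends to functions that consist of two solutions, vanish at their
   ends and have a corner at [c]: for these, the form of [L - l] is the jump of the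
   quasi-derivative at [c]. They are not in the domain of the minimal operator, but they
   are limits of the functions of [corner_perturbed] as the length [t] of the sources
   tends to zero. The strengths of the sources are the jumps of the quasi-derivatives,
   so that the coefficients to be removed behind [e] vanish in the limit. *)
Theorem corner_ineq l la d c e (v1 w1 v2 w2 : K -> 'cV[C]_m) (X1 X2 : K -> 'M[C]_1) Z :
  l < la -> holds_for_compact a b Z -> Tmin_bounded_below a b P Q R la Z ->
  I d -> I e -> d < c -> c < e ->
  sol a b P Q R (realC l) v1 w1 -> sol a b P Q R (realC l) v2 w2 ->
  v1 d = 0 -> v2 e = 0 -> v1 c = v2 c ->
  mprim a b X1 (fun x => (v1 x) ^t* *m R x *m v1 x) ->
  mprim a b X2 (fun x => (v2 x) ^t* *m R x *m v2 x) ->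
  realC (la - l) * ((X1 c - X1 d + (X2 e - X2 c)) 0 0) <= ((v1 c) ^t* *m (w1 c - w2 c)) 0 0.
Proof.
move=> lla hZ hT Id Ie dc ce hv1 hv2 v1d v2e v12 hX1 hX2.
have Ic : I c := oint_conv Id Ie (ltW dc) (ltW ce).
have [e1 Ie1 ee1] := oint_right Ie; have [e2 Ie2 e12] := oint_right Ie1.
have [U [W [hU hJ]]] := fundamental_ex hPQR l Id.
have UJU x : I x -> U x *m J *m (U x) ^t* = 0 by move=> Ix; have [] := symplectic_blocks (hJ x Ix).
(* The jumps of the quasi-derivative at [d], [c] and [e], when the function is
   continued by zero. *)
pose ga1 := - w1 d; pose ga2 := w1 c - w2 c; pose ga3 := w2 e.
pose B1 := wr U W v1 w1 c; pose B2 := wr U W v2 w2 c.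
have B1d : B1 = - ((U d) ^t* *m ga1).
  have := wr0 hPQR hU (V := v1) (Z := w1) _ Ic Id; rewrite realC_conj /wr v1d mulmx0 subr0 => /(_ hv1) e0.
  by rewrite /B1 /wr e0 /ga1 mulmxN opprK.
have B2e : B2 = (U e) ^t* *m ga3.
  have := wr0 hPQR hU (V := v2) (Z := w2) _ Ic Ie; rewrite realC_conj /wr v2e mulmx0 subr0 => /(_ hv2) e0.
  by rewrite /B2 /wr e0.
have B12 : B2 = B1 - (U c) ^t* *m ga2.
  by rewrite /B1 /B2 /wr /ga2 v12 mulmxBr opprB addrCA addrAC subrr add0r addrC.
pose G := gram R d U.
pose Gi := invmx (G e2 - G e1).
pose D := gram_cut R U e1 e2 e2; pose T := gram_cutE R U e1 e2 e2.
pose A x t := srcA R d U x (x + t) (x + t).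
pose E x t := srcE R d U x (x + t) (x + t).
pose b1 t := - (A d t *m ga1).
pose b2 t := b1 t - A c t *m ga2.
pose b3 t := b2 t - A e t *m ga3.
pose eta t := Gi *m b3 t.
pose lhs t := (J *m b1 t) ^t* *m (G c - G (d + t)) *m (J *m b1 t)
    + (J *m b2 t) ^t* *m (G e - G (c + t)) *m (J *m b2 t).
pose rhs t := (- (ga1 ^t* *m E d t *m ga1)
   + ((b1 t) ^t* *m J *m (A c t *m ga2) - ga2 ^t* *m E c t *m ga2))
   + ((b2 t) ^t* *m J *m (A e t *m ga3) - ga3 ^t* *m E e t *m ga3)
   + ((b3 t) ^t* *m J *m (D *m eta t) - (eta t) ^t* *m T *m eta t).
have ineq : \forall t \near 0^'+, 0 <= (rhs t - realC (la - l) *: lhs t) 0 0.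
  apply: near0_right; exists (Num.min (c - d) (Num.min (e - c) (e1 - e))).
    by rewrite !lt_min !subr_gt0 dc ce ee1.
  move=> t t0; rewrite !lt_min !ltrBrDl => /andP[t1 /andP[t2 t3]].
  have ue : (G e2 - G e1) *m eta t = b3 t by rewrite /eta mulKVmx // (gram_unit hPQR Id hU hJ).
  have := corner_perturbed hPQR Id hU hJ Id Ie2 t0 t1 t2 t3 e12 (erefl (b1 t)) (erefl (b2 t)) (erefl (b3 t)) ue
    (fun=> erefl) (fun=> erefl) (fun=> erefl) (fun=> erefl) (fun=> erefl) lla hZ hT.
  by rewrite -subr_ge0 sub_scale00.
have lA x : I x -> mcvg 0^'+ (A x) ((U x) ^t*) by move=> Ix; exact: (srcA_lim hPQR Id hU Ix).
have lE x : I x -> mcvg 0^'+ (E x) 0 by move=> Ix; exact: (srcE_lim hPQR Id hU hJ Ix).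
have cst n p (M : 'M[C]_(n, p)) : mcvg (0 : K)^'+ (fun=> M) M by exact: mcvg_cst.
have lb1 : mcvg 0^'+ b1 B1 by rewrite B1d; exact: (mcvgN (mcvgM (lA d Id) (cst _ _ ga1))).
have lb2 : mcvg 0^'+ b2 B2.
  by rewrite B12; exact: (mcvgD lb1 (mcvgN (mcvgM (lA c Ic) (cst _ _ ga2)))).
have lb3 : mcvg 0^'+ b3 0.
  have h : mcvg 0^'+ b3 (B2 - (U e) ^t* *m ga3) by exact: (mcvgD lb2 (mcvgN (mcvgM (lA e Ie) (cst _ _ ga3)))).
  by rewrite -(subrr B2) {2}B2e.
have leta : mcvg 0^'+ eta 0.
  by rewrite -(mulmx0 _ Gi); exact: (mcvgM (cst _ _ Gi) lb3).
have lG x : I x -> mcvg 0^'+ (fun t => G (x + t)) (G x).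
  move=> Ix; apply: (mcvg_comp (F := nbhs x)); last exact: mcac_mcvg (mprim_mcac (gram_prim hPQR Id hU)) Ix.
  move=> S /nbhs_ballP[r r0 H]; apply: near0_right; exists r => // t t0 tr; apply: H.
  by rewrite /ball /= opprD addrA subrr sub0r normrN gtr0_norm.
pose L := (J *m B1) ^t* *m (G c - G d) *m (J *m B1) + (J *m B2) ^t* *m (G e - G c) *m (J *m B2).
have llhs : mcvg 0^'+ lhs L.
  have q (bt : K -> 'cV[C]_(m + m)) B x y : I x -> mcvg 0^'+ bt B ->
      mcvg 0^'+ (fun t => (J *m bt t) ^t* *m (G y - G (x + t)) *m (J *m bt t))
        ((J *m B) ^t* *m (G y - G x) *m (J *m B)).
    move=> Ix hb; have hJb : mcvg 0^'+ (fun t => J *m bt t) (J *m B) by exact: (mcvgM (cst _ _ J) hb).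
    exact: (mcvgM (mcvgM (mcvg_ct hJb) (mcvgD (cst _ _ (G y)) (mcvgN (lG x Ix)))) hJb).
  exact: (mcvgD (q b1 B1 d c Id lb1) (q b2 B2 c e Ic lb2)).
have lrhs : mcvg 0^'+ rhs (B1 ^t* *m J *m ((U c) ^t* *m ga2)).
  have qE x (ga : 'cV_m) : I x -> mcvg 0^'+ (fun t => ga ^t* *m E x t *m ga) 0.
    move=> Ix; rewrite -(mul0mx _ ga) -(mulmx0 _ (ga ^t*)).
    exact: (mcvgM (mcvgM (cst _ _ (ga ^t*)) (lE x Ix)) (cst _ _ ga)).
  have qA x (ga : 'cV_m) (bt : K -> 'cV[C]_(m + m)) B : I x -> mcvg 0^'+ bt B ->
      mcvg 0^'+ (fun t => (bt t) ^t* *m J *m (A x t *m ga)) (B ^t* *m J *m ((U x) ^t* *m ga)).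
    move=> Ix hb; exact: (mcvgM (mcvgM (mcvg_ct hb) (cst _ _ J)) (mcvgM (lA x Ix) (cst _ _ ga))).
  have z1 : B2 ^t* *m J *m ((U e) ^t* *m ga3) = 0.
    by rewrite B2e ctM ctK -!mulmxA (mulmxA J) (mulmxA (U e)) (mulmxA (U e)) UJU // mul0mx mulmx0.
  have -> : B1 ^t* *m J *m ((U c) ^t* *m ga2) = (- 0 + (B1 ^t* *m J *m ((U c) ^t* *m ga2) - 0))
     + (B2 ^t* *m J *m ((U e) ^t* *m ga3) - 0)
     + ((0 : 'cV_(m + m)) ^t* *m J *m (D *m 0) - (0 : 'cV_(m + m)) ^t* *m T *m 0).
    by rewrite z1 !mulmx0 !oppr0 !addr0 add0r.
  exact: (mcvgD (mcvgD (mcvgD (mcvgN (qE d ga1 Id)) (mcvgD (qA c ga2 b1 B1 Ic lb1) (mcvgN (qE c ga2 Ic))))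
    (mcvgD (qA e ga3 b2 B2 Ie lb2) (mcvgN (qE e ga3 Ie))))
    (mcvgD (mcvgM (mcvgM (mcvg_ct lb3) (cst _ _ J)) (mcvgM (cst _ _ D) leta))
      (mcvgN (mcvgM (mcvgM (mcvg_ct leta) (cst _ _ T)) leta)))).
have lim : 0 <= (B1 ^t* *m J *m ((U c) ^t* *m ga2) - realC (la - l) *: L) 0 0.
  have h : mcvg 0^'+ (fun t => rhs t - realC (la - l) *: lhs t)
      (B1 ^t* *m J *m ((U c) ^t* *m ga2) - realC (la - l) *: L).
    have hz : mcvg 0^'+ (fun t => realC (la - l) *: lhs t) (realC (la - l) *: L).
      by apply: mcvgZ; exact: llhs.
    exact: (mcvgD lrhs (mcvgN hz)).
  exact: cvgC_ge (h 0 0) ineq.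
have r1 x : I x -> v1 x = - (U x *m J *m B1) by move=> Ix; exact: (sol_rep hPQR hU hJ hv1 Ic Ix).
have r2 x : I x -> v2 x = - (U x *m J *m B2) by move=> Ix; exact: (sol_rep hPQR hU hJ hv2 Ic Ix).
have XE (v : K -> 'cV[C]_m) (X : K -> 'M[C]_1) B x y :
    (forall s, I s -> v s = - (U s *m J *m B)) ->
    mprim a b X (fun s => (v s) ^t* *m R s *m v s) -> I x -> I y -> x < y ->
    (J *m B) ^t* *m (G y - G x) *m (J *m B) = X y - X x.
  move=> vE hX Ix Iy xy.
  have hg := mprimMr (J *m B) (mprimMl ((J *m B) ^t*) (gram_prim hPQR Id hU)).
  have e0 : (J *m B) ^t* *m G x *m (J *m B) - X x = (J *m B) ^t* *m G y *m (J *m B) - X y.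
    apply: (mprim_flat (mprimD hg (mprimN hX)) Ix Iy (ltW xy)) => s /andP[xs sy].
    have Is := oint_conv Ix Iy (ltW xs) (ltW sy).
    rewrite vE // ctN mulNmx mulNmx mulmxN opprK -!mulmxA !ctM -!mulmxA; apply/eqP; rewrite subr_eq0; apply/eqP.
    by rewrite ?mulmxA.
  rewrite mulmxBr mulmxBl; apply/eqP; rewrite -subr_eq0; apply/eqP.
  move/eqP: e0; rewrite eq_sym subr_eq => /eqP ->; move: (_ *m G x *m _) => gx.
  by rewrite [_ - gx]addrAC [gx - _ - _]addrAC subrr add0r opprB addrACA addNr addrN addr0.
rewrite -(XE v1 X1 B1 d c r1 hX1 Id Ic dc) -(XE v2 X2 B2 c e r2 hX2 Ic Ie ce) -/L.
rewrite -subr_ge0; move: lim; rewrite sub_scale00.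
suff -> : (v1 c) ^t* *m (w1 c - w2 c) = B1 ^t* *m J *m ((U c) ^t* *m ga2) by [].
by rewrite (r1 c Ic) ctN !ctM ctJJ !(mulmxN, mulNmx) opprK !mulmxA.
Qed.
End corner_limit.

(** * Monotone families of Hermitian matrices *)
Section sesquilinear.
Variable K : realType.
Notation C := (cplx K).
Local Open Scope sesquilinear_scope.
Variable m : nat.
Implicit Types (A B M : 'M[C]_m) (x y v : 'cV[C]_m).

Definition sf M x y : C := (x ^t* *m M *m y) 0 0.
Definition im : C := mkC 0 1.

Lemma imM : im * im = -1.
Proof. by apply: cplx_eq; rewrite !reimE; ring. Qed.
Lemma im_conj : im^* = - im.
Proof. by apply: cplx_eq; rewrite !reimE ?oppr0. Qed.
Lemma qfE M v : qf M v = sf M v v. Proof. by []. Qed.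
Lemma sfDl M x y v : sf M (x + y) v = sf M x v + sf M y v.
Proof. by rewrite /sf ctD !mulmxDl mxE. Qed.
Lemma sfDr M x y v : sf M v (x + y) = sf M v x + sf M v y.
Proof. by rewrite /sf mulmxDr mxE. Qed.
Lemma sfNl M x v : sf M (- x) v = - sf M x v.
Proof. by rewrite /sf ctN !mulNmx mxE. Qed.
Lemma sfNr M x v : sf M v (- x) = - sf M v x.
Proof. by rewrite /sf mulmxN mxE. Qed.
Lemma sfZl M k x v : sf M (k *: x) v = k^* * sf M x v.
Proof. by rewrite /sf ctZ -!scalemxAl mxE. Qed.
Lemma sfZr M k x v : sf M v (k *: x) = k * sf M v x.
Proof. by rewrite /sf -scalemxAr mxE. Qed.
Lemma sf_delta M i j : sf M (delta_mx i 0) (delta_mx j 0) = M i j.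
Proof.
rewrite /sf (_ : (delta_mx i 0) ^t* = delta_mx 0 i :> 'rV[C]_m).
  by rewrite -rowE -colE !mxE.
by apply/matrixP => k l; rewrite ctE !mxE andbC; case: (_ && _); rewrite ?rmorph1 ?rmorph0.
Qed.
Lemma sf_herm M x y : M ^t* = M -> (sf M x y)^* = sf M y x.
Proof. by move=> hM; rewrite /sf -ctE !ctM ctK hM mulmxA. Qed.
Lemma sf_sub A B x y : sf (A - B) x y = sf A x y - sf B x y.
Proof. by rewrite /sf mulmxBr mulmxBl !mxE. Qed.

Lemma polarization M i j : let e k := delta_mx k 0 : 'cV[C]_m in
  M i j = 2^-1 * ((qf M (e i + e j) - qf M (e i) - qf M (e j))
    - im * (qf M (e i + im *: e j) - qf M (e i) - qf M (e j))).
Proof.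
move=> e; rewrite !qfE !(sfDl, sfDr, sfZl, sfZr) im_conj !sf_delta.
have e2 : (2 : C) != 0 by rewrite pnatr_eq0.
apply: (mulfI e2); rewrite mulVKf //; move: imM; move: im => z zz.
rewrite [RHS](_ : _ = M i j + M j i - (z * z) * M i j + (z * z) * M j i + z * (1 + z * z) * M j j); last by ring.
by rewrite zz subrr mulr0 mul0r addr0; ring.
Qed.

Lemma qf0_mx0 M : (forall v, qf M v = 0) -> M = 0.
Proof. by move=> h; apply/matrixP => i j; rewrite polarization !h !subrr mulr0 subrr mulr0 mxE. Qed.
Lemma qf_inj M M' : (forall v, qf M v = qf M' v) -> M = M'.
Proof.
by move=> h; apply/eqP; rewrite -subr_eq0; apply/eqP/qf0_mx0 => v; rewrite !qfE sf_sub -!qfE h subrr.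
Qed.
Lemma qf_herm M : (forall v, (qf M v)^* = qf M v) -> M ^t* = M.
Proof. by move=> h; apply: qf_inj => v; rewrite -[RHS]h /qf -ctE !ctM ctK mulmxA. Qed.

Lemma qf_conj M B v : qf M (B *m v) = qf (B ^t* *m M *m B) v.
Proof. by rewrite /qf ctM !mulmxA. Qed.

(** Completing the square. *)
Lemma inv_gap0 A B v x y : A ^t* = A -> B ^t* = B -> A *m x = v -> B *m y = v ->
  sf 1%:M v y - sf 1%:M v x = qf B (x - y) + (qf A x - qf B x).
Proof.
move=> hA hB Ax By; rewrite !qfE !(sfDl, sfDr, sfNl, sfNr).
have xt : x ^t* *m A = v ^t* by rewrite -Ax ctM hA.
have yt : y ^t* *m B = v ^t* by rewrite -By ctM hB.
have e1 : sf B x y = sf 1%:M v x by rewrite /sf mulmx1 -xt -!mulmxA By Ax.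
have e2 : sf B y x = sf 1%:M v x by rewrite /sf yt mulmx1.
have e3 : sf B y y = sf 1%:M v y by rewrite /sf yt mulmx1.
have e4 : sf A x x = sf 1%:M v x by rewrite /sf xt mulmx1.
by rewrite e1 e2 e3 e4; move: (sf _ v x) (sf _ v y) (sf B x x) => p q r; ring.
Qed.

Lemma inv_gap A B v : posdef A -> posdef B ->
  qf (invmx B) v - qf (invmx A) v =
  qf B (invmx A *m v - invmx B *m v) + (qf A (invmx A *m v) - qf B (invmx A *m v)).
Proof.
move=> pA pB; have [hA _] := pA; have [hB _] := pB.
rewrite -(inv_gap0 hA hB (mulKVmx (posdef_unit pA) v) (mulKVmx (posdef_unit pB) v)).
by rewrite /sf !mulmx1 !mulmxA.
Qed.

Lemma inv_anti A B v : posdef A -> posdef B -> (forall x, qf B x <= qf A x) ->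
  qf (invmx A) v <= qf (invmx B) v.
Proof.
move=> pA pB h; rewrite -subr_ge0 inv_gap // addr_ge0 ?subr_ge0 //; exact: qf_ge0.
Qed.

(** The gap of [inv_gap] is a sum of two nonnegative terms, of which the second is
   positive. *)
Lemma inv_anti_lt A B v : posdef A -> posdef B -> (forall x, x != 0 -> qf B x < qf A x) ->
  v != 0 -> qf (invmx A) v < qf (invmx B) v.
Proof.
move=> pA pB h v0; rewrite -subr_gt0 inv_gap // ltr_wpDl ?subr_gt0 ?qf_ge0 //; apply: h.
by apply: contraNneq v0 => e; apply/eqP; rewrite -(mulKVmx (posdef_unit pA) v) e mulmx0.
Qed.

Lemma qf_gt0 A v : posdef A -> v != 0 -> 0 < qf A v.
Proof. by move=> [_ h] v0; rewrite /qf -mulmxA; exact: h. Qed.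
Lemma posdefP A : (forall v, v != 0 -> 0 < qf A v) -> posdef A.
Proof.
move=> h; split; last by move=> v v0; rewrite /cdot mulmxA; exact: h.
apply: qf_herm => v; have [->|v0] := eqVneq v 0; first by rewrite /qf mulmx0 mxE rmorph0.
by have := h v v0; rewrite ltcP => /andP[/eqP e _]; apply: cplx_eq; rewrite !reimE // e !reimE oppr0.
Qed.
Lemma qf_reC A v : posdef A -> qf A v = realC (reC (qf A v)).
Proof.
by move=> /(qf_ge0 v); rewrite lecP => /andP[/eqP e _]; apply: cplx_eq; rewrite !reimE // e.
Qed.

(** Cauchy's inequality, in the form of a weighted arithmetic mean. *)
Lemma young A x y (th : K) : posdef A -> 0 < th ->
  `|reC (sf 1%:M y x)| * 2 <= th * reC (qf A x) + th^-1 * reC (qf (invmx A) y).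
Proof.
move=> pA th0; have uA := posdef_unit pA; have [hA _] := pA.
have key (s : K) : s ^+ 2 = 1 ->
    0 <= th * reC (qf A x) + 2 * s * reC (sf 1%:M y x) + th^-1 * reC (qf (invmx A) y).
  move=> ss; have := qf_ge0 (realC th *: x + realC s *: (invmx A *m y)) pA.
  rewrite qfE !(sfDl, sfDr, sfZl, sfZr) !realC_conj.
  have e1 : sf A x (invmx A *m y) = (sf 1%:M y x)^*.
    by rewrite sf_herm ?ct1 // /sf mulmx1 -mulmxA mulKVmx.
  have e2 : sf A (invmx A *m y) x = sf 1%:M y x.
    by rewrite /sf ctM ctV hA mulmxKV // mulmx1.
  have e3 : sf A (invmx A *m y) (invmx A *m y) = qf (invmx A) y.
    by rewrite /sf ctM ctV hA mulmxKV // /qf mulmxA.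
  rewrite e1 e2 e3 -qfE; move: (qf A x) (sf _ y x) (qf _ y) => p q r.
  rewrite lecP !reimE => /andP[_]; move: (reC p) (reC q) (reC r) => p' q' r' h.
  have e : th * p' + 2 * s * q' + th^-1 * r' = th^-1 * (th * (th * p' + s * q') + s * (th * q' + s * r')).
    have rr : r' = s ^+ 2 * r' by rewrite ss mul1r.
    by rewrite {1}rr; field; rewrite gt_eqF.
  rewrite e mulr_ge0 ?invr_ge0 ?(ltW th0) //; apply: le_trans h _.
  by rewrite le_eqVlt; apply/orP; left; apply/eqP; ring.
have := key 1 (expr1n _ _); have := key (-1) (ltac:(by rewrite sqrrN expr1n)).
move: (reC (sf _ _ _)) (th * _) (_^-1 * _) => p q r h1 h2.
by case: (ger0P p) => _; lra.
Qed.
End sesquilinear.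

Section endpoint_filter.
Variable K : realType.
Variables a b : \bar K.
Notation I := (oint a b).
Notation C := (cplx K).

Lemma to_aP c (p : K -> Prop) : I c -> (forall x, I x -> x < c -> p x) -> to_a a p.
Proof.
move=> Ic H; have Ix x : (a < x%:E)%E -> x < c -> I x.
  move=> ax xc; apply/andP; split => //; move: Ic => /andP[_]; apply: lt_trans; by rewrite lte_fin.
move: Ic Ix H; rewrite /to_a; case: (a) => [r| |] Ic Ix H.
- have rc : r < c by move: Ic => /andP[]; rewrite lte_fin.
  have h1 := nbhs_right_gt r; have h2 := nbhs_right_lt rc.
  apply: filterS (filterI h1 h2) => t [/= t0 td]; apply: H => //; apply: Ix => //; by rewrite lte_fin.
- by case/andP: Ic.
- exists c; split; first exact: num_real.
  by move=> x xc; apply: H => //; apply: Ix => //; exact: ltNyr.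
Qed.

Lemma to_a_proper : ProperFilter (to_a a).
Proof.
case: a => [r| |]; rewrite /to_a.
- exact: at_right_proper_filter.
- exact: proper_ninfty_nbhs.
- exact: proper_ninfty_nbhs.
Qed.

Lemma to_a_ex c (p : K -> Prop) : I c -> to_a a p -> exists x, [/\ I x, x < c & p x].
Proof.
move=> Ic h; have PF := to_a_proper.
have : to_a a (fun x => p x /\ (I x /\ x < c)).
  by apply: filterI => //; apply: (to_aP Ic) => x Ix xc; split.
by move=> /filter_ex[x [px [Ix xc]]]; exists x.
Qed.

Local Instance to_a_filter : Filter (to_a a). Proof. move: to_a_proper => PF; exact _. Qed.

(** A real function that increases with [x] and is bounded below converges at [a]. *)
Lemma to_a_mono c (q : K -> K) k : I c -> (forall x, I x -> x < c -> k <= q x) ->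
  (forall x y, I x -> x <= y -> y < c -> q x <= q y) ->
  exists2 L, q x @[x --> to_a a] --> L & forall x, I x -> x < c -> L <= q x.
Proof.
move=> Ic qk mono; have [c' Ic' cc'] := oint_left Ic.
pose S := [set q x | x in [set x | I x /\ x < c]].
have S0 : S !=set0 by exists (q c'); exists c'.
have Sb : has_inf S by split => //; exists k => _ [x [Ix xc] <-]; exact: qk.
have L x : I x -> x < c -> inf S <= q x.
  by move=> Ix xc; apply: ge_inf; [by case: Sb|exists x].
exists (inf S) => //; apply/cvgrPdist_lt => e e0.
have [_ [y [Iy yc] <-] qy] := inf_adherent e0 Sb.
apply: (to_aP Iy) => x Ix xy; have xc := lt_trans xy yc.
rewrite distrC ger0_norm ?subr_ge0 ?L // ltrBlDl; apply: le_lt_trans qy.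
exact: mono (ltW xy) yc.
Qed.

Section monotone_family.
Variable m : nat.
Local Open Scope sesquilinear_scope.
Variable c : K.
Variable G : K -> 'M[C]_m.
Hypothesis Ic : I c.
Hypothesis pG : forall x, I x -> x < c -> posdef (G x).
Hypothesis mG : forall x y v, I x -> x <= y -> y < c -> qf (G y) v <= qf (G x) v.

(** The quadratic forms of the inverses decrease, hence converge, and a Hermitian matrix
   is determined by its form. The last bound is the limit, as [y] tends to [a], of the
   comparison of the forms of [G x] and [G y] at the vector [G y ^-1 v]. *)
Lemma monotone_inverse : exists B : 'M[C]_m,
  [/\ B ^t* = B, mcvg (to_a a) (fun x => invmx (G x)) B,
      forall x v, I x -> x < c -> qf B v <= qf (invmx (G x)) v &
      forall x v, I x -> x < c -> qf (G x) (B *m v) <= qf B v].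
Proof.
have PF := to_a_proper.
have In x y : I x -> x <= y -> y < c -> I y by move=> Ix xy yc; exact: (oint_conv Ix Ic xy (ltW yc)).
have Hmono x y v : I x -> x <= y -> y < c -> qf (invmx (G x)) v <= qf (invmx (G y)) v.
  move=> Ix xy yc; have Iy := In _ _ Ix xy yc; have xc := le_lt_trans xy yc.
  by apply: inv_anti => [||w]; [exact: pG|exact: pG|exact: mG].
have lim v : exists l : C, qf (invmx (G x)) v @[x --> to_a a] --> l.
  pose q x := reC (qf (invmx (G x)) v).
  have qE x : I x -> x < c -> qf (invmx (G x)) v = realC (q x).
    by move=> Ix xc; apply: qf_reC; exact: posdef_inv (pG Ix xc).
  have [L qL Lq] : exists2 L, q x @[x --> to_a a] --> L & forall x, I x -> x < c -> L <= q x.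
    apply: (@to_a_mono c q 0 Ic).
      by move=> x Ix xc; rewrite -realC_le -qE //; apply: qf_ge0; exact: posdef_inv (pG Ix xc).
    move=> x y Ix xy yc; have := Hmono x y v Ix xy yc.
    by rewrite (qE x Ix (le_lt_trans xy yc)) (qE y (In _ _ Ix xy yc) yc) realC_le.
  exists (realC L); apply/cvgC_parts; split; first exact: qL.
  apply: (@cvg_trans _ ((0 : K) @[x --> to_a a])); last exact: cvg_cst.
  by apply: near_eq_cvg; apply: (to_aP Ic) => x Ix xc; rewrite qE.
have [l lP] := choice lim.
pose e k := delta_mx k 0 : 'cV[C]_m.
pose B : 'M[C]_m := \matrix_(i, j) (2^-1 * ((l (e i + e j) - l (e i) - l (e j))
    - @im K * (l (e i + @im K *: e j) - l (e i) - l (e j)))).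
have HB : mcvg (to_a a) (fun x => invmx (G x)) B.
  move=> i j; rewrite mxE (_ : (fun x => _) = fun x =>
    2^-1 * ((qf (invmx (G x)) (e i + e j) - qf (invmx (G x)) (e i) - qf (invmx (G x)) (e j))
    - @im K * (qf (invmx (G x)) (e i + @im K *: e j) - qf (invmx (G x)) (e i) - qf (invmx (G x)) (e j)))).
    have t v1 v2 v3 : qf (invmx (G x)) v1 - qf (invmx (G x)) v2 - qf (invmx (G x)) v3
        @[x --> to_a a] --> l v1 - l v2 - l v3.
      exact: (cvgB (cvgB (lP v1) (lP v2)) (lP v3)).
    exact: (cvgM (cvg_cst _) (cvgB (t _ _ _) (cvgM (cvg_cst _) (t _ _ _)))).
  by apply/funext => x; rewrite polarization.
have qB v : qf (invmx (G x)) v @[x --> to_a a] --> qf B v.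
  have cst n p (M : 'M[C]_(n, p)) : mcvg (to_a a) (fun=> M) M by exact: mcvg_cst.
  exact: (mcvgM (mcvgM (cst _ _ (v ^t*)) HB) (cst _ _ v)).
have BH x v : I x -> x < c -> qf B v <= qf (invmx (G x)) v.
  move=> Ix xc; apply: (cvgC_le (qB v)); apply: (to_aP Ix) => y Iy yx.
  exact: Hmono (ltW yx) xc.
exists B; split; [|exact: HB|exact: BH|].
- apply: qf_herm => v; have : 0 <= qf B v.
    apply: (cvgC_ge (qB v)); apply: (to_aP Ic) => x Ix xc; apply: qf_ge0; exact: posdef_inv (pG Ix xc).
  by rewrite lecP => /andP[/eqP h _]; apply: cplx_eq; rewrite !reimE // h !reimE oppr0.
- move=> x v Ix xc.
  have cst n p (M : 'M[C]_(n, p)) : mcvg (to_a a) (fun=> M) M by exact: mcvg_cst.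
  have HBv : mcvg (to_a a) (fun y => invmx (G y) *m v) (B *m v) by exact: (mcvgM HB (cst _ _ v)).
  have h : mcvg (to_a a) (fun y => (invmx (G y) *m v) ^t* *m G x *m (invmx (G y) *m v)) ((B *m v) ^t* *m G x *m (B *m v)).
    exact: (mcvgM (mcvgM (mcvg_ct HBv) (cst _ _ (G x))) HBv).
  have hd : qf (invmx (G y)) v - qf (G x) (invmx (G y) *m v) @[y --> to_a a] --> qf B v - qf (G x) (B *m v).
    exact: (cvgB (qB v) (h 0 0)).
  rewrite -subr_ge0; apply: (cvgC_ge hd); apply: (to_aP Ix) => y Iy yx.
  have yc := lt_trans yx xc; have pGy := pG Iy yc; have [hGy _] := pGy.
  rewrite subr_ge0; apply: (le_trans (mG (invmx (G y) *m v) Iy (ltW yx) xc)).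
  by rewrite qf_conj ctV hGy mulVmx ?posdef_unit // mul1mx.
Qed.
End monotone_family.
End endpoint_filter.

(** * Absolutely continuous plane curves *)
HB.instance Definition _ (K : realType) := NormedModule.on 'rV[K]_2.

Section curve.
Variable K : realType.
Variables a b : \bar K.
Notation I := (oint a b).
Notation C := (cplx K).

Lemma tv_bound c d f : c <= d -> rac c d f -> exists tv : K -> K, exists V : K,
  (forall x, c <= x -> x <= d -> 0 <= tv x <= V) /\
  forall x y, c <= x -> x <= y -> y <= d -> `|f y - f x| <= tv y - tv x.
Proof.
move=> cd F; have fi := rac_bv cd F.
have fx x : c <= x -> x <= d -> total_variation c x f \is a fin_num.
  by move=> cx xd; apply: rac_bv => //; apply: rac_sub F.
exists (fun x => fine (total_variation c x f)), (fine (total_variation c d f)).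
split=> [x cx xd|].
  rewrite fine_ge0 ?total_variation_ge0 //= fine_le // ?fx //.
  by rewrite (total_variationD f cx xd) leeDl // total_variation_ge0.
move=> x y cx xy yd; have xd := le_trans xy yd; have cy := le_trans cx xy.
have h : total_variation x y f \is a fin_num by apply: rac_bv => //; apply: rac_sub F.
rewrite (total_variationD f cx xy) fineD ?fx // addrAC subrr add0r.
by rewrite -lee_fin fineK //; exact: total_variation_ge.
Qed.

(** A rectifiable curve cannot come close to every point of a disc: among [N ^ 2]
   grid points of mutual distance [r / N] the curve would need length of order [r N]. *)
Lemma rectifiable_not_dense c d (f g : K -> K) u v r : c <= d -> rac c d f -> rac c d g ->
  0 < r -> exists p q e, [/\ `|p - u| < r, `|q - v| < r, 0 < e &
    forall x, c <= x -> x <= d -> ~ (`|f x - p| < e /\ `|g x - q| < e)].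
Proof.
move=> cd F G r0; apply: contrapT => H.
have [tf [Vf [tfV tfL]]] := tv_bound cd F; have [tg [Vg [tgV tgL]]] := tv_bound cd G.
have Vf0 : 0 <= Vf by have /andP[h1 h2] := tfV c (lexx c) cd; exact: le_trans h1 h2.
have Vg0 : 0 <= Vg by have /andP[h1 h2] := tgV c (lexx c) cd; exact: le_trans h1 h2.
pose V := Vf + Vg; have V0 : 0 <= V by rewrite addr_ge0.
pose N := (Num.truncn (6 * V / r + 1)).+1.
have NV : 6 * V / r + 1 < N%:R by rewrite /N truncnS_gt.
have N0 : 0 < N%:R :> K by rewrite ltr0n.
pose e := r / (6 * N%:R); have e0 : 0 < e by rewrite divr_gt0 // mulr_gt0.
pose w (k : 'I_N) : K := r / (2 * N%:R) * k%:R.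
have w_bd k : `|w k| < r.
  have k0 : (0 : K) <= k%:R by [].
  have kN : k%:R <= N%:R :> K by rewrite ler_nat ltnW.
  have h : 0 < r / (2 * N%:R) by rewrite divr_gt0 // mulr_gt0.
  rewrite ger0_norm; last by rewrite mulr_ge0 // ltW.
  apply: (@le_lt_trans _ _ (r / (2 * N%:R) * N%:R)); first by rewrite ler_wpM2l // ltW.
  rewrite (_ : _ * _ = r / 2); first by lra.
  by field; rewrite gt_eqF.
have w_sep j k : j != k -> 3 * e <= `|w j - w k|.
  move=> jk; rewrite /w -mulrBr normrM gtr0_norm; last by rewrite divr_gt0 // mulr_gt0.
  have h : 1 <= `|(j%:R - k%:R : K)|.
    have [jk'|kj] := ltnP j k.
      by rewrite distrC ger0_norm ?subr_ge0 ?ler_nat ?(ltnW jk') // -natrB ?(ltnW jk') // ler1n subn_gt0.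
    have {}kj : (k < j)%N by rewrite ltn_neqAle kj eq_sym andbT.
    by rewrite ger0_norm ?subr_ge0 ?ler_nat ?(ltnW kj) // -natrB ?(ltnW kj) // ler1n subn_gt0.
  rewrite (_ : 3 * e = r / (2 * N%:R) * 1); first by rewrite ler_wpM2l // ltW // divr_gt0 // mulr_gt0.
  by rewrite /e; field; rewrite gt_eqF.
have ex (k : 'I_N * 'I_N) : exists x, [/\ c <= x, x <= d, `|f x - (u + w k.1)| < e & `|g x - (v + w k.2)| < e].
  apply: contrapT => nx; apply: H; exists (u + w k.1), (v + w k.2), e; split => //.
  - by rewrite addrAC subrr add0r.
  - by rewrite addrAC subrr add0r.
  - by move=> x cx xd [h1 h2]; apply: nx; exists x.
have [X XP] := choice ex.
pose tau k := tf (X k) + tg (X k).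
have tauV k : 0 <= tau k <= V.
  have [cx xd _ _] := XP k; have /andP[h1 h2] := tfV _ cx xd; have /andP[h3 h4] := tgV _ cx xd.
  by rewrite addr_ge0 //= lerD.
have far f' (w' : 'I_N * 'I_N -> K) u' k k' : (forall k, `|f' (X k) - (u' + w' k)| < e) ->
    3 * e <= `|w' k - w' k'| -> e <= `|f' (X k') - f' (X k)|.
  move=> near h; have h1 := near k; have h2 := near k'.
  have : `|w' k - w' k'| <= `|f' (X k') - (u' + w' k')| + `|f' (X k) - (u' + w' k)| + `|f' (X k') - f' (X k)|.
    rewrite (_ : w' k - w' k' = (f' (X k') - (u' + w' k')) - (f' (X k) - (u' + w' k)) - (f' (X k') - f' (X k))); last by ring.
    by apply: le_trans (ler_normB _ _) _; rewrite lerD2r; exact: ler_normB.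
  by move=> h3; lra.
have tau_sep k k' : k != k' -> X k <= X k' -> e <= tau k' - tau k.
  move=> kk xx; have [cx xd _ _] := XP k; have [cx' xd' _ _] := XP k'.
  have hf := tfL _ _ cx xx xd'; have hg := tgL _ _ cx xx xd'.
  have f0 := le_trans (normr_ge0 _) hf; have g0 := le_trans (normr_ge0 _) hg.
  rewrite /tau; have [e1|n1] := eqVneq k.1 k'.1.
    have n2 : k.2 != k'.2 by apply: contraNneq kk => e2; apply/eqP; rewrite [k]surjective_pairing [k']surjective_pairing e1 e2.
    have : e <= `|g (X k') - g (X k)|.
      by apply: (far g (fun k => w k.2) v) => [j|]; [have [] := XP j|exact: w_sep].
    by move=> h; lra.
  have : e <= `|f (X k') - f (X k)|.
    by apply: (far f (fun k => w k.1) u) => [j|]; [have [] := XP j|exact: w_sep].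
  by move=> h; lra.
pose B := Num.truncn (V / e).
have phiB k : (Num.truncn (tau k / e) < B.+1)%N.
  by have /andP[h1 h2] := tauV k; rewrite ltnS; apply: le_truncn; rewrite ler_pM2r ?invr_gt0.
pose phi k : 'I_B.+1 := Ordinal (phiB k).
have phi_inj : injective phi.
  have main k k' : X k <= X k' -> phi k = phi k' -> k = k'.
    move=> xx [ee]; apply/eqP; apply: contraT => nk; have h := tau_sep k k' nk xx.
    have t0 k0 : 0 <= tau k0 / e by have /andP[h1 h2] := tauV k0; rewrite divr_ge0 // ltW.
    have /andP[a1 a2] := truncn_itv (t0 k); have /andP[b1 b2] := truncn_itv (t0 k').
    move: b2; rewrite -ee -natr1 => b2.
    have : 1 <= (tau k' - tau k) / e by rewrite ler_pdivlMr // mul1r.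
    by rewrite mulrBl => h'; lra.
  by move=> k k' kk; have [/main|/ltW/main h] := leP (X k) (X k'); [apply|apply/esym/h].
have := leq_card phi phi_inj; rewrite card_prod !card_ord -(ler_nat K) natrM -natr1.
have BV : B%:R <= V / e by rewrite /B; have /andP[] := truncn_itv (divr_ge0 V0 (ltW e0)).
have eV : V / e = N%:R * (6 * V / r) by rewrite /e; field; rewrite !gt_eqF.
have N1 : (1 : K) <= N%:R by rewrite ler1n.
have : N%:R * (6 * V / r + 1) < N%:R * N%:R :> K by rewrite ltr_pM2l.
by rewrite mulrDr -eV mulr1 => h1 h2; lra.
Qed.

(** The open interval is a countable union of compact ones, each of which contributes a
   nowhere dense piece; by Baire's theorem the pieces do not fill the half plane of
   positive abscissae. *)
Lemma curve_misses (f g : K -> K) : loc_rac a b f -> loc_rac a b g ->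
  exists p q, (p != 0) /\ forall x, I x -> ~ (f x = p /\ g x = q).
Proof.
move=> F G.
have denseT : dense (setT : set 'rV[K]_2) by move=> S [w Sw] _; exists w.
pose img c d : set 'rV[K]_2 := [set M | exists x, [/\ c <= x, x <= d, M 0 0 = f x & M 0 ord_max = g x]].
pose O n : set 'rV[K]_2 := if unpickle n is Some (p, q) then
  (if asbool (I (ratr p) /\ I (ratr q) /\ (ratr p : K) <= ratr q) then ~` closure (img (ratr p) (ratr q)) else setT)
  else setT.
have odO : forall n, open (O n) /\ dense (O n).
  move=> n; rewrite /O; case: (unpickle n) => [[p q]|]; last by split; [exact: openT|exact: denseT].
  case: asboolP => [[Ip [Iq pq]]|_]; last by split; [exact: openT|exact: denseT].
  split; first by apply: closed_openC; exact: closed_closure.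
  move=> S [w Sw] oS; have : nbhs w S by exact: open_nbhs_nbhs.
  move=> /nbhs_ballP[r r0 rS].
  have [p' [q' [e [h1 h2 e0 H]]]] := rectifiable_not_dense (w 0 0) (w 0 ord_max) pq (F _ _ Ip Iq) (G _ _ Ip Iq) r0.
  exists (\row_j (if j == 0 then p' else q')); split.
    apply: rS; split=> [|i j]; first exact: r0.
    rewrite !mxE; case: ifP => [/eqP ->|j0].
      by rewrite /ball /= (ord1 i) distrC.
    have -> : j = ord_max by apply/val_inj; move: j0; case: j => [[|[|]]].
    by rewrite /ball /= (ord1 i) distrC.
  move=> /(_ (ball (\row_j (if j == 0 then p' else q')) e)) [].
    exact: nbhsx_ballx.
  move=> M [[x [px xq M0 M1]] bM]; apply: (H x px xq).
  have [_ bM'] := bM; have := bM' 0 0; have := bM' 0 ord_max; rewrite !mxE /= /ball /= M0 M1 => g1 g2.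
  by split; rewrite distrC.
have := @Baire K 'rV[K]_2 O odO [set M | 0 < M 0 0].
case.
- by exists (const_mx 1); rewrite /= mxE.
- rewrite openE => M /= M0; apply/nbhs_ballP; exists (M 0 0) => //= M' [_ /(_ 0 0)].
  by rewrite /ball /= => h; rewrite ltNge; apply/negP => h'; move: h; rewrite ger0_norm; lra.
move=> M [/= M0 OM]; exists (M 0 0), (M 0 ord_max); split; first by rewrite gt_eqF.
move=> x Ix [fx gx].
have [c Ic cx] := oint_left Ix; have [d Id xd] := oint_right Ix.
have [p] := rat_in_itvoo cx; rewrite in_itv /= => /andP[cp px].
have [q] := rat_in_itvoo xd; rewrite in_itv /= => /andP[xq qd].
have Ip : I (ratr p) := oint_conv Ic Ix (ltW cp) (ltW px).
have Iq : I (ratr q) := oint_conv Ix Id (ltW xq) (ltW qd).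
have := OM (pickle (p, q)) Logic.I; rewrite /O pickleK.
case: asboolP => [_|[]]; last by split => //; split => //; apply: ltW; exact: lt_trans xq.
by apply; apply: subset_closure; exists x; split => //; exact: ltW.
Qed.
End curve.

(** * Square integrability near the left endpoint *)
Section energy.
Variable K : realType.
Variable m : nat.
Variables a b : \bar K.
Notation I := (oint a b).
Notation C := (cplx K).
Variables P Q R : K -> 'M[C]_m.
Hypothesis hPQR : coefficients a b P Q R.
Local Open Scope sesquilinear_scope.

(** The density of the squared norm, or of the Gram matrix of the columns. *)
Definition dens n (y : K -> 'M[C]_(m, n)) x := (y x) ^t* *m R x *m y x.

Lemma dens_loc n (y : K -> 'M[C]_(m, n)) : mcac a b y -> mloc a b (dens y).
Proof. move=> h; exact: (mlocMr (mlocMl (mcac_ct h) (R_loc hPQR)) h). Qed.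

(** Square integrability near [a], expressed by a primitive of the density. *)
Definition L2a (y : K -> 'cV[C]_m) := exists X : K -> 'M[C]_1, exists M : K,
  mprim a b X (dens y) /\ forall x, I x -> - reC (X x 0 0) <= M.

Lemma mx00Z (A B : 'M[C]_1) k : (k *: A - B) 0 0 = k * A 0 0 - B 0 0.
Proof. by rewrite mxE [X in X + _]mxE [X in _ + X]mxE. Qed.
Lemma mx00D (A B : 'M[C]_1) : (A + B) 0 0 = A 0 0 + B 0 0.
Proof. by rewrite mxE. Qed.
Lemma realC2 : realC 2 = 2 :> C. Proof. exact: (@realCD K 1 1). Qed.

Lemma dens_qf n (y : K -> 'M[C]_(m, n)) x v : qf (dens y x) v = qf (R x) (y x *m v).
Proof. by rewrite /qf /dens ctM !mulmxA. Qed.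

(** The densities are nonnegative. *)
Lemma energy_mono n (y : K -> 'M[C]_(m, n)) X v c d : mprim a b X (dens y) -> I c -> I d -> c <= d ->
  qf (X c) v <= qf (X d) v.
Proof.
move=> hX Ic Id cd; have h := mprimMr v (mprimMl (v ^t*) hX).
apply: (@cprim_le _ a b _ _ c d (h 0 0) Ic Id cd).
apply: ae_mono (ae_coef hPQR) => x hx /andP[cx xd].
have Ix := oint_conv Ic Id (ltW cx) (ltW xd); have [_ pR _] := hx Ix.
by rewrite -/(qf (dens y x) v) dens_qf; exact: qf_ge0.
Qed.

(** A consequence of the parallelogram identity. *)
Lemma parallelogram (A : 'M[C]_m) u v : posdef A -> qf A (u + v) <= 2 * (qf A u + qf A v).
Proof.
move=> pA; rewrite -subr_ge0; have := qf_ge0 (u - v) pA.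
rewrite !qfE !(sfDl, sfDr, sfNl, sfNr); move: (sf A u u) (sf A u v) (sf A v u) (sf A v v) => p q r s.
by rewrite [X in _ -> 0 <= X](_ : _ = p - q + (- r - - s)) //; ring.
Qed.

Lemma L2a_near y X c (M : K) : mprim a b X (dens y) -> I c ->
  (forall x, I x -> x <= c -> - reC (X x 0 0) <= M) -> L2a y.
Proof.
move=> hX Ic hM; exists X, M; split => // x Ix; have [xc|/ltW cx] := leP x c; first exact: hM.
apply: le_trans (hM c Ic (lexx c)); rewrite lerN2.
have := energy_mono (1%:M : 'cV_1) hX Ic Ix cx.
by rewrite /qf ct1 !mul1mx !mulmx1 lecP => /andP[_].
Qed.

Lemma L2a_eq (y y' : K -> 'cV[C]_m) : L2a y -> (forall x, I x -> y x = y' x) -> L2a y'.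
Proof.
move=> [X [M [h hM]]] e; exists X, M; split => //.
by apply: (mprim_ae h); apply: ae_always => x Ix; rewrite /dens e.
Qed.

(** A density dominated by those of square integrable functions is itself integrable. *)
Lemma L2a_dom (k : K) (y z w : K -> 'cV[C]_m) : mcac a b w -> L2a y -> L2a z ->
  (forall x, I x -> posdef (R x) -> dens w x 0 0 <= realC k * (dens y x 0 0 + dens z x 0 0)) ->
  0 <= k -> L2a w.
Proof.
move=> cw [X [M [hX hM]]] [Z [N [hZ hN]]] le k0.
have [[e Ie]|nI] := pselect (exists e, I e); last first.
  exists (fun=> 0), 0; split=> [|x Ix]; last by case: nI; exists x.
  by move=> i j; split => c d Ic; case: nI; exists c.
have hT := mprimfP Ie (dens_loc cw); move: (mprimf e _) (mprimf0 e (dens w)) hT => T T0 hT.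
apply: (@L2a_near _ T e (k * (reC (X e 0 0) + reC (Z e 0 0) + M + N)) hT Ie) => x Ix xe.
have h := mprimD (mprimZ (realC k) (mprimD hX hZ)) (mprimN hT).
have : (realC k *: (X x + Z x) - T x) 0 0 <= (realC k *: (X e + Z e) - T e) 0 0.
  apply: (@cprim_le _ a b _ _ x e (h 0 0) Ix Ie xe).
  apply: ae_mono (ae_coef hPQR) => s hs /andP[xs se].
  have Is := oint_conv Ix Ie (ltW xs) (ltW se); have [_ pR _] := hs Is.
  rewrite mx00Z mx00D subr_ge0; exact: le.
rewrite !mx00Z !mx00D T0 [(0 : 'M[C]_1) 0 0]mxE subr0 lecP !reimE => /andP[_].
have := hM x Ix; have := hN x Ix; rewrite !mul0r !subr0.
move: (reC (X x 0 0)) (reC (X e 0 0)) (reC (Z x 0 0)) (reC (Z e 0 0)) (reC (T x 0 0)) => p q r s t h1 h2 h3.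
have : 0 <= k * ((p + M) + (r + N)) by apply: mulr_ge0 => //; lra.
rewrite mulrDr mulrDr mulrDr mulrDr !mulrDr; lra.
Qed.

Lemma L2aD (y z : K -> 'cV[C]_m) : mcac a b y -> mcac a b z -> L2a y -> L2a z -> L2a (fun x => y x + z x).
Proof.
move=> cy cz ly lz.
have cyz : mcac a b (fun x => y x + z x) by move=> i j; apply: cac_eq (cacD (cy i j) (cz i j)) _ => x; rewrite mxE.
apply: (L2a_dom (k := 2) cyz ly lz) => // x Ix pR.
by have := parallelogram (y x) (z x) pR; rewrite realC2.
Qed.

Lemma L2aZ (y : K -> 'cV[C]_m) k : mcac a b y -> L2a y -> L2a (fun x => k *: y x).
Proof.
move=> cy ly.
have cky : mcac a b (fun x => k *: y x) by move=> i j; apply: cac_eq (cacM (cac_cst _ _ k) (cy i j)) _ => x; rewrite mxE.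
have kE : k^* * k = realC (reC k ^+ 2 + imC k ^+ 2) by apply: cplx_eq; rewrite !reimE; ring.
have k0 : 0 <= reC k ^+ 2 + imC k ^+ 2 by rewrite addr_ge0 // sqr_ge0.
apply: (L2a_dom (k := reC k ^+ 2 + imC k ^+ 2) cky ly ly) => // x Ix pR.
have q0 : 0 <= dens y x 0 0 by exact: qf_ge0.
rewrite -kE (_ : dens _ x 0 0 = k^* * k * dens y x 0 0); last first.
  by rewrite /dens ctZ -!scalemxAl -scalemxAr scalerA mxE.
by rewrite kE ler_wpM2l ?lerDl // -realC0 realC_le.
Qed.

Lemma dens_cmeas n (y : K -> 'M[C]_(m, n)) : mcac a b y -> mx_measurable I (dens y).
Proof.
move=> cy; have my : mx_measurable I y by move=> i j; exact: cac_cmeas.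
have [[_ _ mR] _ _ _] := hPQR.
exact: (mmeasM (mmeasM (mmeas_ct my) mR) my).
Qed.

Lemma exhaust c : I c -> exists d : nat -> K,
  [/\ forall n, I (d n), forall n, d n < c, nonincreasing_seq d &
      forall x, I x -> exists n, d n <= x].
Proof.
move=> Ic; have Ic' := Ic; case/andP: Ic' => ac cb.
have Ib x : x < c -> (x%:E < b)%E by move=> xc; apply: lt_trans cb; rewrite lte_fin.
rewrite /oint in Ic *; case: (a) ac => [r|//|] ac.
- rewrite lte_fin in ac; exists (fun n => r + (c - r) / n.+2%:R).
  have cr : 0 < c - r by rewrite subr_gt0.
  have dlt n : r + (c - r) / n.+2%:R < c.
    by rewrite -ltrBrDl ltr_pdivrMr ?ltr0n // ltr_pMr // ltr1n.
  have dgt n : (r%:E < (r + (c - r) / n.+2%:R)%:E)%E by rewrite lte_fin ltrDl divr_gt0 ?ltr0n.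
  split.
  + by move=> n; rewrite /mkset dgt Ib.
  + exact: dlt.
  + by move=> n k nk; rewrite lerD2l ler_wpM2l ?(ltW cr) // lef_pV2 ?posrE ?ltr0n // ler_nat.
  + move=> x /andP[rx _]; rewrite lte_fin in rx; exists (Num.truncn ((c - r) / (x - r))).
    have xr : 0 < x - r by rewrite subr_gt0.
    rewrite -lerBrDl ler_pdivrMr ?ltr0n // mulrC -ler_pdivrMr //.
    by apply: ltW; apply: lt_trans (truncnS_gt _) _; rewrite ltr_nat.
- exists (fun n => c - n.+1%:R).
  have dlt n : c - n.+1%:R < c by rewrite ltrBlDr ltrDl ltr0n.
  split.
  + by move=> n; rewrite /mkset ltNyr Ib.
  + exact: dlt.
  + by move=> n k nk; rewrite lerD2l lerN2 ler_nat.
  + by move=> x _; exists (Num.truncn (c - x)); rewrite lerBlDr -lerBlDl; apply/ltW/truncnS_gt.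
Qed.

(** Monotone convergence along an exhaustion of the interval. *)
Lemma L2a_integrable (y : K -> 'cV[C]_m) c : mcac a b y -> L2a y -> I c ->
  rintg (oint a c%:E) (fun x => reC (dens y x 0 0)).
Proof.
move=> cy [X [M [hX hM]]] Ic; pose h x := reC (dens y x 0 0).
have sub x : oint a c%:E x -> I x.
  move=> /andP[ax]; rewrite lte_fin => xc; apply/andP; split => //.
  by move: Ic => /andP[_]; apply: lt_trans; rewrite lte_fin.
have [mh _] := dens_cmeas cy 0 0.
have mhD : measurable_fun (oint a c%:E : set (lebT K)) (h : lebT K -> K).
  by apply: (measurable_funS (@oint_meas _ a b)) mh.
have [d [Id dc dmono dex]] := exhaust Ic.
pose F n : set (lebT K) := `[d n, c[%classic.
have FD n x : F n x -> oint a c%:E x.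
  rewrite /F /= in_itv /= => /andP[dx xc]; apply/andP; split; last by rewrite lte_fin.
  by have /andP[ad _] := Id n; apply: lt_le_trans ad _; rewrite lee_fin.
have mF n : measurable (F n) by apply: measurable_leb; exact: measurable_itv.
have nF : nondecreasing_seq F.
  move=> n k nk; apply/subsetPset => x; rewrite /F /= !in_itv /= => /andP[dx ->].
  by rewrite andbT; apply: le_trans dx; exact: dmono.
have UF : \bigcup_n F n = oint a c%:E.
  apply/seteqP; split=> [x [n _ /FD]//|x Dx]; have [n dx] := dex x (sub x Dx).
  by exists n => //; rewrite /F /= in_itv /= dx; move: Dx => /andP[_]; rewrite lte_fin.
have [hre _] := hX 0 0.
apply/integrableP; split; first exact/measurable_EFinP.
pose g x : \bar K := (`|h x|)%:E.
have mg n : measurable_fun (F n) (g : lebT K -> \bar K).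
  apply/measurable_EFinP; apply: (measurable_funS (@oint_meas _ a c%:E) (FD n)).
  by apply: (rmeas_comp mhD); exact: norm_continuous.
have g0 n x : F n x -> (0 <= g x)%E by move=> _; rewrite lee_fin.
have := ge0_nondecreasing_set_cvg_integral (mu := leb) nF mF mg g0.
rewrite UF => cv.
apply: (@le_lt_trans _ _ (reC (X c 0 0) + M)%:E); last exact: ltry.
have -> : (\int[leb]_(x in (oint a c%:E : set (lebT K))) `|(h x)%:E| =
    \int[leb]_(x in (oint a c%:E : set (lebT K))) g x)%E by [].
rewrite -(cvg_lim _ cv) //; apply: lime_le; first by apply/cvg_ex; eexists; exact: cv.
apply: nearW => n.
have [hi hE] := hre _ _ (Id n) Ic (ltW (dc n)).
have ni : rintg `[d n, c] (fun x => `|h x|) := integrable_norm hi.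
apply: (@le_trans _ _ (\int[leb]_(x in (`[d n, c]%classic : set (lebT K))) g x)%E).
  apply: ge0_subset_integral => //; first exact: measurable_itvl.
  - exact: (measurable_int leb ni).
  - by move=> x _; rewrite lee_fin.
  - by move=> x; rewrite /F /= !in_itv /= => /andP[-> /ltW ->].
have -> : (\int[leb]_(x in (`[d n, c]%classic : set (lebT K))) g x)%E = (rint (d n) c (fun x => `|h x|))%:E.
  by rewrite /rint /Rintegral fineK //; apply: integrable_fin_num => //; exact: measurable_itvl.
have [_ ->] : rintg `[d n, c] (fun x => `|h x|) /\ rint (d n) c (fun x => `|h x|) = rint (d n) c h.
  apply: rint_ae => //; apply: ae_mono (ae_coef hPQR) => x hx /andP[dx xc].
  have Ix := oint_conv (Id n) Ic (ltW dx) (ltW xc); have [_ pR _] := hx Ix.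
  have : 0 <= dens y x 0 0 by exact: qf_ge0.
  by rewrite lecP => /andP[_ ?]; rewrite ger0_norm.
rewrite lee_fin -hE lerD2l; exact: hM.
Qed.

(** Cauchy's inequality, up to a constant; off-diagonal densities are integrable once
   the diagonal ones are. *)
Lemma sf_bound (A : 'M[C]_m) u v : posdef A -> n1 (sf A u v) <= reC (qf A u) + reC (qf A v).
Proof.
move=> pA; have [hA _] := pA; have vu : sf A v u = (sf A u v)^* by rewrite sf_herm.
have key (s t : K) : 0 <= reC (qf A u) + (s ^+ 2 + t ^+ 2) * reC (qf A v)
    + 2 * (s * reC (sf A u v) - t * imC (sf A u v)).
  have := qf_ge0 (u + mkC s t *: v) pA; have := qf_ge0 v pA.
  rewrite !qfE !(sfDl, sfDr, sfZl, sfZr) vu.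
  move: (sf _ u u) (sf _ v v) (sf _ u v) => p q r; rewrite !lecP !reimE => /andP[/eqP q0 _] /andP[_].
  rewrite q0; move: (reC p) (reC q) (reC r) (imC r) => p1 q1 r1 r2 h; apply: le_trans h _.
  by rewrite le_eqVlt; apply/orP; left; apply/eqP; ring.
have := key 1 0; have := key (-1) 0; have := key 0 1; have := key 0 (-1).
rewrite /n1 !qfE; move: (sf A u v) (sf A u u) (sf A v v) => p q r.
move: (reC p) (imC p) (reC q) (reC r) => p1 p2 q1 r1.
by case: (ger0P p1) => _; case: (ger0P p2) => _ *; lra.
Qed.

Lemma dens_entry (Y : K -> 'M[C]_m) i j x : posdef (R x) ->
  n1 (dens Y x i j) <= reC (dens (fun x => Y x *m (delta_mx i 0 : 'cV[C]_m)) x 0 0) +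
     reC (dens (fun x => Y x *m (delta_mx j 0 : 'cV[C]_m)) x 0 0).
Proof.
move=> pR; have := sf_bound (Y x *m delta_mx i 0) (Y x *m delta_mx j 0) pR.
rewrite -[dens Y x i j]sf_delta => h; apply: le_trans h; rewrite le_eqVlt; apply/orP; left; apply/eqP.
by rewrite /sf /dens ctM !mulmxA.
Qed.

Lemma sq_integrable_of_L2a (Y : K -> 'M[C]_m) c : mcac a b Y -> I c ->
  (forall v, L2a (fun x => Y x *m v)) -> sq_integrable R (oint a c%:E) Y.
Proof.
move=> cY Ic hY i j.
have sub x : oint a c%:E x -> I x.
  move=> /andP[ax]; rewrite lte_fin => xc; apply/andP; split => //.
  by move: Ic => /andP[_]; apply: lt_trans; rewrite lte_fin.
have cYv (v : 'cV[C]_m) : mcac a b (fun x => Y x *m v).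
  by apply: mcacM => //; exact: mprim_mcac (mprim_cst _ _ v).
have hi k := L2a_integrable (cYv (delta_mx k 0)) (hY (delta_mx k 0)) Ic.
have hs := integrableD (@oint_meas _ a c%:E) (hi i) (hi j).
have [m1 m2] := dens_cmeas cY i j.
have mS : measurable (oint a c%:E : set (lebT K)) := @oint_meas _ a c%:E.
pose g x := reC (dens (fun x => Y x *m (delta_mx i 0 : 'cV[C]_m)) x 0 0) + reC (dens (fun x => Y x *m (delta_mx j 0 : 'cV[C]_m)) x 0 0).
have gi : rintg (oint a c%:E) g by exact: hs.
have dom (f : K -> K) : measurable_fun (I : set (lebT K)) (f : lebT K -> K) ->
   (forall x, I x -> posdef (R x) -> `|f x| <= g x) -> rintg (oint a c%:E) f.
  move=> mf fg.
  pose f' x := if `|f x| <= g x then f x else 0.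
  have ff : {ae leb, forall x : lebT K, oint a c%:E x -> f x = f' x}.
    apply: ae_mono (ae_coef hPQR) => x hx Dx; have [_ pR _] := hx (sub x Dx).
    by rewrite /f' fg //; exact: sub.
  have ff' : {ae leb, forall x : lebT K, oint a c%:E x -> f' x = f x} by apply: ae_mono ff => x h Dx; rewrite h.
  apply: (rintg_ae mS ff').
  have mfD : measurable_fun (oint a c%:E : set (lebT K)) (f : lebT K -> K).
    exact: (measurable_funS (@oint_meas _ a b) sub mf).
  apply: (@le_integrable _ _ K leb _ mS _ (fun x : lebT K => (g x)%:E)) gi.
    exact/measurable_EFinP/(rmeas_ae mfD ff).
  move=> x _; rewrite /= lee_fin /f'; case: ifP => h; last by rewrite normr0.
  exact: le_trans h (ler_norm _).
have bnd x : I x -> posdef (R x) -> n1 (dens Y x i j) <= g x by move=> _; exact: dens_entry.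
by split; apply: dom => // x Ix pR; apply: le_trans (bnd x Ix pR); [exact: n1_re|exact: n1_im].
Qed.

Lemma L2a_of_sq_integrable (Y : K -> 'M[C]_m) c v : mcac a b Y -> I c ->
  sq_integrable R (oint a c%:E) Y -> L2a (fun x => Y x *m v).
Proof.
move=> cY Ic hY; have [c' Ic' cc'] := oint_left Ic.
have hX := mprimfP Ic' (dens_loc cY); move: (mprimf c' _) (mprimf0 c' (dens Y)) hX => X X0 hX.
have bound (f h : K -> K) : rprim a b f h -> f c' = 0 -> rintg (oint a c%:E) h ->
    exists M : K, forall x, I x -> x <= c' -> `|f x| <= M.
  move=> hf f0 hi; exists (\int[leb]_(x in (oint a c%:E : set (lebT K))) `|h x|) => x Ix xc.
  have [hxi hE] := hf x c' Ix Ic' xc.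
  rewrite -normrN -sub0r -f0 hE; apply: (le_trans (le_normr_Rintegral (measurable_itvl x c') hxi)).
  have ni := integrable_norm hi; have nxi := integrable_norm hxi.
  have mS : measurable (oint a c%:E : set (lebT K)) := @oint_meas _ a c%:E.
  rewrite /Rintegral fine_le //.
  - by apply: integrable_fin_num => //; exact: measurable_itvl.
  - by apply: integrable_fin_num.
  apply: ge0_subset_integral; [exact: measurable_itvl|exact: mS|exact: (measurable_int leb ni)|by move=> s _; rewrite lee_fin|].
  move=> s; rewrite /= in_itv /= => /andP[xs sc]; apply/andP; split.
    by move: Ix => /andP[ax _]; apply: lt_le_trans ax _; rewrite lee_fin.
  by rewrite lte_fin; exact: le_lt_trans cc'.
have bnd i j : exists M : K, forall x, I x -> x <= c' -> n1 (X x i j) <= M.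
  have [h1 h2] := hX i j; have [i1 i2] := hY i j.
  have [|M1 H1] := bound _ _ h1 _ i1; first by rewrite X0 mxE.
  have [|M2 H2] := bound _ _ h2 _ i2; first by rewrite X0 mxE.
  by exists (M1 + M2) => x Ix xc; apply: lerD; [exact: H1|exact: H2].
have [M HM] := choice (fun ij => bnd ij.1 ij.2).
have h := mprimMr v (mprimMl (v ^t*) hX).
apply: (@L2a_near _ (fun x => v ^t* *m X x *m v) c' (\sum_j (\sum_i n1 (v i 0) * M (i, j)) * n1 (v j 0)) _ Ic').
  by apply: (mprim_eq h) => // x; rewrite /dens ctM !mulmxA.
move=> x Ix xc; apply: (le_trans (ler_norm _)); rewrite normrN; apply: le_trans (n1_re _) _.
rewrite mxE; apply: le_trans (n1_sum _ _ _) _; apply: ler_sum => j _.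
apply: le_trans (n1M _ _) _; apply: ler_wpM2r; first exact: n1_ge0.
rewrite mxE; apply: le_trans (n1_sum _ _ _) _; apply: ler_sum => i _.
apply: le_trans (n1M _ _) _; rewrite ctE n1_conj; apply: ler_wpM2l; first exact: n1_ge0.
exact: (HM (i, j)).
Qed.
End energy.

(** * The limit point case *)
Section limit_point.
Variable K : realType.
Variable m : nat.
Hypothesis hm : (0 < m)%N.
Variables a b : \bar K.
Notation I := (oint a b).
Notation C := (cplx K).
Variables P Q R : K -> 'M[C]_m.
Hypothesis hPQR : coefficients a b P Q R.
Hypothesis lp : limit_point_a a b P Q R.
Local Open Scope sesquilinear_scope.

Lemma dens_Mr n (y : K -> 'M[C]_(m, n)) (v : 'cV[C]_n) :
  dens R (fun t => y t *m v) = fun t => v ^t* *m dens R y t *m v.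
Proof. by apply/funext => t; rewrite /dens ctM !mulmxA. Qed.

Lemma qf1 (A : 'M[C]_1) : qf A (1%:M : 'cV_1) = A 0 0.
Proof. by rewrite /qf ct1 mul1mx mulmx1. Qed.

Lemma wr_diff n p z z' (U W : K -> 'M[C]_(m, n)) (V Z : K -> 'M[C]_(m, p)) X c x :
  sol a b P Q R z U W -> sol a b P Q R z' V Z ->
  mprim a b X (fun x => (U x) ^t* *m R x *m V x) -> I c -> I x ->
  wr U W V Z x - wr U W V Z c = (z^* - z') *: (X x - X c).
Proof.
move=> hU hV hX Ic Ix; have h := wr_prim hPQR hU hV; move: (z^* - z') h => k h.
have h1 := mprimD h (mprimN (mprimZ k hX)).
have h0 : mprim a b (fun t => wr U W V Z t - k *: X t) (fun=> 0).
  by apply: (mprim_eq h1) => // t; rewrite subrr.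
have := mprim0_cst h0 Ix Ic; move: (wr _ _ _ _ x) (wr _ _ _ _ c) (X x) (X c) => p1 p2 q1 q2 e.
rewrite scalerBr; apply/eqP; rewrite subr_eq; apply/eqP.
by rewrite -[p1](subrK (k *: q1)) e addrC -addrA; congr (_ + _); rewrite addrC.
Qed.

(** Otherwise the rank one perturbation [U + k y e_j^T] of a Weyl solution [U] would be a
    second one, not proportional to [U]: it is invertible as soon as the coordinate [f] of
    [y] in the frame [U] avoids [- k^-1], and the rectifiable curve [f] avoids some value. *)
Lemma limit_point_zero (z : C) (y w : K -> 'cV[C]_m) c x : imC z != 0 ->
  sol a b P Q R z y w -> L2a a b R y -> I c -> y c = 0 -> I x -> y x = 0.
Proof.
move=> z0 hy ly Ic yc Ix; have [c0 Ic0 [U [[W hW] uU sU] uniq]] := lp z0.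
have hU := sol_of_solution hPQR hW; have cU := mprim_mcac hU.1; have cy := mprim_mcac hy.1.
pose f x := invmx (U x) *m y x; pose j : 'I_m := Ordinal hm.
have cf : mcac a b f by apply: mcacM => //; exact: mcacV.
have [h1 h2] := cf j 0.
(* The coordinate [f] omits a nonzero value; with [k] minus its inverse, [1 + k f] has
   no zero. *)
have [p [q [p0 pq]]] := curve_misses h1 h2.
have k0 : mkC p q != 0 :> C by apply: contra p0 => /eqP/(congr1 (@reC K))/eqP.
pose k := - (mkC p q : C)^-1; pose N : 'M[C]_(1, m) := k *: delta_mx 0 j.
have kN0 : k != 0 by rewrite oppr_eq0 invr_eq0.
have hV := solD hU (solMr N hy).
have cV := mprim_mcac hV.1.
have uV t : I t -> U t + y t *m N \in unitmx.
  move=> It; apply: unitmx_inj => v.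
  have -> : (U t + y t *m N) *m v = U t *m (v + f t *m (N *m v)).
    by rewrite mulmxDl mulmxDr /f !mulmxA mulmxV ?mul1mx // uU.
  move=> /(congr1 (mulmx (invmx (U t)))); rewrite mulmx0 mulKmx ?uU //.
  have Nv : N *m v = (k * v j 0)%:M by rewrite -scalemxAl -rowE [row j v]mx11_scalar mxE scale_scalar_mx.
  rewrite Nv mul_mx_scalar => e.
  have := congr1 (fun M : 'cV_m => M j 0) e; rewrite mxE [X in _ + X]mxE [RHS]mxE.
  rewrite mulrAC -[X in X + _]mul1r -mulrDl => /eqP.
  rewrite mulf_eq0 => /orP[e1|/eqP vj]; last by rewrite vj mulr0 scale0r addr0 in e.
  case: (pq t It); rewrite (_ : f t j 0 = mkC p q) //; apply/eqP.
  apply/eqP/(mulfI kN0); move: e1; rewrite addrC addr_eq0 => /eqP ->.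
  by rewrite /k mulNr mulVf.
have wV : weyl_solution a b P Q R z (oint a c0%:E) (fun t => U t + y t *m N).
  split; [by eexists; exact: (solution_of_sol hPQR hV)|exact: uV|].
  apply: (sq_integrable_of_L2a hPQR cV Ic0) => v.
  have lU := L2a_of_sq_integrable hPQR v cU Ic0 sU.
  have cUv : mcac a b (fun t => U t *m v) by apply: mcacM => //; exact: mprim_mcac (mprim_cst _ _ v).
  have cyk : mcac a b (fun t => (N *m v) 0 0 *: y t).
    by move=> i i'; apply: cac_eq (cacM (cac_cst _ _ _) (cy i i')) _ => t; rewrite mxE.
  apply: L2a_eq (L2aD hPQR cUv cyk lU (L2aZ hPQR _ cy ly)) _ => t It.
  by rewrite mulmxDl -mulmxA [N *m v]mx11_scalar mul_mx_scalar mxE eqxx mulr1n.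
have [M _ VM] := uniq _ wV.
have M1 : M = 1%:M.
  by have := VM c Ic; rewrite yc mul0mx addr0 => e; rewrite -(mulKmx (uU c Ic) M) -e mulVmx // uU.
have := VM x Ix; rewrite M1 mulmx1 -[RHS]addr0 => /addrI.
have Nj : N *m delta_mx j 0 = k%:M.
  rewrite -scalemxAl mul_delta_mx -scalemx1; congr (_ *: _).
  by apply/matrixP => i i'; rewrite !ord1 !mxE.
move=> /(congr1 (fun M => M *m (delta_mx j 0 : 'cV_m))) /=; rewrite mul0mx -mulmxA Nj.
by rewrite mul_mx_scalar => /eqP; rewrite scaler_eq0 (negbTE kN0) => /eqP.
Qed.

Section nonreal.
Variables (l s : K).
Hypothesis s2 : s ^+ 2 = 1.
Variable z : C.
Hypothesis zE : z = mkC l s.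
Variable c : K.
Hypothesis Ic : I c.
Variables Th WT Y : K -> 'M[C]_m.
Hypothesis hT : sol a b P Q R z Th WT.
Hypothesis Tc : Th c = 0.
Hypothesis WTc : WT c = 1%:M.
Hypothesis hY : mprim a b Y (dens R Th).
Hypothesis Yc : Y c = 0.
Variable G : K -> 'M[C]_m.
Hypothesis GE : forall x, G x = - Y x.
Let s0 : s != 0. Proof. by apply: contraPneq s2 => ->; rewrite expr0n /=; apply/eqP; rewrite eq_sym oner_eq0. Qed.

Lemma dirichlet_gram_posdef x : I x -> x < c -> posdef (G x).
Proof.
move=> Ix xc; apply: posdefP => v v0.
have e1 : qf (G x) v = qf (Y c) v - qf (Y x) v by rewrite Yc GE !qfE -sf_sub sub0r.
have le := energy_mono hPQR v hY Ix Ic (ltW xc).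
rewrite e1 lt_def subr_ge0 le andbT subr_eq0; apply/eqP => e.
have hX := mprimMr v (mprimMl (v ^t*) hY).
have hX' : mprim a b (fun t => v ^t* *m Y t *m v) (fun t => (Th t *m v) ^t* *m R t *m (Th t *m v)).
  by rewrite -/(dens R (fun t => Th t *m v)) dens_Mr.
have [] := sol_energy0 hPQR (solMr v hT) hX' Ix Ic xc _ Ic.
  by apply/matrixP => i j; rewrite !ord1.
by rewrite WTc mul1mx => _ v00; rewrite v00 eqxx in v0.
Qed.

(** Both sides have the same derivative and vanish at [c]. *)
Lemma dirichlet_gram_wr x : I x -> wr Th WT Th WT x = (realC (2 * s) * im K) *: G x.
Proof.
move=> Ix; have := wr_diff hT hT hY Ic Ix; rewrite Yc subr0 GE.
have -> : wr Th WT Th WT c = 0 by rewrite /wr Tc ct0 mul0mx mulmx0 subr0.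
have -> : z^* - z = - (realC (2 * s) * im K) by rewrite zE; apply: cplx_eq; rewrite !reimE; ring.
by rewrite subr0 scaleNr scalerN.
Qed.

(** The imaginary part of [z] excludes zeros besides [c]: the bracket of [Th v] with
   itself would vanish there. *)
Lemma dirichlet_unit x : I x -> x < c -> Th x \in unitmx.
Proof.
move=> Ix xc; apply: unitmx_inj => v Tv; apply: (qf_eq0 (dirichlet_gram_posdef Ix xc)).
have k0 : realC (2 * s) * im K != 0.
  apply/eqP => /(congr1 (@imC K)); rewrite !reimE => /eqP.
  by rewrite mul0r addr0 mulr1 mulf_eq0 (negbTE s0) orbF pnatr_eq0.
apply: (mulfI k0); rewrite mulr0.
have -> : realC (2 * s) * im K * qf (G x) v = (v ^t* *m wr Th WT Th WT x *m v) 0 0.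
  by rewrite dirichlet_gram_wr // -scalemxAr -scalemxAl mxE.
have -> : v ^t* *m wr Th WT Th WT x *m v = (Th x *m v) ^t* *m (WT x *m v) - (WT x *m v) ^t* *m (Th x *m v).
  by rewrite /wr mulmxBr mulmxBl !ctM !mulmxA.
by rewrite Tv ct0 mul0mx mulmx0 subrr mxE.
Qed.

(** In the limit point case the Gram matrices grow in all directions: otherwise the
   limit [B] of their inverses would give a solution [Th B v] of bounded norm that
   vanishes at [c]. *)
Lemma dirichlet_gram_inv : mcvg (to_a a) (fun x => invmx (G x)) 0.
Proof.
have mG x y v : I x -> x <= y -> y < c -> qf (G y) v <= qf (G x) v.
  move=> Ix xy yc; have Iy := oint_conv Ix Ic xy (ltW yc).
  have := energy_mono hPQR v hY Ix Iy xy.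
  have e t : qf (G t) v = - qf (Y t) v by rewrite !qfE GE /sf mulmxN mulNmx mxE.
  by rewrite !e lerN2.
have [B [hB cB _ bB]] := monotone_inverse Ic dirichlet_gram_posdef mG.
suff -> : (0 : 'M[C]_m) = B by [].
apply/esym/qf0_mx0 => v; suff -> : qf B v = 0 by [].
have hX := mprimMr (B *m v) (mprimMl ((B *m v) ^t*) hY).
have hX' : mprim a b (fun t => (B *m v) ^t* *m Y t *m (B *m v)) (dens R (fun t => Th t *m (B *m v))).
  by rewrite dens_Mr.
have pB : 0 <= qf B v.
  have [c' Ic' cc'] := oint_left Ic.
  by apply: le_trans (bB c' v Ic' cc'); exact: qf_ge0 (dirichlet_gram_posdef Ic' cc').
have ly : L2a a b R (fun t => Th t *m (B *m v)).
  apply: (L2a_near hPQR hX' (M := reC (qf B v)) Ic) => x Ix; rewrite le_eqVlt => /orP[/eqP ->|xc].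
    rewrite Yc mulmx0 mul0mx mxE !reimE oppr0.
    by move: pB; rewrite lecP => /andP[_].
  have := bB x v Ix xc; rewrite lecP => /andP[_].
  by rewrite [qf (G x) _]/qf GE mulmxN mulNmx mxE reimE.
have zi : imC z != 0 by rewrite zE.
have y0 x : I x -> Th x *m (B *m v) = 0.
  by apply: (limit_point_zero zi (solMr (B *m v) hT) ly Ic); rewrite Tc mul0mx.
have [c' Ic' cc'] := oint_left Ic.
have hX0 : mprim a b (fun=> 0) (fun t => (Th t *m (B *m v)) ^t* *m R t *m (Th t *m (B *m v))).
  apply: (mprim_ae (mprim_cst _ _ 0)); apply: ae_always => t It; by rewrite y0 // mulmx0.
have [_] := sol_energy0 hPQR (solMr (B *m v) hT) hX0 Ic' Ic cc' erefl Ic.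
by rewrite WTc mul1mx => e; rewrite /qf -mulmxA e mulmx0 mxE.
Qed.

(** Correct [f] by the solution [y] at [z] with [y c = 0] and [y d = - f d]. Lagrange's
    identity for the pair expresses the bracket of [f] by the norm of [y] and by terms which
    this norm and that of [f] control. *)
Lemma self_bracket_bound (f wf : K -> 'cV[C]_m) (X : K -> 'M[C]_1) N :
  sol a b P Q R (realC l) f wf -> mprim a b X (dens R f) ->
  (forall x, I x -> x <= c -> reC (X c 0 0) - reC (X x 0 0) <= N) ->
  s * imC (wr f wf f wf c 0 0) <= N.
Proof.
move=> hf hX hN.
have [c' Ic' cc'] := oint_left Ic.
suff key x : I x -> x < c -> s * imC (wr f wf f wf c 0 0) <= N + reC (qf (invmx (G x)) (f c)).
  rewrite -subr_le0 -realC_le realC0.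
  have cst n p (M : 'M[C]_(n, p)) : mcvg (to_a a) (fun=> M) M.
    by move=> i j; have PF := to_a_proper a; exact: cvg_cst.
  have PF := to_a_proper a.
  have h : mcvg (to_a a) (fun x => (f c) ^t* *m invmx (G x) *m f c) ((f c) ^t* *m 0 *m f c).
    exact: (mcvgM (mcvgM (cst _ _ ((f c) ^t*)) dirichlet_gram_inv) (cst _ _ (f c))).
  have h0 := h 0 0; rewrite mulmx0 mul0mx [X in _ --> X]mxE in h0.
  apply: (cvgC_ge h0); apply: (to_aP Ic) => x Ix xc.
  rewrite -/(qf (invmx (G x)) (f c)).
  rewrite (qf_reC _ (posdef_inv (dirichlet_gram_posdef Ix xc))) realC_le.
  by have h1 := key x Ix xc; move: (s * _) (reC _) h1 => p q *; lra.
move=> Ix xc; have uT := dirichlet_unit Ix xc.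
(* The correction: [f + y] vanishes at [x]. *)
have [al al_def] : exists al, Th x *m al = - f x.
  by exists (- (invmx (Th x) *m f x)); rewrite mulmxN mulKVmx.
have hy := solMr al hT.
pose y t := Th t *m al; pose wy t := WT t *m al.
have yx : y x = - f x := al_def.
have hF := mprimfP Ic (mlocMr (mlocMl (mcac_ct (mprim_mcac hf.1)) (R_loc hPQR)) (mprim_mcac hy.1)).
have F0 := mprimf0 c (fun t => (f t) ^t* *m R t *m (Th t *m al)).
move: (mprimf _ _) hF F0 => F hF F0.
have lim : (realC l)^* - z = - (realC s * im K) by rewrite realC_conj zE; apply: cplx_eq; rewrite !reimE; ring.
have sE : wr f wf y wy x = (f c) ^t* *m al - (realC s * im K) *: F x.
  have := wr_diff hf hy hF Ic Ix; rewrite -/y -/wy F0 subr0 lim.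
  have -> : wr f wf y wy c = (f c) ^t* *m al by rewrite /wr /y /wy Tc WTc mul0mx mul1mx mulmx0 subr0.
  by move=> /eqP; rewrite subr_eq scaleNr addrC => /eqP.
have tE : wr y wy y wy x = (realC (2 * s) * im K) *: (al ^t* *m G x *m al).
  have -> : wr y wy y wy x = al ^t* *m wr Th WT Th WT x *m al.
    by rewrite /wr /y /wy !ctM mulmxBr mulmxBl !mulmxA.
  by rewrite dirichlet_gram_wr // -scalemxAr -scalemxAl.
have kE : wr f wf f wf c = wr f wf f wf x by apply: (wr0 hPQR hf _ Ic Ix); rewrite realC_conj.
have rel : wr f wf y wy x - (wr f wf y wy x) ^t* = - wr y wy y wy x - wr f wf f wf x.
  rewrite /wr; move: (y x) (wy x) (f x) (wf x) yx => y1 y2 f1 f2 ->.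
  rewrite !ctB !ctM !ctK ctN !(mulNmx, mulmxN).
  move: (f1 ^t* *m y2) (y2 ^t* *m f1) (f2 ^t* *m f1) (f1 ^t* *m f2) => p q r t.
  by rewrite !opprK !opprD !opprK; rewrite addrACA [r - t]addrC.
(* The squared norm of [f + y] on [[x, c]] is nonnegative. *)
have mono : 0 <= (reC (X c 0 0) - reC (X x 0 0)) - 2 * reC (F x 0 0) + reC (qf (G x) al).
  have hYa := mprimMr al (mprimMl (al ^t*) hY).
  have hH := mprimD (mprimD hX hF) (mprimD (mprim_ct hF) hYa).
  have hH' : mprim a b (fun t => X t + F t + ((F t) ^t* + al ^t* *m Y t *m al)) (dens R (fun t => f t + y t)).
    apply: (mprim_ae hH); apply: ae_mono (ae_coef hPQR) => t ht It; have [_ [hR _] _] := ht It.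
    rewrite /dens ctD !(mulmxDl, mulmxDr) /y !ctM ctK hR !mulmxA.
    by rewrite -!addrA; congr (_ + _); rewrite addrCA.
  have := energy_mono hPQR (1%:M : 'cV_1) hH' Ix Ic (ltW xc).
  have -> : qf (G x) al = - (al ^t* *m Y x *m al) 0 0 by rewrite /qf GE mulmxN mulNmx mxE.
  have -> : al ^t* *m Y c *m al = 0 by rewrite Yc mulmx0 mul0mx.
  rewrite !qf1 F0 ct0 !addr0; move: (al ^t* *m Y x *m al) (X c) (X x) (F x) => p q r t.
  rewrite mxE [X in X + _ <= _]mxE [X in _ + X <= _]mxE ctE lecP !reimE => /andP[_].
  move: (reC (p 0 0)) (reC (q 0 0)) (reC (r 0 0)) (reC (t 0 0)) => *; lra.
(* Cauchy's inequality for [i s f c], as the product enters through its imaginary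
   part. *)
pose k := im K * realC s.
have yg := young al (k *: f c) (dirichlet_gram_posdef Ix xc) ltr01.
have kk : k^* * k = 1 by apply: cplx_eq; rewrite !reimE ?mulr0 ?mul0r; move: s2; rewrite expr2 => e; rewrite ?mul1r ?subr0 ?oppr0 ?add0r ?addr0 ?mulr0 ?mul0r ?mulN1r ?mulNr ?opprK; lra.
have e1 : qf (invmx (G x)) (k *: f c) = qf (invmx (G x)) (f c).
  by rewrite !qfE sfZl sfZr mulrA kk mul1r.
have e2 : reC (sf 1%:M (k *: f c) al) = s * imC (((f c) ^t* *m al) 0 0).
  rewrite sfZl /sf mulmx1; move: (((f c) ^t* *m al) 0 0) => p; rewrite !reimE; ring.
rewrite e1 e2 invr1 !mul1r in yg.
have hn := hN x Ix (ltW xc).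
have imrel : s * imC (wr f wf f wf c 0 0) =
    - 2 * (reC (qf (G x) al) + s * imC (((f c) ^t* *m al) 0 0) - reC (F x 0 0)).
  have := congr1 (fun M : 'M[C]_1 => imC (M 0 0)) rel; rewrite /= kE sE tE -/(qf _ _).
  move: (wr f wf f wf x) ((f c) ^t* *m al) => k0 fa.
  have -> : al ^t* *m G x *m al = (qf (G x) al)%:M by rewrite [LHS]mx11_scalar.
  move: (qf (G x) al) => g.
  have BE (A B : 'M[C]_1) : (A - B) 0 0 = A 0 0 - B 0 0 by rewrite mxE [X in _ + X]mxE.
  have NE (A : 'M[C]_1) : (- A) 0 0 = - A 0 0 by rewrite mxE.
  have ZE (r : C) (A : 'M[C]_1) : (r *: A) 0 0 = r * A 0 0 by rewrite mxE.
  rewrite !BE NE ctE !BE !ZE [(g%:M : 'M[C]_1) 0 0]mxE eqxx mulr1n; move: (fa 0 0) (F x 0 0) (k0 0 0) => p q r; rewrite !reimE.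
  move: (reC p) (imC p) (reC q) (imC q) (reC r) (imC r) (reC g) (imC g) => p1 p2 q1 q2 r1 r2 g1 g2 e.
  have e3 : r2 = - 2 * (s * g1 + p2 - s * q1) by lra.
  rewrite e3; transitivity (- 2 * (s ^+ 2 * g1 + s * p2 - s ^+ 2 * q1)); first by ring.
  by rewrite s2; ring.
rewrite imrel; have := ler_norm (- (s * imC (((f c) ^t* *m al) 0 0))); rewrite normrN.
move: mono yg hn; move: (s * imC _) (`|_|) (reC (qf (G x) al)) (reC (qf _ (f c))) (reC (F x 0 0)) => *.
lra.
Qed.
End nonreal.

Lemma L2a_small_tail (f : K -> 'cV[C]_m) X (M : K) c0 e : mprim a b X (dens R f) ->
  (forall x, I x -> - reC (X x 0 0) <= M) -> I c0 -> 0 < e ->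
  exists2 c, I c & forall x, I x -> x <= c -> reC (X c 0 0) - reC (X x 0 0) <= e.
Proof.
move=> hX hM I0 e0; pose q x := reC (X x 0 0).
have qM x y : I x -> x <= y -> y < c0 -> q x <= q y.
  move=> Ix xy yc; have Iy := oint_conv Ix I0 xy (ltW yc).
  by have := energy_mono hPQR (1%:M : 'cV_1) hX Ix Iy xy; rewrite !qf1 lecP => /andP[_].
have [L /cvgrPdist_lt cL leL] : exists2 L, q x @[x --> to_a a] --> L & forall x, I x -> x < c0 -> L <= q x.
  apply: (@to_a_mono K a b c0 q (- M) I0) => // x Ix _.
  by have := hM x Ix; rewrite /q; move: (reC _) => p; lra.
have [c [Ic cc qc]] := to_a_ex I0 (cL (to_a_proper a) e e0).
exists c => // x Ix xc; have h := leL x Ix (le_lt_trans xc cc).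
rewrite -/(q c) -/(q x).
have h2 := ler_norm (q c - L); rewrite distrC in h2; lra.
Qed.

(** [self_bracket_bound] holds at every [c] and for both signs of [s]; its right-hand
   side is the norm of [f] to the left of [c], hence arbitrarily small. *)
Lemma L2a_self_bracket l (f wf : K -> 'cV[C]_m) x : sol a b P Q R (realC l) f wf ->
  L2a a b R f -> I x -> wr f wf f wf x = 0.
Proof.
move=> hf [X [M [hX hM]]] Ix.
have bnd (s : K) : s ^+ 2 = 1 -> s * imC (wr f wf f wf x 0 0) <= 0.
  move=> s2; apply/ler_addgt0Pr => e e0; rewrite add0r.
  have [c Ic hc] := L2a_small_tail hX hM Ix e0.
  have -> : wr f wf f wf x = wr f wf f wf c by apply: (wr0 hPQR hf _ Ix Ic); rewrite realC_conj.
  have [Th [WT [hT Tc WTc]]] := sol_ex hPQR (mkC l s) (0 : 'M[C]_m) 1%:M Ic.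
  have hY := mprimfP Ic (dens_loc hPQR (mprim_mcac hT.1)).
  exact: (self_bracket_bound s2 erefl Ic hT Tc WTc hY (mprimf0 _ _) (fun=> erefl) hf hX hc).
have h1 := bnd 1 (expr1n _ _); have h2 := bnd (-1) (ltac:(by rewrite sqrrN expr1n)).
have sk : (wr f wf f wf x 0 0)^* = - wr f wf f wf x 0 0.
  rewrite -ctE /wr ctB !ctM !ctK; move: (_ *m wf x) (_ *m f x) => p q.
  by rewrite !mxE opprB addrC.
apply/matrixP => i j; rewrite !ord1 [RHS]mxE; move: (wr _ _ _ _ x 0 0) sk h1 h2 => k.
move=> /(congr1 (@reC K)); rewrite !reimE => h0 h1 h2.
by apply: cplx_eq; rewrite !reimE; lra.
Qed.

(** Polarization. *)
Lemma L2a_bracket l (f wf g wg : K -> 'cV[C]_m) x : sol a b P Q R (realC l) f wf ->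
  sol a b P Q R (realC l) g wg -> L2a a b R f -> L2a a b R g -> I x -> wr f wf g wg x = 0.
Proof.
move=> hf hg lf lg Ix; have cf := mprim_mcac hf.1; have cg := mprim_mcac hg.1.
(* The bracket of [f + k g] with itself. *)
have hk (k : C) : k *: wr f wf g wg x + k^* *: wr g wg f wf x = 0.
  have hkg : sol a b P Q R (realC l) (fun x => k *: g x) (fun x => k *: wg x).
    have := solMr (k%:M : 'M[C]_1) hg.
    have e (u : K -> 'cV[C]_m) : (fun t => u t *m k%:M) = fun t => k *: u t.
      by apply/funext => t; rewrite mul_mx_scalar.
    by rewrite !e.
  have ckg := mprim_mcac hkg.1.
  have := L2a_self_bracket (solD hf hkg) (L2aD hPQR cf ckg lf (L2aZ hPQR k cg lg)) Ix.
  have f0 := L2a_self_bracket hf lf Ix; have g0 := L2a_self_bracket hg lg Ix.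
  rewrite /wr !ctD !ctZ; move: f0 g0; rewrite /wr.
  move: (f x) (wf x) (g x) (wg x) => f1 f2 g1 g2 /eqP f0 /eqP g0.
  rewrite !(mulmxDl, mulmxDr) -!(scalemxAl, scalemxAr).
  move: f0 g0; rewrite !subr_eq0 => /eqP -> /eqP ->.
  move: (f2 ^t* *m f1) (f1 ^t* *m g2) (g1 ^t* *m f2) (g2 ^t* *m g1) (f2 ^t* *m g1) (g2 ^t* *m f1) => p q r s t u e.
  rewrite -[RHS]e !scalerBr !scalerA opprD !opprD.
  apply/matrixP => i j; rewrite !mxE; ring.
have h1 := hk 1; have h2 := hk (im K).
rewrite rmorph1 !scale1r in h1; rewrite im_conj in h2.
move: (wr _ _ _ _ x) (wr _ _ _ _ x) h1 h2 => p q /eqP; rewrite addr_eq0 => /eqP -> /eqP.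
rewrite scalerN scaleNr -opprD oppr_eq0 -scalerDl scaler_eq0 => /orP[/eqP/(congr1 (@imC K))/eqP|/eqP ->].
  by rewrite !reimE /= -mulr2n pnatr_eq0.
by rewrite oppr0.
Qed.

Lemma L2a_bracket_mx n p l (U W : K -> 'M[C]_(m, n)) (V Z : K -> 'M[C]_(m, p)) x :
  sol a b P Q R (realC l) U W -> sol a b P Q R (realC l) V Z ->
  (forall v : 'cV_n, L2a a b R (fun t => U t *m v)) ->
  (forall v : 'cV_p, L2a a b R (fun t => V t *m v)) -> I x -> wr U W V Z x = 0.
Proof.
move=> hU hV lU lV Ix; apply/matrixP => i j.
have := L2a_bracket (solMr (delta_mx i 0 : 'cV_n) hU) (solMr (delta_mx j 0 : 'cV_p) hV) (lU _) (lV _) Ix.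
have -> : wr (fun t => U t *m (delta_mx i 0 : 'cV_n)) (fun t => W t *m delta_mx i 0)
     (fun t => V t *m (delta_mx j 0 : 'cV_p)) (fun t => Z t *m delta_mx j 0) x
   = (delta_mx i 0 : 'cV_n) ^t* *m wr U W V Z x *m (delta_mx j 0 : 'cV_p).
  by rewrite /wr !ctM mulmxBr mulmxBl !mulmxA.
move=> /(congr1 (fun M : 'M[C]_1 => M 0 0)).
have -> : (delta_mx i 0 : 'cV[C]_n) ^t* = delta_mx 0 i.
  by apply/matrixP => r s; rewrite ctE !mxE andbC; case: (_ && _); rewrite ?rmorph1 ?rmorph0.
by rewrite -rowE -colE !mxE => ->.
Qed.
End limit_point.

(** * Reduction of order and principal solutions *)
Section strict.
Variable K : realType.
Variables a b : \bar K.
Notation I := (oint a b).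
Notation C := (cplx K).

Lemma cprim_lt (f g : K -> C) x y : cprim a b f g -> I x -> I y -> x < y ->
  {ae leb, forall t : lebT K, x < t < y -> 0 < g t} -> f x < f y.
Proof.
move=> hf Ix Iy xy g0; rewrite lt_def (cprim_le hf Ix Iy (ltW xy)) ?andbT; last first.
  by apply: ae_mono g0 => t h xt; exact/ltW/h.
apply/eqP => e.
have sub t : oint x%:E y%:E t -> I t.
  by move=> /andP[]; rewrite !lte_fin => xt ty; apply: (oint_conv Ix Iy); exact: ltW.
have mono s t : x <= s -> s <= t -> t <= y -> f s <= f t.
  move=> xs st ty; have It := oint_conv Ix Iy (le_trans xs st) ty.
  have Is := oint_conv Ix Iy xs (le_trans st ty).
  apply: (cprim_le hf Is It st); apply: ae_mono g0 => r h /andP[sr rt]; apply/ltW/h.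
  by rewrite (le_lt_trans xs sr) (lt_le_trans rt ty).
have h0 : mprim x%:E y%:E (fun t => (f t)%:M : 'M[C]_1) (fun=> 0).
  apply: (mprim_ext (mprim_cst _ _ ((f x)%:M))) => t /andP[]; rewrite !lte_fin => xt ty.
  by congr (_%:M); apply/le_anti; rewrite mono ?(ltW xt) ?(ltW ty) //= -e mono ?(ltW xt) ?(ltW ty).
have h1 : mprim a b (fun t => (f t)%:M : 'M[C]_1) (fun t => (g t)%:M).
  by move=> i j; rewrite !ord1; apply: (cprim_eq hf) => t; rewrite mxE eqxx.
have [t xty []] : exists2 t, x < t < y & (oint x%:E y%:E t -> (g t)%:M = 0 :> 'M[C]_1) /\ (x < t < y -> 0 < g t).
  by apply: ae_point => //; apply: ae_mono (ae_and (mprim_uniq (mprim_sub sub h1) h0) g0) => t [u v] _.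
have It : oint x%:E y%:E t by rewrite /oint /= !lte_fin.
move=> /(_ It)/(congr1 (fun M : 'M[C]_1 => M 0 0)); rewrite !mxE eqxx mulr1n => -> /(_ xty).
by rewrite ltxx.
Qed.

Lemma unit_near m (U : K -> 'M[C]_m) c : mcac a b U -> I c -> U c \in unitmx ->
  exists2 r : K, 0 < r & forall x, `|x - c| < r -> U x \in unitmx.
Proof.
move=> hU Ic uc; have [/nbhs_ballP[r /= r0 H] _] := mcvgV uc (mcac_mcvg hU Ic).
exists r; first exact: r0.
by move=> x xr; apply: H; rewrite /ball /= distrC.
Qed.

Lemma unit_right m (U : K -> 'M[C]_m) c : mcac a b U -> I c -> U c \in unitmx ->
  exists2 c', I c' & c < c' /\ forall x, c <= x -> x < c' -> U x \in unitmx.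
Proof.
move=> hU Ic uc; have [r r0 H] := unit_near hU Ic uc.
have [c1 Ic1 cc1] := oint_right Ic.
exists (Num.min c1 (c + r)).
  apply: (oint_conv Ic Ic1); last by rewrite ge_min lexx.
  by rewrite le_min (ltW cc1) lerDl ltW.
split=> [|x cx]; first by rewrite lt_min cc1 ltrDl.
by rewrite lt_min => /andP[_ xr]; apply: H; rewrite ger0_norm ?subr_ge0 // ltrBlDl.
Qed.

Lemma unit_left m (U : K -> 'M[C]_m) c : mcac a b U -> I c -> U c \in unitmx ->
  exists2 c', I c' & c' < c /\ forall x, c' < x -> x <= c -> U x \in unitmx.
Proof.
move=> hU Ic uc; have [r r0 H] := unit_near hU Ic uc.
have [c1 Ic1 cc1] := oint_left Ic.
exists (Num.max c1 (c - r)).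
  apply: (oint_conv Ic1 Ic); first by rewrite le_max lexx.
  by rewrite ge_max (ltW cc1) gerBl ltW.
split=> [|x]; first by rewrite gt_max cc1 gtrBl.
rewrite gt_max => /andP[_ xr] xc; apply: H; rewrite ler0_norm ?subr_le0 // opprB.
by rewrite ltrBlDl -ltrBlDr.
Qed.
End strict.

Section reduction.
Variable K : realType.
Variable m : nat.
Variables a b : \bar K.
Notation I := (oint a b).
Notation C := (cplx K).
Variables P Q R : K -> 'M[C]_m.
Hypothesis hPQR : coefficients a b P Q R.
Local Open Scope sesquilinear_scope.
Variable l : K.
Notation lsol := (sol a b P Q R (realC l)).

(** The integrand in the definition of principal solutions. *)
Definition pkernel (U : K -> 'M[C]_m) x := invmx (U x) *m invmx (P x) *m (invmx (U x)) ^t*.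

Lemma pkernel_posdef U x : U x \in unitmx -> posdef (P x) -> posdef (pkernel U x).
Proof.
move=> uU pP; apply: posdefP => v v0.
have -> : qf (pkernel U x) v = qf (invmx (P x)) ((invmx (U x)) ^t* *m v).
  by rewrite /qf /pkernel ctM ctK !mulmxA.
apply: qf_gt0; first exact: posdef_inv.
apply: contraNneq v0 => e; apply/eqP; rewrite -[v]mul1mx -(ct1 K m) -(mulVmx uU) ctM -mulmxA e.
by rewrite mulmx0.
Qed.

Lemma sub_left c x : I c -> oint a c%:E x -> I x /\ x < c.
Proof.
move=> Ic /andP[ax]; rewrite lte_fin => xc; split => //; apply/andP; split => //.
by move: Ic => /andP[_]; apply: lt_trans; rewrite lte_fin.
Qed.

Lemma lt_left c x : I x -> x < c -> oint a c%:E x.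
Proof. by move=> /andP[ax _] xc; rewrite /oint /= ax lte_fin. Qed.

(** Reduction of order: for a self-conjugate [U], a solution [V] whose bracket with [U] is
    [-1] is [U] times a primitive of minus the kernel of the principal integral. *)
Lemma reduction_prim (U W V Z : K -> 'M[C]_m) c : I c -> lsol U W -> lsol V Z ->
  (forall x, I x -> x < c -> U x \in unitmx) ->
  (forall x, I x -> wr U W U W x = 0) -> (forall x, I x -> wr U W V Z x = - 1%:M) ->
  mprim a c%:E (fun x => invmx (U x) *m V x) (fun x => - pkernel U x).
Proof.
move=> Ic hU hV uU UU UV.
have sub x : oint a c%:E x -> I x by move=> /(sub_left Ic)[].
have uU' x : oint a c%:E x -> U x \in unitmx by move=> /(sub_left Ic)[Ix xc]; exact: uU.
have h := mprimM (mprimV uU' (mprim_sub sub hU.1)) (mprim_sub sub hV.1).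
apply: (mprim_ae h); apply: ae_always => x Dx; have Ix := sub x Dx; have ux := uU' x Dx.
have key : Z x - W x *m (invmx (U x) *m V x) = - (invmx (U x)) ^t*.
  have uc : (U x) ^t* \in unitmx by rewrite ct_unit.
  apply: (can_inj (mulKmx uc)); rewrite mulmxBr mulmxA mulmxN -ctM mulVmx // ct1.
  have /eqP := UU x Ix; rewrite /wr subr_eq0 => /eqP ->.
  by rewrite -(UV x Ix) /wr -!mulmxA mulKVmx.
have -> : - pkernel U x = invmx (U x) *m invmx (P x) *m (- (invmx (U x)) ^t*) by rewrite mulmxN.
rewrite -key /Pinv.
move: (invmx (U x)) (invmx (P x)) => u p.
by rewrite !mulmxBr !mulmxA !mulNmx addrC.
Qed.

Lemma reduction_ex (U W : K -> 'M[C]_m) c : I c -> lsol U W -> U c \in unitmx ->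
  (forall x, I x -> wr U W U W x = 0) ->
  exists V Z, [/\ lsol V Z, V c = 0, (U c) ^t* *m Z c = - 1%:M,
    forall x, I x -> wr U W V Z x = - 1%:M & forall x, I x -> wr V Z V Z x = 0].
Proof.
move=> Ic hU uc UU.
have [V [Z [hV Vc Zc]]] := sol_ex hPQR (realC l) (0 : 'M[C]_m) (- (invmx (U c)) ^t*) Ic.
have e : (U c) ^t* *m Z c = - 1%:M by rewrite Zc mulmxN -ctM mulVmx // ct1.
exists V, Z; split => // x Ix.
  have <- := @wr0 _ _ _ _ _ _ _ hPQR _ _ _ U W V Z c x hU _ Ic Ix; last by rewrite realC_conj.
  by rewrite /wr Vc mulmx0 subr0.
have <- := @wr0 _ _ _ _ _ _ _ hPQR _ _ _ V Z V Z c x hV _ Ic Ix; last by rewrite realC_conj.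
by rewrite /wr Vc ct0 mul0mx mulmx0 subr0.
Qed.

Section one_sided.
Variables (U W V Z : K -> 'M[C]_m) (c c' : K).
Hypothesis Ic' : I c'.
Hypothesis Ic : I c.
Hypothesis cc' : c < c'.
Hypothesis hU : lsol U W.
Hypothesis hV : lsol V Z.
Hypothesis uU : forall x, I x -> x < c' -> U x \in unitmx.
Hypothesis UU : forall x, I x -> wr U W U W x = 0.
Hypothesis UV : forall x, I x -> wr U W V Z x = - 1%:M.
Hypothesis Vc : V c = 0.
Variable S : K -> 'M[C]_m.
Hypothesis SE : forall x, S x = invmx (U x) *m V x.

Let Sp : mprim a c'%:E S (fun x => - pkernel U x).
Proof.
have h := reduction_prim Ic' hU hV uU UU UV.
by apply: (mprim_eq h) => // x; rewrite SE.
Qed.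

(** The kernel is positive definite. *)
Lemma reduction_strict x y v : I x -> x < y -> y < c' -> v != 0 -> qf (S y) v < qf (S x) v.
Proof.
move=> Ix xy yc v0; have h := mprimMr v (mprimMl (v ^t*) (mprimN Sp)).
have Dx := lt_left Ix (lt_trans xy yc).
have Iy := oint_conv Ix Ic' (ltW xy) (ltW yc); have Dy := lt_left Iy yc.
have e t : (v ^t* *m (- S t) *m v) 0 0 = - qf (S t) v by rewrite mulmxN mulNmx mxE.
rewrite -ltrN2 -!e; apply: (@cprim_lt _ a c'%:E _ _ x y (h 0 0) Dx Dy xy).
apply: ae_mono (ae_coef hPQR) => t ht /andP[xt ty].
have It := oint_conv Ix Iy (ltW xt) (ltW ty); have [pP _ _] := ht It.
rewrite opprK; apply: (qf_gt0 (pkernel_posdef _ pP) v0).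
by apply: uU => //; exact: lt_trans yc.
Qed.

Lemma reduction_mono x y v : I x -> x <= y -> y < c' -> qf (S y) v <= qf (S x) v.
Proof.
move=> Ix; rewrite le_eqVlt => /orP[/eqP -> //|xy] yc.
have [->|v0] := eqVneq v 0; first by rewrite /qf !mulmx0 mxE.
by apply/ltW/reduction_strict.
Qed.

Lemma reduction_posdef x : I x -> x < c -> posdef (S x).
Proof.
move=> Ix xc; apply: posdefP => v v0; have := reduction_strict Ix xc cc' v0.
by rewrite [in X in X < _]/qf SE Vc mulmx0 mulmx0 mul0mx mxE.
Qed.

Lemma reduction_integral x : I x -> x <= c -> principal_integral P x c U = S x.
Proof.
move=> Ix xc; have Dx := lt_left Ix (le_lt_trans xc cc'); have Dc := lt_left Ic cc'.
have := mprim_int (mprimN Sp) Dx Dc xc; rewrite [S c]SE Vc mulmx0 oppr0 sub0r opprK => -[_ <-].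
by congr mx_integral; apply/funext => t; rewrite opprK.
Qed.

Lemma reduction_inverse : exists A : 'M[C]_m,
  [/\ A ^t* = A, mcvg (to_a a) (fun x => invmx (S x)) A &
      forall x v, I x -> x < c -> qf A v <= qf (invmx (S x)) v].
Proof.
have mS x y v : I x -> x <= y -> y < c -> qf (S y) v <= qf (S x) v.
  by move=> Ix xy yc; apply: reduction_mono => //; exact: lt_trans cc'.
by have [A [h1 h2 h3 _]] := monotone_inverse Ic reduction_posdef mS; exists A; split.
Qed.

(** The inverses [S^-1] decrease strictly, so that they stay strictly above their limit. *)
Lemma reduction_gap A x : (forall x v, I x -> x < c -> qf A v <= qf (invmx (S x)) v) ->
  I x -> x < c -> posdef (invmx (S x) - A).
Proof.
move=> hA Ix xc; apply: posdefP => v v0; rewrite qfE sf_sub -!qfE subr_gt0.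
have [x' Ix' xx'] := oint_left Ix; apply: le_lt_trans (hA x' v Ix' (lt_trans xx' xc)) _.
apply: inv_anti_lt v0; [exact: (reduction_posdef Ix' (lt_trans xx' xc))|exact: reduction_posdef|].
by move=> w w0; apply: reduction_strict => //; exact: lt_trans cc'.
Qed.

End one_sided.
End reduction.

(** * The left endpoint *)
Section left_endpoint.
Variable K : realType.
Variable m : nat.
Variables a b : \bar K.
Notation I := (oint a b).
Notation C := (cplx K).
Variables P Q R : K -> 'M[C]_m.
Local Open Scope sesquilinear_scope.

Lemma wr_mul (U W V Z : K -> 'M[C]_m) (M N : 'M[C]_m) x :
  wr (fun t => U t *m M) (fun t => W t *m M) (fun t => V t *m N) (fun t => Z t *m N) x
  = M ^t* *m wr U W V Z x *m N.
Proof. by rewrite /wr !ctM mulmxBr mulmxBl !mulmxA. Qed.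

(** The bracket is conjugate linear in its first argument. *)
Lemma wr_subl (U W V Z : K -> 'M[C]_m) A x :
  wr (fun t => U t - V t *m A) (fun t => W t - Z t *m A) V Z x
  = wr U W V Z x - A ^t* *m wr V Z V Z x.
Proof.
rewrite /wr; move: (U x) (W x) (V x) (Z x) => u w v z.
have e1 : (u - v *m A) ^t* *m z = u ^t* *m z - A ^t* *m (v ^t* *m z) by rewrite ctB ctM mulmxBl mulmxA.
have e2 : (w - z *m A) ^t* *m v = w ^t* *m v - A ^t* *m (z ^t* *m v) by rewrite ctB ctM mulmxBl mulmxA.
rewrite e1 e2 mulmxBr; move: (u ^t* *m z) (w ^t* *m v) (A ^t* *m _) (A ^t* *m _) => p q r s.
by rewrite !opprB addrACA [RHS]addrACA; congr (_ + _); rewrite addrC.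
Qed.

(** The form of the lower bound that the argument at an endpoint uses. It is symmetric
    under reflection, unlike the classes of test functions that it comes from. *)
Definition corner_property (l la : K) :=
  forall d c e (v1 w1 v2 w2 : K -> 'cV[C]_m) (X1 X2 : K -> 'M[C]_1),
  I d -> I e -> d < c -> c < e ->
  sol a b P Q R (realC l) v1 w1 -> sol a b P Q R (realC l) v2 w2 ->
  v1 d = 0 -> v2 e = 0 -> v1 c = v2 c ->
  mprim a b X1 (dens R v1) -> mprim a b X2 (dens R v2) ->
  realC (la - l) * ((X1 c - X1 d + (X2 e - X2 c)) 0 0) <= ((v1 c) ^t* *m (w1 c - w2 c)) 0 0.

Hypothesis hPQR : coefficients a b P Q R.
Variables l la : K.
Hypothesis lla : l < la.
Hypothesis corner : corner_property l la.
Notation lsol := (sol a b P Q R (realC l)).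

(** Below the lower bound no solution vanishes twice. *)
Lemma dirichlet_ex e : I e -> exists U W, [/\ lsol U W, U e = 0,
  forall x, I x -> x < e -> U x \in unitmx & forall x, I x -> wr U W U W x = 0].
Proof.
move=> Ie; have [U [W [hU Ue We]]] := sol_ex hPQR (realC l) (0 : 'M[C]_m) 1%:M Ie.
exists U, W; split => // [x Ix xe|x Ix]; last first.
  have <- := @wr0 _ _ _ _ _ _ _ hPQR _ _ _ U W U W e x hU _ Ie Ix; last by rewrite realC_conj.
  by rewrite /wr Ue ct0 mul0mx mulmx0 subr0.
(* A solution with zeros at [x] and [e], regarded as having a corner at the midpoint,
   has zero jump there, hence zero norm. *)
apply: unitmx_inj => v Uv; have hv := solMr v hU.
have hX := mprimfP Ie (dens_loc hPQR (mprim_mcac hv.1)).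
move: (mprimf _ _) hX => X hX; have [xc ce] := midf_lt xe.
have Ic := oint_conv Ix Ie (ltW xc) (ltW ce).
have Uve : U e *m v = 0 by rewrite Ue mul0mx.
have := corner Ix Ie xc ce hv hv Uv Uve erefl hX hX.
rewrite subrr mulmx0 [X in _ <= X]mxE [_ - _ + _]addrC addrA subrK => le0.
have Xe : X e = X x.
  have := energy_mono hPQR (1%:M : 'cV_1) hX Ix Ie (ltW xe); rewrite !qf1 => Xm.
  apply/matrixP => i j; rewrite !ord1; apply/le_anti; rewrite Xm andbT.
  move: le0; rewrite pmulr_rle0; last by rewrite -realC0 realC_lt subr_gt0.
  by rewrite mxE [X in _ + X]mxE subr_le0.
have [_] := sol_energy0 hPQR hv hX Ix Ie xe Xe Ie.
by rewrite We mul1mx.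
Qed.

Section reduced.
Variables (U W V Z : K -> 'M[C]_m) (c c' : K).
Hypothesis Ic' : I c'.
Hypothesis Ic : I c.
Hypothesis cc' : c < c'.
Hypothesis hU : lsol U W.
Hypothesis hV : lsol V Z.
Hypothesis uU : forall x, I x -> x < c' -> U x \in unitmx.
Hypothesis UU : forall x, I x -> wr U W U W x = 0.
Hypothesis UV : forall x, I x -> wr U W V Z x = - 1%:M.
Hypothesis Vc : V c = 0.
Hypothesis UZc : (U c) ^t* *m Z c = - 1%:M.
Variable S : K -> 'M[C]_m.
Hypothesis SE : forall x, S x = invmx (U x) *m V x.
Variable A : 'M[C]_m.
Hypothesis SA : mcvg (to_a a) (fun x => invmx (S x)) A.

(** The solutions that vanish at [d] and agree with [U eta] at [c] have bounded norms as
    [d] tends to the endpoint: continue them past [c] by a fixed solution and use the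
    lower bound. Their limit is [(U - V A) eta]. *)
Lemma reduced_L2a (eta : 'cV[C]_m) : L2a a b R (fun t => U t *m eta - V t *m (A *m eta)).
Proof.
have [e Ie ce] := oint_right Ic; have [d0 Id0 d0c] := oint_left Ic.
have pS := reduction_posdef hPQR Ic' cc' hU hV uU UU UV Vc SE.
have [Ph [WP [hP Phe uP _]]] := dirichlet_ex Ie; have uPc := uP c Ic ce.
(* [U eta - V B eta] depends on [B] only through the constant vector [ze B], so that
   its energies are values of the form of one Gram matrix [G] and pass to the limit in
   [B]. *)
pose F t := U t *m (row_mx 1%:M 0 : 'M[C]_(m, m + m)) + V t *m (row_mx 0 1%:M : 'M[C]_(m, m + m)).
pose WF t := W t *m (row_mx 1%:M 0 : 'M[C]_(m, m + m)) + Z t *m (row_mx 0 1%:M : 'M[C]_(m, m + m)).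
have hF : lsol F WF := solD (solMr _ hU) (solMr _ hV).
pose ze B : 'cV[C]_(m + m) := (col_mx 1%:M 0 : 'M[C]_(m + m, m)) *m eta - (col_mx 0 1%:M : 'M[C]_(m + m, m)) *m (B *m eta).
have zE (u v : 'M[C]_m) B : (u *m (row_mx 1%:M 0 : 'M[C]_(m, m + m)) + v *m (row_mx 0 1%:M : 'M[C]_(m, m + m))) *m ze B
    = u *m eta - v *m (B *m eta).
  rewrite /ze; move: (B *m eta) => be.
  have e1 : (u *m (row_mx 1%:M 0 : 'M[C]_(m, m + m)) + v *m (row_mx 0 1%:M : 'M[C]_(m, m + m))) *m (col_mx 1%:M 0 : 'M[C]_(m + m, m)) = u.
    by rewrite mulmxDl -!mulmxA !mul_row_col !(mul0mx, mulmx0, mul1mx, mulmx1, addr0, add0r).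
  have e2 : (u *m (row_mx 1%:M 0 : 'M[C]_(m, m + m)) + v *m (row_mx 0 1%:M : 'M[C]_(m, m + m))) *m (col_mx 0 1%:M : 'M[C]_(m + m, m)) = v.
    by rewrite mulmxDl -!mulmxA !mul_row_col !(mul0mx, mulmx0, mul1mx, mulmx1, addr0, add0r).
  by move: (_ + _) e1 e2 => T e1 e2; rewrite mulmxBr !mulmxA e1 e2.
have hG := mprimfP Ic (dens_loc hPQR (mprim_mcac hF.1)).
have G0 := mprimf0 c (dens R F); move: (mprimf _ _) hG G0 => G hG G0.
have hGz (z : 'cV[C]_(m + m)) : mprim a b (fun t => z ^t* *m G t *m z) (dens R (fun t => F t *m z)).
  by rewrite dens_Mr; exact: (mprimMr z (mprimMl (z ^t*) hG)).
(* The right-hand side of the corner inequality at [d0], which by monotonicity serves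
   all [d <= d0]. *)
pose k := (((U c *m eta) ^t* *m (W c *m eta - WP c *m (invmx (Ph c) *m (U c *m eta)))) 0 0).
pose M := (reC k + reC (qf (invmx (S d0)) eta)) / (la - l).
have l0 : 0 < la - l by rewrite subr_gt0.
have bnd d : I d -> d <= d0 -> - reC (qf (G d) (ze (invmx (S d)))) <= M.
  move=> Id dd0; have dc := le_lt_trans dd0 d0c; have uS := posdef_unit (pS d Id dc).
  have h1 := solMr (ze (invmx (S d))) hF.
  have h2 := solMr (invmx (Ph c) *m (U c *m eta)) hP.
  have hX2 := mprimfP Ic (dens_loc hPQR (mprim_mcac h2.1)).
  move: (mprimf _ _) hX2 => X2 hX2.
  have v1d : F d *m ze (invmx (S d)) = 0.
    have ud : U d \in unitmx by apply: uU => //; exact: lt_trans cc'.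
    by rewrite zE -(mulKVmx ud (V d)) -SE -mulmxA mulKVmx // subrr.
  have v1c : F c *m ze (invmx (S d)) = U c *m eta by rewrite zE Vc mul0mx subr0.
  have v2e : Ph e *m (invmx (Ph c) *m (U c *m eta)) = 0.
    by rewrite Phe mul0mx.
  have v12 : F c *m ze (invmx (S d)) = Ph c *m (invmx (Ph c) *m (U c *m eta)) by rewrite v1c mulKVmx.
  have := corner Id Ie dc ce h1 h2 v1d v2e v12 (hGz _) hX2.
  have X20 : 0 <= (X2 e - X2 c) 0 0.
    have := energy_mono hPQR (1%:M : 'cV_1) hX2 Ic Ie (ltW ce); rewrite !qf1.
    by rewrite mxE [X in _ + X]mxE subr_ge0.
  have -> : (F c *m ze (invmx (S d))) ^t* *m (WF c *m ze (invmx (S d)) - WP c *m (invmx (Ph c) *m (U c *m eta)))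
     = (U c *m eta) ^t* *m (W c *m eta - WP c *m (invmx (Ph c) *m (U c *m eta))) + eta ^t* *m invmx (S d) *m eta.
    rewrite v1c zE; move: (WP c *m _) (W c *m eta) (invmx (S d)) => p q B.
    rewrite addrAC mulmxBr; congr (_ + _).
    by rewrite ctM -[in LHS]mulmxA [X in - (_ *m X) = _]mulmxA UZc mulNmx mul1mx mulmxN opprK mulmxA.
  rewrite G0 mulmx0 mul0mx sub0r.
  have -> : (- ((ze (invmx (S d))) ^t* *m G d *m ze (invmx (S d))) + (X2 e - X2 c)) 0 0
      = - qf (G d) (ze (invmx (S d))) + (X2 e - X2 c) 0 0.
    by rewrite /qf; move: (_ *m _) (X2 e - X2 c) => p q; rewrite mxE [X in X + _]mxE.
  move: ((X2 e - X2 c) 0 0) X20 => r X20; rewrite mx00D -/k -/(qf (invmx (S d)) eta).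
  have Sm : qf (invmx (S d)) eta <= qf (invmx (S d0)) eta.
    apply: inv_anti => [||v]; [exact: pS|exact: pS|].
    apply: (reduction_mono hPQR Ic' hU hV uU UU UV SE) => //; exact: lt_trans cc'.
  move: Sm X20; rewrite /M ler_pdivlMr //; clear M; clearbody k.
  move: (qf (invmx (S d)) eta) (qf (invmx (S d0)) eta) (qf (G d) _) k => p q s k'.
  rewrite !lecP !reimE => /andP[_ h3] /andP[_ h4] /andP[_]; rewrite !mul0r ?subr0.
  move: (reC p) (reC q) (reC r) (reC s) (reC k') h3 h4 => p' q' r' s' k'' h3 h4.
  have : 0 <= (la - l) * r' by apply: mulr_ge0 => //; exact: ltW.
  by rewrite mulrDr mulrN mulNr [s' * _]mulrC; move: ((la - l) * r') ((la - l) * s') => *; lra.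
have PF := to_a_proper a.
have cst n p (N : 'M[C]_(n, p)) : mcvg (to_a a) (fun=> N) N.
  by move=> i j; exact: cvg_cst.
have zA : mcvg (to_a a) (fun d => ze (invmx (S d))) (ze A).
  exact: (mcvgD (cst _ _ (_ *m eta)) (mcvgN (mcvgM (cst _ _ (col_mx 0 1%:M : 'M[C]_(m + m, m))) (mcvgM SA (cst _ _ eta))))).
have hX : mprim a b (fun t => (ze A) ^t* *m G t *m ze A) (dens R (fun t => U t *m eta - V t *m (A *m eta))).
  have -> : (fun t => U t *m eta - V t *m (A *m eta)) = fun t => F t *m ze A by apply/funext => t; rewrite zE.
  exact: hGz.
apply: (L2a_near hPQR hX (M := M) Id0) => x Ix xd0.
have xc := le_lt_trans xd0 d0c.
have lim : mcvg (to_a a) (fun d => (ze (invmx (S d))) ^t* *m G x *m ze (invmx (S d))) ((ze A) ^t* *m G x *m ze A).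
  exact: (mcvgM (mcvgM (mcvg_ct zA) (cst _ _ (G x))) zA).
have : realC (- M) <= ((ze A) ^t* *m G x *m ze A) 0 0.
  apply: (cvgC_ge (lim 0 0)); apply: (to_aP Ix) => d Id dx.
  rewrite -/(qf (G x) (ze (invmx (S d)))).
  have h1 := bnd d Id (le_trans (ltW dx) xd0).
  have h2 := energy_mono hPQR (ze (invmx (S d))) hG Id Ix (ltW dx).
  have := energy_mono hPQR (ze (invmx (S d))) hG Ix Ic (ltW xc).
  have -> : qf (G c) (ze (invmx (S d))) = 0 by rewrite /qf G0 mulmx0 mul0mx mxE.
  move: h1 h2; move: (qf (G d) _) (qf (G x) _) => p q.
  rewrite !lecP !reimE => h1 /andP[_ h2] /andP[/eqP-> _]; rewrite eqxx /=; lra.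
by rewrite lecP !reimE => /andP[_]; move: (reC _) => q; lra.
Qed.
End reduced.

Hypothesis hm : (0 < m)%N.
Hypothesis lp : limit_point_a a b P Q R.

Let In (U : K -> 'M[C]_m) := forall v : 'cV[C]_m, L2a a b R (fun t => U t *m v).

(** Square integrable solutions have vanishing brackets with each other, hence they form a
    Lagrangian plane: one of them that is invertible at a point generates all. *)
Lemma L2a_proportional (U W V Z : K -> 'M[C]_m) c : lsol U W -> lsol V Z -> In U -> In V ->
  I c -> U c \in unitmx -> let M := invmx (U c) *m V c in
  forall x, I x -> V x = U x *m M /\ Z x = W x *m M.
Proof.
move=> hU hV lU lV Ic uc M x Ix.
have eq0 (A B : 'M[C]_m) : A - B = 0 -> A = B by move=> /eqP; rewrite subr_eq0 => /eqP.
have UU := eq0 _ _ (L2a_bracket_mx hm hPQR lp hU hU lU lU Ic).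
have UV := eq0 _ _ (L2a_bracket_mx hm hPQR lp hU hV lU lV Ic).
have Zc : Z c = W c *m (invmx (U c) *m V c).
  have uc' : (U c) ^t* \in unitmx by rewrite ct_unit.
  by apply: (can_inj (mulKmx uc')); rewrite UV mulmxA UU -mulmxA mulKVmx.
apply: (@sol_uniq _ _ _ _ _ _ _ hPQR _ _ V Z (fun t => U t *m (invmx (U c) *m V c)) (fun t => W t *m (invmx (U c) *m V c)) c x hV (solMr _ hU) Ic _ Zc Ix).
by rewrite mulKVmx.
Qed.

Lemma self_conjugate_wr U W : lsol U W -> (forall x, I x -> wr U W U W x = 0) ->
  self_conjugate_solution a b P Q R l U.
Proof.
move=> hU UU; exists W; first exact: solution_of_sol hU.
by move=> x Ix; apply/eqP; rewrite -subr_eq0; apply/eqP; exact: UU.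
Qed.

(** Take [U] vanishing at a point to the right and reduce: [N = U - V A] is square
   integrable, so that [Y = N M] for a constant [M]. Since [N = U S (S^-1 - A)] with
   [S^-1 - A] positive, [N] is invertible up to [c], and [V] is also a reduction partner
   for it, with ratio [(S^-1 - A)^-1]. This ratio is the principal integral of [N], and
   its inverse [S^-1 - A] tends to zero by the choice of [A]. *)
Lemma weyl_principal (Y WY : K -> 'M[C]_m) : lsol Y WY -> In Y -> Defs.nondegenerate a b Y ->
  (exists c, I c) -> principal_a a b P Q R l Y.
Proof.
move=> hY lY nY [c Ic]; have [c' Ic' cc'] := oint_right Ic.
have [U [W [hU _ uU UU]]] := dirichlet_ex Ic'; have uc := uU c Ic cc'.
have [V [Z [hV Vc UZc UV VV]]] := reduction_ex hPQR Ic hU uc UU.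
have [S SE] : exists S : K -> 'M[C]_m, forall x, S x = invmx (U x) *m V x.
  by exists (fun x => invmx (U x) *m V x).
have pS := reduction_posdef hPQR Ic' cc' hU hV uU UU UV Vc SE.
have [A [hA SA leA]] := reduction_inverse hPQR Ic' Ic cc' hU hV uU UU UV Vc SE.
have gap x : I x -> x < c -> posdef (invmx (S x) - A).
  by move=> Ix xc; exact: (reduction_gap hPQR Ic' cc' hU hV uU UU UV Vc SE leA Ix xc).
have [N NE] : exists N : K -> 'M[C]_m, N = fun x => U x - V x *m A by eexists.
have [WN WNE] : exists N : K -> 'M[C]_m, N = fun x => W x - Z x *m A by eexists.
have hN : lsol N WN by rewrite NE WNE; exact: (solD hU (solN (solMr A hV))).
have lN : In N.
  move=> v; have h := reduced_L2a Ic' Ic cc' hU hV uU UU UV Vc UZc SE SA v.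
  by apply: (L2a_eq h) => x Ix; rewrite NE mulmxBl mulmxA.
have Nc : N c = U c by rewrite NE Vc mul0mx subr0.
have uNc : N c \in unitmx by rewrite Nc.
have YN := L2a_proportional hN hY lN lY Ic uNc.
move: (invmx (N c) *m Y c) YN => M YNW.
have YN x : I x -> Y x = N x *m M by move=> /YNW[].
have WYE x : I x -> WY x = WN x *m M by move=> /YNW[].
have uM : M \in unitmx.
  by apply: unitmx_inj => v Mv; apply: nY => x Ix; rewrite YN // -mulmxA Mv mulmx0.
have uN x : I x -> x < c -> N x = U x *m S x *m (invmx (S x) - A).
  move=> Ix xc; have us := posdef_unit (pS x Ix xc).
  have ux : U x \in unitmx by apply: uU => //; exact: lt_trans cc'.
  by rewrite NE mulmxBr (mulmxK us) SE (mulKVmx ux).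
have uN' x : I x -> x < c -> N x \in unitmx.
  move=> Ix xc; rewrite (uN x Ix xc) !unitmx_mul (posdef_unit (pS x Ix xc)) (posdef_unit (gap x Ix xc)) !andbT.
  by apply: uU => //; exact: lt_trans cc'.
have uY x : I x -> x <= c -> Y x \in unitmx.
  move=> Ix; rewrite YN // unitmx_mul uM andbT le_eqVlt => /orP[/eqP->|]; [exact: uNc|exact: uN'].
have [c2 Ic2 [cc2 uY2]] := unit_right (mprim_mcac hY.1) Ic (uY c Ic (lexx c)).
have uY3 x : I x -> x < c2 -> Y x \in unitmx.
  by move=> Ix xc2; have [xc|/ltW cx] := leP x c; [exact: uY|exact: uY2].
have YY x : I x -> wr Y WY Y WY x = 0.
  by move=> Ix; exact: (L2a_bracket_mx hm hPQR lp hY hY lY lY Ix).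
(* The reduction partner of [Y = N M], again with bracket [-1]. *)
have [V' V'E] : exists N : K -> 'M[C]_m, N = fun x => V x *m invmx (M ^t*) by eexists.
have [Z' Z'E] : exists N : K -> 'M[C]_m, N = fun x => Z x *m invmx (M ^t*) by eexists.
have hV' : lsol V' Z' by rewrite V'E Z'E; exact: (solMr _ hV).
have YV x : I x -> wr Y WY V' Z' x = - 1%:M.
  move=> Ix; have -> : wr Y WY V' Z' x = M ^t* *m wr N WN V Z x *m invmx (M ^t*).
    rewrite -wr_mul V'E Z'E [LHS]/wr [RHS]/wr (YN x Ix) (WYE x Ix); reflexivity.
  by rewrite NE WNE wr_subl UV // VV // mulmx0 subr0 mulmxN mulmx1 mulNmx mulmxV // ct_unit.
have V'c : V' c = 0 by rewrite V'E Vc mul0mx.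
have [T TE] : exists T : K -> 'M[C]_m, forall x, T x = invmx (Y x) *m V' x.
  by exists (fun x => invmx (Y x) *m V' x).
split; first exact: self_conjugate_wr hY YY.
exists c; split => //; first by move=> x [Ix xc]; exact: uY.
have PF := to_a_proper a.
apply/mcvg_nbhs.
have cst n p (B : 'M[C]_(n, p)) : mcvg (to_a a) (fun=> B) B by move=> i j; exact: cvg_cst.
have lim : mcvg (to_a a) (fun x => M ^t* *m (invmx (S x) - A) *m M) 0.
  have h : mcvg (to_a a) (fun x => M ^t* *m (invmx (S x) - A) *m M) (M ^t* *m (A - A) *m M).
    exact: (mcvgM (mcvgM (cst _ _ (M ^t*)) (mcvgD SA (mcvgN (cst _ _ A)))) (cst _ _ M)).
  by rewrite subrr mulmx0 mul0mx in h.
apply: (mcvg_near lim); apply: (to_aP Ic) => x Ix xc.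
rewrite (reduction_integral Ic2 Ic cc2 hY hV' uY3 YY YV V'c TE Ix (ltW xc)) TE YN // V'E.
have us := posdef_unit (pS x Ix xc); have ug := posdef_unit (gap x Ix xc).
have ux : U x \in unitmx by apply: uU => //; exact: lt_trans cc'.
have -> : V x = U x *m S x by rewrite SE mulKVmx.
have uMc : M ^t* \in unitmx by rewrite ct_unit.
rewrite uN //; move: (invmx (S x) - A) ug => D uD.
have uUS : U x *m S x \in unitmx by rewrite unitmx_mul ux.
move: (U x *m S x) uUS => E uE; have uEDM : E *m D *m M \in unitmx by rewrite !unitmx_mul uE uD.
have e : invmx (E *m D *m M) *m (E *m invmx (M ^t*)) = invmx (M ^t* *m D *m M).
  apply: (can_inj (mulKmx uEDM)); rewrite mulKVmx //.
  have uMDM : M ^t* *m D *m M \in unitmx by rewrite !unitmx_mul uMc uD.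
  apply: (can_inj (mulmxK uMDM)); rewrite (mulmxKV uMDM).
  by rewrite !mulmxA (mulmxKV uMc).
by rewrite e invmxK.
Qed.

(** For a principal solution the limit [A] of the inverse integrals vanishes, so that
    [U - V A] is [U] itself. *)
Lemma principal_L2a U : principal_a a b P Q R l U -> exists W, lsol U W /\ In U.
Proof.
move=> [[W hW UW] [c [Ic uU lim]]]; have hU := sol_of_solution hPQR hW.
have UU x : I x -> wr U W U W x = 0 by move=> Ix; rewrite /wr UW // subrr.
exists W; split => // v.
have uc : U c \in unitmx by apply: uU; split.
have [c' Ic' [cc' uU2]] := unit_right (mprim_mcac hU.1) Ic uc.
have uU' x : I x -> x < c' -> U x \in unitmx.
  by move=> Ix xc'; have [xc|/ltW cx] := leP x c; [apply: uU; split|exact: uU2].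
have [V [Z [hV Vc UZc UV VV]]] := reduction_ex hPQR Ic hU uc UU.
have [S SE] : exists S : K -> 'M[C]_m, forall x, S x = invmx (U x) *m V x.
  by exists (fun x => invmx (U x) *m V x).
have PF := to_a_proper a.
have SA : mcvg (to_a a) (fun x => invmx (S x)) 0.
  have h : mcvg (to_a a) (fun x => invmx (principal_integral P x c U)) 0 by apply/mcvg_nbhs.
  apply: (mcvg_near h); apply: (to_aP Ic) => x Ix xc.
  by rewrite (reduction_integral Ic' Ic cc' hU hV uU' UU UV Vc SE Ix (ltW xc)).
have h := reduced_L2a Ic' Ic cc' hU hV uU' UU UV Vc UZc SE SA v.
by apply: (L2a_eq h) => x Ix; rewrite mul0mx mulmx0 subr0.
Qed.

Theorem left_endpoint Y : solution a b P Q R (realC l) Y -> Defs.nondegenerate a b Y ->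
  (exists2 c, I c & sq_integrable R (oint a c%:E) Y) ->
  principal_a a b P Q R l Y /\
  forall U, principal_a a b P Q R l U -> forall x x0,
    left_of_zeros a b Y x -> left_of_zeros a b U x ->
    left_of_zeros a b Y x0 -> left_of_zeros a b U x0 ->
    Y x *m invmx (Y x0) = U x *m invmx (U x0).
Proof.
move=> [WY hWY] nY [c Ic sY]; have hY := sol_of_solution hPQR hWY.
have lY : In Y by move=> v; exact: (L2a_of_sq_integrable hPQR v (mprim_mcac hY.1) Ic sY).
split; first by apply: (weyl_principal hY lY nY); exists c.
move=> U /principal_L2a[W [hU lU]] x x0 [Ix _] _ [I0 Y0] [_ U0].
have unit0 (F : K -> 'M[C]_m) : (forall y, I y -> y <= x0 -> \det (F y) != 0) -> F x0 \in unitmx.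
  by move=> h; rewrite unitmxE unitfE; exact: h.
have uY := unit0 Y Y0; have uU := unit0 U U0.
have [YU _] := L2a_proportional hU hY lU lY I0 uU Ix.
rewrite YU -mulmxA; congr (_ *m _).
by rewrite -mulmxA mulmxV // mulmx1.
Qed.
End left_endpoint.

(** * Reflection *)
Section reflect_measure.
Variable K : realType.
Notation lebm := (@lebesgue_measure K).
Local Open Scope ereal_scope.
Notation oppK := (fun x : K => (- x)%R).

Lemma opp_itv (x y : K) : oppK @^-1` `]x, y] = `[(- y)%R, (- x)%R[%classic.
Proof.
apply/seteqP; split=> t; rewrite /preimage /mkset /= !in_itv /= => /andP[h1 h2]; apply/andP.
  by rewrite lerNl ltrNr.
by rewrite ltrNr lerNl.
Qed.

Lemma opp_borel : measurable_fun setT (oppK : measurableTypeR K -> measurableTypeR K).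
Proof. exact: oppr_measurable. Qed.

Lemma measurable_opp_borel (A : set K) : measurable (A : set (measurableTypeR K)) ->
  measurable (oppK @^-1` A : set (measurableTypeR K)).
Proof. by move=> mA; rewrite -[X in measurable X]setTI; exact: opp_borel. Qed.

Let opp_mixin := isMeasurableFun.Build _ _ _ _ _ opp_borel.
Let opp_pack : {mfun measurableTypeR K >-> measurableTypeR K} :=
  HB.pack (oppK : measurableTypeR K -> measurableTypeR K) opp_mixin.

(** Reflected half-open intervals have the same length, and these determine the measure. *)
Lemma lebm_opp (A : set K) : measurable (A : set (measurableTypeR K)) ->
  lebm (oppK @^-1` A) = lebm A.
Proof.
move=> mA; apply/esym; apply: (@lebesgue_measure_unique K (pushforward lebm opp_pack)) => // X [[x y] _ <-] /=.
have -> : pushforward lebm opp_pack `]x, y]%classic = lebm (`[(- y)%R, (- x)%R[%classic).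
  by rewrite -opp_itv.
rewrite !lebesgue_measure_itv /= !lte_fin ltrN2; case: ifP => // _.
by rewrite -!EFinB opprK addrC.
Qed.

Lemma leb_null_borel (E : set (lebT K)) : measurable E -> leb E = 0 ->
  exists2 B : set K, measurable (B : set (measurableTypeR K)) & E `<=` B /\ lebm B = 0.
Proof.
move=> mE E0.
have mE' : (completed_algebra_gen lebm).-sigma.-measurable E.
  by rewrite completed_caratheodory_measurable; exact: mE.
move: mE'; rewrite g_sigma_completed_algebra_genE => -[A mA [N [B [mB B0 NB]] EE]].
exists (A `|` B); first exact: measurableU.
split; first by rewrite -EE => x [Ax|/NB Bx]; [left|right].
rewrite (measureU0 mA mB B0); have AE : A `<=` E by rewrite -EE; exact: subsetUl.
exact: (subset_measure0 (measurable_leb mA) mE AE E0).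
Qed.

Lemma leb_opp_null (E : set (lebT K)) : measurable E -> leb E = 0 ->
  exists2 B : set (lebT K), measurable B & (oppK @^-1` E) `<=` B /\ leb B = 0.
Proof.
move=> mE E0; have [B mB [EB B0]] := leb_null_borel mE E0.
exists (oppK @^-1` B); first exact: (measurable_leb (measurable_opp_borel _)).
by split=> [x /EB//|]; rewrite lebE lebm_opp.
Qed.

Lemma ae_opp (p : K -> Prop) : {ae leb, forall x : lebT K, p x} ->
  {ae leb, forall x : lebT K, p (- x)%R}.
Proof.
move=> [N [mN N0 pN]]; have [B mB [NB B0]] := leb_opp_null mN N0.
by exists B; split => // x /pN h; exact: NB.
Qed.

Lemma measurable_opp_leb (E : set (lebT K)) : measurable E ->
  measurable (oppK @^-1` E : set (lebT K)).
Proof.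
move=> mE; have [A mA [AE mD D0]] := leb_borel_approx mE.
rewrite (_ : _ @^-1` _ = oppK @^-1` A `|` oppK @^-1` (E `\` A)); last first.
  by rewrite -preimage_setU setDUK.
apply: measurableU; first exact: (measurable_leb (measurable_opp_borel _)).
have [B mB [DB B0]] := leb_opp_null mD D0.
by apply: (@negligible_sub_caratheodory K); exists B.
Qed.

Lemma opp_leb : measurable_fun setT (oppK : lebT K -> lebT K).
Proof. by move=> _ Y mY; rewrite setTI; exact: measurable_opp_leb. Qed.

Let opp_leb_mixin := isMeasurableFun.Build _ _ _ _ _ opp_leb.
Let opp_leb_pack : {mfun lebT K >-> lebT K} := HB.pack (oppK : lebT K -> lebT K) opp_leb_mixin.

(** The completion of a reflection invariant measure is invariant. *)
Lemma leb_opp (E : set (lebT K)) : measurable E -> leb (oppK @^-1` E : set (lebT K)) = leb E.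
Proof.
have le (F : set (lebT K)) : measurable F -> leb (oppK @^-1` F : set (lebT K)) <= leb F.
  move=> mF; have [A mA [AF mD D0]] := leb_borel_approx mF.
  have [B mB [DB B0]] := leb_opp_null mD D0.
  have mA' := measurable_leb (measurable_opp_borel mA).
  apply: (@le_trans _ _ (leb ((oppK @^-1` A) `|` B : set (lebT K)))).
    apply: le_measure; rewrite ?inE //; [exact: measurable_opp_leb|exact: measurableU|].
    by move=> x Fx; have [Ax|nA] := pselect (A (- x)%R); [left|right; apply: DB; split].
  have e : leb (oppK @^-1` A : set (lebT K)) = leb (A : set (lebT K)) := lebm_opp mA.
  have -> : leb ((oppK @^-1` A) `|` B : set (lebT K)) = leb (A : set (lebT K)) := etrans (measureU0 mA' mB B0) e.
  by apply: le_measure; rewrite ?inE //; exact: measurable_leb.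
move=> mE; apply/le_anti; rewrite le //=.
have := le _ (measurable_opp_leb mE); rewrite -comp_preimage (_ : _ \o _ = id) //.
by apply/funext => x /=; rewrite opprK.
Qed.

Lemma measurable_fun_opp (D : set K) (f : K -> K) : measurable (D : set (lebT K)) ->
  measurable_fun (D : set (lebT K)) (f : lebT K -> K) ->
  measurable_fun (oppK @^-1` D : set (lebT K)) ((fun x => f (- x)%R) : lebT K -> K).
Proof.
move=> mD mf; apply: (@measurable_comp _ _ _ _ _ _ (D : set (lebT K)) f _ (oppK : lebT K -> lebT K)) ; [exact: mD| |exact: mf|].
  by move=> _ [x Dx <-].
by apply: measurable_funTS; exact: opp_leb.
Qed.

Lemma ge0_integral_opp (D : set K) (g : K -> \bar K) : measurable (D : set (lebT K)) ->
  measurable_fun (D : set (lebT K)) (g : lebT K -> \bar K) -> (forall x, 0 <= g x) ->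
  \int[leb]_(x in (oppK @^-1` D : set (lebT K))) g (- x)%R = \int[leb]_(x in (D : set (lebT K))) g x.
Proof.
move=> mD mg g0.
have h := @ge0_integral_pushforward _ _ _ _ K _ opp_leb leb D g mD mg (fun x _ => g0 x).
transitivity (\int[leb]_(x in (oppK @^-1` D : set (lebT K))) (g \o oppK) x); first by [].
rewrite -h; apply: (@eq_measure_integral _ _ K (D : set (lebT K)) leb (pushforward leb opp_leb_pack) g) => A mA _; exact: (leb_opp mA).
Qed.

Lemma rintg_opp (D : set K) (f : K -> K) : measurable (D : set (lebT K)) -> rintg D f ->
  rintg (oppK @^-1` D) (fun x => f (- x)%R) /\
  Rintegral leb (oppK @^-1` D : set (lebT K)) (fun x : lebT K => f (- x)%R)
  = Rintegral leb (D : set (lebT K)) (f : lebT K -> K).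
Proof.
move=> mD /integrableP[/measurable_EFinP mf fi].
have mE (g : K -> K) : measurable_fun (D : set (lebT K)) (g : lebT K -> K) ->
  measurable_fun (D : set (lebT K)) (fun x : lebT K => (g x)%:E) by move=> mg; exact/measurable_EFinP.
split.
  apply/integrableP; split; first exact/measurable_EFinP/measurable_fun_opp.
  have mn : measurable_fun (D : set (lebT K)) (fun x : lebT K => `|(f x)%:E|).
    by apply: measurableT_comp; [exact: abse_measurable|exact: mE].
  by rewrite (@ge0_integral_opp D (fun x => `|(f x)%:E|) mD mn (fun x => abse_ge0 _)).
rewrite /Rintegral; congr fine; rewrite [LHS]integralE [RHS]integralE.
have mfE := mE f mf.
have p1 (x : lebT K) : 0 <= (fun y : lebT K => (f y)%:E)^\+ x by exact: funepos_ge0.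
have p2 (x : lebT K) : 0 <= (fun y : lebT K => (f y)%:E)^\- x by exact: funeneg_ge0.
rewrite -(ge0_integral_opp mD (measurable_funepos mfE) p1) -(ge0_integral_opp mD (measurable_funeneg mfE) p2).
by congr (_ - _); apply: eq_integral => x _; rewrite !(funeposE, funenegE).
Qed.
End reflect_measure.

Section reflect.
Variable K : realType.
Notation C := (cplx K).
Notation oppK := (fun x : K => - x).
Local Open Scope sesquilinear_scope.

Lemma opp2 (T : Type) (F : K -> T) : (fun x => F (- - x)) = F.
Proof. by apply/funext => x; rewrite opprK. Qed.

Lemma opp_itvcc (c d : K) : oppK @^-1` `[c, d] = `[- d, - c]%classic.
Proof.
apply/seteqP; split=> t; rewrite /preimage /mkset /= !in_itv /= => /andP[h1 h2]; apply/andP.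
  by rewrite lerNl lerNr.
by rewrite lerNr lerNl.
Qed.

Lemma oint_opp (a b : \bar K) x : oint (- b)%E (- a)%E x <-> oint a b (- x).
Proof.
rewrite /oint /=; split=> /andP[h1 h2]; apply/andP.
  by rewrite EFinN lteNr lteNl.
by rewrite lteNl lteNr -EFinN.
Qed.

Lemma oint_oppE (a b : \bar K) : oint (- b)%E (- a)%E = oppK @^-1` oint a b.
Proof. by apply/seteqP; split=> x /oint_opp. Qed.

Lemma mx_integral_opp m n (D : set K) (F : K -> 'M[C]_(m, n)) : measurable (D : set (lebT K)) ->
  mx_integrable D F -> mx_integrable (oppK @^-1` D) (fun x => F (- x)) /\
  mx_integral (oppK @^-1` D) (fun x => F (- x)) = mx_integral D F.
Proof.
move=> mD hF; split=> [i j|].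
  by have [h1 h2] := hF i j; split; [exact: (rintg_opp mD h1).1|exact: (rintg_opp mD h2).1].
apply/matrixP => i j; rewrite !mxE; have [h1 h2] := hF i j.
have e1 := (rintg_opp mD h1).2; have e2 := (rintg_opp mD h2).2.
by rewrite /cintegral; congr (mkC _ _); [exact: e1|exact: e2].
Qed.

Variables a b : \bar K.
Notation I := (oint a b).
Notation I' := (oint (- b)%E (- a)%E).

Lemma rprim_opp (f g : K -> K) : rprim a b f g ->
  rprim (- b)%E (- a)%E (fun x => - f (- x)) (fun x => g (- x)).
Proof.
move=> hf c d /oint_opp Ic /oint_opp Id cd.
have [hi he] := hf _ _ Id Ic (ltac:(by rewrite lerN2)).
have [h1 h2] := rintg_opp (measurable_itvl (- d) (- c)) hi.
rewrite opp_itvcc !opprK in h1 h2; split; first exact: h1.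
by rewrite opprK addrC he /rint -h2.
Qed.

(** Reflection reverses the sign of the derivative. *)
Lemma mprim_opp m n (F G : K -> 'M[C]_(m, n)) : mprim a b F G ->
  mprim (- b)%E (- a)%E (fun x => - F (- x)) (fun x => G (- x)).
Proof.
move=> h i j; have [h1 h2] := h i j; split.
  by have := rprim_opp h1; congr (rprim _ _ _ _); apply/funext => x; rewrite mxE reimE.
by have := rprim_opp h2; congr (rprim _ _ _ _); apply/funext => x; rewrite mxE reimE.
Qed.

Section system.
Variable m : nat.
Variables P Q R : K -> 'M[C]_m.
Notation P' := (fun x => P (- x)).
Notation Q' := (fun x => Q (- x)).
Notation R' := (fun x => R (- x)).

Lemma coefficients_opp : coefficients a b P Q R ->
  coefficients (- b)%E (- a)%E P' Q' R'.
Proof.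
have mI : measurable (I : set (lebT K)) := @oint_meas _ a b.
have mm (F : K -> 'M[C]_m) : mx_measurable I F -> mx_measurable I' (fun x => F (- x)).
  by move=> hF i j; have [h1 h2] := hF i j; rewrite oint_oppE; split; [exact: (measurable_fun_opp mI h1)|exact: (measurable_fun_opp mI h2)].
have ml (F : K -> 'M[C]_m) : mx_loc_integrable I F -> mx_loc_integrable I' (fun x => F (- x)).
  move=> hF c d /oint_opp Ic /oint_opp Id.
  have := (mx_integral_opp (measurable_itvl (- d) (- c)) (hF _ _ Id Ic)).1.
  by rewrite opp_itvcc !opprK.
move=> [[p q r] h1 h2 [hp hq hr]]; split.
- by split; exact: mm.
- by apply: ae_mono (ae_opp h1) => x h /oint_opp; exact: h.
- by apply: ae_mono (ae_opp h2) => x h /oint_opp; exact: h.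
- by split; [exact: (ml (fun x => invmx (P x)) hp)|exact: (ml Q hq)|exact: (ml R hr)].
Qed.

Lemma sol_opp n z (U W : K -> 'M[C]_(m, n)) : sol a b P Q R z U W ->
  sol (- b)%E (- a)%E P' Q' R' z (fun x => U (- x)) (fun x => - W (- x)).
Proof.
move=> [h1 h2]; split; last exact: mprim_opp h2.
apply: (mprim_eq (mprimN (mprim_opp h1))) => x; first by rewrite opprK.
by rewrite /Pinv mulmxN.
Qed.

Hypothesis hPQR : coefficients a b P Q R.
Let hPQR' := coefficients_opp hPQR.

Lemma solution_opp z (U : K -> 'M[C]_m) : solution a b P Q R z U ->
  solution (- b)%E (- a)%E P' Q' R' z (fun x => U (- x)).
Proof.
move=> [W /(sol_of_solution hPQR) /sol_opp h].
by eexists; exact: (solution_of_sol hPQR' h).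
Qed.

Lemma weyl_solution_opp z (D : set K) (U : K -> 'M[C]_m) : measurable (D : set (lebT K)) ->
  weyl_solution a b P Q R z D U ->
  weyl_solution (- b)%E (- a)%E P' Q' R' z (oppK @^-1` D) (fun x => U (- x)).
Proof.
move=> mD [sU uU qU]; split; first exact: solution_opp.
- by move=> x /oint_opp; exact: uU.
- exact: (mx_integral_opp mD qU).1.
Qed.

Lemma self_conjugate_opp l (U : K -> 'M[C]_m) : self_conjugate_solution a b P Q R l U ->
  self_conjugate_solution (- b)%E (- a)%E P' Q' R' l (fun x => U (- x)).
Proof.
move=> [W /(sol_of_solution hPQR) /sol_opp h UW].
exists (fun x => - W (- x)); first exact: (solution_of_sol hPQR' h).
by move=> x /oint_opp Ix; rewrite mulmxN ctN mulNmx UW.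
Qed.

(** The kernel is locally integrable wherever [U] is invertible, hence on a neighborhood
   of [[c, d]]. *)
Lemma pkernel_integrable (U : K -> 'M[C]_m) c d : mcac a b U -> I c -> I d -> c <= d ->
  (forall x, c <= x <= d -> U x \in unitmx) -> mx_integrable `[c, d] (pkernel P U).
Proof.
move=> cU Ic Id cd uU.
have [c1 Ic1 [cc1 u1]] := unit_left cU Ic (uU c ltac:(by rewrite lexx)).
have [d1 Id1 [dd1 u2]] := unit_right cU Id (uU d ltac:(by rewrite lexx andbT)).
have sub x : oint c1%:E d1%:E x -> I x.
  by move=> /andP[]; rewrite !lte_fin => cx xd; apply: (oint_conv Ic1 Id1); exact: ltW.
have u x : oint c1%:E d1%:E x -> U x \in unitmx.
  move=> /andP[]; rewrite !lte_fin => cx xd.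
  have [xc|cx'] := leP x c; first exact: u1.
  have [dx|xd'] := leP d x; first exact: u2.
  by apply: uU; rewrite !ltW.
have cV := mcacV u (mcac_sub sub cU).
have hl : mloc c1%:E d1%:E (pkernel P U).
  exact: (mlocMr (mlocMl cV (mloc_sub sub (Pinv_loc hPQR))) (mcac_ct cV)).
have hD x : c <= x -> x <= d -> oint c1%:E d1%:E x.
  by move=> cx xd; rewrite /oint /= !lte_fin (lt_le_trans cc1 cx) (le_lt_trans xd dd1).
by have /mlocP := hl; apply; apply: hD.
Qed.

Lemma principal_integral_opp (U : K -> 'M[C]_m) c d : mcac a b U -> I c -> I d -> c <= d ->
  (forall x, c <= x <= d -> U x \in unitmx) ->
  principal_integral P' (- d) (- c) (fun x => U (- x)) = principal_integral P c d U.
Proof.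
move=> cU Ic Id cd uU.
have := (mx_integral_opp (measurable_itvl c d) (pkernel_integrable cU Ic Id cd uU)).2.
by rewrite opp_itvcc.
Qed.

Lemma to_b_opp : to_b b = - x @[x --> to_a (- b)%E].
Proof.
rewrite /to_b /to_a; case: (b) => [r| |] /=.
- by rewrite -at_leftN opprK.
- apply/funext => S; apply/propext; split=> -[M [_ H]]; exists (- M); split; rewrite ?num_real //.
    by move=> x xM; apply: H; rewrite ltrNr.
  by move=> x xM; rewrite -[x]opprK; apply: H; rewrite ltrNl.
- apply/funext => S; apply/propext; split=> -[M [_ H]]; exists (- M); split; rewrite ?num_real //.
    by move=> x xM; apply: H; rewrite ltrNr.
  by move=> x xM; rewrite -[x]opprK; apply: H; rewrite ltrNl.
Qed.

End system.
End reflect.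

Section right_endpoint.
Variable K : realType.
Notation C := (cplx K).
Notation oppK := (fun x : K => - x).
Local Open Scope sesquilinear_scope.
Variables a b : \bar K.
Notation I := (oint a b).
Notation I' := (oint (- b)%E (- a)%E).
Variable m : nat.
Variables P Q R : K -> 'M[C]_m.
Notation P' := (fun x => P (- x)).
Notation Q' := (fun x => Q (- x)).
Notation R' := (fun x => R (- x)).
Hypothesis hPQR : coefficients a b P Q R.
Let hPQR' := coefficients_opp hPQR.

(* Reflection is an involution, so that what holds for (a,b) transfers back. *)
Let sol_unopp n z (U W : K -> 'M[C]_(m, n)) :
  sol (- b)%E (- a)%E P' Q' R' z U W -> sol a b P Q R z (fun x => U (- x)) (fun x => - W (- x)).
Proof. by move=> /sol_opp; rewrite !oppeK !opp2. Qed.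

Let weyl_solution_unopp z (D : set K) (V : K -> 'M[C]_m) : measurable (D : set (lebT K)) ->
  weyl_solution (- b)%E (- a)%E P' Q' R' z D V ->
  weyl_solution a b P Q R z (oppK @^-1` D) (fun x => V (- x)).
Proof. by move=> mD wV; have := weyl_solution_opp hPQR' mD wV; rewrite !oppeK !opp2. Qed.

Let self_conjugate_unopp l (U : K -> 'M[C]_m) :
  self_conjugate_solution (- b)%E (- a)%E P' Q' R' l U ->
  self_conjugate_solution a b P Q R l (fun x => U (- x)).
Proof. by move=> /(self_conjugate_opp hPQR'); rewrite !oppeK !opp2. Qed.

Lemma unopp_point x : I' x -> I (- x).
Proof. by move=> /oint_opp. Qed.

Lemma opp_point x : I x -> I' (- x).
Proof. by move=> Ix; apply/oint_opp; rewrite opprK. Qed.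

Lemma limit_point_opp : limit_point_b a b P Q R -> limit_point_a (- b)%E (- a)%E P' Q' R'.
Proof.
move=> lp z z0; have [c Ic [U wU uniq]] := lp z z0.
have DE : oint (- b)%E (- c)%:E = oppK @^-1` oint c%:E b by rewrite -oint_oppE EFinN.
have DE' : oppK @^-1` oint (- b)%E (- c)%:E = oint c%:E b.
  by rewrite DE; apply/seteqP; split=> x; rewrite /preimage /mkset opprK.
exists (- c); first by exact: opp_point.
exists (fun x => U (- x)).
  by rewrite DE; apply: (weyl_solution_opp hPQR _ wU); exact: oint_meas.
move=> V wV.
have mD : measurable (oint (- b)%E (- c)%:E : set (lebT K)) := @oint_meas _ _ _.
have wV' := weyl_solution_unopp mD wV; rewrite DE' in wV'.
have [M uM VM] := uniq _ wV'; exists M => // x /unopp_point Ix.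
by rewrite -(VM _ Ix) opprK.
Qed.

Lemma principal_of_opp l (U : K -> 'M[C]_m) :
  principal_a (- b)%E (- a)%E P' Q' R' l (fun x => U (- x)) -> principal_b a b P Q R l U.
Proof.
move=> [sc [c [Ic uU lim]]]; have sc' := self_conjugate_unopp sc; rewrite opp2 in sc'.
have [W /(sol_of_solution hPQR) hW _] := sc'; have cU := mprim_mcac hW.1.
have Ic' : I (- c) := unopp_point Ic.
have uU' x : I x -> - c <= x -> U x \in unitmx.
  move=> Ix cx; have := uU (- x); rewrite opprK; apply; split; last by rewrite lerNl.
  by exact: opp_point.
split; first exact: sc'.
exists (- c); split => //; first by move=> x [Ix cx]; exact: uU'.
have PF := to_a_proper (- b)%E; rewrite to_b_opp.
suff e : \forall x \near to_a (- b)%E, invmx (principal_integral P' x c (fun y => U (- y))) =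
    invmx (principal_integral P (- c) (- x) U) by exact: (cvg_trans (near_eq_cvg e) lim).
apply: (to_aP Ic) => x /unopp_point Ix xc.
have cx : - c <= - x by rewrite lerN2 ltW.
have := @principal_integral_opp K a b m P Q R hPQR U (- c) (- x) cU Ic' Ix cx; rewrite !opprK => -> //.
by move=> y /andP[cy yx]; apply: uU' => //; exact: (oint_conv Ic' Ix).
Qed.

Lemma principal_opp l (U : K -> 'M[C]_m) :
  principal_b a b P Q R l U -> principal_a (- b)%E (- a)%E P' Q' R' l (fun x => U (- x)).
Proof.
move=> [sc [c [Ic uU lim]]].
have [W /(sol_of_solution hPQR) hW _] := sc; have cU := mprim_mcac hW.1.
split; first exact: (self_conjugate_opp hPQR sc).
have Ic' : I' (- c) by exact: opp_point.
exists (- c); split => //.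
  by move=> x [/unopp_point Ix xc]; apply: uU; split => //; rewrite lerNr.
have PF := to_a_proper (- b)%E; rewrite to_b_opp in lim.
suff e : \forall x \near to_a (- b)%E, invmx (principal_integral P c (- x) U) =
    invmx (principal_integral P' x (- c) (fun y => U (- y))) by exact: (cvg_trans (near_eq_cvg e) lim).
apply: (to_aP Ic') => x /unopp_point Ix xc.
have cx : c <= - x by rewrite lerNr ltW.
have := @principal_integral_opp K a b m P Q R hPQR U c (- x) cU Ic Ix cx; rewrite opprK => -> //.
by move=> y /andP[cy yx]; apply: uU; split => //; exact: (oint_conv Ic Ix).
Qed.

(** The corner inequality is invariant under reflection: the two solutions exchange
   their roles and the jump keeps its sign. *)
Lemma corner_opp l lb : l < lb -> Tmin_bounded_below a b P Q R lb (zero_near_a a b) ->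
  corner_property (- b)%E (- a)%E P' Q' R' l lb.
Proof.
move=> llb hT d c e v1 w1 v2 w2 X1 X2 /unopp_point Id /unopp_point Ie dc ce h1 h2 v1d v2e v12 hX1 hX2.
have g1 := sol_unopp h1; have g2 := sol_unopp h2.
have f (X : K -> 'M[C]_1) (v : K -> 'cV[C]_m) : mprim (- b)%E (- a)%E X (dens R' v) ->
    mprim a b (fun x => - X (- x)) (dens R (fun x => v (- x))).
  move=> hX; have := mprim_opp hX; rewrite !oppeK.
  by congr (mprim _ _ _ _); apply/funext => x; rewrite /dens opprK.
have := corner_ineq hPQR llb (@compact_zero_near_a K a b m) hT Ie Id (d := - e) (c := - c) (e := - d)
  (ltac:(by rewrite ltrN2)) (ltac:(by rewrite ltrN2)) g2 g1 _ _ _ (f _ _ hX2) (f _ _ hX1).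
rewrite !opprK => /(_ v2e v1d (esym v12)).
rewrite v12 [- w2 c + _]addrC; move: (X1 d) (X1 c) (X2 c) (X2 e) => p q r s.
by rewrite [- r + s]addrC [- p + q]addrC [s - r + _]addrC.
Qed.

Theorem right_endpoint (hm : (0 < m)%N) l lb Y : l < lb ->
  Tmin_bounded_below a b P Q R lb (zero_near_a a b) -> limit_point_b a b P Q R ->
  solution a b P Q R (realC l) Y -> Defs.nondegenerate a b Y ->
  (exists2 c, I c & sq_integrable R (oint c%:E b) Y) ->
  principal_b a b P Q R l Y /\
  forall U, principal_b a b P Q R l U -> forall x x0,
    right_of_zeros a b Y x -> right_of_zeros a b U x ->
    right_of_zeros a b Y x0 -> right_of_zeros a b U x0 ->
    Y x *m invmx (Y x0) = U x *m invmx (U x0).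
Proof.
move=> llb hT lp sY nY [c Ic qY].
have nY' : Defs.nondegenerate (- b)%E (- a)%E (fun x => Y (- x)).
  move=> v Yv; apply: nY => x Ix; have := Yv (- x); rewrite opprK; apply.
  by exact: opp_point.
have qY' : exists2 c, I' c & sq_integrable R' (oint (- b)%E c%:E) (fun x => Y (- x)).
  exists (- c); first by exact: opp_point.
  rewrite EFinN oint_oppE; exact: (mx_integral_opp (@oint_meas _ _ _) qY).1.
have [pY uniq] := left_endpoint hPQR' llb (corner_opp llb hT) hm (limit_point_opp lp) (solution_opp hPQR sY) nY' qY'.
split=> [|U pU x x0]; first exact: principal_of_opp.
have rl (F : K -> 'M[C]_m) y : right_of_zeros a b F y -> left_of_zeros (- b)%E (- a)%E (fun x => F (- x)) (- y).
  move=> [Iy F0]; split; first by exact: opp_point.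
  by move=> t /unopp_point It ty; apply: F0 => //; rewrite lerNr.
move=> /rl h1 /rl h2 /rl h3 /rl h4.
by have := uniq _ (principal_opp pU) _ _ h1 h2 h3 h4; rewrite !opprK.
Qed.
End right_endpoint.

(** * The theorem *)
Theorem theorem3p10 (K : realType) (m : nat) (hm : (0 < m)%N)
    (a b : \bar K) (hab : (a < b)%E) (P Q R : K -> 'M[cplx K]_m)
    (hPQR : coefficients a b P Q R) :
  (forall la : K,
     Tmin_bounded_below a b P Q R la (zero_near_b a b) ->
     limit_point_a a b P Q R ->
     forall Psi : cplx K -> K -> 'M[cplx K]_m,
     weyl_titchmarsh_a a b P Q R la Psi ->
     forall l : K, l < la ->
       principal_a a b P Q R l (Psi (realC l)) /\
       forall Ua : K -> 'M[cplx K]_m, principal_a a b P Q R l Ua ->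
       forall x x0 : K,
         left_of_zeros a b (Psi (realC l)) x -> left_of_zeros a b Ua x ->
         left_of_zeros a b (Psi (realC l)) x0 -> left_of_zeros a b Ua x0 ->
         Psi (realC l) x *m invmx (Psi (realC l) x0) =
         Ua x *m invmx (Ua x0)) /\
  (forall lb : K,
     Tmin_bounded_below a b P Q R lb (zero_near_a a b) ->
     limit_point_b a b P Q R ->
     forall Psi : cplx K -> K -> 'M[cplx K]_m,
     weyl_titchmarsh_b a b P Q R lb Psi ->
     forall l : K, l < lb ->
       principal_b a b P Q R l (Psi (realC l)) /\
       forall Ub : K -> 'M[cplx K]_m, principal_b a b P Q R l Ub ->
       forall x x0 : K,
         right_of_zeros a b (Psi (realC l)) x -> right_of_zeros a b Ub x ->
         right_of_zeros a b (Psi (realC l)) x0 -> right_of_zeros a b Ub x0 ->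
         Psi (realC l) x *m invmx (Psi (realC l) x0) =
         Ub x *m invmx (Ub x0)).
Proof.
split=> [la hT lp Psi hPsi l lla|lb hT lp Psi hPsi l llb].
  have [_ _ hreal] := hPsi; have [sY nY qY] := hreal l lla.
  apply: (left_endpoint hPQR lla _ hm lp sY nY qY) => d c e v1 w1 v2 w2 X1 X2 Id Ie.
  exact: (corner_ineq hPQR lla (@compact_zero_near_b K a b m) hT Id Ie).
have [_ _ hreal] := hPsi; have [sY nY qY] := hreal l llb.
exact: (right_endpoint hPQR hm llb hT lp sY nY qY).
Qed.
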